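(* Assume that $L$ satisfies the generalized curvature-dimension inequality $\mathrm{CD}(\rho_1,\rho_2,\kappa,d)$ with $\rho_1>0$ (and $\rho_2>0$, $\kappa\ge0$, $0<d<\infty$) and that $\mu(\mathbb{M})=1$. Define $$\iota=\inf\frac{P(E)}{\mu(E)},$$ where the infimum runs over all Caccioppoli sets $E$ with $0<\mu(E)\le\frac12$. Then $$\iota\ge\frac12\sqrt{\frac{\rho_1}{2}}\;\frac{1}{1+\frac{2\kappa}{\rho_2}}.$$
   Context: Setting. $\mathbb{M}$ is a connected finite-dimensional $C^\infty$ manifold endowed with a smooth measure $\mu$ and a second-order diffusion operator $L$ with smooth real coefficients, $L1=0$, which is locally subelliptic in the sense of Fefferman-Phong (each point has a neighborhood $U$ and constants $\varepsilon,c>0$ with $\|u\|_{H^\varepsilon}^2\le c\left(-\int uLu\,d\mu+\int u^2d\mu\right)$ for all $u\in C_0^\infty(U)$), and such that $\int_{\mathbb{M}} fLg\,d\mu=\int_{\mathbb{M}} gLf\,d\mu$ and $\int_{\mathbb{M}} fLf\,d\mu\le 0$ for all $f,g\in C_0^\infty(\mathbb{M})$ (smooth compactly supported functions). The carré du champ is $\Gamma(f,g)=\frac12(L(fg)-fLg-gLf)$, $\Gamma(f)=\Gamma(f,f)$. An absolutely continuous curve $\gamma:[0,T]\to\mathbb{M}$ is subunit for $L$ if $|\frac{d}{dt}f(\gamma(t))|\le\sqrt{\Gamma(f)(\gamma(t))}$ for every smooth $f$; its length is $T$. It is assumed that any two points are joined by a subunit curve; then the infimum $d(x,y)$ of the lengths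 of subunit curves from $x$ to $y$ is a distance, and $(\mathbb{M},d)$ is assumed complete. (The distance $d(\cdot,\cdot)$ is not to be confused with the constant $d$ below.) $\mathbb{M}$ is also endowed with a smooth symmetric bilinear differential form $\Gamma^Z$ on $C^\infty(\mathbb{M})$ satisfying $\Gamma^Z(fg,h)=f\Gamma^Z(g,h)+g\Gamma^Z(f,h)$ and $\Gamma^Z(f)=\Gamma^Z(f,f)\ge0$. Standing assumptions. (H.1) There is an increasing sequence $h_k\in C_0^\infty(\mathbb{M})$ with $h_k\nearrow1$ on $\mathbb{M}$ and $\|\Gamma(h_k)\|_\infty+\|\Gamma^Z(h_k)\|_\infty\to0$. (H.2) $\Gamma(f,\Gamma^Z(f))=\Gamma^Z(f,\Gamma(f))$ for all $f\in C^\infty(\mathbb{M})$. (H.3) For every $f\in C_0^\infty(\mathbb{M})$ and $T\ge0$, $\sup_{t\in[0,T]}\left(\|\Gamma(P_tf)\|_\infty+\|\Gamma^Z(P_tf)\|_\infty\right)<\infty$. Here $P_t=e^{tL}$ is the heat semigroup, defined by the spectral theorem from the self-adjoint extension of $L$ in $L^2(\mu)$ (unique under (H.1)). Curvature-dimension inequality. Put $\Gamma_2(f)=\frac12[L\Gamma(f)-2\Gamma(f,Lf)]$ and $\Gamma_2^Z(f)=\frac12[L\Gamma^Z(f)-2\Gamma^Z(f,Lf)]$. For $\rho_1\in\mathbb{R}$, $\rho_2>0$, $\kappa\ge0$, $0<d<\infty$, $L$ satisfies $\mathrm{CD}(\rho_1,\rho_2,\kappa,d)$ if for every $f\in C^\infty(\mathbb{M})$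 and every $\nu>0$, $$\Gamma_2(f)+\nu\Gamma_2^Z(f)\ge\frac1d(Lf)^2+\left(\rho_1-\frac{\kappa}{\nu}\right)\Gamma(f)+\rho_2\Gamma^Z(f).$$ It is known (Baudoin-Garofalo) that when $\rho_1>0$ the manifold $\mathbb{M}$ is compact and $\mu(\mathbb{M})<\infty$. Horizontal perimeter. Every point has an open neighborhood $U$ on which $L=-\sum_{i=1}^mX_i^*X_i$ with vector fields $X_i$ with Lipschitz coefficients, $X_i^*$ being the formal adjoint in $L^2(\mathbb{M},\mu)$. Let $\mathcal{F}(\mathbb{M})$ be the set of $C^1$ vector fields $\phi$ that are subunit for $L$, i.e. $|\phi(f)|\le\sqrt{\Gamma(f)}$ for all smooth $f$. For $f\in L^1_{loc}(\mathbb{M})$ supported in $U$, $\mathrm{Var}(f)=\sup_{\phi\in\mathcal{F}(\mathbb{M})}\int_Uf\left(\sum_{i=1}^mX_i^*\phi_i\right)d\mu$, where $\phi=\sum_i\phi_iX_i$ on $U$ (so that $\sum_iX_i^*\phi_i=-\mathrm{div}_\mu\phi$). For general $f$ the definition is globalized by a partition of unity, i.e. $\mathrm{Var}(f)=\sup\int_{\mathbb{M}}f\,\mathrm{div}_\mu\phi\,d\mu$ over compactly supported $\phi\in\mathcal{F}(\mathbb{M})$. Set $BV(\mathbb{M})=\{f\in L^1(\mathbb{M}):\mathrm{Var}(f)<\infty\}$. A measurable set $E$ is a Caccioppoli set if $\mathbf 1_E\in BV(\mathbb{M})$, and then $P(E)=\mathrm{Var}(\mathbf 1_E)$. *)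

(* Defs.v *)
From HB Require Import structures.
From mathcomp Require Import all_boot all_order all_algebra.
From mathcomp Require Import all_classical all_reals all_analysis.
Import Order.TTheory GRing.Theory Num.Theory.
Import numFieldNormedType.Exports.

Set Implicit Arguments.
Unset Strict Implicit.
Unset Printing Implicit Defensive.

Local Open Scope classical_set_scope.
Local Open Scope ring_scope.

(** * Calculus on open subsets of R^n *)

Section Euclidean.
Context {R : realType}.

Definition partial n (i : 'I_n) (g : 'rV[R]_n -> R) : 'rV[R]_n -> R :=
  fun x => 'D_(delta_mx 0 i) g x.

(* C^k on an open set; the values of g outside the open set are irrelevant. *)
Fixpoint Ck n (k : nat) (O : set 'rV[R]_n) (g : 'rV[R]_n -> R) : Prop :=
  (forall x, O x -> {for x, continuous g}) /\
  match k with
  | 0%N => True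
  | k'.+1 => forall i : 'I_n,
      (forall x, O x -> derivable g x (delta_mx 0 i)) /\ Ck k' O (partial i g)
  end.

Definition Cinfty n (O : set 'rV[R]_n) (g : 'rV[R]_n -> R) : Prop :=
  forall k, Ck k O g.

(* Integration against n-dimensional Lebesgue measure, written as an iterated
   integral because the library has no Lebesgue measure on 'rV[R]_n. It is only
   applied to nonnegative Borel functions and to absolutely integrable
   continuous ones, where Tonelli and Fubini apply. *)
Fixpoint lebesgue_int (n : nat) : ('rV[R]_n -> \bar R) -> \bar R :=
  match n with
  | 0%N => fun g => g 0
  | m.+1 => fun g =>
      (\int[lebesgue_measure]_(s in [set: R])
         lebesgue_int (fun y : 'rV[R]_m =>
           g (row_mx (s%:M : 'rV[R]_1) y : 'rV[R]_(1 + m))))%E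
  end.

Definition dotv n (x y : 'rV[R]_n) : R := \sum_(i < n) x 0 i * y 0 i.

(* |u^(xi)|^2, for the Fourier transform u^(xi) = \int u(x) e^(- i xi.x) dx *)
Definition fourier_sq n (u : 'rV[R]_n -> R) (xi : 'rV[R]_n) : R :=
  fine (lebesgue_int (fun x => (u x * cos (dotv xi x))%:E)) ^+ 2 +
  fine (lebesgue_int (fun x => (u x * sin (dotv xi x))%:E)) ^+ 2.

(* Squared H^eps norm, up to the power of 2 pi fixed by the choice of
   normalization of the Fourier transform. *)
Definition sobolev_norm_sq n (eps : R) (u : 'rV[R]_n -> R) : \bar R :=
  lebesgue_int (fun xi => (((1 + dotv xi xi) `^ eps) * fourier_sq u xi)%:E).

Definition absolutely_continuous (T : R) (g : R -> R) : Prop :=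
  forall e : R, 0 < e -> exists2 delta : R, 0 < delta &
    forall (N : nat) (s t : nat -> R),
      (forall i, (i < N)%N -> 0 <= s i /\ s i <= t i /\ t i <= T) ->
      trivIset `I_N (fun i => `]s i, t i[%classic) ->
      \sum_(i < N) (t i - s i) < delta ->
      \sum_(i < N) `|g (t i) - g (s i)| < e.

End Euclidean.

(** * Smooth manifolds *)

Record chart (R : realType) (M : ptopologicalType) (n : nat) := Chart {
  cdom : set M ;
  cmap : M -> 'rV[R]_n ;
  cinv : 'rV[R]_n -> M }.

Notation borel M := (g_sigma_algebraType (@open M)).

Section Manifold.
Context {R : realType} {M : ptopologicalType} {n : nat}.
Implicit Types (c : chart R M n) (A : set (chart R M n)) (f g h : M -> R).

Definition cimg c : set 'rV[R]_n := cmap c @` cdom c.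

Definition is_chart c : Prop :=
  [/\ open (cdom c), open (cimg c),
      (forall x, cdom c x -> cinv c (cmap c x) = x),
      (forall x, cdom c x -> {for x, continuous (cmap c)}) &
      (forall y, cimg c y -> {for y, continuous (cinv c)})].

Definition smooth_atlas A : Prop :=
  [/\ (forall c, A c -> is_chart c),
      (forall x : M, exists2 c, A c & cdom c x) &
      (forall c c', A c -> A c' -> forall i : 'I_n,
         Cinfty (cmap c @` (cdom c `&` cdom c'))
                (fun y => cmap c' (cinv c y) 0 i))].

Definition connected_smooth_manifold A : Prop :=
  [/\ hausdorff_space M, @second_countable M,
      connected [set: M] & smooth_atlas A].

(* Coordinate expression of f; meaningful on [cimg c] only. *)
Definition in_chart c f : 'rV[R]_n -> R := f \o cinv c.

Definition smooth A f : Prop :=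
  forall c, A c -> Cinfty (cimg c) (in_chart c f).

Definition supp f : set M := closure [set x | f x != 0].

Definition smooth_csupp A (U : set M) f : Prop :=
  [/\ smooth A f, compact (supp f) & supp f `<=` U].

Definition test_function A f : Prop := smooth_csupp A setT f.

(* In every chart, mu has a smooth positive density w.r.t. Lebesgue measure. *)
Definition smooth_measure A (mu : {measure set (borel M) -> \bar R}) : Prop :=
  forall c, A c -> exists w : 'rV[R]_n -> R,
    [/\ Cinfty (cimg c) w, (forall y, cimg c y -> 0 < w y) &
        forall B : set (borel M), measurable B -> B `<=` cdom c ->
          mu B = lebesgue_int (fun y => (w y * \1_(cmap c @` B) y)%:E)].

(** * Diffusion operators *)

Definition second_order_diffusion A (L : (M -> R) -> M -> R) : Prop :=
  forall c, A c ->
  exists (a : 'I_n -> 'I_n -> 'rV[R]_n -> R) (b : 'I_n -> 'rV[R]_n -> R)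
         (z : 'rV[R]_n -> R),
  [/\ [/\ forall i j, Cinfty (cimg c) (a i j),
          forall i, Cinfty (cimg c) (b i) & Cinfty (cimg c) z],
      (forall i j y, cimg c y -> a i j y = a j i y),
      (forall y (v : 'rV[R]_n), cimg c y ->
         0 <= \sum_(i < n) \sum_(j < n) a i j y * v 0 i * v 0 j) &
      forall f, smooth A f -> forall x, cdom c x ->
        L f x =
          \sum_(i < n) \sum_(j < n)
             a i j (cmap c x) * partial i (partial j (in_chart c f)) (cmap c x)
          + \sum_(i < n) b i (cmap c x) * partial i (in_chart c f) (cmap c x)
          + z (cmap c x) * f x].

Section Measure.
Variable mu : {measure set (borel M) -> \bar R}.

Definition symmetric_operator A (L : (M -> R) -> M -> R) : Prop :=
  forall f g, test_function A f -> test_function A g ->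
    \int[mu]_x (f x * L g x) = \int[mu]_x (g x * L f x).

Definition nonpositive_operator A (L : (M -> R) -> M -> R) : Prop :=
  forall f, test_function A f -> \int[mu]_x (f x * L f x) <= 0.

Definition locally_subelliptic A (L : (M -> R) -> M -> R) : Prop :=
  forall x : M, exists c (U : set M) (eps C : R),
    [/\ A c, open U /\ U x, U `<=` cdom c, 0 < eps /\ 0 < C &
        forall u, smooth_csupp A U u ->
          (sobolev_norm_sq eps (fun y => (\1_(cimg c) y * in_chart c u y)%R) <=
           (C * (- \int[mu]_x (u x * L u x) + \int[mu]_x (u x ^+ 2)))%:E)%E].

(* L = - \sum_k X_k^* X_k on a neighborhood U of each point, where X_k has
   Lipschitz coefficients sigma k in a chart; the formal adjoints are unfolded
   by testing against g in C_0^oo(U). *)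
Definition locally_sum_of_squares A (L : (M -> R) -> M -> R) : Prop :=
  forall x : M, exists c (U : set M) (m : nat)
                       (sigma : 'I_m -> 'I_n -> 'rV[R]_n -> R),
    let X k f y :=
      \sum_(i < n) sigma k i (cmap c y) * partial i (in_chart c f) (cmap c y) in
    [/\ A c, open U /\ U x, U `<=` cdom c,
        (forall k i, exists K : R, forall y z : 'rV[R]_n,
           (cmap c @` U) y -> (cmap c @` U) z ->
           `|sigma k i y - sigma k i z| <= K * `|y - z|) &
        forall f g, smooth A f -> smooth_csupp A U g ->
          \int[mu]_y (g y * L f y) =
          - \int[mu]_y (\sum_(k < m) X k g y * X k f y)].

End Measure.

(** * Carre du champ, subunit curves and the control distance *)

Definition Gamma (L : (M -> R) -> M -> R) f g : M -> R := fun x =>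
  2^-1 * (L (fun y => f y * g y) x - f x * L g x - g x * L f x).

Definition subunit_curve A L (T : R) (gam : R -> M) : Prop :=
  {within `[0, T], continuous gam} /\
  forall f, smooth A f ->
    absolutely_continuous T (f \o gam) /\
    {ae lebesgue_measure, forall t : R, 0 < t < T ->
       derivable (f \o gam) t 1 /\
       `|'D_1 (f \o gam) t| <= Num.sqrt (Gamma L f f (gam t))}.

Definition joining_lengths A L (x y : M) : set R :=
  [set T | 0 <= T /\ exists gam : R -> M,
     [/\ subunit_curve A L T gam, gam 0 = x & gam T = y]].

Definition subunit_connected A L : Prop :=
  forall x y : M, joining_lengths A L x y !=set0.

Definition cc_dist A L (x y : M) : R := inf (joining_lengths A L x y).

Definition cc_complete A L : Prop :=
  forall u : nat -> M,
    (forall e : R, 0 < e -> exists N : nat, forall p q : nat,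
       (N <= p)%N -> (N <= q)%N -> cc_dist A L (u p) (u q) < e) ->
    exists x : M, cc_dist A L (u k) x @[k --> \oo] --> (0 : R).

(** * The vertical form *)

Definition vertical_form A (GammaZ : (M -> R) -> (M -> R) -> M -> R) : Prop :=
  [/\ (forall f g, smooth A f -> smooth A g -> smooth A (GammaZ f g)),
      (forall f g, smooth A f -> smooth A g -> GammaZ f g = GammaZ g f),
      (forall (a : R) f g h, smooth A f -> smooth A g -> smooth A h ->
         forall x, GammaZ (fun y => a * f y + g y) h x =
                   a * GammaZ f h x + GammaZ g h x),
      (forall f g h, smooth A f -> smooth A g -> smooth A h ->
         forall x, GammaZ (fun y => f y * g y) h x =
                   f x * GammaZ g h x + g x * GammaZ f h x) &
      (forall f, smooth A f -> forall x, 0 <= GammaZ f f x)].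

(** * The heat semigroup *)

Section HeatSemigroup.
Variable mu : {measure set (borel M) -> \bar R}.

Definition L2 f : Prop := f \in Lfun mu 2%:E.

Definition ip f g : R := \int[mu]_x (f x * g x).

Definition eq_ae f g : Prop := {ae mu, forall x, f x = g x}.

(* E is a projection-valued measure on L^2(mu) and nu f is the associated
   scalar measure B |-> <E(B) f, f>. The spectrum is contained in ]-oo, 0]. *)
Definition spectral_resolution (E : set R -> (M -> R) -> M -> R)
    (nu : (M -> R) -> {measure set (measurableTypeR R) -> \bar R}) : Prop :=
  [/\ (forall (B : set (measurableTypeR R)) f,
         measurable B -> L2 f -> L2 (E B f)),
      (forall (B : set (measurableTypeR R)) (a : R) f g,
         measurable B -> L2 f -> L2 g ->
         eq_ae (E B (fun x => a * f x + g x))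
               (fun x => a * E B f x + E B g x)),
      (forall (B : set (measurableTypeR R)) f g,
         measurable B -> L2 f -> L2 g ->
         ip (E B f) g = ip f (E B g)),
      (forall (B C : set (measurableTypeR R)) f,
         measurable B -> measurable C -> L2 f ->
         eq_ae (E (B `&` C) f) (E B (E C f))) /\
      (forall f, L2 f -> eq_ae (E setT f) f) &
      (forall (B : set (measurableTypeR R)) f,
         measurable B -> L2 f -> nu f B = (ip (E B f) f)%:E) /\
      (forall f, L2 f -> nu f [set lam : R | 0 < lam] = 0%E)].

(* \int theta(lam) d<E(lam) f, g>, by polarization *)
Definition spectral_int
    (nu : (M -> R) -> {measure set (measurableTypeR R) -> \bar R})
    (theta : R -> R) f g : R :=
  4^-1 * (\int[nu (fun x => (f x + g x)%R)]_lam theta lam -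
          \int[nu (fun x => (f x - g x)%R)]_lam theta lam).

Definition spectral_domain
    (nu : (M -> R) -> {measure set (measurableTypeR R) -> \bar R}) f : Prop :=
  L2 f /\ (\int[nu f]_lam (lam ^+ 2)%:E < +oo)%E.

(* The self-adjoint operator \int lam dE(lam) extends L on C_0^oo. *)
Definition spectral_extension A L
    (nu : (M -> R) -> {measure set (measurableTypeR R) -> \bar R}) : Prop :=
  forall f, test_function A f -> spectral_domain nu f /\
    forall g, spectral_domain nu g -> ip (L f) g = spectral_int nu id f g.

(* P t = \int e^(t lam) dE(lam) *)
Definition heat_semigroup A L (P : R -> (M -> R) -> M -> R) : Prop :=
  exists E nu,
    [/\ spectral_resolution E nu, spectral_extension A L nu &
        forall (t : R) f, 0 <= t -> L2 f -> L2 (P t f) /\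
          forall g, L2 g ->
            ip (P t f) g = spectral_int nu (fun lam => expR (t * lam)) f g].

End HeatSemigroup.

(** * Standing assumptions and the curvature-dimension inequality *)

Definition supnorm f : \bar R := ereal_sup [set (`|f x|)%:E | x in [set: M]].

Definition H1 A L (GammaZ : (M -> R) -> (M -> R) -> M -> R) : Prop :=
  exists h : nat -> M -> R,
    [/\ (forall k, test_function A (h k)),
        (forall k x, h k x <= h k.+1 x),
        (forall x, h k x @[k --> \oo] --> (1 : R)) &
        (supnorm (Gamma L (h k) (h k)) + supnorm (GammaZ (h k) (h k)))%E
          @[k --> \oo] --> 0%E].

Definition H2 A L (GammaZ : (M -> R) -> (M -> R) -> M -> R) : Prop :=
  forall f, smooth A f -> forall x,
    Gamma L f (GammaZ f f) x = GammaZ f (Gamma L f f) x.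

(* P t f is an L^2 class; u is its (unique) smooth representative. *)
Definition H3 A (mu : {measure set (borel M) -> \bar R}) L
    (GammaZ : (M -> R) -> (M -> R) -> M -> R)
    (P : R -> (M -> R) -> M -> R) : Prop :=
  forall f (T : R), test_function A f -> 0 <= T ->
    exists C : R, forall t : R, 0 <= t <= T ->
      exists u : M -> R, [/\ smooth A u, eq_ae mu (P t f) u &
        (supnorm (Gamma L u u) + supnorm (GammaZ u u) <= C%:E)%E].

Definition Gamma2 L f : M -> R := fun x =>
  2^-1 * (L (Gamma L f f) x - 2 * Gamma L f (L f) x).

Definition Gamma2Z L (GammaZ : (M -> R) -> (M -> R) -> M -> R) f : M -> R :=
  fun x => 2^-1 * (L (GammaZ f f) x - 2 * GammaZ f (L f) x).

Definition CD A L GammaZ (rho1 rho2 kappa d : R) : Prop :=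
  forall f (nu : R), smooth A f -> 0 < nu -> forall x,
    d^-1 * (L f x) ^+ 2 + (rho1 - kappa / nu) * Gamma L f f x
      + rho2 * GammaZ f f x
    <= Gamma2 L f x + nu * Gamma2Z L GammaZ f x.

(** * Horizontal perimeter *)

(* A vector field is represented by its action on smooth functions. *)
Definition C1_vector_field A (phi : (M -> R) -> M -> R) : Prop :=
  forall c, A c -> exists v : 'I_n -> 'rV[R]_n -> R,
    (forall i, Ck 1 (cimg c) (v i)) /\
    forall f, smooth A f -> forall x, cdom c x ->
      phi f x =
      \sum_(i < n) v i (cmap c x) * partial i (in_chart c f) (cmap c x).

Definition subunit_field A L (phi : (M -> R) -> M -> R) : Prop :=
  C1_vector_field A phi /\
  forall f, smooth A f -> forall x, `|phi f x| <= Num.sqrt (Gamma L f f x).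

Definition compactly_supported_field A (phi : (M -> R) -> M -> R) : Prop :=
  exists2 K : set M, compact K &
    forall f, smooth A f -> forall x, ~ K x -> phi f x = 0.

Section Perimeter.
Variable mu : {measure set (borel M) -> \bar R}.

(* D = div_mu phi; a continuous D is determined by this identity. *)
Definition is_divergence A (phi : (M -> R) -> M -> R) (D : M -> R) : Prop :=
  continuous D /\
  forall g, test_function A g ->
    \int[mu]_x (g x * D x) = - \int[mu]_x (phi g x).

Definition Var A L f : \bar R :=
  ereal_sup [set v | exists (phi : (M -> R) -> M -> R) (D : M -> R),
    [/\ subunit_field A L phi, compactly_supported_field A phi,
        is_divergence A phi D & v = (\int[mu]_x (f x * D x)%:E)%E]].

Definition BV A L f : Prop :=
  mu.-integrable setT (EFin \o f) /\ (Var A L f < +oo)%E.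

Definition caccioppoli A L (E : set M) : Prop :=
  measurable (E : set (borel M)) /\ BV A L \1_E.

Definition perimeter A L (E : set M) : \bar R := Var A L \1_E.

Definition isoperimetric_constant A L : \bar R :=
  ereal_inf [set (fine (perimeter A L E) / fine (mu E))%:E | E in
    [set E : set M | [/\ caccioppoli A L E, (0 < mu E)%E &
                         (mu E <= (2^-1)%:E)%E]]].

End Perimeter.

End Manifold.

(* Main.v *)
Require Import Defs.
From HB Require Import structures.
From mathcomp Require Import all_boot all_order all_algebra.
From mathcomp Require Import all_classical all_reals all_analysis.
From mathcomp Require Import measurable_realfun ring lra.
Import Order.TTheory GRing.Theory Num.Theory.
Import numFieldNormedType.Exports.
Set Implicit Arguments.
Unset Strict Implicit.
Unset Printing Implicit Defensive.
Local Open Scope classical_set_scope.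
Local Open Scope ring_scope.

(* Write u_t = P_t f for a test function f with |f| <= 1, put alpha = rho1 rho2 / (rho2 + kappa)
   and K = 1 + 2 kappa / rho2. The functional a(t) Gamma(u_t) + b(t) Gamma^Z(u_t) with
   b = (e^(alpha t) - 1)^2 and a = (alpha / rho2) e^(alpha t) (e^(alpha t) - 1) is, by the
   curvature-dimension inequality with nu = b / a and after adding a multiple of u_t^2, a
   subsolution of the heat equation. Testing it against the (positive, mass preserving) heat
   flow of a nonnegative test function gives the reverse Poincare bound
   Gamma(u_t) <= (alpha K / 2) / (e^(alpha t) - 1).
   Along subunit curves this bound forces u_t to converge pointwise to the mean of f. On the
   other hand the time derivative of the integral of u_t over E is the integral over E of
   L u_t, that is, of the divergence of a field of horizontal length at most
   ((alpha K / 2) / (e^(alpha t) - 1))^(1/2), hence at most this length times P(E). Integrating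
   over t > 0 and letting f tend to 1 - 2 * 1_E in L^1 gives
   2 mu(E) (1 - mu(E)) <= 4 (K / (2 alpha))^(1/2) P(E). *)

(** * Functions of class C^k *)

(** The semigroup is given by its spectral resolution, so at first only the numbers <P_t f, g> are
    accessible, with a second-order expansion in t supplied by second spectral moments. Pointwise
    statements are recovered by duality: [form_adjoint] writes the integral of chi * Gamma(v, w) as
    the pairing of v with a fixed test function, expansions with quadratic error replace time
    derivatives, and an inequality tested against all chi >= 0 holds pointwise. Supports of u_t are
    not controlled, so integrations by parts go through the cutoffs h_k of (H.1), with errors of
    order Gamma(h_k)^(1/2). The weights satisfy b' = 2 rho2 a, which cancels Gamma^Z in the
    differential inequality, and alpha is the rate at which the e^(2 alpha t) terms in front of
    Gamma cancel too. There remains - (alpha^2 K / rho2) e^(alpha t) Gamma(u_t), absorbed by a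
    multiple of u_t^2 because (L - d/dt) u_t^2 = 2 Gamma(u_t). The resulting bound on
    Gamma(u_t)^(1/2) is like t^(-1/2) near 0 and exponentially small at infinity, hence integrable
    in time. *)

Section CkCalculus.
Context {R : realType} {n : nat}.
Implicit Types (O : set 'rV[R]_n) (f g : 'rV[R]_n -> R) (x v : 'rV[R]_n).

(** Restriction to a line turns directional derivatives into one-variable ones, where the chain rule
    and the mean value theorem are at hand. *)
Lemma is_derive_slice f x v (df : R) :
  is_derive x v f df <-> is_derive (0 : R) 1 (fun h : R => f (h *: v + x)) df.
Proof.
have E : 'D_v f x = 'D_1 (fun h : R => f (h *: v + x)) 0.
  rewrite /derive (_ : (fun h : R => h^-1 *: ((f \o shift x) (h *: v) - f x)) =
    (fun h : R => h^-1 *: (((fun h : R => f (h *: v + x)) \o shift 0) (h *: 1) -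
       f (0 *: v + x)))) //.
  by apply/funext => h /=; rewrite scale0r add0r addr0 [h *: 1]mulr1.
split=> -[H1 H2]; split.
- exact: (proj1 (derivable1P f x v) H1).
- by rewrite -E.
- exact: (proj2 (derivable1P f x v) H1).
- by rewrite E.
Qed.

Lemma is_derive_comp1 (th : R -> R) f x v (a df : R) :
  is_derive (f x) 1 th a -> is_derive x v f df ->
  is_derive x v (th \o f) (a * df).
Proof.
move=> h1 /is_derive_slice h2; apply/is_derive_slice.
apply: (@is_derive1_comp _ th (fun h : R => f (h *: v + x))) h2.
by rewrite scale0r add0r.
Qed.

Lemma is_derive_local O f g x v (df : R) : open O -> O x ->
  (forall y, O y -> f y = g y) -> is_derive x v f df -> is_derive x v g df.
Proof.
(* Locality of [is_derive] is stated for nonzero directions, so v = 0 is settled apart. *)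
move=> oO Ox fg; have [->|v0] := eqVneq v 0.
  move=> [_ <-]; split; first exact: derivable0.
  by rewrite !derive0.
apply: near_eq_is_derive => //.
by apply: filterS (open_nbhs_nbhs (conj oO Ox)) => y /fg.
Qed.

Lemma Ck_continuous k O f x : Ck k O f -> O x -> {for x, continuous f}.
Proof. by case: k => [|k] [h _]; exact: h. Qed.

Lemma Ck_is_derive k O f x i : Ck k.+1 O f -> O x ->
  is_derive x (delta_mx 0 i) f (partial i f x).
Proof. by move=> [_ h] Ox; apply: derivableP; exact: (proj1 (h i)). Qed.

Lemma Ck_partial k O f i : Ck k.+1 O f -> Ck k O (partial i f).
Proof. by move=> [_ h]; exact: (proj2 (h i)). Qed.

Lemma continuous_local O f g x : open O -> O x -> (forall y, O y -> f y = g y) ->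
  {for x, continuous f} -> {for x, continuous g}.
Proof.
move=> oO Ox fg; rewrite /prop_for /continuous_at fg //.
have H : \forall y \near x, f y = g y.
  by apply: filterS (open_nbhs_nbhs (conj oO Ox)) => y /fg.
apply: cvg_trans; exact: (near_eq_cvg H).
Qed.

Lemma Ck_ext k O f g : open O -> (forall x, O x -> f x = g x) ->
  Ck k O f -> Ck k O g.
Proof.
move=> oO; elim: k f g => [|k IH] f g fg [fc fk]; split=> //.
1,2: by move=> x Ox; apply: (continuous_local oO Ox fg); exact: fc.
move=> i; have [fd fp] := fk i.
have dg x : O x -> is_derive x (delta_mx 0 i) g (partial i f x).
  move=> Ox; apply: (is_derive_local oO Ox fg).
  by apply: derivableP; exact: fd.
split; first by move=> x /dg [].
apply: IH fp => x Ox; rewrite [RHS]/partial.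
by have [_ ->] := dg x Ox.
Qed.

(** The usual way to prove regularity below: exhibit the partial derivatives in closed form, then
    recurse on them. *)
Lemma Ck_intro k O f (df : 'I_n -> 'rV[R]_n -> R) : open O ->
  (forall x, O x -> {for x, continuous f}) ->
  (forall i x, O x -> is_derive x (delta_mx 0 i) f (df i x)) ->
  (forall i, Ck k O (df i)) -> Ck k.+1 O f.
Proof.
move=> oO fc fd fk; split=> // i; split; first by move=> x /(fd i) [].
apply: Ck_ext (fk i) => // x Ox.
by rewrite /partial; have [_ ->] := fd i x Ox.
Qed.

Lemma Ck_local k O f :
  (forall x, O x -> exists2 O', O' x & Ck k O' f) -> Ck k O f.
Proof.
elim: k f => [|k IH] f H; split=> //.
1,2: by move=> x Ox; have [V Vx h] := H x Ox; exact: Ck_continuous h Vx.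
move=> i; split; first by move=> x Ox; have [V Vx [_ /(_ i)[h _]]] := H x Ox; exact: h.
apply: IH => x Ox; have [V Vx h] := H x Ox; exists V => //; exact: Ck_partial.
Qed.

Lemma Ck_sub k O O' f : O' `<=` O -> Ck k O f -> Ck k O' f.
Proof. by move=> OO fk; apply: Ck_local => x /OO Ox; exists O. Qed.

Lemma Ck_le k O f : Ck k.+1 O f -> Ck k O f.
Proof.
elim: k f => [|k IH] f [fc fk]; split=> // i.
by have [h1 h2] := fk i; split=> //; exact: IH.
Qed.

Lemma Ck_cst k O (c : R) : open O -> Ck k O (fun=> c).
Proof.
move=> oO; elim: k c => [|k IH] c; first by split=> // x _; exact: (@cst_continuous _ _ c).
apply: (Ck_intro (df := fun _ _ => 0)) => // x _; exact: (@cst_continuous _ _ c).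
Qed.

Lemma CkD k O f g : open O -> Ck k O f -> Ck k O g ->
  Ck k O (fun x => f x + g x).
Proof.
move=> oO; elim: k f g => [|k IH] f g fk gk.
  split=> // x Ox; apply: continuousD; [exact: (Ck_continuous fk)|exact: (Ck_continuous gk)].
apply: (Ck_intro (df := fun i x => partial i f x + partial i g x)) => //.
- move=> x Ox; apply: continuousD; [exact: (Ck_continuous fk)|exact: (Ck_continuous gk)].
- by move=> i x Ox; apply: is_deriveD; apply: Ck_is_derive Ox; eassumption.
- by move=> i; apply: IH; apply: Ck_partial.
Qed.

Lemma CkM k O f g : open O -> Ck k O f -> Ck k O g ->
  Ck k O (fun x => f x * g x).
Proof.
move=> oO; elim: k f g => [|k IH] f g fk gk.
  split=> // x Ox; apply: continuousM; [exact: (Ck_continuous fk)|exact: (Ck_continuous gk)].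
apply: (Ck_intro (df := fun i x => f x * partial i g x + g x * partial i f x)) => //.
- move=> x Ox; apply: continuousM; [exact: (Ck_continuous fk)|exact: (Ck_continuous gk)].
- move=> i x Ox; apply: (@is_deriveM _ _ f g x);
    apply: Ck_is_derive Ox; eassumption.
- move=> i; apply: CkD => //; apply: IH; (try exact: Ck_partial); exact: Ck_le.
Qed.

Lemma CkZ k O (c : R) f : open O -> Ck k O f -> Ck k O (fun x => c * f x).
Proof. by move=> oO fk; apply: CkM => //; exact: Ck_cst. Qed.

Lemma CkN k O f : open O -> Ck k O f -> Ck k O (fun x => - f x).
Proof.
move=> oO fk; apply: Ck_ext (CkZ (-1) oO fk) => // x _; by rewrite mulN1r.
Qed.

Lemma Ck_sum k O (I : Type) (r : seq I) (f : I -> 'rV[R]_n -> R) : open O ->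
  (forall i, Ck k O (f i)) -> Ck k O (fun x => \sum_(i <- r) f i x).
Proof.
move=> oO fk; elim: r => [|i r IH].
  by apply: Ck_ext (Ck_cst k 0 oO) => // x _; rewrite big_nil.
by apply: Ck_ext (CkD oO (fk i) IH) => // x _; rewrite big_cons.
Qed.

Lemma Ck_comp_continuous (th : R -> R) k O f x : Ck k O f -> O x ->
  {for f x, continuous th} -> {for x, continuous (th \o f)}.
Proof. by move=> fk Ox; apply: continuous_comp; exact: Ck_continuous fk Ox. Qed.

Lemma CkV k O f : open O -> (forall x, O x -> f x != 0) -> Ck k O f ->
  Ck k O (fun x => (f x)^-1).
Proof.
move=> oO f0; elim: k => [|k IH] fk.
  split=> // x Ox; apply: (Ck_comp_continuous fk Ox).
  by apply: inv_continuous; exact: f0.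
apply: (Ck_intro (df := fun i x => - ((f x)^-1 * (f x)^-1) * partial i f x)) => //.
- move=> x Ox; apply: (Ck_comp_continuous fk Ox).
  by apply: inv_continuous; exact: f0.
- move=> i x Ox; apply: (is_derive_comp1 (th := GRing.inv)); last exact: (Ck_is_derive i fk Ox).
  have := @is_deriveV R idfun (f x) 1 1 (f0 _ Ox) (is_derive_id _ _).
  by rewrite /GRing.scale /= mulr1 -invfM -expr2.
- move=> i; apply: CkM => //; last exact: Ck_partial.
  by apply: CkN => //; apply: CkM => //; apply: IH; exact: Ck_le.
Qed.

Lemma Ck_sqrt k O f : open O -> (forall x, O x -> 0 < f x) -> Ck k O f ->
  Ck k O (fun x => Num.sqrt (f x)).
Proof.
move=> oO f0; elim: k => [|k IH] fk.
  split=> // x Ox; apply: (Ck_comp_continuous fk Ox); exact: sqrt_continuous.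
apply: (Ck_intro (df := fun i x => (2 * Num.sqrt (f x))^-1 * partial i f x)) => //.
- move=> x Ox; apply: (Ck_comp_continuous fk Ox); exact: sqrt_continuous.
- move=> i x Ox; apply: (is_derive_comp1 (th := Num.sqrt)); last exact: (Ck_is_derive i fk Ox).
  exact/is_derive1_sqrt/f0.
- move=> i; apply: CkM => //; last exact: Ck_partial.
  apply: CkV => //; first by move=> x Ox; rewrite mulf_neq0// gt_eqF// sqrtr_gt0 f0.
  by apply: CkZ => //; apply: IH; exact: Ck_le.
Qed.

Lemma Ck_coord k O i : open O -> Ck k O (fun x => x 0 i).
Proof.
move=> oO; have c x : {for x, continuous (fun x : 'rV[R]_n => x 0 i)}.
  exact: coord_continuous.
case: k => [|k]; first by split=> // x _; exact: c.
apply: (Ck_intro (df := fun j _ => (j == i)%:R)) => // j; last exact: Ck_cst.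
move=> x _; apply/is_derive_slice.
rewrite (_ : (fun h : R => _) = fun h : R => h * (j == i)%:R + x 0 i).
  apply: is_derive_eq; by rewrite addr0 scaler0 add0r [RHS]mulr1n -[RHS]mulr1.
by apply/funext => h; rewrite !mxE eqxx /= eq_sym.
Qed.

End CkCalculus.

(** * Flat functions and smooth steps *)

Section Flat.
Context {R : realType}.

(* The functions [p(1/x) exp(-1/x)] (extended by 0 to x <= 0) form a class closed under differentiation. *)
Definition flat (p : {poly R}) (x : R) : R :=
  if 0 < x then p.[x^-1] * expR (- x^-1) else 0.

(** With q this polynomial, the derivative of p(1/x) e^(-1/x) is q(1/x) e^(-1/x), since 1/x has
    derivative -1/x^2. *)
Definition flat' (p : {poly R}) : {poly R} := 'X ^+ 2 * (p - p^`()).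

Lemma flat_pos_derive p (x : R) : 0 < x ->
  is_derive x 1 (flat p) (flat (flat' p) x).
Proof.
move=> x0.
have hV : is_derive x 1 (fun y : R => y^-1) (- x^-1 ^+ 2).
  have := @is_deriveV R idfun x 1 1 (lt0r_neq0 x0) (is_derive_id _ _).
  by rewrite /GRing.scale /= mulr1 exprVn.
have h1 : is_derive x 1 (fun y : R => p.[y^-1]) (p^`().[x^-1] * (- x^-1 ^+ 2)).
  exact: (@is_derive1_comp _ (horner p) (fun y => y^-1)).
have h2 : is_derive x 1 (fun y : R => expR (- y^-1)) (expR (- x^-1) * x^-1 ^+ 2).
  have := @is_derive1_comp _ expR (fun y : R => - y^-1) x _ _ (is_derive_expR _) (is_deriveN hV).
  by rewrite opprK.
have := @is_deriveM _ _ _ _ _ _ _ _ h1 h2.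
have E : p.[x^-1] *: (expR (- x^-1) * x^-1 ^+ 2) +
  expR (- x^-1) *: (p^`().[x^-1] * - x^-1 ^+ 2) = flat (flat' p) x.
  rewrite /flat x0 /flat' !hornerE /= /GRing.scale /=; ring.
rewrite E; apply: near_eq_is_derive => //.
near=> y; rewrite /flat ifT //.
by near: y; exact: lt_nbhsr.
Unshelve. all: by end_near. Qed.

(** With y = 1/x, the inequality e^y >= y^(i+2) / (i+2)! gives x^(-i) e^(-1/x) <= (i+2)! x^2. The
    spare factor x^2 is what makes the derivative at 0 vanish. *)
Lemma flat_bound p : exists2 C : R, 0 <= C & forall x : R, `|flat p x| <= C * x ^+ 2.
Proof.
have key : forall y : R, 0 <= y -> forall i, y ^+ i.+2 * expR (- y) <= (i.+2)`!%:R.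
  move=> y y0 i; rewrite expRN ler_pdivrMr ?expR_gt0// mulrC -ler_pdivrMr ?ltr0n ?fact_gt0//.
  by apply: le_trans (expR_ge1Dxn i.+1 y0); rewrite lerDr.
exists (\sum_(i < size p) `|p`_i| * (i.+2)`!%:R).
  by apply: sumr_ge0 => i _; rewrite mulr_ge0.
move=> x; rewrite /flat; case: ifPn => x0; last first.
  by rewrite normr0 mulr_ge0 ?sqr_ge0// sumr_ge0// => i _; rewrite mulr_ge0.
rewrite horner_coef normrM (ger0_norm (expR_ge0 _)) mulr_suml.
apply: le_trans (_ : (\sum_(i < size p) `|p`_i * x^-1 ^+ i|) * expR (- x^-1) <= _).
  by rewrite ler_wpM2r ?expR_ge0// ler_norm_sum.
rewrite mulr_suml; apply: ler_sum => i _.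
have xV0 : 0 <= x^-1 by rewrite invr_ge0 ltW.
rewrite normrM -!mulrA ler_wpM2l// normrX (ger0_norm xV0).
rewrite -ler_pdivrMr ?exprn_gt0//; apply: le_trans (key _ xV0 i).
rewrite mulrAC -exprVn -exprD addn2; exact: lexx.
Qed.

End Flat.

(** An explicit quadratic error is the form in which most one-variable derivatives are obtained:
    flat functions at 0, radial means, and the heat flow in time. *)
Lemma is_derive_quadratic {R : realType} (f : R -> R) (x d r C : R) : 0 < r ->
  (forall h, `|h| < r -> `|f (x + h) - f x - d * h| <= C * h ^+ 2) ->
  is_derive x 1 f d.
Proof.
move=> r0 H.
suff H1 : (fun h : R => h^-1 *: ((f \o shift x) (h *: 1) - f x)) @ 0^' --> d.
  by split; [apply/cvg_ex; exists d|exact: cvg_lim H1].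
apply/cvgrPdist_le => e e0.
near=> h.
have h0 : h != 0 by near: h; exact: nbhs_dnbhs_neq.
have hr : `|h| < r.
  near: h; apply: nbhs_dnbhs; exact: (@nbhs0_lt _ R r r0).
have he : (`|C| + 1) * `|h| < e.
  rewrite mulrC -ltr_pdivlMr ?ltr_wpDl//.
  near: h; apply: nbhs_dnbhs; apply: (@nbhs0_lt _ R).
  by rewrite divr_gt0// ltr_wpDl.
rewrite /= [h *: 1]mulr1 (addrC h) -normrN opprB.
have -> : h^-1 *: (f (x + h) - f x) - d = h^-1 * (f (x + h) - f x - d * h).
  by rewrite mulrBr [d * h]mulrC mulKf.
rewrite normrM normfV mulrC ler_pdivrMr ?normr_gt0//.
apply: le_trans (H _ hr) _.
rewrite -(real_normK (num_real h)) expr2 mulrA ler_wpM2r// (le_trans _ (ltW he))//.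
rewrite ler_wpM2r// (le_trans (ler_norm _))// lerDl//.
Unshelve. all: by end_near. Qed.

Section Flat2.
Context {R : realType}.

Lemma flat_derive (p : {poly R}) (x : R) :
  is_derive x 1 (flat p) (flat (flat' p) x).
Proof.
have [x0|] := ltP 0 x; first exact: flat_pos_derive.
rewrite le_eqVlt => /orP[/eqP->|x0]; last first.
  rewrite {2}/flat ltNge (ltW x0) /=.
  apply: (@is_derive_quadratic _ _ _ _ (- x) 0); first by rewrite oppr_gt0.
  move=> h; rewrite ltr_norml opprK => /andP[_ hx].
  rewrite /flat ltNge (_ : x + h <= 0) /=; last by lra.
  by rewrite ltNge (ltW x0) /= !mul0r !subr0 normr0.
rewrite {2}/flat ltxx.
have [C C0 HC] := flat_bound p.
apply: (@is_derive_quadratic _ _ _ _ 1 C) => // h _.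
by rewrite {2}/flat ltxx mul0r !subr0 add0r.
Qed.

Lemma flat_continuous (p : {poly R}) : continuous (flat p).
Proof.
move=> x; apply: differentiable_continuous; apply/derivable1_diffP.
by have [] := flat_derive p x.
Qed.

Lemma Ck_flat n k (O : set 'rV[R]_n) (f : 'rV[R]_n -> R) p : open O -> Ck k O f ->
  Ck k O (fun x => flat p (f x)).
Proof.
move=> oO; elim: k p => [|k IH] p fk.
  split=> // x Ox; apply: (Ck_comp_continuous fk Ox); exact: flat_continuous.
apply: (Ck_intro (df := fun i x => flat (flat' p) (f x) * partial i f x)) => //.
- move=> x Ox; apply: (Ck_comp_continuous fk Ox); exact: flat_continuous.
- move=> i x Ox; apply: (is_derive_comp1 (th := flat p)); last exact: (Ck_is_derive i fk Ox).
  exact: flat_derive.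
- by move=> i; apply: CkM => //; [apply: IH; exact: Ck_le|exact: Ck_partial].
Qed.

(** Smooth step from 0 on x <= 0 to 1 on x >= 1; the denominator never vanishes because x and 1 - x
    are not both nonpositive. *)
Definition sstep (x : R) : R := flat 1 x / (flat 1 x + flat 1 (1 - x)).

Lemma flat1_ge0 (x : R) : 0 <= flat 1 x.
Proof. by rewrite /flat; case: ifP => // _; rewrite hornerC mul1r expR_ge0. Qed.

Lemma flat1_gt0 (x : R) : 0 < x -> 0 < flat 1 x.
Proof. by move=> x0; rewrite /flat x0 hornerC mul1r expR_gt0. Qed.

Lemma flat1_le0 (x : R) : x <= 0 -> flat 1 x = 0.
Proof. by move=> x0; rewrite /flat ltNge x0. Qed.

Lemma sstep_den_gt0 (x : R) : 0 < flat 1 x + flat 1 (1 - x).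
Proof.
have [x0|x0] := ltP 0 x; first by rewrite ltr_pwDl ?flat1_gt0 ?flat1_ge0.
by rewrite ltr_wpDl ?flat1_ge0 ?flat1_gt0// subr_gt0 (le_lt_trans x0).
Qed.

Lemma sstep_ge0 (x : R) : 0 <= sstep x.
Proof. by rewrite divr_ge0 ?flat1_ge0// ltW// sstep_den_gt0. Qed.

Lemma sstep_le1 (x : R) : sstep x <= 1.
Proof. by rewrite ler_pdivrMr ?sstep_den_gt0// mul1r lerDl flat1_ge0. Qed.

Lemma sstep_le0 (x : R) : x <= 0 -> sstep x = 0.
Proof. by move=> x0; rewrite /sstep flat1_le0// mul0r. Qed.

Lemma sstep_ge1 (x : R) : 1 <= x -> sstep x = 1.
Proof.
move=> x1; rewrite /sstep (flat1_le0 (x := 1 - x)) ?subr_le0// addr0 divff//.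
by rewrite gt_eqF// flat1_gt0// (lt_le_trans ltr01).
Qed.

Lemma Ck_sstep n k (O : set 'rV[R]_n) (f : 'rV[R]_n -> R) : open O -> Ck k O f ->
  Ck k O (fun x => sstep (f x)).
Proof.
move=> oO fk; apply: CkM => //; first exact: Ck_flat.
apply: CkV => //; first by move=> x _; rewrite gt_eqF// sstep_den_gt0.
apply: CkD => //; first exact: Ck_flat.
by apply: Ck_flat => //; apply: CkD => //; [exact: Ck_cst|exact: CkN].
Qed.

End Flat2.

Lemma frac_le {R : realType} (e S : R) : 0 <= e -> 0 <= S -> e / (S + 1) * S <= e.
Proof.
move=> e0 S0; rewrite -[leRHS]mulr1 -mulrA; apply: ler_wpM2l => //.
by rewrite mulrC ler_pdivrMr ?ltr_wpDl// mul1r lerDl.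
Qed.

(** * The chain rule in several variables *)

Section MultivariateChainRule.
Context {R : realType} {n : nat}.
Implicit Types (O : set 'rV[R]_n) (f : 'rV[R]_n -> R) (x y : 'rV[R]_n).

(* Passing from x to y one coordinate at a time and applying the mean value theorem to each step. *)
Lemma coordinatewise_mvt O f (x y : 'rV[R]_n) (d : 'I_n -> R) (e : R) : Ck 1 O f ->
  (forall z : 'rV[R]_n, (forall i, `|z 0 i - x 0 i| <= `|y 0 i - x 0 i|) -> O z /\
     forall i, `|partial i f z - d i| <= e) ->
  `|f y - f x - \sum_(i < n) (y 0 i - x 0 i) * d i| <=
    e * \sum_(i < n) `|y 0 i - x 0 i|.
Proof.
move=> fk H.
pose q (k : nat) : 'rV[R]_n := \row_i (if (i < k)%N then y 0 i else x 0 i).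
have q0 : q 0 = x by apply/rowP => i; rewrite mxE.
have qn : q n = y by apply/rowP => i; rewrite mxE ltn_ord.
rewrite -{1}qn -{1}q0 -(telescope_sumr (fun k => f (q k))) // big_mkord -sumrB mulr_sumr.
apply: le_trans (ler_norm_sum _ _ _) _; apply: ler_sum => i _.
pose D := y 0 i - x 0 i.
pose z (t : R) := (t * D) *: delta_mx 0 i + q i.
have zE t j : z t 0 j = if j == i then x 0 j + t * D else q i 0 j.
  rewrite !mxE eqxx /=; case: eqVneq => [->|_]; last by rewrite mulr0 add0r.
  by rewrite ltnn mulr1 addrC.
have q1 : q i.+1 = z 1.
  apply/rowP => j; rewrite zE mxE ltnS leq_eqVlt mul1r /D.
  have [->|ji] := eqVneq j i; first by rewrite eqxx /= addrC subrK.
  by rewrite mxE (negbTE ji : (j == i :> nat) = false).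
have qi : q i = z 0.
  by rewrite /z mul0r scale0r add0r.
have zin (t : R) : 0 <= t <= 1 -> forall j, `|z t 0 j - x 0 j| <= `|y 0 j - x 0 j|.
  move=> /andP[t0 t1] j; rewrite zE; case: eqVneq => [->|_].
    rewrite addrAC subrr add0r normrM (ger0_norm t0) ler_piMl//.
  by rewrite mxE; case: ifP => // _; rewrite subrr normr0.
have dz (t : R) : 0 <= t <= 1 -> is_derive t 1 (f \o z) (D * partial i f (z t)).
  move=> tI; have [Oz _] := H _ (zin t tI).
  have /is_derive_slice fd := Ck_is_derive i fk Oz.
  have hd : is_derive t 1 (fun s : R => (s - t) * D) D.
    apply: (@is_derive_quadratic _ _ _ _ 1 0) => // h _.
    by rewrite (_ : _ - _ - _ = 0) ?normr0 ?mul0r//; ring.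
  have := @is_derive1_comp _ (fun h : R => f (h *: delta_mx 0 i + z t)) (fun s : R => (s - t) * D) t _ _ _ hd.
  rewrite subrr mul0r => /(_ _ fd); rewrite mulrC.
  rewrite (_ : _ \o _ = f \o z) //; apply/funext => s /=; congr f.
  by rewrite /z addrA -scalerDl -mulrDl subrK.
have cz : {within `[0, 1], continuous (f \o z)}.
  apply: derivable_within_continuous => t; rewrite in_itv /= => tI.
  by have [] := dz t tI.
have dz' (t : R) : t \in `]0, 1[ -> is_derive t 1 (f \o z) (D * partial i f (z t)).
  by rewrite in_itv /= => /andP[? ?]; apply: dz; rewrite !ltW.
have [c cI] := MVT_segment ler01 dz' cz.
rewrite subr0 mulr1 /= -q1 -qi => ->.
rewrite -/D -mulrBr normrM mulrC ler_wpM2r//.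
by have [_] := H _ (zin c cI); exact.
Qed.

Lemma C1_differentiable_bound O f x (e : R) : open O -> O x -> Ck 1 O f -> 0 < e ->
  exists2 r : R, 0 < r & forall y : 'rV[R]_n, (forall i, `|y 0 i - x 0 i| < r) -> O y /\
    `|f y - f x - \sum_(i < n) (y 0 i - x 0 i) * partial i f x| <=
       e * \sum_(i < n) `|y 0 i - x 0 i|.
Proof.
move=> oO Ox fk e0.
have : \forall z \near x, O z /\ forall i : 'I_n, `|partial i f z - partial i f x| <= e.
  apply: filterI; first exact: open_nbhs_nbhs.
  apply: (@filter_forall _ _ _ (nbhs x)) => i.
  have /cvgrPdist_le /(_ _ e0) := Ck_continuous (Ck_partial i fk) Ox.
  by apply: filterS => z; rewrite distrC.
move=> /nbhs_ballP[r /= r0 Hr].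
have inb (z : 'rV[R]_n) : (forall i, `|z 0 i - x 0 i| < r) -> ball x r z.
  by move=> zr; split=> // i j; rewrite !ord1 /ball /= distrC.
exists r => // y yr; split; first by have [] := Hr _ (inb _ yr).
apply: (coordinatewise_mvt fk) => z zy.
by apply: Hr; apply: inb => i; exact: le_lt_trans (zy i) (yr i).
Qed.

Lemma continuous_row (T : topologicalType) (x : T) (g : 'I_n -> T -> R) :
  (forall j, {for x, continuous (g j)}) ->
  {for x, continuous (fun z => (\row_j g j z) : 'rV[R]_n)}.
Proof.
move=> gc; apply/(@cvg_ballP _ _ _ (nbhs x)) => e e0.
suff H : \forall z \near x, forall j : 'I_n, ball (g j x) e (g j z).
  by apply: filterS H => z H; split=> // i j; rewrite !mxE.
apply: (@filter_forall _ _ _ (nbhs x)) => j.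
by have /cvg_ballP/(_ _ e0) := gc j.
Qed.

Lemma chain_rule m O f (x v : 'rV[R]_m) (g : 'I_n -> 'rV[R]_m -> R) (dg : 'I_n -> R) :
  open O -> Ck 1 O f -> O (\row_j g j x) ->
  (forall j, is_derive x v (g j) (dg j)) ->
  is_derive x v (fun z => f (\row_j g j z))
    (\sum_(j < n) dg j * partial j f (\row_j g j x)).
Proof.
move=> oO fk Ogx gd; apply/is_derive_slice.
pose G (j : 'I_n) (h : R) := g j (h *: v + x).
pose y0 : 'rV[R]_n := \row_j g j x.
have G0 j : G j 0 = y0 0 j by rewrite /G scale0r add0r mxE.
have Gd j : is_derive (0 : R) 1 (G j) (dg j) by apply/is_derive_slice.
have Gc j : {for 0, continuous (G j)}.
  by apply: differentiable_continuous; apply/derivable1_diffP; have [] := Gd j.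
have GQ j : (fun h : R => h^-1 * (G j h - G j 0)) @ 0^' --> dg j.
  have [d1 d2] := Gd j.
  have : (fun h : R => h^-1 *: ((G j \o shift 0) (h *: 1) - G j 0)) @ 0^' --> dg j.
    by rewrite -d2; exact: d1.
  rewrite (_ : (fun h : R => h^-1 *: _) = fun h : R => h^-1 * (G j h - G j 0)) //.
  by apply/funext => h /=; rewrite addr0 [h *: 1]mulr1.
pose F (h : R) := f (\row_j G j h).
rewrite (_ : (fun h : R => _) = F) //.
have F0 : F 0 = f y0 by congr f; apply/rowP => j; rewrite mxE G0.
suff HF : (fun h : R => h^-1 *: ((F \o shift 0) (h *: 1) - F 0)) @ 0^' -->
    (\sum_(j < n) dg j * partial j f y0 : R).
  by split; [apply/cvg_ex; eexists; exact: HF|exact: cvg_lim HF].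
apply/cvgrPdist_le => e e0.
pose S1 := \sum_(j < n) (`|dg j| + 1); pose S2 := \sum_(j < n) `|partial j f y0|.
have S10 : 0 <= S1 by apply: sumr_ge0.
have S20 : 0 <= S2 by apply: sumr_ge0.
(* Half of e pays for the linearization error of f, half for the error of the difference quotients.
   The cap [e2 <= 1] keeps these quotients below |dg j| + 1, whence the choice of [S1]. *)
pose e1 := e / 2 / (S1 + 1); have e10 : 0 < e1 by rewrite !divr_gt0// ltr_wpDl.
pose e2 := Num.min 1 (e / 2 / (S2 + 1)).
have e20 : 0 < e2 by rewrite lt_min ltr01 !divr_gt0// ltr_wpDl.
have [r r0 Hr] := C1_differentiable_bound oO Ogx fk e10.
have n1 : \forall h \near 0^', forall j : 'I_n, `|h^-1 * (G j h - G j 0) - dg j| <= e2.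
  apply: filter_forall => j; have /cvgrPdist_le/(_ _ e20) := GQ j.
  by apply: filterS => h; rewrite distrC.
have n2 : \forall h \near 0^', forall j : 'I_n, `|G j h - y0 0 j| < r.
  apply: filter_forall => j; apply: nbhs_dnbhs.
  have /cvgrPdist_lt/(_ _ r0) := Gc j.
  by apply: filterS => h; rewrite distrC G0.
near=> h.
have h0 : h != 0 by near: h; exact: nbhs_dnbhs_neq.
have H1 : forall j : 'I_n, `|h^-1 * (G j h - G j 0) - dg j| <= e2 by near: h.
have H2 : forall j : 'I_n, `|G j h - y0 0 j| < r by near: h.
rewrite /= addr0 [h *: 1]mulr1 F0 distrC.
pose Rem := F h - f y0 - \sum_(j < n) (G j h - y0 0 j) * partial j f y0.
have HRem : `|Rem| <= e1 * \sum_(j < n) `|G j h - y0 0 j|.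
  have [|_] := Hr (\row_j G j h); first by move=> j; rewrite mxE; exact: H2.
  by rewrite /Rem; under eq_bigr do rewrite mxE; under [X in _ * X]eq_bigr do rewrite mxE.
have -> : h^-1 *: (F h - f y0) - \sum_(j < n) dg j * partial j f y0 =
  h^-1 * Rem + \sum_(j < n) (h^-1 * (G j h - G j 0) - dg j) * partial j f y0.
  rewrite /Rem mulrBr -!addrA; congr (_ + _).
  rewrite mulr_sumr -!sumrN -big_split /=; apply: eq_bigr => j _; rewrite G0; ring.
apply: le_trans (ler_normD _ _) _; rewrite (splitr e); apply: lerD.
  rewrite normrM normfV mulrC ler_pdivrMr ?normr_gt0//.
  apply: le_trans HRem _.
  have : \sum_(j < n) `|G j h - y0 0 j| <= S1 * `|h|.
    rewrite mulr_suml; apply: ler_sum => j _.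
    rewrite -ler_pdivrMr ?normr_gt0// mulrC -normfV -normrM -G0.
    have := H1 j; set q := h^-1 * _ => hq.
    rewrite -(subrK (dg j) q); apply: le_trans (ler_normD _ _) _; rewrite addrC lerD2l.
    by apply: le_trans hq _; rewrite ge_min lexx.
  move=> hS; apply: le_trans (ler_wpM2l (ltW e10) hS) _.
  by rewrite mulrA; apply: ler_wpM2r => //; apply: frac_le => //; apply: divr_ge0 => //; exact: ltW.
apply: le_trans (ler_norm_sum _ _ _) _.
apply: le_trans (_ : e2 * S2 <= _).
  rewrite mulr_sumr; apply: ler_sum => j _; rewrite normrM ler_wpM2r//.
apply: le_trans (_ : e / 2 / (S2 + 1) * S2 <= _).
  by rewrite ler_wpM2r// ge_min lexx orbT.
by apply: frac_le => //; apply: divr_ge0 => //; exact: ltW.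
Unshelve. all: by end_near. Qed.

Lemma Ck_comp m k O (O' : set 'rV[R]_m) f (g : 'I_n -> 'rV[R]_m -> R) : open O -> open O' ->
  (forall x : 'rV[R]_m, O' x -> O (\row_j g j x)) -> (forall j, Ck k O' (g j)) -> Ck k O f ->
  Ck k O' (fun z => f (\row_j g j z)).
Proof.
move=> oO oO' gO.
have C k' f' : (forall j, Ck k' O' (g j)) -> Ck k' O f' ->
    forall x : 'rV[R]_m, O' x -> {for x, continuous (fun z => f' (\row_j g j z))}.
  move=> gk fk x O'x.
  apply: (@continuous_comp _ _ _ (fun z => (\row_j g j z) : 'rV[R]_n) f').
    by apply: continuous_row => j; exact: Ck_continuous (gk j) O'x.
  by apply: (Ck_continuous fk); exact: gO.
elim: k f => [|k IH] f gk fk; first by split=> //; exact: (C 0).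
apply: (Ck_intro (df := fun i z => \sum_(j < n) partial i (g j) z *
    partial j f (\row_j g j z))) => //.
- exact: (C k.+1).
- move=> i x O'x; apply: (chain_rule oO); [|exact: gO|].
    by elim: k fk {IH gk} => // k IHk fk; apply: IHk; exact: Ck_le.
  by move=> j; exact: Ck_is_derive O'x.
- move=> i; apply: Ck_sum => // j; apply: CkM => //; first exact: Ck_partial.
  by apply: IH; [move=> l; exact: Ck_le|exact: Ck_partial].
Qed.

End MultivariateChainRule.

(** * Smooth functions on the manifold *)

(** Compactness as an induction principle: a hereditary property stable under unions that holds near
    every point holds on K. It builds cutoffs, adjoints and uniform indices without handling finite
    covers each time. *)
Lemma compact_ind (T : ptopologicalType) (P : set T -> Prop) (K : set T) :
  P set0 -> (forall X Y, P X -> P Y -> P (X `|` Y)) ->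
  (forall X Y, X `<=` Y -> P Y -> P X) ->
  (forall x, K x -> exists V, [/\ open V, V x & P V]) -> compact K -> P K.
Proof.
move=> P0 PU PS PV; rewrite compact_cover => cK.
pose F (V : set T) := if `[< open V /\ P V >] then V else set0.
have [] := cK _ setT F.
- move=> V _; rewrite /F; case: asboolP => [[]//|_]; exact: open0.
- move=> x Kx; have [V [oV Vx PV']] := PV x Kx.
  by exists V => //; rewrite /F; case: asboolP => // -[].
move=> D _ KD; apply: (PS _ _ KD).
have H (s : seq (set T)) : P (\bigcup_(i in [set x | x \in s]) F i).
  elim: s => [|V s IH]; first by apply: PS P0 => x [].
  have : P (F V `|` \bigcup_(i in [set x | x \in s]) F i).
    by apply: PU IH; rewrite /F; case: asboolP => // -[].
  apply: PS => x [W /=]; rewrite inE => /orP[/eqP->|Ws] Wx; first by left.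
  by right; exists W.
apply: PS (H (finmap.enum_fset D)) => x [V DV FVx]; by exists V.
Qed.

Lemma partial_local {R : realType} n (O : set 'rV[R]_n) (f g : 'rV[R]_n -> R) y i :
  open O -> O y -> (forall z, O z -> f z = g z) -> partial i f y = partial i g y.
Proof.
move=> oO Oy fg; apply: near_eq_derive.
by apply: filterS (open_nbhs_nbhs (conj oO Oy)) => z /fg.
Qed.

Section Smooth.
Context {R : realType} {M : ptopologicalType} {n : nat}.
Variable A : set (chart R M n).
Hypothesis at_A : smooth_atlas A.
Implicit Types (c : chart R M n) (f g h : M -> R) (U V K : set M) (x : M).

Lemma chart_is_chart c : A c -> is_chart c.
Proof. by case: at_A => h _ _; exact: h. Qed.

Lemma chart_at x : exists2 c, A c & cdom c x.
Proof. by case: at_A => _ h _. Qed.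

Lemma open_cimg c : A c -> open (cimg c).
Proof. by move=> /chart_is_chart[]. Qed.

Lemma open_cdom c : A c -> open (cdom c).
Proof. by move=> /chart_is_chart[]. Qed.

Lemma cmapK c x : A c -> cdom c x -> cinv c (cmap c x) = x.
Proof. by move=> /chart_is_chart[_ _ h _ _]; exact: h. Qed.

Lemma cimg_cmap c x : cdom c x -> cimg c (cmap c x).
Proof. by move=> cx; exists x. Qed.

Lemma cdom_cinv c y : A c -> cimg c y -> cdom c (cinv c y).
Proof. by move=> Ac [x cx <-]; rewrite cmapK. Qed.

Lemma cinvK c y : A c -> cimg c y -> cmap c (cinv c y) = y.
Proof. by move=> Ac [x cx <-]; rewrite cmapK. Qed.

Lemma cmap_continuous c x : A c -> cdom c x -> {for x, continuous (cmap c)}.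
Proof. by move=> /chart_is_chart[_ _ _ h _]; exact: h. Qed.

Lemma cinv_continuous c y : A c -> cimg c y -> {for y, continuous (cinv c)}.
Proof. by move=> /chart_is_chart[_ _ _ _ h]; exact: h. Qed.

Lemma open_chart_preimage c U : A c -> open U -> open (cimg c `&` cinv c @^-1` U).
Proof.
move=> Ac oU; rewrite openE => y [cy Uy].
apply: filterI; first exact: open_nbhs_nbhs (conj (open_cimg Ac) cy).
by apply: (cinv_continuous Ac cy); exact: open_nbhs_nbhs (conj oU Uy).
Qed.

Lemma open_chart_image c (O : set 'rV[R]_n) : A c -> open O -> open (cdom c `&` cmap c @^-1` O).
Proof.
move=> Ac oO; rewrite openE => x [cx Ox].
apply: filterI; first exact: open_nbhs_nbhs (conj (open_cdom Ac) cx).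
by apply: (cmap_continuous Ac cx); exact: open_nbhs_nbhs (conj oO Ox).
Qed.

Lemma smooth_glue f :
  (forall x, exists U, [/\ open U, U x &
     forall c k, A c -> Ck k (cimg c `&` cinv c @^-1` U) (in_chart c f)]) ->
  smooth A f.
Proof.
move=> H c Ac k; apply: Ck_local => y cy.
have [U [oU Uy HU]] := H (cinv c y).
by exists (cimg c `&` cinv c @^-1` U) => //; exact: HU.
Qed.

Lemma smooth_cst (a : R) : smooth A (fun=> a).
Proof. by move=> c Ac k; apply: Ck_cst; exact: open_cimg. Qed.

Lemma smoothD f g : smooth A f -> smooth A g -> smooth A (fun x => f x + g x).
Proof. by move=> sf sg c Ac k; apply: CkD; [exact: open_cimg|exact: sf|exact: sg]. Qed.

Lemma smoothM f g : smooth A f -> smooth A g -> smooth A (fun x => f x * g x).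
Proof. by move=> sf sg c Ac k; apply: CkM; [exact: open_cimg|exact: sf|exact: sg]. Qed.

Lemma smoothN f : smooth A f -> smooth A (fun x => - f x).
Proof. by move=> sf c Ac k; apply: CkN; [exact: open_cimg|exact: sf]. Qed.

Lemma smoothB f g : smooth A f -> smooth A g -> smooth A (fun x => f x - g x).
Proof. by move=> sf sg; apply: smoothD => //; exact: smoothN. Qed.

Lemma smoothZ (a : R) f : smooth A f -> smooth A (fun x => a * f x).
Proof. by move=> sf; apply: smoothM => //; exact: smooth_cst. Qed.

Lemma smoothX f k : smooth A f -> smooth A (fun x => f x ^+ k).
Proof.
move=> sf; elim: k => [|k IH]; first exact: smooth_cst.
by under [X in smooth A X]eq_fun do rewrite exprS; exact: smoothM.
Qed.

Lemma smoothV f : smooth A f -> (forall x, f x != 0) -> smooth A (fun x => (f x)^-1).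
Proof.
by move=> sf f0 c Ac k; apply: CkV => //; [exact: open_cimg|exact: sf].
Qed.

Lemma smooth_sqrt f : smooth A f -> (forall x, 0 < f x) ->
  smooth A (fun x => Num.sqrt (f x)).
Proof.
by move=> sf f0 c Ac k; apply: Ck_sqrt => //; [exact: open_cimg|exact: sf].
Qed.

Lemma smooth_continuous f : smooth A f -> continuous f.
Proof.
move=> sf x; have [c Ac cx] := chart_at x.
have H : {near nbhs x, (in_chart c f) \o cmap c =1 f}.
  apply: filterS (open_nbhs_nbhs (conj (open_cdom Ac) cx)) => y cy.
  by rewrite /in_chart /= cmapK.
have : {for x, continuous (in_chart c f \o cmap c)}.
  apply: continuous_comp; first exact: cmap_continuous.
  by apply: (Ck_continuous (sf c Ac 0)); exact: cimg_cmap.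
rewrite /prop_for /continuous_at {2}/in_chart /= cmapK //.
by apply: cvg_trans; exact: near_eq_cvg H.
Qed.

Lemma partial_germ c U f g x i : A c -> cdom c x -> open U -> U x ->
  (forall y, U y -> f y = g y) ->
  partial i (in_chart c f) (cmap c x) = partial i (in_chart c g) (cmap c x).
Proof.
move=> Ac cx oU Ux fg; apply: (partial_local (O := cimg c `&` cinv c @^-1` U)).
- exact: open_chart_preimage.
- by split; [exact: cimg_cmap|rewrite /= cmapK].
- by move=> y [_ /fg].
Qed.

Lemma partial2_germ c U f g x i j : A c -> cdom c x -> open U -> U x ->
  (forall y, U y -> f y = g y) ->
  partial i (partial j (in_chart c f)) (cmap c x) =
  partial i (partial j (in_chart c g)) (cmap c x).
Proof.
move=> Ac cx oU Ux fg; apply: (partial_local (O := cimg c `&` cinv c @^-1` U)).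
- exact: open_chart_preimage.
- by split; [exact: cimg_cmap|rewrite /= cmapK].
- move=> y [cy Uy]; rewrite -(cinvK Ac cy).
  apply: (partial_germ _ Ac _ oU) => //; exact: cdom_cinv.
Qed.

Lemma supp_out f x : ~ supp f x -> f x = 0.
Proof.
move=> sx; apply/eqP; apply: contra_notT sx => fx; exact: subset_closure.
Qed.

Lemma closed_supp f : closed (supp f).
Proof. exact: closed_closure. Qed.

Lemma supp_sub f K : closed K -> (forall x, ~ K x -> f x = 0) -> supp f `<=` K.
Proof.
move=> cK fK; move/closure_id: cK => ->; apply: closure_subset => x /= /eqP fx.
by apply: contrapT => /fK.
Qed.

Hypothesis hM : hausdorff_space M.

(* A function given in the chart c, vanishing off a compact subset of the image of c, extends by zero. *)
Lemma chart_extend c (F : 'rV[R]_n -> R) (K : set 'rV[R]_n) : A c ->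
  Cinfty (cimg c) F -> compact K -> K `<=` cimg c ->
  (forall y, cimg c y -> ~ K y -> F y = 0) ->
  exists f, [/\ smooth A f, (forall x, cdom c x -> f x = F (cmap c x)),
    compact (supp f), supp f `<=` cdom c & supp f `<=` cinv c @` K].
Proof.
move=> Ac sF cK KO F0; pose f x := if `[< cdom c x >] then F (cmap c x) else 0.
have cKi : compact (cinv c @` K).
  apply: continuous_compact => //; apply: continuous_in_subspaceT => y /[!inE] Ky.
  exact: cinv_continuous (KO _ Ky).
have clK : closed (cinv c @` K) by exact: compact_closed.
have fd x : cdom c x -> f x = F (cmap c x) by rewrite /f; case: asboolP.
have f0 x : ~ (cinv c @` K) x -> f x = 0.
  move=> Kx; rewrite /f; case: asboolP => // cx; apply: F0; first exact: cimg_cmap.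
  by move=> Kc; apply: Kx; exists (cmap c x) => //; exact: cmapK.
have sK : supp f `<=` cinv c @` K by exact: supp_sub.
exists f; split=> //.
(* Inside [cdom c] the coordinate changes of the atlas carry F to every other chart. Elsewhere f
   vanishes on the complement of a compact set, which is open because the space is Hausdorff. *)
- apply: smooth_glue => x; have [cx|ncx] := pselect (cdom c x).
    exists (cdom c); split=> //; first exact: open_cdom.
    move=> c' k Ac'; set O' := _ `&` _.
    have oO' : open O' by apply: open_chart_preimage => //; exact: open_cdom.
    apply: (Ck_ext oO' (f := fun y => F (\row_j cmap c (cinv c' y) 0 j))).
      move=> y [c'y cy]; rewrite /in_chart /= fd //; congr F.
      by apply/rowP => j; rewrite mxE.
    apply: (Ck_comp (open_cimg Ac) oO') (sF k).
      move=> y [c'y cy]; exists (cinv c' y) => //.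
      by apply/rowP => j; rewrite mxE.
    move=> j; case: at_A => _ _ /(_ c' c Ac' Ac j k).
    apply: Ck_sub => y [c'y cy]; exists (cinv c' y); last exact: cinvK.
    by split => //; exact: cdom_cinv.
  exists (~` (cinv c @` K)); split.
  - exact: closed_openC.
  - by move=> [y Ky yx]; apply: ncx; rewrite -yx; apply: cdom_cinv => //; exact: KO.
  - move=> c' k Ac'; set O' := _ `&` _.
    have oO' : open O' by apply: open_chart_preimage => //; exact: closed_openC.
    apply: (Ck_ext oO' (f := fun=> 0)); last exact: Ck_cst.
    by move=> y [_ Ky]; rewrite /in_chart /= f0.
- exact: subclosed_compact (@closed_supp f) cKi sK.
- by move=> x /sK[y Ky <-]; apply: cdom_cinv => //; exact: KO.
Qed.

Lemma bump_at U x : open U -> U x -> exists f V,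
  [/\ smooth_csupp A U f, (forall z, 0 <= f z <= 1), open V, V x & forall z, V z -> f z = 1].
Proof.
move=> oU Ux; have [c Ac cx] := chart_at x.
pose O := cimg c `&` cinv c @^-1` U.
have oO : open O by exact: open_chart_preimage.
pose y0 := cmap c x.
have Oy0 : O y0 by split; [exact: cimg_cmap|rewrite /= cmapK].
have /nbhs_ballP[r /= r0 Hr] : nbhs y0 O by exact: open_nbhs_nbhs (conj oO Oy0).
(* The quadratic [q] below is smooth, unlike the norm. Since 2 (r/2)^2 < r^2, the set [q <= 2] that
   carries the bump stays inside the ball of radius r. *)
pose s := r / 2; have s0 : 0 < s by rewrite divr_gt0.
pose q (y : 'rV[R]_n) := \sum_(j < n) (y 0 j - y0 0 j) ^+ 2 / s ^+ 2.
have qc (k : nat) O' : open O' -> Ck k O' q.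
  move=> oO'; apply: Ck_sum => // j; apply: CkM => //; last exact: Ck_cst.
  have h : Ck k O' (fun y : 'rV[R]_n => y 0 j - y0 0 j).
    by apply: CkD => //; [exact: Ck_coord|exact: Ck_cst].
  by apply: Ck_ext (CkM oO' h h) => // y _; rewrite expr2.
have qcont : continuous q.
  by move=> y; apply: (Ck_continuous (qc 0%N setT openT)).
pose F y := sstep (2 - q y).
pose K := [set y | q y <= 2].
have Ky j y : K y -> `|y 0 j - y0 0 j| < r.
  move=> Kqy; have : (y 0 j - y0 0 j) ^+ 2 / s ^+ 2 <= 2.
    apply: le_trans Kqy; rewrite /q (bigD1 j) //= lerDl.
    by apply: sumr_ge0 => i _; rewrite divr_ge0 ?sqr_ge0.
  rewrite ler_pdivrMr ?exprn_gt0// => h.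
  have h2 : `|y 0 j - y0 0 j| ^+ 2 < r ^+ 2.
    rewrite real_normK ?num_real//; apply: le_lt_trans h _; rewrite /s; nra.
  by rewrite -(@ltr_pXn2r _ 2%N) // nnegrE ltW.
have Kb : K `<=` ball y0 r.
  move=> y Kqy; split=> // i j; rewrite !ord1 /ball /= distrC; exact: Ky.
have KO : K `<=` O.
  by move=> y /Kb/Hr.
have cK : compact K.
  apply: bounded_closed_compact.
    exists (r + `|y0|); split; first exact: num_real.
    move=> t rt y Kqy /=.
    rewrite -(subrK y0 y); apply: le_trans (ler_normD _ _) _.
    apply: ltW; apply: le_lt_trans rt; rewrite lerD2r.
    by have := Kb _ Kqy; rewrite -ball_normE /= distrC => /ltW.
  rewrite (_ : K = q @^-1` [set z | z <= 2]) //.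
  by apply: closed_comp => [y _|]; [exact: qcont|exact: closed_le].
have [] := @chart_extend c F K Ac _ cK.
- by move=> k; apply: Ck_sstep; [exact: open_cimg|apply: CkD; [exact: open_cimg|apply: Ck_cst|apply: CkN]; try (apply: qc); exact: open_cimg].
- by move=> y /KO[].
- by move=> y _ /negP; rewrite -ltNge => h; rewrite /F sstep_le0// subr_le0 ltW.
move=> f [sf fF csf sfd sfK].
exists f, (cdom c `&` cmap c @^-1` [set y | q y < 1]); split.
- by split=> // z /sfK[y /KO[cy Uy] <-].
- move=> z; have [cz|ncz] := pselect (cdom c z).
    by rewrite fF // sstep_ge0 sstep_le1.
  by rewrite supp_out ?lexx ?ler01// => /sfd.
- apply: open_chart_image => //.
  rewrite (_ : [set y | _] = q @^-1` [set z | z < 1]) //.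
  by apply: open_comp => [y _|]; [exact: qcont|exact: open_lt].
- split => //=; rewrite /q big1 ?ltr01// => j _; by rewrite subrr expr0n mul0r.
- by move=> z [cz /= qz]; rewrite fF // /F sstep_ge1//; lra.
Qed.

Lemma cutoff U K : open U -> compact K -> K `<=` U -> exists f V,
  [/\ smooth_csupp A U f, (forall z, 0 <= f z <= 1), open V, K `<=` V & forall z, V z -> f z = 1].
Proof.
move=> oU cK KU.
apply: (compact_ind (P := fun K => exists f V,
  [/\ smooth_csupp A U f, (forall z, 0 <= f z <= 1), open V, K `<=` V &
   forall z, V z -> f z = 1])) cK.
- exists (fun=> 0), set0; split=> //; last 2 first.
  + by move=> z; rewrite lexx ler01.
  + exact: open0.
  have s0 : supp (fun=> 0 : R) `<=` (set0 : set M).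
    by apply: supp_sub => //; exact: closed0.
  split; first exact: smooth_cst.
    apply: subclosed_compact s0; [exact: closed_supp|exact: compact0].
  by move=> x /s0.
- move=> X Y [f [V [[sf cf fU] fI oV XV fV]]] [g [W [[sg cg gU] gI oW YW gW]]].
  (* This combination stays in [0, 1] and equals 1 as soon as f or g does. *)
  exists (fun x => 1 - (1 - f x) * (1 - g x)), (V `|` W).
  have sS : supp (fun x => 1 - (1 - f x) * (1 - g x)) `<=` supp f `|` supp g.
    apply: supp_sub; first by apply: closedU; exact: closed_supp.
    move=> x /not_orP[fx gx]; rewrite !supp_out // !subr0 mulr1 subrr //.
  split=> //.
  + split.
    * apply: smoothB; first exact: smooth_cst.
      by apply: smoothM; apply: smoothB => //; exact: smooth_cst.
    * apply: subclosed_compact sS; [exact: closed_supp|exact: compactU].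
    * by move=> x /sS[/fU|/gU].
  + by move=> z; move: (fI z) (gI z) => /andP[? ?] /andP[? ?]; apply/andP; split; nra.
  + exact: openU.
  + by move=> x [/XV|/YW]; [left|right].
  + by move=> z [/fV ->|/gW ->]; rewrite subrr ?mul0r ?mulr0 subr0.
- by move=> X Y XY [f [V [? ? ? YV ?]]]; exists f, V; split=> // x /XY/YV.
- move=> x Kx; have [f [V [? ? oV Vx fV]]] := bump_at oU (KU _ Kx).
  by exists V; split=> //; exists f, V; split.
Qed.

End Smooth.

(** * Carre du champ, vertical form and diffusion operator *)

Lemma discriminant_le {R : realType} (a b c : R) : 0 <= c ->
  (forall t : R, 0 <= a + 2 * t * b + t ^+ 2 * c) -> b ^+ 2 <= a * c.
Proof.
rewrite le_eqVlt => /orP[/eqP <-|c0] H.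
  rewrite mulr0; suff -> : b = 0 by rewrite expr0n.
  apply/eqP/negPn/negP => b0.
  have := H (- (a + 1) / (2 * b)); rewrite mulr0 addr0.
  have -> : a + 2 * (- (a + 1) / (2 * b)) * b = -1 by field; rewrite b0.
  by rewrite lerNr oppr0 ler10.
have := H (- b / c); rewrite expr2.
have -> : a + 2 * (- b / c) * b + - b / c * (- b / c) * c = (a * c - b ^+ 2) / c.
  by field; rewrite gt_eqF.
by rewrite ler_pdivlMr// mul0r subr_ge0.
Qed.

Section Forms.
Context {R : realType} {M : ptopologicalType} {n : nat}.
Variable A : set (chart R M n).
Hypothesis at_A : smooth_atlas A.
Hypothesis hM : hausdorff_space M.
Implicit Types (c : chart R M n) (f g h : M -> R) (U V K : set M) (x : M).

Local Notation S := (smooth A).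
Let sC := smooth_cst at_A.

(** * Calculus of a nonnegative symmetric derivation, common to Gamma and Gamma^Z *)

Section Form.
Variable B : (M -> R) -> (M -> R) -> M -> R.
Hypothesis vB : vertical_form A B.

Lemma form_smooth f g : S f -> S g -> S (B f g).
Proof. by case: vB => h _ _ _ _; exact: h. Qed.

Lemma formC f g : S f -> S g -> B f g = B g f.
Proof. by case: vB => _ h _ _ _; exact: h. Qed.

Lemma form_ge0 f x : S f -> 0 <= B f f x.
Proof. by case: vB => _ _ _ _ h sf; exact: h. Qed.

Lemma form_lin (a : R) f g h x : S f -> S g -> S h ->
  B (fun y => a * f y + g y) h x = a * B f h x + B g h x.
Proof. by case: vB => _ _ H _ _ *; exact: H. Qed.

Lemma formMl f g h x : S f -> S g -> S h ->
  B (fun y => f y * g y) h x = f x * B g h x + g x * B f h x.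
Proof. by case: vB => _ _ _ H _ *; exact: H. Qed.

Lemma formDl f g h x : S f -> S g -> S h ->
  B (fun y => f y + g y) h x = B f h x + B g h x.
Proof.
move=> sf sg sh; rewrite -[B f h x]mul1r -form_lin//.
by congr (B _ h x); apply/funext => y; rewrite mul1r.
Qed.

(** The Leibniz rule for 1 = 1 * 1 reads B(1, h) = 2 B(1, h); bilinearity extends the vanishing to
    all constants. *)
Lemma form_cst (a : R) h x : S h -> B (fun=> a) h x = 0.
Proof.
move=> sh; have := @formMl (fun=> 1) (fun=> 1) h x (sC _) (sC _) sh.
rewrite (_ : (fun y => _) = fun=> 1 : R); last by apply/funext => y; rewrite mul1r.
rewrite !mul1r => /eqP; rewrite -subr_eq0 opprD addNKr oppr_eq0 => /eqP B1.
have B0 : B (fun=> 0) h x = 0.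
  have := @form_lin (- 1) (fun=> 1) (fun=> 1) h x (sC _) (sC _) sh.
  by rewrite B1 mulr0 addr0 => E; rewrite -[RHS]E; congr (B _ h x); apply/funext => y; rewrite mulN1r addNr.
have := @form_lin a (fun=> 1) (fun=> 0) h x (sC _) (sC _) sh.
by rewrite B1 B0 mulr0 => E; rewrite -[RHS](addr0 0) -E; congr (B _ h x); apply/funext => y; rewrite mulr1 addr0.
Qed.

Lemma formZl (a : R) f h x : S f -> S h -> B (fun y => a * f y) h x = a * B f h x.
Proof.
by move=> sf sh; rewrite (formMl x (sC a) sf sh) form_cst// mulr0 addr0.
Qed.

Lemma formNl f h x : S f -> S h -> B (fun y => - f y) h x = - B f h x.
Proof.
move=> sf sh; rewrite -mulN1r -formZl//.
by congr (B _ h x); apply/funext => y; rewrite mulN1r.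
Qed.

Lemma formBl f g h x : S f -> S g -> S h ->
  B (fun y => f y - g y) h x = B f h x - B g h x.
Proof. by move=> sf sg sh; rewrite formDl ?formNl//; exact: smoothN. Qed.

Lemma formDr f g h x : S f -> S g -> S h ->
  B h (fun y => f y + g y) x = B h f x + B h g x.
Proof.
move=> sf sg sh; rewrite formC//; last exact: smoothD.
by rewrite formDl// (formC sf sh) (formC sg sh).
Qed.

Lemma formZr (a : R) f h x : S f -> S h -> B h (fun y => a * f y) x = a * B h f x.
Proof.
move=> sf sh; rewrite formC//; last exact: smoothZ.
by rewrite formZl// (formC sf sh).
Qed.

Lemma form_sqD f g x : S f -> S g ->
  B (fun y => f y + g y) (fun y => f y + g y) x = B f f x + 2 * B f g x + B g g x.
Proof.
move=> sf sg; have sfg := smoothD at_A sf sg.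
rewrite formDl// !formDr// (formC sg sf); ring.
Qed.

Lemma form_sqZ (a : R) f x : S f ->
  B (fun y => a * f y) (fun y => a * f y) x = a ^+ 2 * B f f x.
Proof.
by move=> sf; rewrite formZl ?formZr//; [rewrite mulrA -expr2|exact: smoothZ].
Qed.

Lemma form_CS f g x : S f -> S g -> B f g x ^+ 2 <= B f f x * B g g x.
Proof.
move=> sf sg; apply: discriminant_le; first exact: form_ge0.
move=> t; have stg := smoothZ at_A t sg.
have := form_ge0 x (smoothD at_A sf stg).
by rewrite form_sqD// formZr// form_sqZ// mulrA.
Qed.

Lemma form_abs f g x : S f -> S g ->
  `|B f g x| <= Num.sqrt (B f f x) * Num.sqrt (B g g x).
Proof.
move=> sf sg; rewrite -sqrtrM ?form_ge0// -sqrtr_sqr ler_sqrt.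
  exact: form_CS.
by rewrite mulr_ge0 ?form_ge0.
Qed.

(** With a bump b equal to 1 near x, f - g = (1 - b)(f - g), and both factors vanish at x, so the
    Leibniz rule gives 0. *)
Lemma form_local U f g h x : S f -> S g -> S h -> open U -> U x ->
  (forall y, U y -> f y = g y) -> B f h x = B g h x.
Proof.
move=> sf sg sh oU Ux fg; apply/eqP; rewrite -subr_eq0 -formBl//.
have [b [V [[sb _ bU] _ oV Vx bV]]] := bump_at at_A hM oU Ux.
pose k y := f y - g y; have sk : S k by exact: smoothB.
have -> : (fun y => f y - g y) = (fun y => (1 - b y) * k y).
  apply/funext => y; have [Uy|nUy] := pselect (U y).
    by rewrite /k fg// subrr mulr0.
  by rewrite (@supp_out _ _ b) ?subr0 ?mul1r// => /bU.
have s1b : S (fun y => 1 - b y) by exact: smoothB.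
by rewrite (formMl x s1b sk sh) bV// subrr mul0r add0r /k fg// subrr mul0r.
Qed.

End Form.

(** * Second-order operators and their carré du champ *)

Section Operator.
Variable L : (M -> R) -> M -> R.
Hypothesis dL : second_order_diffusion A L.
Hypothesis L1 : forall x, L (fun=> 1) x = 0.

Lemma partial_chartD c f g y i : A c -> S f -> S g -> cimg c y ->
  partial i (in_chart c (fun x => f x + g x)) y =
  partial i (in_chart c f) y + partial i (in_chart c g) y.
Proof.
move=> Ac sf sg cy.
have [_ h] := @is_deriveD _ _ _ _ _ _ _ _ _ (Ck_is_derive i (sf c Ac 1%N) cy) (Ck_is_derive i (sg c Ac 1%N) cy).
exact: h.
Qed.

Lemma partial_chartM c f g y i : A c -> S f -> S g -> cimg c y ->
  partial i (in_chart c (fun x => f x * g x)) y =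
  in_chart c f y * partial i (in_chart c g) y + in_chart c g y * partial i (in_chart c f) y.
Proof.
move=> Ac sf sg cy.
have [_ h] := @is_deriveM _ _ _ _ _ _ _ _ (Ck_is_derive i (sf c Ac 1%N) cy) (Ck_is_derive i (sg c Ac 1%N) cy).
exact: h.
Qed.

Lemma partial_chartZ c (a : R) f y i : A c -> S f -> cimg c y ->
  partial i (in_chart c (fun x => a * f x)) y = a * partial i (in_chart c f) y.
Proof.
move=> Ac sf cy; rewrite partial_chartM//.
have -> : partial i (in_chart c (fun=> a)) y = 0 by exact: derive_cst.
by rewrite mulr0 addr0 /in_chart.
Qed.

Lemma Cinfty_partial c f i : A c -> S f -> Cinfty (cimg c) (partial i (in_chart c f)).
Proof. by move=> Ac sf k; apply: Ck_partial; exact: sf. Qed.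

Lemma partial2_chartM c f g y i j : A c -> S f -> S g -> cimg c y ->
  partial i (partial j (in_chart c (fun x => f x * g x))) y =
  in_chart c f y * partial i (partial j (in_chart c g)) y +
  in_chart c g y * partial i (partial j (in_chart c f)) y +
  partial i (in_chart c f) y * partial j (in_chart c g) y +
  partial j (in_chart c f) y * partial i (in_chart c g) y.
Proof.
move=> Ac sf sg cy.
have h u v : S u -> S v -> is_derive y (delta_mx 0 i)
    (in_chart c u * partial j (in_chart c v))
    (in_chart c u y * partial i (partial j (in_chart c v)) y +
     partial j (in_chart c v) y * partial i (in_chart c u) y).
  move=> su sv; apply: is_deriveM; first exact: (Ck_is_derive i (su c Ac 1%N) cy).
  exact: (Ck_is_derive i (Cinfty_partial j Ac sv 1%N) cy).
have [_ E] := @is_deriveD _ _ _ _ _ _ _ _ _ (h _ _ sf sg) (h _ _ sg sf).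
rewrite (@partial_local _ _ (cimg c) _ (in_chart c f * partial j (in_chart c g) +
  in_chart c g * partial j (in_chart c f))).
- rewrite [LHS]E.
  move: (in_chart c f y) (in_chart c g y) (partial i (partial j (in_chart c g)) y)
    (partial i (partial j (in_chart c f)) y) (partial i (in_chart c f) y)
    (partial i (in_chart c g) y) (partial j (in_chart c f) y) (partial j (in_chart c g) y).
  by move=> a b p q r s t u; ring.
- exact: (open_cimg at_A Ac).
- exact: cy.
- by move=> z cz; rewrite partial_chartM.
Qed.

Lemma partial2_chart_lin c (a : R) f g y i j : A c -> S f -> S g -> cimg c y ->
  partial i (partial j (in_chart c (fun x => a * f x + g x))) y =
  a * partial i (partial j (in_chart c f)) y + partial i (partial j (in_chart c g)) y.
Proof.
move=> Ac sf sg cy.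
have hg := Ck_is_derive i (Cinfty_partial j Ac sg 1%N) cy.
have hf := Ck_is_derive i (Cinfty_partial j Ac sf 1%N) cy.
have [_ E] := @is_deriveD _ _ _ _ _ _ _ _ _ (@is_deriveZ _ _ _ _ a _ _ _ hf) hg.
rewrite (@partial_local _ _ (cimg c) _ (a *: partial j (in_chart c f) +
   partial j (in_chart c g))).
- exact: E.
- exact: (open_cimg at_A Ac).
- exact: cy.
- by move=> z cz; rewrite partial_chartD ?partial_chartZ//; exact: smoothZ.
Qed.

Definition second_order_part (a : 'I_n -> 'I_n -> 'rV[R]_n -> R) c f (y : 'rV[R]_n) : R :=
  \sum_(i < n) \sum_(j < n) a i j y * partial i (partial j (in_chart c f)) y.

Definition first_order_part (b : 'I_n -> 'rV[R]_n -> R) c f (y : 'rV[R]_n) : R :=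
  \sum_(i < n) b i y * partial i (in_chart c f) y.

Lemma diffusion_chart c : A c ->
  exists a b z,
  [/\ [/\ forall i j, Cinfty (cimg c) (a i j),
          forall i, Cinfty (cimg c) (b i) & Cinfty (cimg c) z],
      (forall i j y, cimg c y -> a i j y = a j i y),
      (forall y (v : 'rV[R]_n), cimg c y ->
         0 <= \sum_(i < n) \sum_(j < n) a i j y * v 0 i * v 0 j) &
      forall f, S f -> forall x, cdom c x ->
        L f x = second_order_part a c f (cmap c x) + first_order_part b c f (cmap c x)
          + z (cmap c x) * f x].
Proof. exact: dL. Qed.

Lemma second_order_part_lin al c (a : R) f g y : A c -> S f -> S g -> cimg c y ->
  second_order_part al c (fun x => a * f x + g x) y =
  a * second_order_part al c f y + second_order_part al c g y.
Proof.
move=> Ac sf sg cy; rewrite /second_order_part mulr_sumr -big_split.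
apply: eq_bigr => i _ /=; rewrite mulr_sumr -big_split; apply: eq_bigr => j _ /=.
rewrite partial2_chart_lin//.
by move: (partial i _ y) (partial i _ y) (al i j y) => *; ring.
Qed.

Lemma first_order_part_lin b c (a : R) f g y : A c -> S f -> S g -> cimg c y ->
  first_order_part b c (fun x => a * f x + g x) y =
  a * first_order_part b c f y + first_order_part b c g y.
Proof.
move=> Ac sf sg cy; rewrite /first_order_part mulr_sumr -big_split.
apply: eq_bigr => i _ /=; rewrite partial_chartD ?partial_chartZ//; first by ring.
exact: smoothZ.
Qed.

Lemma L_lin (a : R) f g x : S f -> S g ->
  L (fun y => a * f y + g y) x = a * L f x + L g x.
Proof.
move=> sf sg; have [c Ac cx] := chart_at at_A x.
have [al [b [z [_ _ _ E]]]] := diffusion_chart Ac.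
have ci := cimg_cmap cx.
rewrite (E _ (smoothD at_A (smoothZ at_A a sf) sg)) // (E f) // (E g) //.
rewrite second_order_part_lin// first_order_part_lin//.
move: (second_order_part _ _ _ _) (second_order_part _ _ _ _) (first_order_part _ _ _ _)
  (first_order_part _ _ _ _) (f x) (g x) (z _) => *; ring.
Qed.

Lemma L_smooth f : S f -> S (L f).
Proof.
move=> sf c Ac k; have [al [b [z [[sa sb sz] _ _ E]]]] := dL Ac.
have oc := open_cimg at_A Ac.
apply: (Ck_ext oc (f := fun y => \sum_(i < n) \sum_(j < n)
             al i j y * partial i (partial j (in_chart c f)) y
          + \sum_(i < n) b i y * partial i (in_chart c f) y
          + z y * in_chart c f y)).
  move=> y cy; rewrite /in_chart /= E//; last exact: (cdom_cinv at_A).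
  by rewrite (cinvK at_A).
apply: CkD => //; last by apply: CkM => //; exact: sf.
apply: CkD => //; apply: Ck_sum => // i.
  apply: Ck_sum => // j; apply: CkM => //; first exact: sa.
  exact: (Ck_partial i (Cinfty_partial j Ac sf k.+1)).
by apply: CkM => //; [exact: sb|exact: Cinfty_partial].
Qed.

Lemma L_local U f g x : S f -> S g -> open U -> U x ->
  (forall y, U y -> f y = g y) -> L f x = L g x.
Proof.
move=> sf sg oU Ux fg; have [c Ac cx] := chart_at at_A x.
have [al [b [z [_ _ _ E]]]] := diffusion_chart Ac.
rewrite (E f) // (E g) //.
have -> : second_order_part al c f (cmap c x) = second_order_part al c g (cmap c x).
  apply: eq_bigr => i _; apply: eq_bigr => j _.
  by rewrite (partial2_germ at_A i j Ac cx oU Ux fg).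
have -> : first_order_part b c f (cmap c x) = first_order_part b c g (cmap c x).
  by apply: eq_bigr => i _; rewrite (partial_germ at_A i Ac cx oU Ux fg).
by rewrite fg.
Qed.

Lemma LD f g x : S f -> S g -> L (fun y => f y + g y) x = L f x + L g x.
Proof.
move=> sf sg; rewrite -[L f x]mul1r -L_lin//.
by congr (L _ x); apply/funext => y; rewrite mul1r.
Qed.

Lemma L_cst (a : R) x : L (fun=> a) x = 0.
Proof.
have L0 : L (fun=> 0) x = 0.
  have := @L_lin (- 1) (fun=> 1) (fun=> 1) x (sC _) (sC _).
  by rewrite L1 mulr0 addr0 => E; rewrite -[RHS]E; congr (L _ x); apply/funext => y; rewrite mulN1r addNr.
have := @L_lin a (fun=> 1) (fun=> 0) x (sC _) (sC _).
by rewrite L1 L0 mulr0 => E; rewrite -[RHS](addr0 0) -E; congr (L _ x); apply/funext => y; rewrite mulr1 addr0.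
Qed.

Lemma LZ (a : R) f x : S f -> L (fun y => a * f y) x = a * L f x.
Proof.
move=> sf; rewrite -[RHS]addr0 -(L_cst 0 x) -L_lin//.
by congr (L _ x); apply/funext => y; rewrite addr0.
Qed.

Lemma LN f x : S f -> L (fun y => - f y) x = - L f x.
Proof.
move=> sf; rewrite -mulN1r -LZ//; congr (L _ x); apply/funext => y; by rewrite mulN1r.
Qed.

Lemma LB f g x : S f -> S g -> L (fun y => f y - g y) x = L f x - L g x.
Proof. by move=> sf sg; rewrite LD ?LN//; exact: smoothN. Qed.

Lemma LM f g x : L (fun y => f y * g y) x = f x * L g x + g x * L f x + 2 * Gamma L f g x.
Proof. rewrite /Gamma; lra. Qed.

Definition principal_form (a : 'I_n -> 'I_n -> 'rV[R]_n -> R) c f g (y : 'rV[R]_n) : R :=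
  \sum_(i < n) \sum_(j < n) a i j y * partial i (in_chart c f) y * partial j (in_chart c g) y.

Lemma second_order_partM al c f g y : A c -> S f -> S g -> cimg c y ->
  (forall i j, al i j y = al j i y) ->
  second_order_part al c (fun x => f x * g x) y =
  in_chart c f y * second_order_part al c g y + in_chart c g y * second_order_part al c f y +
  2 * principal_form al c f g y.
Proof.
move=> Ac sf sg cy asym.
have -> : 2 * principal_form al c f g y = principal_form al c f g y +
    \sum_(i < n) \sum_(j < n) al i j y * partial j (in_chart c f) y * partial i (in_chart c g) y.
  rewrite mulrDl mul1r; congr (_ + _).
  by rewrite exchange_big; apply: eq_bigr => i _; apply: eq_bigr => j _; rewrite asym.
rewrite !mulr_sumr addrA -!big_split; apply: eq_bigr => i _ /=.
rewrite !mulr_sumr -!big_split; apply: eq_bigr => j _ /=.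
rewrite partial2_chartM//.
move: (in_chart c f y) (in_chart c g y) (partial i (partial j (in_chart c g)) y)
    (partial i (partial j (in_chart c f)) y) (partial i (in_chart c f) y)
    (partial i (in_chart c g) y) (partial j (in_chart c f) y) (partial j (in_chart c g) y) (al i j y).
by move=> a b p q r s t u v; ring.
Qed.

Lemma first_order_partM b c f g y : A c -> S f -> S g -> cimg c y ->
  first_order_part b c (fun x => f x * g x) y =
  in_chart c f y * first_order_part b c g y + in_chart c g y * first_order_part b c f y.
Proof.
move=> Ac sf sg cy; rewrite /first_order_part !mulr_sumr -big_split.
apply: eq_bigr => i _ /=; rewrite partial_chartM//.
move: (in_chart c f y) (in_chart c g y) (partial i _ y) (partial i _ y) (b i y).
by move=> *; ring.
Qed.

Lemma Gamma_chart c : A c ->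
  exists a : 'I_n -> 'I_n -> 'rV[R]_n -> R,
  [/\ forall i j, Cinfty (cimg c) (a i j),
      (forall y (v : 'rV[R]_n), cimg c y ->
         0 <= \sum_(i < n) \sum_(j < n) a i j y * v 0 i * v 0 j) &
   forall f g x, S f -> S g -> cdom c x ->
     Gamma L f g x = principal_form a c f g (cmap c x)].
Proof.
move=> Ac; have [al [b [z [[sa sb sz] asym apos E]]]] := diffusion_chart Ac.
exists al; split=> // f g x sf sg cx.
have ci := cimg_cmap cx.
(* L 1 = 0 kills the zeroth-order coefficient, which would otherwise contribute - z f g / 2 to
   Gamma. *)
have z0 : z (cmap c x) = 0.
  have := L1 x; rewrite (E (fun=> 1)) //.
  have p1 (i : 'I_n) (y : 'rV[R]_n) : partial i (in_chart c (fun=> 1)) y = 0 by exact: derive_cst.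
  rewrite /second_order_part big1; last first.
    move=> i _; rewrite big1 // => j _.
    rewrite (_ : partial j _ = fun=> 0); last by apply/funext => y; exact: p1.
    by rewrite /partial derive_cst mulr0.
  by rewrite /first_order_part big1 ?add0r ?mulr1// => i _; rewrite p1 mulr0.
rewrite /Gamma (E _ (smoothM at_A sf sg)) // (E f) // (E g) //.
rewrite second_order_partM//; last by move=> i j; exact: asym.
rewrite first_order_partM// z0.
have fE u : in_chart c u (cmap c x) = u x by rewrite /in_chart /= (cmapK at_A).
rewrite !fE.
move: (second_order_part _ _ _ _) (second_order_part _ _ _ _) (first_order_part _ _ _ _)
  (first_order_part _ _ _ _) (principal_form _ _ _ _ _) (f x) (g x).
by move=> *; field.
Qed.

(** Gamma has the formal properties required of Gamma^Z, so one calculus serves both. The Leibniz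
    rule and the sign are read off the principal part in a chart. *)
Lemma Gamma_form : vertical_form A (Gamma L).
Proof.
split.
- move=> f g sf sg; apply: smoothZ => //.
  by apply: smoothB => //; [apply: smoothB => //|]; [|apply: smoothM => //|apply: smoothM => //];
    apply: L_smooth => //; exact: smoothM.
- move=> f g sf sg; apply/funext => x; rewrite /Gamma.
  rewrite (_ : (fun y => f y * g y) = (fun y => g y * f y)); first by ring.
  by apply/funext => y; rewrite mulrC.
- move=> a f g h sf sg sh x; rewrite /Gamma.
  have sfh := smoothM at_A sf sh; have sgh := smoothM at_A sg sh.
  rewrite (_ : (fun y => (a * f y + g y) * h y) = (fun y => a * (f y * h y) + g y * h y)).
    by rewrite !L_lin//; ring.
  by apply/funext => y; ring.
- move=> f g h sf sg sh x; have [c Ac cx] := chart_at at_A x.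
  have [a [_ _ E]] := Gamma_chart Ac.
  have ci := cimg_cmap cx.
  rewrite (E _ _ _ (smoothM at_A sf sg) sh) // (E g) // (E f) //.
  rewrite /principal_form !mulr_sumr -big_split; apply: eq_bigr => i _ /=.
  rewrite !mulr_sumr -big_split; apply: eq_bigr => j _ /=.
  rewrite partial_chartM// {1 3}/in_chart /= (cmapK at_A)//.
  move: (a i j _) (f x) (g x) (partial i _ _) (partial i _ _) (partial j _ _).
  by move=> *; ring.
- move=> f sf x; have [c Ac cx] := chart_at at_A x.
  have [a [_ ap E]] := Gamma_chart Ac.
  have ci := cimg_cmap cx.
  rewrite E//; have := ap _ (\row_i partial i (in_chart c f) (cmap c x)) ci.
  by under eq_bigr do under eq_bigr do rewrite !mxE.
Qed.

End Operator.

Implicit Type T : M -> R.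
Local Notation test := (test_function A).

Lemma test_smooth f : test f -> S f.
Proof. by case. Qed.

Lemma test_of_supp f g : test f -> S g -> supp g `<=` supp f -> test g.
Proof.
move=> [sf cf _] sg gf; split=> //; apply: subclosed_compact gf => //.
exact: closed_supp.
Qed.

Lemma test_of_zero f g : test f -> S g -> (forall x, f x = 0 -> g x = 0) -> test g.
Proof.
move=> tf sg gf; apply: (test_of_supp tf) => //.
by apply: closure_subset => x /=; apply: contra_neq; exact: gf.
Qed.

Lemma testMl f g : test f -> S g -> test (fun x => f x * g x).
Proof.
move=> tf sg; apply: (test_of_zero tf); first by apply: smoothM => //; exact: test_smooth.
by move=> x ->; rewrite mul0r.
Qed.

Lemma testMr f g : S f -> test g -> test (fun x => f x * g x).
Proof.
move=> sf tg; apply: (test_of_zero tg); first by apply: smoothM => //; exact: test_smooth.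
by move=> x ->; rewrite mulr0.
Qed.

Lemma testD f g : test f -> test g -> test (fun x => f x + g x).
Proof.
move=> [sf cf _] [sg cg _].
have sS : supp (fun x => f x + g x) `<=` supp f `|` supp g.
  apply: supp_sub; first by apply: closedU; exact: closed_supp.
  by move=> x /not_orP[fx gx]; rewrite (supp_out fx) (supp_out gx) addr0.
split=> //; first exact: smoothD.
by apply: subclosed_compact sS; [exact: closed_supp|exact: compactU].
Qed.

Lemma testN f : test f -> test (fun x => - f x).
Proof.
move=> tf; apply: (test_of_zero tf); first by apply: smoothN => //; exact: test_smooth.
by move=> x ->; rewrite oppr0.
Qed.

Lemma testB f g : test f -> test g -> test (fun x => f x - g x).
Proof. by move=> tf tg; apply: testD => //; exact: testN. Qed.

Lemma test0 : test (fun=> 0).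
Proof.
have s0 : supp (fun=> 0 : R) `<=` (set0 : set M).
  by apply: supp_sub => //; exact: closed0.
split; [exact: sC|exact: subclosed_compact (@closed_supp _ _ _) compact0 s0|by []].
Qed.

Lemma test_L L f : second_order_diffusion A L -> (forall x, L (fun=> 1) x = 0) ->
  test f -> test (L f).
Proof.
move=> dL L1 tf; have [sf cf _] := tf; apply: (test_of_supp tf).
  exact: L_smooth.
apply: supp_sub; first exact: closed_supp.
move=> x fx; rewrite (@L_local L dL (~` supp f) f (fun=> 0) x) //.
- exact: (L_cst dL L1).
- exact/closed_openC/closed_supp.
- by move=> y fy; rewrite supp_out.
Qed.

Lemma test_form B f g : vertical_form A B -> test f -> S g -> test (B f g).
Proof.
move=> vB tf sg; have [sf cf _] := tf; apply: (test_of_supp tf).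
  exact: form_smooth.
apply: supp_sub; first exact: closed_supp.
move=> x fx; rewrite (@form_local B vB (~` supp f) f (fun=> 0) g x) //.
- by rewrite form_cst.
- exact/closed_openC/closed_supp.
- by move=> y fy; rewrite supp_out.
Qed.

Lemma continuous_compact_bound (f : M -> R) K : compact K -> continuous f ->
  exists2 C : R, 0 <= C & forall x, K x -> `|f x| <= C.
Proof.
move=> cK cf; have ck : compact (f @` K).
  by apply: continuous_compact => //; exact: continuous_subspaceT.
have [N [_ HN]] := compact_bounded ck.
exists (`|N| + 1) => // x Kx; apply: HN; last by exists x.
by rewrite (le_lt_trans (ler_norm N))// ltrDl.
Qed.

Lemma test_bounded f : test f -> exists2 C : R, 0 <= C & forall x, `|f x| <= C.
Proof.
move=> [sf cf _]; have [C C0 HC] := continuous_compact_bound cf (smooth_continuous at_A sf).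
exists C => // x; have [sx|nsx] := pselect (supp f x); first exact: HC.
by rewrite (supp_out nsx) normr0.
Qed.

Lemma test_cutoff f : test f -> exists g V,
  [/\ test g, open V, supp f `<=` V & forall z, V z -> g z = 1].
Proof.
move=> [_ cf _].
have [g [V [tg _ oV fV gV]]] := cutoff at_A hM openT cf (fun _ _ => I).
by exists g, V.
Qed.

End Forms.

(** * Integration against a finite smooth measure *)

Lemma cvgr_dominated_seq {R : realType} (u : R^nat) (l : R) :
  (fun k => (u k)%:E) @ \oo --> l%:E -> u @ \oo --> l.
Proof. by move=> /fine_cvgP[_]; exact. Qed.

Section FiniteMeasure.
Context {R : realType} d (T : measurableType d) (mu : {measure set T -> \bar R}).
Hypothesis finmu : (mu setT < +oo)%E.
Implicit Types f g h : T -> R.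

Local Notation I f := (\int[mu]_x f x).
Local Notation mfun f := (measurable_fun [set: T] f).
Local Notation intg f := (mu.-integrable [set: T] (EFin \o f)).
Local Notation L2 f := (f \in Lfun mu 2%:E).

Lemma intg_measurable f : intg f -> mfun f.
Proof. by move=> /integrableP[/measurable_EFinP]. Qed.

Lemma intgD f g : intg f -> intg g -> intg (fun x => f x + g x).
Proof. exact: integrableD. Qed.

Lemma intgB f g : intg f -> intg g -> intg (fun x => f x - g x).
Proof. exact: integrableB. Qed.

Lemma intgN f : intg f -> intg (fun x => - f x).
Proof. exact: integrableN. Qed.

Lemma intgZ (a : R) f : intg f -> intg (fun x => a * f x).
Proof. exact: integrableZl. Qed.

Lemma intg_le f g : mfun f -> intg g -> (forall x, `|f x| <= g x) -> intg f.
Proof.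
move=> mf ig fg; apply: le_integrable ig => //; first exact/measurable_EFinP.
by move=> x _ /=; rewrite lee_fin (le_trans (fg x))// ler_norm.
Qed.

Lemma intg_bounded f (C : R) : mfun f -> (forall x, `|f x| <= C) -> intg f.
Proof.
move=> mf fC; apply: measurable_bounded_integrable => //.
exists C; split; first exact: num_real.
by move=> t Ct x _ /=; rewrite (le_trans (fC x))// ltW.
Qed.

Lemma intg_cst (a : R) : intg (fun=> a).
Proof. exact: (intg_bounded (C := `|a|)). Qed.

Lemma intg_norm f : intg f -> intg (fun x => `|f x|).
Proof. by move=> /integrable_abse. Qed.

Lemma intg_Mbounded f g (C : R) : intg f -> mfun g -> (forall x, `|g x| <= C) ->
  intg (fun x => f x * g x).
Proof.
move=> fi mg gC; apply: (@intg_le _ (fun x => C * `|f x|)).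
- by apply: measurable_funM => //; exact: intg_measurable.
- by apply: intgZ; exact: intg_norm.
- by move=> x; rewrite normrM mulrC ler_wpM2r.
Qed.

Lemma intg_ext f g : (forall x, f x = g x) -> intg f -> intg g.
Proof. by move=> /funext ->. Qed.

Lemma ID f g : intg f -> intg g -> I (fun x => f x + g x) = I f + I g.
Proof. by move=> fi gi; rewrite RintegralD. Qed.

Lemma IB f g : intg f -> intg g -> I (fun x => f x - g x) = I f - I g.
Proof. by move=> fi gi; rewrite RintegralB. Qed.

Lemma IZ (a : R) f : intg f -> I (fun x => a * f x) = a * I f.
Proof. by move=> fi; rewrite RintegralZl. Qed.

Lemma IN f : intg f -> I (fun x => - f x) = - I f.
Proof.
move=> fi; rewrite -mulN1r -IZ//; apply: eq_Rintegral => x _; by rewrite mulN1r.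
Qed.

Lemma I_le f g : intg f -> intg g -> (forall x, f x <= g x) -> I f <= I g.
Proof. by move=> fi gi fg; apply: le_Rintegral. Qed.

Lemma I_ge0 f : (forall x, 0 <= f x) -> 0 <= I f.
Proof. by move=> f0; apply: Rintegral_ge0. Qed.

Lemma I_abs f : intg f -> `|I f| <= I (fun x => `|f x|).
Proof. by move=> fi; apply: le_normr_Rintegral. Qed.

Lemma I_cst (a : R) : I (fun=> a) = a * fine (mu setT).
Proof. by rewrite Rintegral_cst. Qed.

Lemma I_ae f g : mfun f -> mfun g -> {ae mu, forall x, f x = g x} -> I f = I g.
Proof.
move=> mf mg fg; rewrite /Rintegral; congr fine; apply: ae_eq_integral => //.
- exact/measurable_EFinP.
- exact/measurable_EFinP.
- by apply: filterS fg => x fg _; rewrite /= fg.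
Qed.

Lemma I0_ae f : mfun f -> (forall x, 0 <= f x) -> intg f -> I f = 0 ->
  {ae mu, forall x, f x = 0}.
Proof.
move=> mf f0 fi If.
have mEf : measurable_fun setT (EFin \o f) by exact/measurable_EFinP.
have H : (\int[mu]_(x in setT) `|(EFin \o f) x|)%E = 0%E.
  under eq_integral do rewrite gee0_abs ?lee_fin//.
  rewrite -[LHS]fineK ?integrable_fin_num//.
  by rewrite -[fine _]/(I f) If.
have /(ae_eq_integral_abs _ measurableT mEf) := H.
by apply: filterS => x /(_ Logic.I) /= [].
Qed.

Lemma L2_measurable f : L2 f -> mfun f.
Proof. by rewrite inE => /andP[]; rewrite inE. Qed.

Lemma L2_sq f : L2 f -> intg (fun x => f x ^+ 2).
Proof. exact: Lfun2_integrable_sqr. Qed.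

Lemma L2_intro f : mfun f -> intg (fun x => f x ^+ 2) -> L2 f.
Proof.
move=> mf /integrableP[_ f2]; rewrite inE; apply/andP; split; first by rewrite inE.
rewrite inE /finite_norm unlock /Lnorm /=.
rewrite poweR_lty//.
move: f2; congr (_ < _)%E; apply: eq_integral => x _.
by rewrite /= powR_mulrn// real_normK ?num_real// ger0_norm ?sqr_ge0.
Qed.

Lemma L2_bounded f (C : R) : mfun f -> (forall x, `|f x| <= C) -> L2 f.
Proof.
move=> mf fC; apply: L2_intro => //; apply: (intg_bounded (C := C ^+ 2)).
  exact: measurable_funX.
move=> x; rewrite normrX ler_pXn2r ?nnegrE//.
exact: le_trans (normr_ge0 _) (fC x).
Qed.

Lemma L2_lin (a : R) f g : L2 f -> L2 g -> L2 (fun x => a * f x + g x).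
Proof.
move=> fL gL; have [_] := @Lfun_submod_closed _ T R mu 2%:E (lee1n 2).
by move=> /(_ a f g fL gL).
Qed.

Lemma L2D f g : L2 f -> L2 g -> L2 (fun x => f x + g x).
Proof.
move=> fL gL; have := L2_lin 1 fL gL.
by rewrite (_ : (fun x => 1 * f x + g x) = (fun x => f x + g x)) //; apply/funext => x; rewrite mul1r.
Qed.

Lemma L2_cst (a : R) : L2 (fun=> a).
Proof. exact: (L2_bounded (C := `|a|)). Qed.

Lemma L2Z (a : R) f : L2 f -> L2 (fun x => a * f x).
Proof.
move=> fL; have := L2_lin a fL (L2_cst 0).
by rewrite (_ : (fun x => a * f x + 0) = (fun x => a * f x)) //; apply/funext => x; rewrite addr0.
Qed.

Lemma L2N f : L2 f -> L2 (fun x => - f x).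
Proof.
move=> fL; have := L2Z (- 1) fL.
by rewrite (_ : (fun x => -1 * f x) = (fun x => - f x)) //; apply/funext => x; rewrite mulN1r.
Qed.

Lemma L2B f g : L2 f -> L2 g -> L2 (fun x => f x - g x).
Proof. by move=> fL gL; apply: L2D => //; exact: L2N. Qed.

Lemma L2_mul f g : L2 f -> L2 g -> intg (fun x => f x * g x).
Proof. by move=> fL gL; apply/Lfun1_integrable; exact: Lfun2_mul_Lfun1. Qed.

Lemma L2_intg f : L2 f -> intg f.
Proof.
move=> fL; apply: intg_ext (L2_mul fL (L2_cst 1)) => x; by rewrite mulr1.
Qed.

Lemma L2_ae f g : L2 f -> mfun g -> {ae mu, forall x, f x = g x} -> L2 g.
Proof.
move=> fL mg fg; apply: L2_intro => //.
have /integrableP[m1 h1] := L2_sq fL.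
have mg2 : measurable_fun setT (EFin \o (fun x => g x ^+ 2)).
  by apply/measurable_EFinP; exact: measurable_funX.
apply/integrableP; split => //.
rewrite (@ge0_ae_eq_integral _ _ _ mu setT _ (fun x => `|(f x ^+ 2)%:E|%E)) //.
- exact: measurableT_comp.
- exact: measurableT_comp.
- by apply: filterS fg => x fg _; rewrite /= fg.
Qed.

Lemma L2_CS f g : L2 f -> L2 g ->
  I (fun x => f x * g x) ^+ 2 <= I (fun x => f x ^+ 2) * I (fun x => g x ^+ 2).
Proof.
move=> fL gL.
have disc (a b c : R) : 0 <= c ->
    (forall t : R, 0 <= a + 2 * t * b + t ^+ 2 * c) -> b ^+ 2 <= a * c.
  rewrite le_eqVlt => /orP[/eqP <-|c0] H.
    rewrite mulr0; suff -> : b = 0 by rewrite expr0n.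
    apply/eqP/negPn/negP => b0.
    have := H (- (a + 1) / (2 * b)); rewrite mulr0 addr0.
    have -> : a + 2 * (- (a + 1) / (2 * b)) * b = -1 by field; rewrite b0.
    by rewrite lerNr oppr0 ler10.
  have := H (- b / c); rewrite expr2.
  have -> : a + 2 * (- b / c) * b + - b / c * (- b / c) * c = (a * c - b ^+ 2) / c.
    by field; rewrite gt_eqF.
  by rewrite ler_pdivlMr// mul0r subr_ge0.
apply: disc; first by apply: I_ge0 => x; exact: sqr_ge0.
move=> t.
have i1 := L2_sq fL; have i2 := intgZ (2 * t) (L2_mul fL gL); have i3 := intgZ (t ^+ 2) (L2_sq gL).
have -> : I (fun x => f x ^+ 2) + 2 * t * I (fun x => f x * g x) + t ^+ 2 * I (fun x => g x ^+ 2) =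
    I (fun x => f x ^+ 2 + 2 * t * (f x * g x) + t ^+ 2 * g x ^+ 2).
  rewrite ID//; last exact: intgD.
  by rewrite ID// !IZ//; [exact: L2_sq|exact: L2_mul].
apply: I_ge0 => x.
have -> : f x ^+ 2 + 2 * t * (f x * g x) + t ^+ 2 * g x ^+ 2 = (f x + t * g x) ^+ 2 by ring.
exact: sqr_ge0.
Qed.

Lemma I_dominated (fk : nat -> T -> R) f g : (forall k, mfun (fk k)) -> mfun f -> intg g ->
  {ae mu, forall x, fk k x @[k --> \oo] --> f x} -> (forall k x, `|fk k x| <= g x) ->
  I (fk k) @[k --> \oo] --> I f.
Proof.
move=> mfk mf gi fkf fkg.
have [] := @dominated_convergence _ T R mu setT measurableT
  (fun k => EFin \o fk k) (EFin \o f) (EFin \o g).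
- by move=> k; exact/measurable_EFinP.
- exact/measurable_EFinP.
- apply: filterS fkf => x H _ /=; apply: cvg_EFin => //; exact: nearW.
- exact: gi.
- by apply: aeW => x k _ /=; rewrite lee_fin.
move=> fi _ H; apply: cvgr_dominated_seq; rewrite /Rintegral.
have fki k : intg (fk k) by exact: intg_le gi (fkg k).
rewrite fineK ?(integrable_fin_num measurableT fi)//.
apply: cvg_trans H; apply: near_eq_cvg; apply: nearW => k /=.
by rewrite fineK// (integrable_fin_num measurableT (fki k)).
Qed.

End FiniteMeasure.

Section BorelContinuous.
Context {R : realType} {M : ptopologicalType}.

Lemma open_measurable_borel (U : set M) : open U -> measurable (U : set (borel M)).
Proof. by move=> oU; apply: sub_sigma_algebra. Qed.

Lemma continuous_borel (f : M -> R) : continuous f ->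
  measurable_fun [set: borel M] (f : borel M -> R).
Proof.
move=> cf; apply: (measurability _ (RGenOInfty.measurableE R)) => _ [_ [x ->] <-].
rewrite setTI; apply: open_measurable_borel.
by apply: open_comp => [y _|]; [exact: cf|exact: interval_open].
Qed.

End BorelContinuous.

(** * Change of variables *)

Section ChangeOfVariables.
Import HBNNSimple.
Context {R : realType} d1 d2 (T1 : measurableType d1) (T2 : measurableType d2).
Variables (m1 : {measure set T1 -> \bar R}) (m2 : {measure set T2 -> \bar R}).
Variables (phi : T2 -> T1) (g : T2 -> \bar R).
Hypothesis mphi : measurable_fun setT phi.
Hypothesis mg : measurable_fun setT g.
Hypothesis g0 : forall y, (0 <= g y)%E.
Variable D : set T1.
Hypothesis m1E : forall B, measurable B -> B `<=` D ->
  m1 B = (\int[m2]_y (g y * (\1_B (phi y))%:E))%E.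

Lemma change_variables_nnsfun (h : {nnsfun T1 >-> R}) : (forall x, ~ D x -> h x = 0) ->
  (\int[m1]_x (h x)%:E = \int[m2]_y (g y * (h (phi y))%:E))%E.
Proof.
move=> h0; rewrite integral_nnsfun// patch_setT sintegralE.
transitivity (\int[m2]_y (\sum_(r \in range h) (g y * (r * \1_(h @^-1` [set r]) (phi y))%:E)))%E; last first.
  apply: eq_integral => y _; rewrite -ge0_mule_fsumr; last first.
    by move=> r; exact: nnfun_muleindic_ge0.
  by rewrite fsumEFin// -fimfunE.
rewrite ge0_integral_fsum//; last first.
- by move=> r y _; rewrite mule_ge0//; exact: nnfun_muleindic_ge0.
- move=> r; apply: emeasurable_funM => //; apply/measurable_EFinP.
  apply: measurable_funM => //; apply: (measurableT_comp _ mphi) => //.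
apply: eq_fsbigr => r; rewrite inE => -[x _ <-].
have [->|r0] := eqVneq (h x) 0.
  by rewrite mul0e; under eq_integral do rewrite mul0r mule0; rewrite integral0.
rewrite m1E//; last by move=> y /= hy; apply: contrapT => /h0 e; move: r0; rewrite -hy e eqxx.
under [RHS]eq_integral do rewrite EFinM muleCA.
rewrite ge0_integralZl//.
- apply: emeasurable_funM => //; apply/measurable_EFinP.
  exact: (measurableT_comp _ mphi).
- by move=> y _; rewrite mule_ge0// lee_fin.
- by rewrite lee_fin.
Qed.

(** The identity [m1E] between set functions passes to simple functions and then to monotone limits.
    It covers only subsets of D, whence the condition that f vanish off D. *)
Lemma change_variables (f : T1 -> \bar R) : measurable_fun setT f ->
  (forall y, g y \is a fin_num) -> (forall x, 0 <= f x)%E -> (forall x, ~ D x -> f x = 0%E) ->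
  (\int[m1]_x f x = \int[m2]_y (g y * f (phi y)))%E.
Proof.
move=> mf gfin f0 fD; pose h := nnsfun_approx measurableT mf.
have hf x : EFin \o h^~ x @ \oo --> f x by exact: cvg_nnsfun_approx.
have -> : (\int[m1]_x f x = lim (\int[m1]_x (EFin \o h n) x @[n --> \oo]))%E.
  rewrite -monotone_convergence//.
  - by apply: eq_integral => x _; apply/esym/cvg_lim => //; exact: hf.
  - by move=> n; apply/measurable_EFinP.
  - by move=> n x _; rewrite lee_fin.
  - by move=> x _ a b ab; rewrite lee_fin; exact/lefP/nd_nnsfun_approx.
have -> : (\int[m2]_y (g y * f (phi y)) = lim (\int[m2]_y (g y * (EFin \o h n) (phi y)) @[n --> \oo]))%E.
  rewrite -monotone_convergence//.
  - apply: eq_integral => y _; apply/esym/cvg_lim => //.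
    by apply: cvgeZl => //; exact: hf.
  - move=> n; apply: emeasurable_funM => //; apply/measurable_EFinP.
    exact: (measurableT_comp _ mphi).
  - by move=> n y _; rewrite mule_ge0// lee_fin.
  - move=> y _ a b ab; rewrite lee_wpmul2l//= lee_fin; exact/lefP/nd_nnsfun_approx.
(* The simple approximants increase to f, so they vanish wherever f does and the previous lemma
   applies to them. *)
congr (limn _); apply/funext => k; apply: change_variables_nnsfun => x /fD fx.
have hx : (h ^~ x) @ \oo --> (0 : R) by apply: cvgr_dominated_seq; have := hf x; rewrite fx.
apply/eqP; rewrite eq_le fun_ge0 andbT -(cvg_lim _ hx)//.
apply: nondecreasing_cvgn_le; last by apply/cvg_ex; exists 0.
by move=> a b ab; exact/lefP/nd_nnsfun_approx.
Qed.

End ChangeOfVariables.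

(** * Borel sets of R^n *)

Section BorelRV.
Context {R : realType}.

Lemma ball_rVE n (c x : 'rV[R]_n) (e : R) : 0 < e ->
  ball c e x <-> forall i, `|c 0 i - x 0 i| < e.
Proof.
move=> e0; split=> [[_ h] i|h]; first by have := h 0 i.
by split=> // i j; rewrite !ord1; exact: h.
Qed.

(** An open set is a countable union of balls with rational center and radius 1/(k+1), and such a
    ball is a product of intervals, so measurable coordinates suffice. *)
Lemma measurable_rV d (T : measurableType d) n (phi : T -> 'rV[R]_n) :
  (forall i, measurable_fun setT (fun t => phi t 0 i)) ->
  measurable_fun setT (phi : T -> borel 'rV[R]_n).
Proof.
move=> mphi.
apply: (@measurability _ _ _ (borel 'rV[R]_n) setT phi (@open 'rV[R]_n)) => //.
move=> _ [U oU <-]; rewrite setTI.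
pose Q (q : 'rV[rat]_n * nat) := ball (map_mx ratr q.1 : 'rV[R]_n) (q.2.+1%:R^-1).
have -> : U = \bigcup_(q in [set q | Q q `<=` U]) Q q.
  apply/seteqP; split=> [x Ux|x [q /= h] /h //].
  have /nbhs_ballP[e /= e0 he] : nbhs x U by exact: open_nbhs_nbhs.
  have [k hk] : exists k : nat, k.+1%:R^-1 < e / 2.
    have e20 : 0 < e / 2 by rewrite divr_gt0.
    have := near_infty_natSinv_lt (PosNum e20) => -[k _ hk].
    by exists k; exact: (hk k (leqnn k)).
  have k0 : (0 : R) < k.+1%:R^-1 by rewrite invr_gt0.
  have hq (i : 'I_n) : exists q : rat, `|ratr q - x 0 i| < k.+1%:R^-1.
    have hlt : x 0 i - k.+1%:R^-1 < x 0 i + k.+1%:R^-1.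
      by rewrite ltrBlDr -addrA ltrDl addr_gt0.
    have [q] := rat_in_itvoo hlt.
    by rewrite in_itv /= => hq; exists q; rewrite ltr_distl.
  have [q hq'] := choice hq.
  exists (\row_i q i, k) => /=; last first.
    by apply/ball_rVE => // i; rewrite !mxE.
  move=> y /ball_rVE-/(_ k0) hy; apply: he; apply/ball_rVE => // i.
  have := hy i; rewrite !mxE => h1; have h2 := hq' i.
  rewrite (_ : x 0 i - y 0 i = (ratr (q i) - y 0 i) - (ratr (q i) - x 0 i)); last by ring.
  apply: le_lt_trans (ler_normB _ _) _; rewrite (splitr e).
  by apply: ltrD; [exact: lt_trans h1 hk|exact: lt_trans h2 hk].
rewrite preimage_bigcup.
have -> : \bigcup_(q in [set q | Q q `<=` U]) phi @^-1` Q q =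
   \bigcup_q (if `[< Q q `<=` U >] then phi @^-1` Q q else set0).
  apply/seteqP; split=> [t [q h ht]|t [q _]].
    by exists q => //; case: asboolP.
  by case: asboolP => // h ht; exists q.
apply: countable_bigcupT_measurable; first exact: countableP.
move=> q; case: asboolP => // _.
have k0 : (0 : R) < q.2.+1%:R^-1 by rewrite invr_gt0.
have -> : phi @^-1` Q q = \bigcap_(i in [set: 'I_n])
   ((fun t => phi t 0 i) @^-1` [set` `](ratr (q.1 0 i) - q.2.+1%:R^-1), (ratr (q.1 0 i) + q.2.+1%:R^-1)[]).
  apply/seteqP; split=> [t /ball_rVE-/(_ k0) h i _ /=|t h].
    by have := h i; rewrite !mxE in_itv /= ltr_distlC.
  apply/ball_rVE => // i; have /= := h i Logic.I; rewrite !mxE in_itv /=.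
  by rewrite ltr_distlC.
apply: fin_bigcap_measurable; first exact: finite_finset.
move=> i _; rewrite -[X in measurable X]setTI; apply: mphi => //.
Qed.

Lemma measurable_coord n (i : 'I_n) :
  measurable_fun setT ((fun x => x 0 i) : borel 'rV[R]_n -> R).
Proof. by apply: (@continuous_borel R 'rV[R]_n) => x; exact: coord_continuous. Qed.

Lemma measurable_row_mx m :
  measurable_fun setT ((fun p => row_mx (p.1%:M : 'rV[R]_1) p.2 : 'rV[R]_(1 + m)) :
    (measurableTypeR R * borel 'rV[R]_m)%type -> borel 'rV[R]_(1 + m)).
Proof.
apply: measurable_rV => i; case: (split_ordP i) => j ->.
  apply: (eq_measurable_fun fst); last exact: measurable_fst.
  by move=> t _ /=; rewrite row_mxEl mxE !ord1 eqxx mulr1n.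
apply: (eq_measurable_fun ((fun x : borel 'rV[R]_m => (x : 'rV[R]_m) 0 j) \o (snd : measurableTypeR R * borel 'rV[R]_m -> _))).
  by move=> t _ /=; rewrite row_mxEr.
apply: measurableT_comp; last exact: measurable_snd.
exact: measurable_coord.
Qed.

End BorelRV.

Section Packing.
Context {R : realType}.

Definition image_measure d d' (T1 : measurableType d) (T2 : measurableType d')
  (m : {measure set T1 -> \bar R}) (f : T1 -> T2)
  (mf : measurable_fun [set: T1] f) : {measure set T2 -> \bar R}.
Proof. by refine [the {measure set T2 -> \bar R} of pushforward m f]; exact: mf. Defined.

Lemma image_measureE d d' (T1 : measurableType d) (T2 : measurableType d')
  (m : {measure set T1 -> \bar R}) (f : T1 -> T2) (mf : measurable_fun [set: T1] f) :
  image_measure m mf = pushforward m f :> (set T2 -> \bar R).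
Proof. by []. Qed.

(** Endows a measure with the sigma-finite structure that product measures ask for, leaving its
    values unchanged. *)
Definition sigma_finite_pack d (T : measurableType d) (mu : {measure set T -> \bar R})
  (sf : sigma_finite setT mu) : {sigma_finite_measure set T -> \bar R} :=
  HB.pack_for (sigma_finite_measure T R) (Measure.sort mu)
    (isSFinite.Build _ _ _ _ (sfinite_measure_sigma_finite sf))
    (isSigmaFinite.Build _ _ _ _ sf).

Lemma sigma_finite_packE d (T : measurableType d) (mu : {measure set T -> \bar R})
  (sf : sigma_finite setT mu) : sigma_finite_pack sf = mu :> {measure set T -> \bar R}.
Proof. exact: eq_measure. Qed.

End Packing.

(** * Lebesgue measure on R^n *)

Section LebesgueRV.
Context {R : realType}.

Definition rV_box n (k : nat) : set 'rV[R]_n := [set x | forall i, `|x 0 i| <= k%:R].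
#[local] Arguments rV_box n k : clear implicits.

Lemma measurable_rV_box n k : measurable (rV_box n k : set (borel 'rV[R]_n)).
Proof.
have -> : rV_box n k = \bigcap_(i in [set: 'I_n])
   ((fun t : 'rV[R]_n => t 0 i) @^-1` [set` `[- k%:R, k%:R]]).
  apply/seteqP; split=> [t h i _ /=|t h i]; first by rewrite in_itv /= -ler_norml; exact: h.
  by have /= := h i Logic.I; rewrite in_itv /= -ler_norml.
apply: fin_bigcap_measurable; first exact: finite_finset.
move=> i _; rewrite -[X in measurable X]setTI; apply: measurable_coord => //.
Qed.

Lemma ibp_1d (h h' : R -> R) (k : nat) : (forall x : R, is_derive x 1 h (h' x)) ->
  continuous h' -> (forall x : R, k%:R < `|x| -> h x = 0) ->
  (\int[lebesgue_measure]_x (h' x)%:E = 0)%E.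
Proof.
move=> hd ch' h0.
have ch : continuous h.
  by move=> x; apply: differentiable_continuous; apply/derivable1_diffP; have [] := hd x.
have h'0 (x : R) : k%:R < `|x| -> h' x = 0.
  move=> kx; have [_ <-] := hd x.
  rewrite (_ : 0 = 'D_1 (cst 0 : R -> R) x); last by rewrite derive_cst.
  apply: near_eq_derive.
  have oK : open [set y : R | k%:R < `|y|].
    rewrite (_ : [set y : R | _] = (fun y : R => `|y|) @^-1` [set z | k%:R < z]) //.
    by apply: open_comp => [y _|]; [exact: norm_continuous|exact: open_gt].
  by apply: filterS (open_nbhs_nbhs (conj oK kx)) => y /h0.
(* h vanishes only for |x| > k, so the endpoints are taken one unit further out. *)
have K1 : - (k.+1%:R : R) < k.+1%:R by rewrite gtrN.
have -> : (\int[lebesgue_measure]_x (h' x)%:E = \int[lebesgue_measure]_(x in `[(- k.+1%:R)%R : R, (k.+1%:R)%R]) (h' x)%:E)%E.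
  rewrite [RHS]integral_mkcond; apply: eq_integral => x _.
  rewrite patchE; case: ifPn => // /negP hx; congr (_%:E).
  apply: h'0; rewrite ltNge; apply/negP => xk; apply: hx.
  rewrite inE /= in_itv /= -ler_norml (le_trans xk)// ler_nat//.
rewrite (continuous_FTC2 K1 (F := h)).
- have e : (k%:R : R) < `|k.+1%:R| by rewrite ger0_norm// ltr_nat.
  by rewrite (h0 _ e) h0 ?normrN// subee.
- exact: continuous_subspaceT.
- split; [by move=> x _; have [] := hd x| |]; apply: cvg_at_right_filter || apply: cvg_at_left_filter; exact: ch.
- by move=> x _; rewrite derive1E; have [_ ->] := hd x.
Qed.

(** What is used of Lebesgue measure. It lets the iterated integral [lebesgue_int] be replaced by a
    genuine measure, for which convergence theorems are available. *)
Definition lebesgue_rV_spec n (lam : {measure set (borel 'rV[R]_n) -> \bar R}) : Prop :=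
  [/\ (forall k, (lam (rV_box n k) < +oo)%E),
      (forall g : 'rV[R]_n -> \bar R, measurable_fun setT (g : borel 'rV[R]_n -> \bar R) ->
         (forall x, 0 <= g x)%E -> (\int[lam]_x g x = lebesgue_int g)%E) &
      (forall (H : 'rV[R]_n -> R) i k, continuous H ->
         (forall x, derivable H x (delta_mx 0 i)) -> continuous (partial i H) ->
         (forall x, ~ rV_box n k x -> H x = 0) -> (\int[lam]_x (partial i H x)%:E = 0)%E)].

Lemma rV_box_sigma_finite n (lam : {measure set (borel 'rV[R]_n) -> \bar R}) :
  (forall k, (lam (rV_box n k) < +oo)%E) -> sigma_finite setT lam.
Proof.
move=> fin; exists (rV_box n) => [|k]; last by split; [exact: measurable_rV_box|exact: fin].
apply/esym/seteqP; split=> // x _.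
pose N := (Num.truncn (\sum_(i < n) `|x 0 i|)).+1.
exists N => // i; apply: ltW; apply: le_lt_trans (truncnS_gt _).
by rewrite (bigD1 i)//= lerDl sumr_ge0.
Qed.

(* Off the box the function is locally constant, hence so is its gradient. *)
Lemma partial_out_box n (H : 'rV[R]_n -> R) i k : (forall x, ~ rV_box n k x -> H x = 0) ->
  forall x, ~ rV_box n k x -> partial i H x = 0.
Proof.
move=> H0 x bx.
have oB : open (~` rV_box n k).
  apply: closed_openC; rewrite (_ : rV_box n k = \bigcap_(j in [set: 'I_n])
     ((fun y : 'rV[R]_n => y 0 j) @^-1` [set` `[- k%:R, k%:R]])).
    apply: closed_bigI => j _; apply: closed_comp => [y _|]; last exact: interval_closed.
    exact: coord_continuous.
  apply/seteqP; split=> [t h j _ /=|t h j]; first by rewrite in_itv /= -ler_norml; exact: h.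
  by have /= := h j Logic.I; rewrite in_itv /= -ler_norml.
rewrite (@partial_local _ _ (~` rV_box n k) _ (fun=> 0)) //; exact: derive_cst.
Qed.

Lemma box_integrable n (lam : {measure set (borel 'rV[R]_n) -> \bar R}) (G : 'rV[R]_n -> R) k :
  (forall k, (lam (rV_box n k) < +oo)%E) -> continuous G ->
  (forall x, ~ rV_box n k x -> G x = 0) -> lam.-integrable setT (EFin \o (G : borel 'rV[R]_n -> R)).
Proof.
move=> fin cG G0.
have mG : measurable_fun setT (G : borel 'rV[R]_n -> R) by exact: continuous_borel.
have cB : compact (rV_box n k).
  have -> : rV_box n k = [set v : 'rV[R]_n | forall i, `[- k%:R, k%:R]%classic (v ord0 i)].
    by apply/seteqP; split=> v h i; have := h i; rewrite /= in_itv /= ler_norml.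
  by apply: (@rV_compact R n (fun=> `[- k%:R, k%:R]%classic)) => i; exact: segment_compact.
have [C C0 HC] := continuous_compact_bound cB cG.
have mB := @measurable_rV_box n k.
have E : (EFin \o (G : borel 'rV[R]_n -> R)) = (EFin \o (G : borel 'rV[R]_n -> R)) \_ (rV_box n k).
  apply/funext => x; rewrite patchE; case: ifPn => //= /negP; rewrite inE => /G0 -> //.
rewrite E; have [h _] := @integrable_restrict _ _ _ lam _ mB _ measurableT (EFin \o (G : borel 'rV[R]_n -> R)).
apply: h; rewrite setTI.
apply: measurable_bounded_integrable => //.
- exact: measurable_funS mG.
- exists C; split; first exact: num_real.
  by move=> t Ct x bx /=; rewrite (le_trans (HC _ bx))// ltW.
Qed.

(** Induction on the dimension: a Dirac mass in dimension 0, then the product with the line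
    transported by [row_mx]. Tonelli identifies it with the iterated integral. *)
Lemma lebesgue_rV_exists n : exists lam : {measure set (borel 'rV[R]_n) -> \bar R}, lebesgue_rV_spec lam.
Proof.
elim: n => [|m [lam [fin tonelli ibp]]].
  exists [the {measure set (borel 'rV[R]_0) -> \bar R} of @dirac _ (borel 'rV[R]_0) (0 : 'rV[R]_0) R]; split.
  - by move=> k /=; rewrite diracE ltry.
  - by move=> g mg g0; rewrite integral_dirac//= diracT mul1e.
  - by move=> H [].
have sf := rV_box_sigma_finite fin.
pose lamS := sigma_finite_pack sf.
have lamSE : lamS = lam :> {measure set _ -> \bar R} := sigma_finite_packE sf.
pose phi (p : R * 'rV[R]_m) : 'rV[R]_(1 + m) := row_mx (p.1%:M : 'rV[R]_1) p.2.
have mphi := @measurable_row_mx R m.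
pose prod := ((@lebesgue_measure R) \x lamS)%E.
pose lam' := image_measure prod mphi.
have phi0 s y : phi (s, y) 0 (lshift m 0) = s by rewrite row_mxEl mxE eqxx mulr1n.
have phiS s y j : phi (s, y) 0 (rshift 1 j) = y 0 j by rewrite row_mxEr.
have phi_box k s y : rV_box (1 + m) k (phi (s, y)) <-> `|s| <= k%:R /\ rV_box m k y.
  split=> [h|[h1 h2] i].
    split; first by have := h (lshift m 0); rewrite phi0.
    by move=> j; have := h (rshift 1 j); rewrite phiS.
  by case: (split_ordP i) => j ->; rewrite ?(ord1 j) ?phi0 ?phiS.
have fin' k : (lam' (rV_box (1 + m) k) < +oo)%E.
  rewrite image_measureE /pushforward.
  have -> : (fun p : measurableTypeR R * borel 'rV[R]_m => row_mx (p.1%:M : 'rV[R]_1) p.2 : 'rV[R]_(1 + m)) @^-1` rV_box (1 + m) k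
     = [set` `[- k%:R, k%:R]] `*` rV_box m k.
    apply/seteqP; split=> -[s y] /=.
      by move=> /phi_box[h1 h2]; rewrite in_itv /= -ler_norml.
    by rewrite in_itv /= -ler_norml => /phi_box.
  have mI : measurable ([set` `[- k%:R, k%:R]] : set (measurableTypeR R)) by exact: measurable_itv.
  refine (eq_ind_r (fun z => (z < +oo)%E) _ (@product_measure1E _ _ _ _ _ lebesgue_measure lamS _ _ mI (measurable_rV_box k))).
  have lf : (lebesgue_measure ([set` `[- k%:R, k%:R]] : set R) : \bar R) \is a fin_num.
    by rewrite lebesgue_measure_itv /=; case: ifP.
  have := fin k; rewrite -lamSE => fk.
  exact: (lte_mul_pinfty (measure_ge0 _ _) lf fk).
have tonelli' (g : 'rV[R]_(1 + m) -> \bar R) :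
    measurable_fun setT (g : borel 'rV[R]_(1 + m) -> \bar R) ->
    (forall x, 0 <= g x)%E -> (\int[lam']_x g x = lebesgue_int (n := m.+1) g)%E.
  move=> mg g0; rewrite [LHS](ge0_integral_pushforward mphi)//.
  have mgp := measurableT_comp mg mphi.
  rewrite preimage_setT (fubini_tonelli1 _ mgp); last by move=> p; exact: g0.
  apply: eq_integral => s _; rewrite /fubini_F /=.
  have mgs : measurable_fun setT ((fun y => g (row_mx (s%:M : 'rV[R]_1) y)) : borel 'rV[R]_m -> \bar R).
    exact: (measurableT_comp mgp (pair1_measurable s)).
  apply: etrans; last exact: (tonelli _ mgs (fun y => g0 _)).
  by rewrite -lamSE.
have ibp' (H : 'rV[R]_(1 + m) -> R) i k : continuous H ->
   (forall x, derivable H x (delta_mx 0 i)) -> continuous (partial i H) ->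
   (forall x, ~ rV_box (1 + m) k x -> H x = 0) -> (\int[lam']_x (partial i H x)%:E = 0)%E.
  move=> cH dH cdH H0.
  have int := box_integrable fin' cdH (@partial_out_box _ H i k H0).
  have mdH : measurable_fun setT (EFin \o (partial i H : borel 'rV[R]_(1 + m) -> R)).
    by apply/measurable_EFinP; exact: continuous_borel.
  have int2 : prod.-integrable setT ((EFin \o (partial i H : borel 'rV[R]_(1 + m) -> R)) \o phi).
    apply/integrableP; split; first exact: measurableT_comp mdH mphi.
    move/integrableP : int => [_]; rewrite (ge0_integral_pushforward mphi)//.
    exact: measurableT_comp.
  rewrite [LHS](integral_pushforward mphi)// preimage_setT.
  have cphi y : continuous (fun s => phi (s, y)).
    move=> s; rewrite (_ : (fun s => phi (s, y)) = (fun s => \row_l phi (s, y) 0 l)); last first.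
      by apply/funext => t; apply/rowP => l; rewrite mxE.
    apply: continuous_row => l; case: (split_ordP l) => l' ->.
      rewrite (_ : (fun z => phi (z, y) 0 (lshift m l')) = id); first exact: cvg_id.
      by apply/funext => z; rewrite (ord1 l') phi0.
    rewrite (_ : (fun z => phi (z, y) 0 (rshift 1 l')) = cst (y 0 l')); first exact: cst_continuous.
    by apply/funext => z; rewrite phiS.
  have cphi2 s : continuous (fun y => phi (s, y)).
    move=> y; rewrite (_ : (fun y => phi (s, y)) = (fun y => \row_l phi (s, y) 0 l)); last first.
      by apply/funext => t; apply/rowP => l; rewrite mxE.
    apply: continuous_row => l; case: (split_ordP l) => l' ->.
      rewrite (_ : (fun z => phi (s, z) 0 (lshift m l')) = cst s); first exact: cst_continuous.
      by apply/funext => z; rewrite (ord1 l') phi0.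
    rewrite (_ : (fun z => phi (s, z) 0 (rshift 1 l')) = (fun z : 'rV[R]_m => z 0 l')); first exact: coord_continuous.
    by apply/funext => z; rewrite phiS.
  (* Fubini is used in the order that integrates the differentiated variable first: the new
     coordinate falls under [ibp_1d], an old one under the induction hypothesis on each slice. *)
  case: (split_ordP i) => j ij.
    rewrite -(integral21_prod_meas1 int2).
    apply: integral0_eq => y _; rewrite /fubini_G /=.
    apply: (@ibp_1d (fun s => H (phi (s, y))) _ k).
    + move=> s; have /is_derive_slice hd := derivableP (dH (phi (s, y))).
      have sd : is_derive s (1 : R) (fun t : R => t - s) 1.
        by apply: is_derive_eq; rewrite ?subr0.
      have := @is_derive1_comp _ (fun h : R => H (h *: delta_mx 0 i + phi (s, y))) (fun t : R => t - s) s _ _ _ sd.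
      rewrite subrr => /(_ _ hd); rewrite mulr1.
      rewrite (_ : _ \o _ = (fun t => H (phi (t, y)))) //.
      apply/funext => t /=; congr H; apply/rowP => l; rewrite ij (ord1 j).
      case: (split_ordP l) => l' ->; rewrite ?(ord1 l') 2!mxE ?phi0 ?phiS !mxE ?phi0 ?phiS !eqxx /=.
        by rewrite mulr1 subrK.
      by rewrite mulr0 add0r.
    + by move=> s; apply: (continuous_comp (cphi y s)); exact: cdH.
    + by move=> s ks; apply: H0 => /phi_box[]; rewrite leNgt ks.
  rewrite -(integral12_prod_meas1 int2).
  apply: integral0_eq => s _; rewrite /fubini_F /=.
  transitivity (\int[lam]_z (partial i H (phi (s, z)))%:E)%E; first by rewrite -lamSE.
  pose Hs y := H (phi (s, y)).
  have dHs y : is_derive y (delta_mx 0 j) Hs (partial i H (phi (s, y))).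
    apply/is_derive_slice; have /is_derive_slice := derivableP (dH (phi (s, y))).
    rewrite (_ : (fun h : R => H (h *: delta_mx 0 i + phi (s, y))) =
        (fun h : R => Hs (h *: delta_mx 0 j + y))) //.
    apply/funext => h; congr H; apply/rowP => l; rewrite ij.
    case: (split_ordP l) => l' ->; rewrite ?(ord1 l') 2!mxE ?phi0 ?phiS !mxE ?phi0 ?phiS !eqxx /=.
      by rewrite mulr0 add0r.
    by rewrite eq_rshift.
  have pHs : partial j Hs = (fun y => partial i H (phi (s, y))).
    by apply/funext => y; have [_ h] := dHs y; exact: h.
  rewrite -(ibp Hs j k).
  - by rewrite pHs.
  - by move=> y; apply: (continuous_comp (cphi2 s y)); exact: cH.
  - by move=> y; have [] := dHs y.
  - by rewrite pHs => y; apply: (continuous_comp (cphi2 s y)); exact: cdH.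
  - by move=> y by_; apply: H0 => /phi_box[].
exists lam'; split; [exact: fin'|exact: tonelli'|exact: ibp'].
Qed.

End LebesgueRV.

(** * Derivations in coordinates and their adjoints *)

Section Hadamard.
Context {R : realType} {n : nat}.
Implicit Types (O : set 'rV[R]_n) (f G : 'rV[R]_n -> R) (x y z : 'rV[R]_n).

Lemma compact_bound_on (T : topologicalType) (f : T -> R) (K : set T) : compact K ->
  (forall x : T, K x -> {for x, continuous f}) ->
  exists2 C : R, 0 <= C & forall x : T, K x -> `|f x| <= C.
Proof.
move=> cK cf; have ck : compact (f @` K).
  by apply: continuous_compact => //; apply: continuous_in_subspaceT => x /[!inE] /cf.
have [N [_ HN]] := compact_bounded ck.
exists (`|N| + 1) => // x Kx; apply: HN; last by exists x.
by rewrite (le_lt_trans (ler_norm N))// ltrDl.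
Qed.

Lemma sum_continuous_at (T : topologicalType) (I : Type) (r : seq I) (f : I -> T -> R) (t : T) :
  (forall i, {for t, continuous (f i)}) -> {for t, continuous (fun t => \sum_(i <- r) f i t)}.
Proof.
move=> cf; elim: r => [|i r IH].
  rewrite (_ : (fun t => _) = cst 0); first exact: cst_continuous.
  by apply/funext => s; rewrite big_nil.
rewrite (_ : (fun t => _) = (fun t => f i t + \sum_(i <- r) f i t)).
  by apply: (@continuousD _ _ _ (f i)) => //; exact: cf.
by apply/funext => s; rewrite big_cons.
Qed.

Definition cube x (s : R) : set 'rV[R]_n := [set z | forall i, `|z 0 i - x 0 i| <= s].

Lemma compact_cube x s : compact (cube x s).
Proof.
have -> : cube x s = [set v : 'rV[R]_n | forall i, `[x 0 i - s, x 0 i + s]%classic (v ord0 i)].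
  by apply/seteqP; split=> v h i; have := h i; rewrite /= in_itv /= ler_distl.
by apply: (@rV_compact R n (fun i => `[x 0 i - s, x 0 i + s]%classic)) => i; exact: segment_compact.
Qed.

Lemma taylor_cube x0 (r : R) f : 0 < r -> Cinfty (ball x0 (4 * r)) f ->
  exists2 C : R, 0 <= C & forall x y, cube x0 r x -> cube x0 r y ->
    `|f y - f x| <= C * (\sum_(i < n) `|y 0 i - x 0 i|) /\
    `|f y - f x - \sum_(i < n) (y 0 i - x 0 i) * partial i f x| <=
      C * (\sum_(i < n) `|y 0 i - x 0 i|) ^+ 2.
Proof.
(* The coordinatewise path from x to y stays within 2r of x, hence in the cube of half-side 3r about
   x0. This compact cube lies in the open ball of radius 4r, so derivatives are bounded on it. *)
move=> r0 sf; pose O := ball x0 (4 * r); pose K := cube x0 (3 * r).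
have KO : K `<=` O.
  move=> z Kz; apply/ball_rVE; first by rewrite mulr_gt0.
  by move=> i; rewrite distrC; apply: le_lt_trans (Kz i) _; rewrite ltr_pM2r// ltr_nat.
have cK : compact K by exact: compact_cube.
have bnd (g : 'rV[R]_n -> R) : Cinfty O g -> exists2 C : R, 0 <= C & forall x, K x -> `|g x| <= C.
  by move=> sg; apply: compact_bound_on => // x Kx; exact: (Ck_continuous (sg 0%N) (KO _ Kx)).
have sp (g : 'rV[R]_n -> R) i : Cinfty O g -> Cinfty O (partial i g).
  by move=> sg k; exact: Ck_partial (sg k.+1).
have bndI (g : 'I_n -> 'rV[R]_n -> R) : (forall i, Cinfty O (g i)) ->
   exists2 C : R, 0 <= C & forall i x, K x -> `|g i x| <= C.
  move=> sg; have /choice[C HC] : forall i, exists C : R, 0 <= C /\ forall x, K x -> `|g i x| <= C.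
    by move=> i; have [C C0 HC] := bnd _ (sg i); exists C.
  exists (\sum_i C i); first by apply: sumr_ge0 => i _; have [] := HC i.
  move=> i x Kx; rewrite (bigD1 i) //=; have [_ /(_ _ Kx) h] := HC i.
  by apply: le_trans h _; rewrite lerDl; apply: sumr_ge0 => j _; have [] := HC j.
have [C1 C10 HC1] := bndI (fun i => partial i f) (fun i => sp _ i sf).
have /choice[C2 HC2] : forall i, exists C : R, 0 <= C /\ forall j x, K x -> `|partial j (partial i f) x| <= C.
  move=> i; have [C C0 HC] := bndI (fun j => partial j (partial i f)) (fun j => sp _ j (sp _ i sf)).
  by exists C.
pose C3 := \sum_i C2 i.
have C30 : 0 <= C3 by apply: sumr_ge0 => i _; have [] := HC2 i.
have inK x y z : cube x0 r x -> cube x0 r y -> (forall i, `|z 0 i - x 0 i| <= `|y 0 i - x 0 i|) -> K z.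
  move=> hx hy hz i; rewrite (_ : z 0 i - x0 0 i = (z 0 i - x 0 i) + (x 0 i - x0 0 i)); last by ring.
  apply: le_trans (ler_normD _ _) _.
  have h : `|y 0 i - x 0 i| <= 2 * r.
    rewrite (_ : y 0 i - x 0 i = (y 0 i - x0 0 i) - (x 0 i - x0 0 i)); last by ring.
    by apply: le_trans (ler_normB _ _) _; rewrite mulrDl mul1r lerD// ?(hx i)// (hy i).
  by rewrite (_ : 3 * r = 2 * r + r); [rewrite lerD// (le_trans (hz i))|ring].
exists (C1 + C3); first exact: addr_ge0.
move=> x y hx hy; set S := \sum_(i < n) `|_|.
have S0 : 0 <= S by apply: sumr_ge0.
split.
  have := @coordinatewise_mvt R n O f x y (fun=> 0) C1 (sf 1%N).
  rewrite big1 ?subr0; last by move=> i _; rewrite mulr0.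
  move=> h; apply: le_trans (h _) _; last by rewrite ler_wpM2r// lerDl.
  move=> z hz; have Kz := inK _ _ _ hx hy hz; split; first exact: KO.
  by move=> i; rewrite subr0; exact: HC1.
apply: le_trans (_ : (C3 * S) * S <= _); last first.
  by rewrite -mulrA -expr2 ler_wpM2r ?sqr_ge0// lerDr.
apply: (@coordinatewise_mvt R n O f x y _ (C3 * S) (sf 1%N)) => z hz.
have Kz := inK _ _ _ hx hy hz; split; first exact: KO.
move=> i; have := @coordinatewise_mvt R n O (partial i f) x z (fun=> 0) (C2 i) (sp _ i sf 1%N).
rewrite big1 ?subr0; last by move=> j _; rewrite mulr0.
move=> h; apply: le_trans (h _) _.
  move=> w hw; have Kw : K w.
    by apply: (inK x y w hx hy) => j; exact: le_trans (hw j) (hz j).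
  split; first exact: KO.
  by move=> j; rewrite subr0; have [_] := HC2 i; exact.
apply: ler_pM; [by have [] := HC2 i|exact: sumr_ge0| |exact: ler_sum].
by rewrite /C3 (bigD1 i) //= lerDl; apply: sumr_ge0 => j _; have [] := HC2 j.
Qed.

Lemma itv01_integrable (g : R -> R) : continuous g ->
  lebesgue_measure.-integrable `[0, 1] (EFin \o g).
Proof.
move=> cg; apply: continuous_compact_integrable; first exact: segment_compact.
exact: continuous_subspaceT.
Qed.

Lemma itv01_integrableB (g h : R -> R) :
  lebesgue_measure.-integrable `[0, 1] (EFin \o g) ->
  lebesgue_measure.-integrable `[0, 1] (EFin \o h) ->
  lebesgue_measure.-integrable `[0, 1] (EFin \o (fun t => g t - h t)).
Proof. by move=> gi hi; exact: (integrableB _ gi hi). Qed.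

Lemma itv01_integrableZ (a : R) (g : R -> R) :
  lebesgue_measure.-integrable `[0, 1] (EFin \o g) ->
  lebesgue_measure.-integrable `[0, 1] (EFin \o (fun t => a * g t)).
Proof. by move=> gi; exact: (integrableZl _ a gi). Qed.

Lemma itv01_sum (a : 'I_n -> R) (g : 'I_n -> R -> R) :
  (forall i, lebesgue_measure.-integrable `[0, 1] (EFin \o (g i))) ->
  \int[lebesgue_measure]_(t in `[0, 1]) (\sum_(i < n) a i * g i t) =
  \sum_(i < n) a i * \int[lebesgue_measure]_(t in `[0, 1]) g i t.
Proof.
move=> gi.
have [_ ] : lebesgue_measure.-integrable `[0, 1] (EFin \o (fun t => \sum_(i < n) a i * g i t)) /\
  \int[lebesgue_measure]_(t in `[0, 1]) (\sum_(i < n) a i * g i t) =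
  \sum_(i < n) a i * \int[lebesgue_measure]_(t in `[0, 1]) g i t; last by [].
elim: (index_enum _) => [|i s [IH1 IH2]].
  rewrite big_nil; under [X in EFin \o X]eq_fun do rewrite big_nil.
  by under eq_Rintegral do rewrite big_nil; split; [exact: integrable0|rewrite Rintegral_cst// mul0r].
have E : (fun t => \sum_(j <- i :: s) a j * g j t) =
  (fun t => a i * g i t + \sum_(j <- s) a j * g j t) by apply/funext => t; rewrite big_cons.
have h := itv01_integrableZ (a i) (gi i).
rewrite E big_cons; split; first exact: (integrableD _ h IH1).
by rewrite RintegralD// RintegralZl// IH2.
Qed.

Lemma itv01_bound (g : R -> R) (C : R) : lebesgue_measure.-integrable `[0, 1] (EFin \o g) ->
  (forall t, 0 <= t <= 1 -> `|g t| <= C) -> `|\int[lebesgue_measure]_(t in `[0, 1]) g t| <= C.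
Proof.
move=> ig gC; apply: le_trans (le_normr_Rintegral _ ig) _ => //.
have -> : C = \int[lebesgue_measure]_(t in `[0, 1]) (cst C t).
  by rewrite Rintegral_cst//= lebesgue_measure_itv /= lte_fin ltr01 -EFinB subr0 /= mulr1.
apply: le_Rintegral => //.
- exact: (integrable_abse ig).
- by apply: itv01_integrable; exact: cst_continuous.
Qed.

Definition radial x0 y (t : R) : 'rV[R]_n := x0 + t *: (y - x0).

Lemma radial_coord x0 y t i : radial x0 y t 0 i - x0 0 i = t * (y 0 i - x0 0 i).
Proof. by rewrite !mxE addrAC subrr add0r. Qed.

(** The weight [t ^+ m] makes the family stable under differentiation: a partial derivative in y
    brings out one more factor t. *)
Definition radial_mean (m : nat) x0 G y : R :=
  \int[lebesgue_measure]_(t in `[0, 1]) (t ^+ m * G (radial x0 y t)).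

Lemma radial_cube x0 y (r t : R) : 0 <= t <= 1 -> cube x0 r y -> cube x0 r (radial x0 y t).
Proof.
move=> /andP[t0 t1] hy i; rewrite radial_coord normrM ger0_norm//.
by apply: le_trans (hy i); rewrite ler_piMl.
Qed.

Section RadialMean.
Variables (x0 : 'rV[R]_n) (r : R).
Hypothesis r0 : 0 < r.

Lemma radial_integrable m G y : Cinfty (ball x0 (4 * r)) G -> cube x0 r y ->
  lebesgue_measure.-integrable `[0, 1] (EFin \o (fun t => t ^+ m * G (radial x0 y t))).
Proof.
move=> sG hy; apply: continuous_compact_integrable; first exact: segment_compact.
apply: continuous_in_subspaceT => t; rewrite inE /= in_itv /= => ht.
apply: (@continuousM R R^o (fun t : R => t ^+ m) (fun t => G (radial x0 y t))).
  exact: exprn_continuous.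
apply: (@continuous_comp _ _ _ (radial x0 y) G).
  apply: differentiable_continuous.
  rewrite /radial; apply: differentiableD => //; exact: differentiableZl.
apply: (Ck_continuous (sG 0%N)); apply/ball_rVE; first by rewrite mulr_gt0.
move=> i; rewrite distrC; by apply: le_lt_trans (radial_cube ht hy i) _; rewrite ltr_pMl// ltr1n.
Qed.

Lemma sub_ball_cube y : ball x0 r y -> cube x0 r y.
Proof. by move=> /(ball_rVE _ _ r0) h i; rewrite distrC ltW. Qed.

(** Differentiation under the integral sign: the Taylor bound of [taylor_cube] is uniform in t, so
    it integrates to a quadratic error and [is_derive_quadratic] applies. *)
Lemma radial_mean_Ck k m G : Cinfty (ball x0 (4 * r)) G -> Ck k (ball x0 r) (radial_mean m x0 G).
Proof.
have oB : open (ball x0 r) by exact: ball_open.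
have inc m' G' : Cinfty (ball x0 (4 * r)) G' -> exists2 C : R, 0 <= C &
    forall y y', cube x0 r y -> cube x0 r y' ->
    `|radial_mean m' x0 G' y' - radial_mean m' x0 G' y| <= C * (\sum_(i < n) `|y' 0 i - y 0 i|).
  move=> sG; have [C C0 HC] := taylor_cube r0 sG; exists C => // y y' hy hy'.
  rewrite /radial_mean -RintegralB//; [|exact: radial_integrable..].
  apply: itv01_bound.
    by apply: itv01_integrableB => //; exact: radial_integrable.
  move=> t /[dup] ht /andP[t0 t1].
  have [h _] := HC _ _ (radial_cube ht hy) (radial_cube ht hy').
  rewrite -mulrBr normrM ger0_norm ?exprn_ge0//.
  apply: le_trans (ler_wpM2r (normr_ge0 _) (exprn_ile1 _ t0 t1)) _.
  rewrite mul1r; apply: le_trans h _; rewrite ler_wpM2l//; apply: ler_sum => i _.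
  have -> : radial x0 y' t 0 i - radial x0 y t 0 i = t * (y' 0 i - y 0 i) by rewrite !mxE; ring.
  by rewrite normrM ger0_norm// ler_piMl.
have cont m' G' : Cinfty (ball x0 (4 * r)) G' ->
    forall y, ball x0 r y -> {for y, continuous (radial_mean m' x0 G')}.
  move=> sG y By; have [C C0 HC] := inc m' G' sG.
  apply/(@cvgrPdist_le _ _ _ (nbhs y)) => e e0.
  have n0 : 0 < n%:R + 1 :> R by rewrite ltr_wpDl.
  pose d := e / ((C + 1) * (n%:R + 1)).
  have d0 : 0 < d by rewrite divr_gt0// mulr_gt0// ltr_wpDl.
  have : \forall y' \near y, ball x0 r y' /\ ball y d y'.
    by apply: filterI; [exact: open_nbhs_nbhs|exact: nbhsx_ballx].
  apply: filterS => y' [By' /(ball_rVE _ _ d0) hd].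
  rewrite distrC; apply: le_trans (HC _ _ (sub_ball_cube By) (sub_ball_cube By')) _.
  apply: le_trans (_ : C * (n%:R * d) <= _).
    rewrite ler_wpM2l//; apply: le_trans (_ : \sum_(i < n) d <= _).
      by apply: ler_sum => i _; rewrite distrC ltW.
    by rewrite sumr_const card_ord mulr_natl lexx.
  have -> : C * (n%:R * d) = e * ((C / (C + 1)) * (n%:R / (n%:R + 1))).
    by rewrite /d; field; rewrite !gt_eqF// ltr_wpDl.
  rewrite ger_pMr//; apply: mulr_ile1; rewrite ?divr_ge0 ?addr_ge0//.
    by rewrite ler_pdivrMr ?ltr_wpDl// mul1r lerDl.
  by rewrite ler_pdivrMr// mul1r lerDl.
elim: k m G => [|k IH] m G sG.
  by split=> // y By; exact: cont.
apply: (Ck_intro (df := fun i => radial_mean m.+1 x0 (partial i G))) => //.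
- exact: cont.
- move=> i y By; apply/is_derive_slice.
  have spG : Cinfty (ball x0 (4 * r)) (partial i G) by move=> l; exact: Ck_partial (sG l.+1).
  have [C C0 HC] := taylor_cube r0 sG.
  have /nbhs_ballP[e /= e0 He] : nbhs y (ball x0 r) by exact: open_nbhs_nbhs.
  apply: (@is_derive_quadratic _ _ _ _ e C) => // h he.
  rewrite add0r scale0r add0r.
  have By' : ball x0 r (h *: delta_mx 0 i + y).
    apply: He; apply/ball_rVE => // j; rewrite !mxE eqxx /= opprD addrCA subrr addr0 normrN.
    by case: eqVneq => _; rewrite ?mulr1 ?mulr0 ?normr0.
  have hy := sub_ball_cube By; have hy' := sub_ball_cube By'.
  have i1 := radial_integrable m sG hy; have i2 := radial_integrable m sG hy'.
  have i3 := radial_integrable m.+1 spG hy.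
  rewrite /radial_mean -RintegralB// [X in _ - X]mulrC -RintegralZl// -RintegralB//; last 2 first.
  - exact: itv01_integrableB.
  - exact: itv01_integrableZ.
  apply: itv01_bound.
    by apply: itv01_integrableB; [exact: itv01_integrableB|exact: itv01_integrableZ].
  move=> t /[dup] ht /andP[t0 t1].
  have [_] := HC _ _ (radial_cube ht hy) (radial_cube ht hy').
  have E j : radial x0 (h *: delta_mx 0 i + y) t 0 j - radial x0 y t 0 j = (j == i)%:R * (t * h).
    rewrite !mxE eqxx /=; ring.
  rewrite (bigD1 i)//= E eqxx mul1r big1 ?addr0; last by move=> j ji; rewrite E (negbTE ji) !mul0r.
  rewrite (bigD1 i)//= E eqxx mul1r big1 ?addr0; last by move=> j ji; rewrite E (negbTE ji) mul0r normr0.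
  move=> H.
  have -> : t ^+ m * G (radial x0 (h *: delta_mx 0 i + y) t) - t ^+ m * G (radial x0 y t) -
      h * (t ^+ m.+1 * partial i G (radial x0 y t)) =
    t ^+ m * (G (radial x0 (h *: delta_mx 0 i + y) t) - G (radial x0 y t) - t * h * partial i G (radial x0 y t)).
    by rewrite exprS; ring.
  rewrite normrM ger0_norm ?exprn_ge0//.
  apply: le_trans (ler_wpM2r (normr_ge0 _) (exprn_ile1 _ t0 t1)) _.
  rewrite mul1r; apply: le_trans H _; rewrite ler_wpM2l// real_normK ?num_real//.
  by rewrite exprMn ler_piMl ?sqr_ge0// exprn_ile1.
- move=> i; apply: IH => l; exact: Ck_partial (sG l.+1).
Qed.

(** The fundamental theorem of calculus along the segment from x0 to y: [b i] is the mean of the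
    i-th partial derivative over that segment. *)
Lemma hadamard f : Cinfty (ball x0 (4 * r)) f -> exists b : 'I_n -> 'rV[R]_n -> R,
  [/\ forall i, Cinfty (ball x0 r) (b i), forall i, b i x0 = partial i f x0 &
   forall y, ball x0 r y -> f y = f x0 + \sum_(i < n) (y 0 i - x0 0 i) * b i y].
Proof.
move=> sf; have sp i : Cinfty (ball x0 (4 * r)) (partial i f) by move=> l; exact: Ck_partial (sf l.+1).
exists (fun i => radial_mean 0 x0 (partial i f)); split.
- by move=> i k; exact: radial_mean_Ck.
- move=> i; rewrite /radial_mean.
  under eq_Rintegral do rewrite expr0 mul1r /radial subrr scaler0 addr0.
  by rewrite Rintegral_cst//= lebesgue_measure_itv /= lte_fin ltr01 -EFinB subr0 /= mulr1.
- move=> y By; have hy := sub_ball_cube By.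
  have B4 t : 0 <= t <= 1 -> ball x0 (4 * r) (radial x0 y t).
    move=> ht; apply/ball_rVE; first by rewrite mulr_gt0.
    move=> i; rewrite distrC; by apply: le_lt_trans (radial_cube ht hy i) _; rewrite ltr_pMl// ltr1n.
  pose g (t : R) := f (radial x0 y t).
  pose g' (t : R) := \sum_(i < n) (y 0 i - x0 0 i) * partial i f (radial x0 y t).
  have [C C0 HC] := taylor_cube r0 sf.
  have radc : continuous (radial x0 y).
    move=> t; apply: differentiable_continuous.
    rewrite /radial; apply: differentiableD => //; exact: differentiableZl.
  have gc t : 0 <= t <= 1 -> {for t, continuous g}.
    move=> ht; apply: (@continuous_comp _ _ _ (radial x0 y) f); first exact: radc.
    exact: (Ck_continuous (sf 0%N) (B4 _ ht)).
  have g'c : {within `[0, 1], continuous g'}.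
    apply: continuous_in_subspaceT => t; rewrite inE /= in_itv /= => ht.
    apply: sum_continuous_at => i.
    apply: (@continuousM R R^o (fun t : R => y 0 i - x0 0 i) (fun t => partial i f (radial x0 y t))).
      exact: cst_continuous.
    apply: (@continuous_comp _ _ _ (radial x0 y) (partial i f)); first exact: radc.
    exact: (Ck_continuous (sp i 0%N) (B4 _ ht)).
  have gd (t : R) : 0 < t < 1 -> is_derive t 1 g (g' t).
    move=> /andP[t0 t1]; have m0 : 0 < Num.min t (1 - t) by rewrite lt_min t0 subr_gt0.
    apply: (@is_derive_quadratic _ _ _ _ _ (C * (\sum_(i < n) `|y 0 i - x0 0 i|) ^+ 2) m0) => h.
    rewrite lt_min => /andP[h1 h2].
    have hI : 0 <= t + h <= 1.
      move: h1 h2; rewrite !ltr_norml => /andP[? ?] /andP[? ?]; apply/andP; split; lra.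
    have tI : 0 <= t <= 1 by rewrite !ltW.
    have [_ H] := HC _ _ (radial_cube tI hy) (radial_cube hI hy).
    have E j : radial x0 y (t + h) 0 j - radial x0 y t 0 j = h * (y 0 j - x0 0 j).
      by rewrite !mxE; ring.
    have E1 : \sum_(i < n) (radial x0 y (t + h) 0 i - radial x0 y t 0 i) * partial i f (radial x0 y t) = g' t * h.
      by rewrite mulr_suml; apply: eq_bigr => i _; rewrite E; move: (partial _ _ _) => D; ring.
    have E2 : \sum_(i < n) `|radial x0 y (t + h) 0 i - radial x0 y t 0 i| = `|h| * \sum_(i < n) `|y 0 i - x0 0 i|.
      by rewrite mulr_sumr; apply: eq_bigr => i _; rewrite E normrM.
    move: H; rewrite E1 E2 exprMn real_normK ?num_real// => H.
    by apply: le_trans H _; rewrite mulrCA mulrC lexx.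
  have FTC : \int[lebesgue_measure]_(t in `[0, 1]) g' t = g 1 - g 0.
    rewrite /Rintegral (continuous_FTC2 ltr01 g'c (F := g)) //.
      split.
      - by move=> t; rewrite in_itv /= => ht; have [] := gd t ht.
      - by apply: cvg_at_right_filter; apply: gc; rewrite lexx ler01.
      - by apply: cvg_at_left_filter; apply: gc; rewrite lexx ler01.
    by move=> t; rewrite in_itv /= => ht; rewrite derive1E; have [_ ->] := gd t ht.
  have g1 : g 1 = f y by rewrite /g /radial scale1r addrC subrK.
  have g0 : g 0 = f x0 by rewrite /g /radial scale0r addr0.
  rewrite -g1 -g0 /radial_mean -itv01_sum; last first.
    by move=> i; exact: radial_integrable.
  under eq_Rintegral do under eq_bigr do rewrite expr0 mul1r.
  by rewrite FTC addrC subrK.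
Qed.

End RadialMean.
End Hadamard.

Section Piecewise.
Context {R : realType}.

(** Chart maps are continuous on an open domain only. Completed by a constant they remain Borel, as
    preimages of open sets are unions of an open and a closed set. *)
Lemma piecewise_preimage (T T' : topologicalType) (O : set T) (h : T -> T') (p : T') (V : set T') :
  open O -> (forall x : T, O x -> {for x, continuous h}) -> open V ->
  exists U1 U2 : set T, [/\ open U1, closed U2 &
    (fun x => if `[< O x >] then h x else p) @^-1` V = U1 `|` U2].
Proof.
move=> oO ch oV; exists (O `&` h @^-1` V), (if `[< V p >] then ~` O else set0); split.
- rewrite openE => x [Ox Vx]; apply: filterI; first exact: open_nbhs_nbhs.
  by apply: ch => //; exact: open_nbhs_nbhs.
- by case: asboolP => _; [exact: open_closedC|exact: closed0].
- apply/seteqP; split=> x /=.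
    case: asboolP => Ox Vx; first by left.
    by right; case: asboolP.
  by case=> [[Ox Vx]|]; case: asboolP => // Ox; case: asboolP.
Qed.

Lemma piecewise_preimage_measurable (T T' : ptopologicalType) (O : set T) (h : T -> T') (p : T') (V : set T') :
  open O -> (forall x : T, O x -> {for x, continuous h}) -> open V ->
  measurable ((fun x => if `[< O x >] then h x else p) @^-1` V : set (borel T)).
Proof.
move=> oO ch oV; have [U1 [U2 [op1 cl2 ->]]] := piecewise_preimage p oO ch oV.
apply: measurableU; first exact: open_measurable_borel.
rewrite -(setCK U2); apply: measurableC; apply: open_measurable_borel; exact: closed_openC.
Qed.

Lemma measurable_piecewise_real (T : ptopologicalType) (O : set T) (h : T -> R) (p : R) :
  open O -> (forall x : T, O x -> {for x, continuous h}) ->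
  measurable_fun [set: borel T] ((fun x => if `[< O x >] then h x else p) : borel T -> R).
Proof.
move=> oO ch; apply: (measurability _ (RGenOInfty.measurableE R)) => _ [_ [x ->] <-].
rewrite setTI; apply: piecewise_preimage_measurable => //; exact: interval_open.
Qed.

Lemma measurable_piecewise (T T' : ptopologicalType) (O : set T) (h : T -> T') (p : T') :
  open O -> (forall x : T, O x -> {for x, continuous h}) ->
  measurable_fun [set: borel T] ((fun x => if `[< O x >] then h x else p) : borel T -> borel T').
Proof.
move=> oO ch.
apply: (@measurability _ _ _ (borel T') setT _ (@open T')) => //.
move=> _ [U oU <-]; rewrite setTI; exact: piecewise_preimage_measurable.
Qed.

End Piecewise.

(** * Integrals in charts *)

Section Transfer.
Context {R : realType} {M : ptopologicalType} {n : nat}.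
Variable A : set (chart R M n).
Hypothesis at_A : smooth_atlas A.
Hypothesis hM : hausdorff_space M.
Implicit Types (c : chart R M n) (f g h : M -> R) (K : set M) (x : M) (F : 'rV[R]_n -> R).
Local Notation S := (smooth A).

Definition ext0 c F : 'rV[R]_n -> R := fun y => if `[< cimg c y >] then F y else 0.

Lemma ext0_in c F y : cimg c y -> ext0 c F y = F y.
Proof. by rewrite /ext0; case: asboolP. Qed.

Lemma ext0_out c F y : ~ cimg c y -> ext0 c F y = 0.
Proof. by rewrite /ext0; case: asboolP. Qed.

Lemma compact_chart_image c K : A c -> compact K -> K `<=` cdom c -> compact (cmap c @` K).
Proof.
move=> Ac cK Kc; apply: continuous_compact => //; apply: continuous_in_subspaceT => x /[!inE] Kx.
by apply: (cmap_continuous at_A) => //; exact: Kc.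
Qed.

Lemma rV_hausdorff : hausdorff_space 'rV[R]_n.
Proof. exact: norm_hausdorff. Qed.

Lemma compact_box (K : set 'rV[R]_n) : compact K -> exists k, K `<=` @rV_box R n k.
Proof.
move=> cK.
have /choice[C HC] : forall i : 'I_n, exists C : R, forall x : 'rV[R]_n, K x -> `|x 0 i| <= C.
  move=> i; have [C _ HC] := compact_bound_on cK (fun (x : 'rV[R]_n) _ => @coord_continuous R 1 n 0 i x).
  by exists C.
exists (Num.truncn (\sum_i `|C i|)).+1 => x Kx i; apply: le_trans (HC i x Kx) _.
apply: le_trans (ler_norm _) _; apply: ltW; apply: le_lt_trans (truncnS_gt _).
by rewrite (bigD1 i)//= lerDl sumr_ge0.
Qed.

Lemma ext0_Cinfty c F (K : set 'rV[R]_n) : A c -> Cinfty (cimg c) F -> compact K ->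
  K `<=` cimg c -> (forall y, cimg c y -> ~ K y -> F y = 0) -> Cinfty setT (ext0 c F).
Proof.
move=> Ac sF cK Kc F0 k; apply: Ck_local => y _; have [cy|ncy] := pselect (cimg c y).
  exists (cimg c) => //; apply: Ck_ext (sF k); first exact: (open_cimg at_A).
  by move=> z cz; rewrite ext0_in.
have oK : open (~` K) by apply: closed_openC; apply: compact_closed => //; exact: rV_hausdorff.
exists (~` K); first by move=> /Kc.
apply: (Ck_ext oK (f := fun=> 0)); last exact: Ck_cst.
move=> z Kz; have [cz|ncz] := pselect (cimg c z); first by rewrite ext0_in// F0.
by rewrite ext0_out.
Qed.

Variable mu : {measure set (borel M) -> \bar R}.
Variable lam : {measure set (borel 'rV[R]_n) -> \bar R}.
Hypothesis lamP : lebesgue_rV_spec lam.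
Hypothesis smooth_mu : smooth_measure A mu.

(** The definition of a smooth measure speaks of sets; this passes to functions of any sign through
    positive and negative parts. *)
Lemma chart_measure c : A c -> exists w : 'rV[R]_n -> R,
  [/\ Cinfty (cimg c) w, (forall y, cimg c y -> 0 < w y) &
   forall f, measurable_fun [set: borel M] (f : borel M -> R) -> (forall x, ~ cdom c x -> f x = 0) ->
     \int[mu]_x f x = \int[lam]_y (ext0 c (fun y => w y * in_chart c f y) y)].
Proof.
move=> Ac; have [w [sw w0 muE]] := smooth_mu Ac; exists w; split=> // f mf f0.
have oc := open_cimg at_A Ac.
(* The default value off the image of the chart is harmless, because the density [g] is 0 there. *)
pose phi (y : borel 'rV[R]_n) : borel M := if `[< cimg c y >] then cinv c y else point.
pose g (y : borel 'rV[R]_n) : \bar R := (ext0 c w y)%:E.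
have mphi : measurable_fun setT phi.
  apply: measurable_piecewise => // y cy; exact: (cinv_continuous at_A).
have mg : measurable_fun setT g.
  apply/measurable_EFinP; apply: measurable_piecewise_real => // y cy.
  exact: (Ck_continuous (sw 0%N) cy).
have g0 y : (0 <= g y)%E.
  by rewrite /g lee_fin /ext0; case: asboolP => // /w0 /ltW.
have m1E (B : set (borel M)) : measurable B -> B `<=` cdom c ->
    mu B = (\int[lam]_y (g y * (\1_B (phi y))%:E))%E.
  move=> mB Bc; rewrite muE//.
  have E : (fun y => (w y * \1_(cmap c @` B) y)%:E) = (fun y => (g y * (\1_B (phi y))%:E)%E).
    apply/funext => y; rewrite /g /phi /ext0 !indicE -EFinM; congr (_%:E).
    case: asboolP => cy.
      congr (_ * (nat_of_bool _)%:R); apply/idP/idP; rewrite !inE.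
        by move=> [x Bx <-]; rewrite (cmapK at_A)//; exact: Bc.
      by move=> By; exists (cinv c y) => //; exact: (cinvK at_A).
    rewrite mul0r (_ : (y \in _) = false) ?mulr0//; apply/negbTE; rewrite notin_setE => -[x Bx xy].
    by apply: cy; exists x => //; exact: Bc.
  rewrite E; have [_ tonelli _] := lamP; rewrite -tonelli//.
    apply: emeasurable_funM => //; apply/measurable_EFinP.
    exact: measurableT_comp.
  by move=> y; rewrite mule_ge0.
have mfE : measurable_fun setT (EFin \o (f : borel M -> R)) by apply/measurable_EFinP.
have h1 := change_variables mphi mg g0 m1E (measurable_funepos mfE) (fun=> isT) (funepos_ge0 _).
have h2 := change_variables mphi mg g0 m1E (measurable_funeneg mfE) (fun=> isT) (funeneg_ge0 _).
rewrite /Rintegral; congr fine; rewrite [LHS]integralE [RHS]integralE.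
have g00 y : 0 <= ext0 c w y by rewrite -lee_fin; exact: g0.
rewrite h1; last by move=> x cx; rewrite funeposE /= f0// maxxx.
rewrite h2; last by move=> x cx; rewrite funenegE /= f0// oppr0 maxxx.
congr (_ - _)%E; apply: eq_integral => y _.
  rewrite !funeposE /g /phi -!EFin_max -EFinM maxr_pMr// mulr0; congr (Num.max _ _)%:E.
  by rewrite /ext0; case: asboolP => //; rewrite mul0r.
rewrite !funenegE /g /phi -!EFinN -!EFin_max -EFinM maxr_pMr// mulr0 mulrN; congr (Num.max (- _) _)%:E.
by rewrite /ext0; case: asboolP => //; rewrite mul0r.
Qed.

End Transfer.

(** * Derivations in local coordinates *)

Section Derivation.
Context {R : realType} {M : ptopologicalType} {n : nat}.
Variable A : set (chart R M n).
Hypothesis at_A : smooth_atlas A.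
Hypothesis hM : hausdorff_space M.
Implicit Types (c : chart R M n) (f g h u v : M -> R) (K V : set M) (x : M) (F : 'rV[R]_n -> R).
Local Notation S := (smooth A).
Local Notation test := (test_function A).

Lemma smooth_sum (I : Type) (r : seq I) (f : I -> M -> R) : (forall i, S (f i)) ->
  S (fun x => \sum_(i <- r) f i x).
Proof.
move=> sf; elim: r => [|i r IH].
  rewrite (_ : (fun x => _) = fun=> 0); first exact: (smooth_cst at_A).
  by apply/funext => x; rewrite big_nil.
rewrite (_ : (fun x => _) = fun x => f i x + \sum_(j <- r) f j x).
  exact: (smoothD at_A).
by apply/funext => x; rewrite big_cons.
Qed.

Section OneForm.
Variable B : (M -> R) -> (M -> R) -> M -> R.
Hypothesis vB : vertical_form A B.

Lemma form_suml (I : Type) (r : seq I) (f : I -> M -> R) u x : (forall i, S (f i)) -> S u ->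
  B (fun y => \sum_(i <- r) f i y) u x = \sum_(i <- r) B (f i) u x.
Proof.
move=> sf su; elim: r => [|i r IH].
  rewrite (_ : (fun y => _) = fun=> 0); first by rewrite (form_cst at_A vB)// big_nil.
  by apply/funext => y; rewrite big_nil.
rewrite (_ : (fun y => _) = fun y => f i y + \sum_(j <- r) f j y).
  by rewrite (formDl vB)//; [rewrite IH big_cons|exact: smooth_sum].
by apply/funext => y; rewrite big_cons.
Qed.

(** The form B accepts global functions only, so the coordinates are multiplied by a cutoff equal to
    1 near K. *)
Lemma coordinate_extension c K : A c -> compact K -> K `<=` cdom c ->
  exists (xi : 'I_n -> M -> R) V, [/\ forall i, S (xi i), open V, K `<=` V, V `<=` cdom c &
    forall i x, V x -> xi i x = cmap c x 0 i].
Proof.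
move=> Ac cK Kc; have [chi [V [[schi cchi schiU] _ oV KV V1]]] := cutoff at_A hM (open_cdom at_A Ac) cK Kc.
have oc := open_cimg at_A Ac.
have Vc : V `<=` cdom c.
  move=> x Vx; apply: schiU; apply: contrapT => /supp_out; rewrite V1// => /eqP.
  by rewrite oner_eq0.
have /choice[xi Hxi] : forall i : 'I_n, exists xi, S xi /\ forall x, cdom c x -> xi x = chi x * cmap c x 0 i.
  move=> i; pose F := fun y : 'rV[R]_n => in_chart c chi y * y 0 i.
  have sF : Cinfty (cimg c) F by move=> k; apply: CkM => //; [exact: schi|exact: Ck_coord].
  have [||//|xi [sxi xiE _ _ _]] := chart_extend at_A hM (K := cmap c @` supp chi) Ac sF.
  - exact: (compact_chart_image at_A).
  - by move=> _ [x sx <-]; apply: cimg_cmap; exact: schiU.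
  - move=> y cy Ky; rewrite /F /in_chart /= (@supp_out _ _ chi) ?mul0r// => sy; apply: Ky.
    by exists (cinv c y) => //; exact: (cinvK at_A).
  exists xi; split=> // x cx; rewrite xiE// /F /in_chart /=.
  by rewrite (cmapK at_A).
exists xi, V; split=> // [i|i x Vx]; first by have [] := Hxi i.
by have [_ ->] := Hxi i; rewrite ?V1 ?mul1r//; exact: Vc.
Qed.

(* By Hadamard's lemma a derivation at a point is a combination of the coordinate derivatives. *)
Lemma form_chart c (xi : 'I_n -> M -> R) V u v x : A c -> (forall i, S (xi i)) -> open V ->
  V `<=` cdom c -> (forall i x, V x -> xi i x = cmap c x 0 i) -> S u -> S v -> V x ->
  B v u x = \sum_(i < n) partial i (in_chart c v) (cmap c x) * B (xi i) u x.
Proof.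
move=> Ac sxi oV Vc xiE su sv Vx; have cx := Vc _ Vx.
have oc := open_cimg at_A Ac; set y0 := cmap c x.
have /nbhs_ballP[e /= e0 He] : nbhs y0 (cimg c).
  by apply: open_nbhs_nbhs; split=> //; exact: cimg_cmap.
(* [hadamard] asks for smoothness on a ball four times larger than the one it describes. *)
pose r := e / 4; have r0 : 0 < r by rewrite divr_gt0.
have r4 : 4 * r = e by rewrite /r mulrC divfK.
have sv4 : Cinfty (ball y0 (4 * r)) (in_chart c v).
  by rewrite r4 => k; apply: Ck_sub He _; exact: sv.
have [b [sb b0 bE]] := hadamard r0 sv4.
have re : ball y0 r `<=` cimg c.
  by move=> y hy; apply: He; apply: le_ball hy; rewrite -r4 ler_pMl// ler1n.
pose U := V `&` (cdom c `&` cmap c @^-1` ball y0 r).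
have oU : open U by apply: openI => //; apply: (open_chart_image at_A) => //; exact: ball_open.
have Ux : U x by split=> //; split=> //; exact: ballxx.
have [be [V' [[sbe cbe sbeU] _ oV' V'x V'1]]] := bump_at at_A hM oU Ux.
have suppU y : cimg c y -> ~ ball y0 r y -> ~ supp be (cinv c y).
  by move=> cy nb /sbeU[_ [_ /=]]; rewrite (cinvK at_A).
have /choice[bt Hbt] : forall i : 'I_n, exists bt, S bt /\
    forall z, cdom c z -> bt z = be z * (if `[< ball y0 r (cmap c z) >] then b i (cmap c z) else 0).
  move=> i; pose F y := in_chart c be y * (if `[< ball y0 r y >] then b i y else 0).
  have cK : compact (cmap c @` supp be).
    by apply: (compact_chart_image at_A) => // z /sbeU[_ []].
  have Kc : cmap c @` supp be `<=` cimg c.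
    by move=> _ [z /sbeU[_ [cz _]] <-]; exact: cimg_cmap.
  have F0 y : cimg c y -> ~ (cmap c @` supp be) y -> F y = 0.
    move=> cy Ky; rewrite /F /in_chart /= (@supp_out _ _ be) ?mul0r// => sy; apply: Ky.
    by exists (cinv c y) => //; exact: (cinvK at_A).
  have sF : Cinfty (cimg c) F.
    move=> k; apply: Ck_local => y cy; have [by_|nby] := pselect (ball y0 r y).
      exists (ball y0 r) => //; apply: (Ck_ext (f := fun y => in_chart c be y * b i y)).
      - exact: ball_open.
      - by move=> z bz; rewrite /F; case: asboolP.
      - apply: CkM; [exact: ball_open| |exact: sb].
        by apply: Ck_sub re _; exact: sbe.
    have oO : open (cimg c `&` ~` (cmap c @` supp be)).
      apply: openI => //; apply: closed_openC; apply: compact_closed => //; exact: rV_hausdorff.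
    exists (cimg c `&` ~` (cmap c @` supp be)).
      split=> // -[z sz zy]; apply: (suppU y) => //; rewrite -zy (cmapK at_A)//.
      by have [_ []] := sbeU _ sz.
    apply: (Ck_ext oO (f := fun=> 0)); last exact: Ck_cst.
    by move=> z [cz Kz]; rewrite F0.
  have [bt [sbt btE _ _ _]] := chart_extend at_A hM Ac sF cK Kc F0.
  exists bt; split=> // z cz; rewrite btE// /F /in_chart /= (cmapK at_A)//.
have sbt i : S (bt i) by have [] := Hbt i.
have bt_x i : bt i x = partial i (in_chart c v) y0.
  have [_ ->//] := Hbt i; rewrite V'1// mul1r -/y0 asboolT ?b0//; exact: ballxx.
(* Near x, v equals v x plus the sum of these global functions. By locality B sees only them, and at
   x the Leibniz rule keeps just the terms in which [xi i] is differentiated. *)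
pose T i z := (xi i z - xi i x) * bt i z.
have sT i : S (T i).
  by apply: (smoothM at_A) => //; apply: (smoothB at_A) => //; exact: (smooth_cst at_A).
have sT' : S (fun z => v x + \sum_(i < n) T i z).
  by apply: (smoothD at_A); [exact: (smooth_cst at_A)|exact: smooth_sum].
rewrite (@form_local _ _ _ _ at_A hM _ vB (V' `&` U) v (fun z => v x + \sum_(i < n) T i z))//; last 2 first.
- exact: openI.
- move=> z [V'z [Vz [cz bz]]].
  have := bE _ bz; rewrite /in_chart /= (cmapK at_A)// (cmapK at_A)// => ->.
  congr (_ + _); apply: eq_bigr => i _; rewrite /T !xiE//.
  have [_ ->//] := Hbt i; rewrite V'1// mul1r asboolT//.
rewrite (formDl vB)//; [|exact: (smooth_cst at_A)|exact: smooth_sum].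
rewrite (form_cst at_A vB)// add0r form_suml//; apply: eq_bigr => i _.
rewrite (formMl vB)//; last by apply: (smoothB at_A) => //; exact: (smooth_cst at_A).
rewrite subrr mul0r add0r bt_x (formBl at_A vB)//; last exact: (smooth_cst at_A).
by rewrite (form_cst at_A vB)// subr0.
Qed.

End OneForm.
End Derivation.

Section RintegralSum.
Context {R : realType}.

Lemma Rintegral_sum0 d (T : measurableType d) (m : {measure set T -> \bar R}) (I : Type) (r : seq I)
  (f : I -> T -> R) : (forall i, m.-integrable setT (EFin \o f i)) ->
  (forall i, \int[m]_x f i x = 0) ->
  m.-integrable setT (EFin \o (fun x => \sum_(i <- r) f i x)) /\ \int[m]_x (\sum_(i <- r) f i x) = 0.
Proof.
move=> intf f0; elim: r => [|i r [IH1 IH2]].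
  have -> : (fun x => \sum_(i <- [::]) f i x) = fun=> 0 by apply/funext => x; rewrite big_nil.
  split; first exact: integrable0.
  by rewrite /Rintegral integral0.
have -> : (fun x => \sum_(j <- i :: r) f j x) = fun x => f i x + \sum_(j <- r) f j x.
  by apply/funext => x; rewrite big_cons.
split; first exact: (integrableD _ (intf i) IH1).
by rewrite RintegralD// f0 add0r.
Qed.

End RintegralSum.

(** * Adjoints of first-order operators *)

Section Adjoint.
Context {R : realType} {M : ptopologicalType} {n : nat}.
Variable A : set (chart R M n).
Hypothesis at_A : smooth_atlas A.
Hypothesis hM : hausdorff_space M.
Implicit Types (c : chart R M n) (f g h u v : M -> R) (K V : set M) (x : M) (F : 'rV[R]_n -> R).
Local Notation S := (smooth A).
Local Notation test := (test_function A).
Variable mu : {measure set (borel M) -> \bar R}.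
Hypothesis finmu : (mu setT < +oo)%E.
Hypothesis smooth_mu : smooth_measure A mu.
Local Notation mfun f := (measurable_fun [set: borel M] (f : borel M -> R)).
Local Notation intg f := (mu.-integrable [set: borel M] (EFin \o (f : borel M -> R))).

Lemma smooth_mfun f : S f -> mfun f.
Proof. by move=> sf; apply: continuous_borel; exact: (smooth_continuous at_A). Qed.

Lemma test_intg f : test f -> intg f.
Proof.
move=> tf; have [C C0 HC] := test_bounded at_A tf.
by apply: (intg_bounded finmu _ HC); apply: smooth_mfun; case: tf.
Qed.

Lemma partialM F1 F2 O i (y : 'rV[R]_n) : open O -> O y -> Ck 1 O F1 -> Ck 1 O F2 ->
  partial i (fun z => F1 z * F2 z) y = F1 y * partial i F2 y + F2 y * partial i F1 y.
Proof.
move=> oO Oy s1 s2; have d1 := Ck_is_derive i s1 Oy; have d2 := Ck_is_derive i s2 Oy.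
by have [_ h] := is_deriveM d1 d2; exact: h.
Qed.

Variable B : (M -> R) -> (M -> R) -> M -> R.
Hypothesis vB : vertical_form A B.

(** In coordinates v |-> rho B(v, u) is a vector field with components [zeta i] = rho B(xi_i, u).
    Integration by parts against the density w gives psi = - (1/w) sum_i d_i (w zeta_i), extended by
    zero. *)
Lemma form_adjoint_chart c rho K u : A c -> S rho -> compact K -> K `<=` cdom c ->
  (forall x, ~ K x -> rho x = 0) -> S u ->
  exists2 psi, test psi & forall v, S v -> \int[mu]_x (rho x * B v u x) = \int[mu]_x (psi x * v x).
Proof.
move=> Ac srho cK Kc rho0 su.
have oc := open_cimg at_A Ac.
have [xi [V [sxi oV KV Vc xiE]]] := coordinate_extension at_A hM Ac cK Kc.
have [lam lamP] := lebesgue_rV_exists (R := R) n.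
have [w [sw w0 tr]] := chart_measure at_A lamP smooth_mu Ac.
pose K' := cmap c @` K.
have cK' : compact K' by exact: (compact_chart_image at_A).
have K'c : K' `<=` cimg c by move=> _ [x Kx <-]; apply: cimg_cmap; exact: Kc.
have oK' : open (~` K') by apply: closed_openC; apply: compact_closed => //; exact: rV_hausdorff.
have nK y : cimg c y -> ~ K' y -> ~ K (cinv c y).
  by move=> cy Ky k; apply: Ky; exists (cinv c y) => //; exact: (cinvK at_A).
have ext0P g : S g -> (forall x, ~ K x -> g x = 0) ->
    Cinfty setT (ext0 c (fun y => w y * in_chart c g y)) /\
    forall y, ~ K' y -> ext0 c (fun y => w y * in_chart c g y) y = 0.
  move=> sg g0; have z0 y : cimg c y -> ~ K' y -> w y * in_chart c g y = 0.
    by move=> cy Ky; rewrite /in_chart /= g0 ?mulr0//; exact: nK.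
  split.
    apply: (ext0_Cinfty at_A Ac _ cK' K'c z0) => k.
    by apply: CkM => //; exact: sg.
  move=> y Ky; have [cy|ncy] := pselect (cimg c y); first by rewrite ext0_in// z0.
  by rewrite ext0_out.
pose zeta i x := rho x * B (xi i) u x.
have szeta i : S (zeta i) by apply: (smoothM at_A) => //; exact: (form_smooth vB).
have zeta0 i x : ~ K x -> zeta i x = 0 by move=> /rho0; rewrite /zeta => ->; rewrite mul0r.
pose G i := ext0 c (fun y => w y * in_chart c (zeta i) y).
have sG i : Cinfty setT (G i) by have [] := ext0P _ (szeta i) (zeta0 i).
have G0 i y : ~ K' y -> G i y = 0 by have [_] := ext0P _ (szeta i) (zeta0 i); exact.
pose psi0 y := - (\sum_(i < n) partial i (G i) y) * (w y)^-1.
have spsi0 : Cinfty (cimg c) psi0.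
  move=> k; apply: CkM => //; last by apply: CkV => // y /w0 /lt0r_neq0.
  apply: CkN => //; apply: Ck_sum => // i; apply: (@Ck_sub _ _ _ setT) => //.
  exact: Ck_partial (sG i k.+1).
have psi00 y : cimg c y -> ~ K' y -> psi0 y = 0.
  move=> cy Ky; rewrite /psi0 big1 ?oppr0 ?mul0r// => i _.
  rewrite (@partial_local _ _ (~` K') _ (fun=> 0)) //; first exact: derive_cst.
  by move=> z; exact: G0.
have [psi [spsi psiE cpsi _ psiK']] := chart_extend at_A hM Ac spsi0 cK' K'c psi00.
have psiK x : ~ K x -> psi x = 0.
  move=> Kx; apply: supp_out => /psiK'[y [z Kz <-] zx]; apply: Kx.
  by rewrite -zx (cmapK at_A)//; exact: Kc.
exists psi; first by split.
move=> v sv; pose H i := ext0 c (fun y => w y * in_chart c (fun x => zeta i x * v x) y).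
have szv i : S (fun x => zeta i x * v x) by exact: (smoothM at_A).
have zv0 i x : ~ K x -> zeta i x * v x = 0 by move=> /zeta0 ->; rewrite mul0r.
have sH i : Cinfty setT (H i) by have [] := ext0P _ (szv i) (zv0 i).
have H0 i y : ~ K' y -> H i y = 0 by have [_] := ext0P _ (szv i) (zv0 i); exact.
pose g x := rho x * B v u x - psi x * v x.
have sB : S (B v u) by exact: (form_smooth vB).
have g0 x : ~ cdom c x -> g x = 0.
  move=> cx; have nK' : ~ K x by move=> /Kc.
  by rewrite /g rho0// psiK// !mul0r subrr.
have t1 : test (fun x => rho x * B v u x).
  split=> //; first exact: (smoothM at_A).
  have clK := compact_closed hM cK.
  apply: subclosed_compact cK _; first exact: closed_supp.
  by apply: supp_sub => // x /rho0 ->; rewrite mul0r.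
have t2 : test (fun x => psi x * v x) by apply: (testMl at_A) => //; split.
have i1 := test_intg t1; have i2 := test_intg t2.
(* In the chart, w (rho B(v, u) - psi v) is the divergence of the compactly supported field [H], so
   its integral is zero. *)
have key y : ext0 c (fun y => w y * in_chart c g y) y = \sum_(i < n) partial i (H i) y.
  have [cy|ncy] := pselect (cimg c y); last first.
    rewrite ext0_out// big1// => i _.
    rewrite (@partial_local _ _ (~` K') _ (fun=> 0)) //.
    - exact: derive_cst.
    - by move=> /K'c.
    - by move=> z; exact: H0.
  have E i : partial i (H i) y = G i y * partial i (in_chart c v) y + in_chart c v y * partial i (G i) y.
    rewrite (@partial_local _ _ (cimg c) _ (fun z => G i z * in_chart c v z)) //.
      apply: (partialM _ oc) => //; last exact: sv.
      by apply: (@Ck_sub _ _ _ setT) => //; exact: sG.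
    by move=> z cz; rewrite /H /G !ext0_in// /in_chart /= mulrA.
  rewrite ext0_in// (eq_bigr _ (fun i _ => E i)) big_split /= -mulr_sumr.
  have E2 : in_chart c v y * (\sum_(i < n) partial i (G i) y) = - (w y * (psi (cinv c y) * v (cinv c y))).
    have := psiE (cinv c y) (cdom_cinv at_A Ac cy); rewrite (cinvK at_A)// => ->.
    rewrite /psi0 /in_chart /= mulNr mulNr mulrN opprK mulrC.
    rewrite -!mulrA [_ * v _]mulrC mulrCA [(w y)^-1 * _]mulrC mulrCA mulrA.
    have wn := lt0r_neq0 (w0 _ cy); move: (\sum_(i < n) _) (v _) => a b.
    by field.
  rewrite E2 /in_chart /= /g mulrBr; congr (_ - _).
  have E3 i : G i y * partial i (in_chart c v) y =
     w y * rho (cinv c y) * (partial i (in_chart c v) y * B (xi i) u (cinv c y)).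
    rewrite /G ext0_in// /in_chart /= /zeta; move: (partial _ _ _) (B _ _ _) => a b; ring.
  rewrite (eq_bigr _ (fun i _ => E3 i)) -mulr_sumr -mulrA; congr (_ * _).
  have [Kx|nKx] := pselect (K (cinv c y)); last by rewrite rho0// !mul0r.
  congr (_ * _); rewrite (form_chart at_A hM vB Ac sxi oV Vc xiE su sv (KV _ Kx)).
  by rewrite (cinvK at_A).
have [k Kk] := compact_box cK'.
have [fin _ ibp] := lamP.
have cH i : continuous (H i) by move=> y; exact: (Ck_continuous (sH i 0%N)).
have cdH i : continuous (partial i (H i)).
  by move=> y; apply: (@Ck_continuous _ _ 0 setT) => //; exact: Ck_partial (sH i 1%N).
have dH i y : derivable (H i) y (delta_mx 0 i).
  by have [] := Ck_is_derive i (sH i 1%N) (Logic.I : setT y).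
have H0k i y : ~ @rV_box R n k y -> H i y = 0 by move=> hy; apply: H0 => /Kk.
have [_ sum0] := @Rintegral_sum0 R _ _ lam _ (index_enum 'I_n) (fun i => partial i (H i))
   (fun i => box_integrable fin (cdH i) (@partial_out_box _ _ _ i k (@H0k i)))
   (fun i => f_equal fine (ibp _ i k (cH i) (dH i) (cdH i) (@H0k i))).
have : \int[mu]_x g x = 0.
  rewrite tr//; last first.
    apply: smooth_mfun; apply: (smoothB at_A); [by case: t1|by case: t2].
  by rewrite -[RHS]sum0; apply: eq_Rintegral => y _; exact: key.
by rewrite /g (IB i1 i2) => /eqP; rewrite subr_eq0 => /eqP.
Qed.

(** The heat flow is known through pairings with test functions; this turns integrals of chi B(v, u)
    into such pairings, linear in v. The chart version is globalized by [compact_ind]. *)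
Lemma form_adjoint chi u : test chi -> S u ->
  exists2 psi, test psi & forall v, S v -> \int[mu]_x (chi x * B v u x) = \int[mu]_x (psi x * v x).
Proof.
move=> tchi su.
(* The claim is required for every test function chi, because the union step, with cutoff e1 + e2 -
   e1 e2, applies the second adjoint to chi * e1. *)
pose P (X : set M) := exists eta V, [/\ S eta, open V, X `<=` V, (forall x, V x -> eta x = 1) &
  forall chi, test chi -> exists2 psi, test psi &
    forall v, S v -> \int[mu]_x (chi x * eta x * B v u x) = \int[mu]_x (psi x * v x)].
have : P (supp chi).
  apply: compact_ind; last by case: tchi.
  - exists (fun=> 0), set0; split=> //; [exact: (smooth_cst at_A)|exact: open0|].
    move=> h th; exists (fun=> 0); first exact: (test0 at_A).
    by move=> v sv; apply: eq_Rintegral => x _; rewrite mulr0 !mul0r.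
  - move=> X Y [e1 [V1 [s1 o1 X1 h1 a1]]] [e2 [V2 [s2 o2 X2 h2 a2]]].
    have sC := smooth_cst at_A.
    exists (fun x => e1 x + e2 x - e1 x * e2 x), (V1 `|` V2); split=> //.
    + apply: (smoothB at_A); [exact: (smoothD at_A)|exact: (smoothM at_A)].
    + exact: openU.
    + by move=> x [/X1|/X2]; [left|right].
    + by move=> x [/h1|/h2] ->; ring.
    + move=> h th; have [p1 tp1 H1] := a1 h th; have [p2 tp2 H2] := a2 h th.
      have the : test (fun x => h x * e1 x) by exact: (testMl at_A).
      have [p3 tp3 H3] := a2 _ the.
      exists (fun x => p1 x + p2 x - p3 x).
        by apply: (testB at_A) => //; exact: (testD at_A).
      move=> v sv; have sB : S (B v u) by exact: (form_smooth vB).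
      have tt q : test q -> intg (fun x => q x * v x).
        by move=> tq; apply: test_intg; exact: (testMl at_A).
      have tB q e : test q -> S e -> intg (fun x => q x * e x * B v u x).
        by move=> tq se; apply: test_intg; apply: (testMl at_A) => //; exact: (testMl at_A).
      transitivity (\int[mu]_x (h x * e1 x * B v u x + h x * e2 x * B v u x - h x * e1 x * e2 x * B v u x)).
        by apply: eq_Rintegral => x _; ring.
      have i1 := tB _ _ th s1; have i2 := tB _ _ th s2; have i3 := tB _ _ the s2.
      rewrite (IB (intgD i1 i2) i3) (ID i1 i2) H1// H2// H3//.
      transitivity (\int[mu]_x (p1 x * v x + p2 x * v x - p3 x * v x)); last first.
        by apply: eq_Rintegral => x _; ring.
      have j1 := tt _ tp1; have j2 := tt _ tp2; have j3 := tt _ tp3.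
      by rewrite (IB (intgD j1 j2) j3) (ID j1 j2).
  - by move=> X Y XY [e [V [se oV YV h a]]]; exists e, V; split=> // x /XY /YV.
  - move=> x _; have [c Ac cx] := chart_at at_A x.
    have [e [V [[se ce seU] _ oV Vx V1]]] := bump_at at_A hM (open_cdom at_A Ac) cx.
    exists V; split=> //; exists e, V; split=> // h th.
    apply: (form_adjoint_chart (K := supp e) Ac) => //.
      by apply: (smoothM at_A) => //; case: th.
    by move=> y /supp_out ->; rewrite mulr0.
move=> [eta [V [se oV KV V1 /(_ _ tchi)[psi tpsi H]]]]; exists psi => // v sv.
rewrite -H//; apply: eq_Rintegral => x _.
have [sx|/supp_out ->] := pselect (supp chi x); last by rewrite !mul0r.
by rewrite V1 ?mulr1//; exact: KV.
Qed.

End Adjoint.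

Section LebesgueCube.
Context {R : realType}.

Lemma lebesgue_int0 n : lebesgue_int (fun _ : 'rV[R]_n => 0%E) = 0%E.
Proof.
elim: n => [//|m IH] /=; rewrite -[RHS](integral0 lebesgue_measure [set: R]).
by apply: eq_integral => s _; exact: IH.
Qed.

(** The volume of a cube is needed to see that nonempty open sets have positive measure. *)
Lemma lebesgue_int_cube n (x : 'rV[R]_n) (s : R) : 0 < s ->
  lebesgue_int (fun y => (\1_(cube x s) y)%:E) = ((2 * s) ^+ n)%:E.
Proof.
move=> s0; elim: n x => [|m IH] x /=; first by rewrite indicE mem_set//; case.
pose x1 := rsubmx (x : 'rV_(1 + m)); pose a := x 0 (lshift m (ord0 : 'I_1)).
have cubeE (t : R) (y : 'rV[R]_m) :
    cube x s (row_mx (t%:M : 'rV[R]_1) y : 'rV[R]_(1 + m)) <-> `[a - s, a + s]%classic t /\ cube x1 s y.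
  split=> [h|[h1 h2] i].
    split=> [|j].
      have h0 : `|(row_mx (t%:M : 'rV[R]_1) y : 'rV[R]_(1 + m)) 0 (lshift m ord0) - a| <= s by exact: h.
      by move: h0; rewrite row_mxEl mxE eqxx mulr1n /= in_itv /= ler_distl.
    have h0 : `|(row_mx (t%:M : 'rV[R]_1) y : 'rV[R]_(1 + m)) 0 (rshift 1 j) - x 0 (rshift 1 j : 'I_(1 + m))| <= s.
      exact: h.
    by move: h0; rewrite row_mxEr mxE.
  case: (@split_ordP 1 m i) => j ->.
    rewrite (ord1 j); have h0 : (row_mx (t%:M : 'rV[R]_1) y : 'rV[R]_(1 + m)) 0 (lshift m ord0) = t.
      by rewrite row_mxEl mxE eqxx mulr1n.
    change (`|(row_mx (t%:M : 'rV[R]_1) y : 'rV[R]_(1 + m)) 0 (lshift m ord0) - a| <= s).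
    by rewrite h0; move: h1; rewrite /= in_itv /= ler_distl.
  have h0 : (row_mx (t%:M : 'rV[R]_1) y : 'rV[R]_(1 + m)) 0 (rshift 1 j) = y 0 j by rewrite row_mxEr.
  have := h2 j; rewrite mxE -h0; exact.
transitivity (\int[lebesgue_measure]_(t in [set: R]) (((2 * s) ^+ m)%:E * (\1_(`[a - s, a + s]%classic) t)%:E))%E.
  apply: eq_integral => t _; rewrite indicE; have [ht|ht] := boolP (t \in `[a - s, a + s]%classic).
    rewrite mule1 -(IH x1); congr (lebesgue_int _); apply/funext => y; rewrite !indicE.
    congr ((nat_of_bool _)%:R%:E); apply/idP/idP; rewrite !inE => h; first by have [] := (cubeE t y).1 h.
    by apply/cubeE; split=> //; rewrite inE in ht.
  rewrite mule0 -[RHS](lebesgue_int0 m); congr (lebesgue_int _); apply/funext => y; rewrite indicE.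
  case: (boolP (_ \in _)) => //; rewrite inE => /cubeE[h _]; by rewrite notin_setE in ht.
rewrite ge0_integralZl//; last 2 first.
- by apply/measurable_EFinP; exact: measurable_indic.
- by rewrite lee_fin exprn_ge0// mulr_ge0// ltW.
have lm : lebesgue_measure (`[a - s, a + s]%classic : set R) = (2 * s)%:E.
  rewrite lebesgue_measure_itv /= lte_fin ltrD2l gtrN// -EFinD; congr (_%:E); ring.
by rewrite integral_indic// setIT exprSr EFinM; congr (_ * _)%E; exact: lm.
Qed.

End LebesgueCube.

(** * Positivity on open sets and Green's formulas *)

Section Positivity.
Context {R : realType} {M : ptopologicalType} {n : nat}.
Variable A : set (chart R M n).
Hypothesis at_A : smooth_atlas A.
Hypothesis hM : hausdorff_space M.
Implicit Types (c : chart R M n) (f g h u v : M -> R) (K V U : set M) (x : M) (F : 'rV[R]_n -> R).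
Local Notation S := (smooth A).
Local Notation test := (test_function A).
Variable mu : {measure set (borel M) -> \bar R}.
Hypothesis finmu : (mu setT < +oo)%E.
Hypothesis smooth_mu : smooth_measure A mu.
Local Notation mfun f := (measurable_fun [set: borel M] (f : borel M -> R)).
Local Notation intg f := (mu.-integrable [set: borel M] (EFin \o (f : borel M -> R))).

Lemma le_mu U V : measurable (U : set (borel M)) -> measurable (V : set (borel M)) -> U `<=` V ->
  (mu U <= mu V)%E.
Proof. by move=> mU mV UV; apply: le_measure; rewrite ?inE. Qed.

(** In a chart, the density exceeds half its central value on a small cube. It follows that almost
    everywhere relations between continuous functions hold everywhere. *)
Lemma open_measure_gt0 U x : open U -> U x -> (0 < mu U)%E.
Proof.
move=> oU Ux; have [c Ac cx] := chart_at at_A x.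
have [w [sw w0 muE]] := smooth_mu Ac; set y0 := cmap c x.
have cy0 : cimg c y0 by exact: cimg_cmap.
have [lam [fin tonelli _]] := lebesgue_rV_exists (R := R) n.
pose e := w y0 / 2; have e0 : 0 < e by rewrite divr_gt0// w0.
have /nbhs_ballP[r /= r0 Hr] : nbhs y0 [set y | (cimg c `&` cinv c @^-1` U) y /\ e < w y].
  apply: filterI.
    apply: open_nbhs_nbhs; split; first exact: (open_chart_preimage at_A).
    by split=> //=; rewrite (cmapK at_A).
  have cw := Ck_continuous (sw 0%N) cy0.
  apply: (cw [set z | e < z]); apply: open_nbhs_nbhs; split; first exact: open_gt.
  by rewrite /= /e gtr_pMr ?w0// invf_lt1// ltr1n.
pose O : set 'rV[R]_n := ball y0 r; pose B := cdom c `&` cmap c @^-1` O.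
have oO : open O by exact: ball_open.
have oB : open B by exact: (open_chart_image at_A).
have BU : B `<=` U by move=> z [cz /Hr[[_ /=]]]; rewrite (cmapK at_A).
have imB : cmap c @` B = O.
  apply/seteqP; split=> [_ [z [cz Oz] <-]//|y Oy].
  have [[cy _] _] := Hr _ Oy; exists (cinv c y); last exact: (cinvK at_A).
  by split; [exact: (cdom_cinv at_A)|rewrite /= (cinvK at_A)].
apply: lt_le_trans (le_mu _ _ BU); [|exact: open_measurable_borel..].
rewrite muE; [|exact: open_measurable_borel|by move=> z []].
rewrite imB -tonelli; last 2 first.
- apply/measurable_EFinP.
  rewrite (_ : (fun y => w y * \1_O y) = (fun y => if `[< O y >] then w y else 0)).
    apply: measurable_piecewise_real => // y /Hr[[cy _] _]; exact: (Ck_continuous (sw 0%N) cy).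
  apply/funext => y; rewrite indicE; case: asboolP => Oy; first by rewrite mem_set// mulr1.
  by rewrite memNset// mulr0.
- move=> y; rewrite lee_fin indicE; case: (boolP (y \in O)); last by rewrite mulr0.
  by rewrite inE mulr1 => /Hr[[cy _] _]; rewrite ltW// w0.
pose s := r / 2; have s0 : 0 < s by rewrite divr_gt0.
have mcube : measurable (cube y0 s : set (borel 'rV[R]_n)).
  rewrite -(setCK (cube y0 s)); apply: measurableC; apply: open_measurable_borel.
  by apply: closed_openC; apply: compact_closed; [exact: rV_hausdorff|exact: compact_cube].
have cubeO : cube y0 s `<=` O.
  move=> y hy; apply/ball_rVE => // i; rewrite distrC; apply: le_lt_trans (hy i) _.
  by rewrite /s ltr_pdivrMr// ltr_pMr// ltr1n.
have lamc : lam (cube y0 s) = ((2 * s) ^+ n)%:E.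
  rewrite -(lebesgue_int_cube y0 s0) -tonelli; last 2 first.
  - by apply/measurable_EFinP; exact: measurable_indic.
  - by move=> y; rewrite lee_fin.
  by rewrite integral_indic// setIT.
apply: (@lt_le_trans _ _ (\int[lam]_y (e%:E * (\1_(cube y0 s) y)%:E))%E).
  rewrite ge0_integralZl//; last 2 first.
  - by apply/measurable_EFinP; exact: measurable_indic.
  - by rewrite lee_fin ltW.
  rewrite integral_indic// setIT lamc -EFinM lte_fin mulr_gt0// exprn_gt0// mulr_gt0//.
apply: ge0_le_integral => //.
- by move=> y _; rewrite mule_ge0// ?lee_fin// ltW.
- by apply: emeasurable_funM => //; apply/measurable_EFinP; exact: measurable_indic.
- apply/measurable_EFinP.
  rewrite (_ : (fun y => w y * \1_O y) = (fun y => if `[< O y >] then w y else 0)).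
    apply: measurable_piecewise_real => // y /Hr[[cy _] _]; exact: (Ck_continuous (sw 0%N) cy).
  apply/funext => y; rewrite indicE; case: asboolP => Oy; first by rewrite mem_set// mulr1.
  by rewrite memNset// mulr0.
- move=> y _; rewrite -EFinM lee_fin !indicE; case: (boolP (y \in cube y0 s)).
    rewrite inE => /cubeO Oy; rewrite mem_set// !mulr1; have [_ h] := Hr _ Oy; exact: ltW.
  move=> _; rewrite mulr0; case: (boolP (y \in O)); last by rewrite mulr0.
  by rewrite inE mulr1 => /Hr[[cy _] _]; rewrite ltW// w0.
Qed.

Lemma ae_le_everywhere f g : continuous f -> continuous g -> {ae mu, forall x, f x <= g x} ->
  forall x, f x <= g x.
Proof.
move=> cf cg [N [mN N0 HN]] x; rewrite leNgt; apply/negP => gf.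
pose U := [set y : M | g y < f y].
have oU : open U.
  rewrite (_ : U = (fun y => f y - g y) @^-1` [set r | 0 < r]).
    by apply: open_comp => [y _|]; [apply: continuousB; [exact: cf|exact: cg]|exact: open_gt].
  by apply/seteqP; split=> y /=; rewrite subr_gt0.
have UN : U `<=` N by move=> y Uy; apply: HN => /=; rewrite leNgt Uy.
have h2 := open_measure_gt0 oU gf.
have := le_mu (open_measurable_borel oU) mN UN; rewrite N0 => h1.
by have := lt_le_trans h2 h1; rewrite ltxx.
Qed.

Lemma ae_eq_everywhere f g : continuous f -> continuous g -> {ae mu, forall x, f x = g x} ->
  f = g.
Proof.
move=> cf cg [N [mN N0 HN]]; apply/funext => x; apply/eqP; rewrite eq_le; apply/andP; split.
  apply: ae_le_everywhere => //; exists N; split=> // y ny; apply: HN => /= e.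
  by apply: ny; rewrite /= e.
apply: ae_le_everywhere => //; exists N; split=> // y ny; apply: HN => /= e.
by apply: ny; rewrite /= e.
Qed.

Variable L : (M -> R) -> M -> R.
Hypothesis dL : second_order_diffusion A L.
Hypothesis L1 : forall x, L (fun=> 1) x = 0.
Hypothesis symL : symmetric_operator mu A L.

Lemma L_supp f x : test f -> ~ supp f x -> L f x = 0.
Proof.
move=> [sf _ _] fx; rewrite (@L_local _ _ _ _ at_A _ dL (~` supp f) f (fun=> 0))//.
- exact: (L_cst at_A dL L1).
- exact: (smooth_cst at_A).
- by apply: closed_openC; exact: closed_supp.
- by move=> y /supp_out.
Qed.

(** Symmetry is assumed for two test functions; multiplying v by a cutoff equal to 1 near the
    support of phi changes neither side, since L is local. *)
Lemma L_adjoint phi v : test phi -> S v -> \int[mu]_x (phi x * L v x) = \int[mu]_x (v x * L phi x).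
Proof.
move=> tphi sv; have [chi [V [tchi oV sV V1]]] := test_cutoff at_A hM tphi.
have tcv : test (fun x => chi x * v x) by exact: (testMl at_A).
have := symL tphi tcv.
rewrite (_ : \int[mu]_x (phi x * L (fun x => chi x * v x) x) = \int[mu]_x (phi x * L v x)); last first.
  apply: eq_Rintegral => x _; have [sx|/supp_out ->] := pselect (supp phi x); last by rewrite !mul0r.
  congr (_ * _); apply: (@L_local _ _ _ _ at_A _ dL V) => //; [by case: tcv|exact: sV|].
  by move=> y /V1 ->; rewrite mul1r.
move=> ->; apply: eq_Rintegral => x _.
have [sx|nsx] := pselect (supp phi x); last by rewrite L_supp// !mulr0.
by rewrite V1 ?mul1r//; exact: sV.
Qed.

Lemma L_mean0 w : test w -> \int[mu]_x (L w x) = 0.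
Proof.
move=> tw; have := L_adjoint tw (smooth_cst at_A 1).
rewrite (_ : \int[mu]_x (w x * _) = 0) => [h|].
  by rewrite h; apply: eq_Rintegral => x _; rewrite mul1r.
by rewrite -[RHS](mul0r (fine (mu setT))) -I_cst; apply: eq_Rintegral => x _; rewrite L1 mulr0.
Qed.

(** Integrate L(phi v) = phi L v + v L phi + 2 Gamma(phi, v): the left side has mean zero and the
    first two terms on the right have equal integrals. *)
Lemma L_Gamma phi v : test phi -> S v -> \int[mu]_x (phi x * L v x) = - \int[mu]_x (Gamma L phi v x).
Proof.
move=> tphi sv; have sphi : S phi by case: tphi.
have tG : test (Gamma L phi v) by apply: (test_form at_A hM) => //; exact: (Gamma_form at_A dL L1).
have t1 : test (fun x => phi x * L v x) by apply: (testMl at_A) => //; exact: (L_smooth at_A dL).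
have t2 : test (fun x => v x * L phi x) by apply: (testMr at_A) => //; exact: (test_L at_A).
have := L_mean0 (testMl at_A tphi sv).
have i1 := test_intg at_A finmu t1; have i2 := test_intg at_A finmu t2; have iG := test_intg at_A finmu tG.
have -> : \int[mu]_x L (fun x => phi x * v x) x = \int[mu]_x (phi x * L v x + v x * L phi x + 2 * Gamma L phi v x).
  by apply: eq_Rintegral => x _; exact: LM.
rewrite (ID (intgD i1 i2) (intgZ 2 iG)) (ID i1 i2) (IZ _ iG) (L_adjoint tphi sv).
move: (\int[mu]_x (v x * _)) (\int[mu]_x Gamma _ _ _ _) => a b h; lra.
Qed.

End Positivity.

Lemma ae_imp2 {R : realType} d (T : measurableType d) (mu : {measure set T -> \bar R})
  (P Q Z : T -> Prop) : {ae mu, forall x, P x} -> {ae mu, forall x, Q x} ->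
  (forall x, P x -> Q x -> Z x) -> {ae mu, forall x, Z x}.
Proof. by move=> hP hQ PQZ; apply: filterS2 hP hQ. Qed.

Lemma ae_imp {R : realType} d (T : measurableType d) (mu : {measure set T -> \bar R})
  (P Z : T -> Prop) : {ae mu, forall x, P x} -> (forall x, P x -> Z x) -> {ae mu, forall x, Z x}.
Proof. by move=> hP PZ; apply: filterS hP. Qed.

(** * Density of test functions *)

Section Density.
Context {R : realType} {M : ptopologicalType} {n : nat}.
Variable A : set (chart R M n).
Hypothesis at_A : smooth_atlas A.
Hypothesis hM : hausdorff_space M.
Hypothesis scM : @second_countable M.
Implicit Types (f g h u v : M -> R) (K V U : set M) (x : M).
Local Notation S := (smooth A).
Local Notation test := (test_function A).
Variable mu : {measure set (borel M) -> \bar R}.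
Hypothesis finmu : (mu setT < +oo)%E.
Local Notation mfun f := (measurable_fun [set: borel M] (f : borel M -> R)).
Local Notation intg f := (mu.-integrable [set: borel M] (EFin \o (f : borel M -> R))).
Local Notation L2 f := (L2 mu f).
Local Notation unit_valued g := (forall x, 0 <= g x <= 1).

Lemma unitC (a : R) : 0 <= a <= 1 -> 0 <= 1 - a <= 1.
Proof. by move=> /andP[a0 a1]; rewrite subr_ge0 a1 gerBl. Qed.

Lemma unitM (a b : R) : 0 <= a <= 1 -> 0 <= b <= 1 -> 0 <= a * b <= 1.
Proof. by move=> /andP[a0 a1] /andP[b0 b1]; rewrite mulr_ge0//= mulr_ile1. Qed.

Lemma smooth_prod (I : Type) (r : seq I) (f : I -> M -> R) : (forall i, S (f i)) ->
  S (fun x => \prod_(i <- r) f i x).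
Proof.
move=> sf; elim: r => [|i r IH].
  rewrite (_ : (fun x => _) = fun=> 1); first exact: (smooth_cst at_A).
  by apply/funext => x; rewrite big_nil.
rewrite (_ : (fun x => _) = fun x => f i x * \prod_(j <- r) f j x).
  exact: (smoothM at_A).
by apply/funext => x; rewrite big_cons.
Qed.

(** Second countability reduces U to countably many bumps f_j, and the partial products 1 - prod (1
    - f_j) become equal to 1 at each point of U. *)
Lemma open_approx U : open U -> exists g : nat -> M -> R,
  [/\ forall k, S (g k), forall k, unit_valued (g k) & forall x, g k x @[k --> \oo] --> (\1_U x : R)].
Proof.
move=> oU; have [b cb [bo bas]] := scM.
have /countable_injP[num numI] := cb.
(* For the j-th base set, a bump equal to 1 on it and vanishing off U whenever one exists, and 0
   otherwise. *)
have /choice[be Hbe] : forall j : nat, exists be, [/\ S be, unit_valued be, (forall x, ~ U x -> be x = 0) &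
    forall V, b V -> num V = j -> (exists f, [/\ S f, unit_valued f, (forall x, ~ U x -> f x = 0) & forall x, V x -> f x = 1]) ->
      forall x, V x -> be x = 1].
  move=> j.
  have [[V [bV Vj [f [sf f01 fU f1]]]]|no] := pselect (exists V, [/\ b V, num V = j &
      exists f, [/\ S f, unit_valued f, (forall x, ~ U x -> f x = 0) & forall x, V x -> f x = 1]]).
    exists f; split=> // W bW Wj _ x Wx; apply: f1.
    by rewrite (numI V W) ?inE// Vj.
  exists (fun=> 0); split=> //; first exact: (smooth_cst at_A).
  - by move=> x; rewrite lexx ler01.
  - by move=> W bW Wj ex; exfalso; apply: no; exists W.
exists (fun k x => 1 - \prod_(j < k) (1 - be j x)).
have be01 j x : 0 <= be j x <= 1 by have [_ h _ _] := Hbe j; exact: h.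
split.
- move=> k; apply: (smoothB at_A); first exact: (smooth_cst at_A).
  apply: smooth_prod => j; apply: (smoothB at_A); first exact: (smooth_cst at_A).
  by have [] := Hbe j.
- move=> k x; apply: unitC; elim/big_ind: _ => //; first by rewrite ler01 lexx.
    exact: unitM.
  by move=> j _; exact: unitC.
- move=> x; rewrite indicE; have [Ux|Ux] := pselect (U x); last first.
    rewrite memNset//; rewrite (_ : (fun k => _) = cst 0); first exact: cvg_cst.
    apply/funext => k; rewrite big1 ?subrr// => j _.
    by have [_ _ -> //] := Hbe j; rewrite subr0.
  rewrite mem_set//.
  have [f [V [[sf _ suppf] f01 oV Vx V1]]] := bump_at at_A hM oU Ux.
  have [W [bW Wx] WV] : filter_from [set W | b W /\ W x] id V by apply: bas; exact: open_nbhs_nbhs.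
  have e1 : be (num W) x = 1.
    have [_ _ _ /(_ _ bW erefl)] := Hbe (num W); apply => //.
    exists f; split=> // [y Uy|y /WV /V1//].
    by apply: supp_out => /suppf.
  apply: cvg_near_cst; exists (num W).+1 => // k /= hk.
  by rewrite (bigD1 (Ordinal hk)) //= e1 subrr mul0r subr0.
Qed.

(** These sets are shown to form a sigma-algebra containing the open sets, hence to be all Borel
    sets. *)
Definition smooth_dense (E : set (borel M)) := measurable E /\
  forall e : R, 0 < e -> exists g, [/\ S g, unit_valued g & \int[mu]_x `|\1_E x - g x| <= e].

Lemma bounded_intg f (C : R) : mfun f -> (forall x, `|f x| <= C) -> intg f.
Proof. exact: intg_bounded. Qed.

Lemma unit_diff_intg (E : set (borel M)) g : measurable E -> S g -> unit_valued g ->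
  [/\ mfun (fun x => `|\1_E x - g x|), intg (fun x => `|\1_E x - g x|) & forall x, `|\1_E x - g x| <= 1].
Proof.
move=> mE sg g01.
have b x : `|\1_E x - g x| <= 1.
  have /andP[a0 a1] := g01 x; rewrite indicE; case: (_ \in _); rewrite /= ?sub0r ?normrN ger0_norm//.
  - by rewrite gerBl.
  - by rewrite subr_ge0.
have m : mfun (fun x => `|\1_E x - g x|).
  apply: measurableT_comp => //; apply: measurable_funB; first exact: measurable_indic.
  exact: (smooth_mfun at_A).
by split=> //; apply: (bounded_intg m (C := 1)) => x; rewrite normr_id.
Qed.

Lemma smooth_dense_open U : open U -> smooth_dense U.
Proof.
move=> oU; have mU := open_measurable_borel oU; split=> // e e0.
have [g [sg g01 gU]] := open_approx oU.
have h k := unit_diff_intg mU (sg k) (g01 k).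
have : \int[mu]_x `|\1_U x - g k x| @[k --> \oo] --> \int[mu]_x ((fun=> 0 : R) x).
  apply: (I_dominated (g := fun=> 1)).
  - by move=> k; have [] := h k.
  - exact: measurable_cst.
  - exact: intg_cst.
  - apply: aeW => x; rewrite -(@normr0 _ R) -(subrr (\1_U x : R)).
    by apply: cvg_norm; apply: cvgB; [exact: cvg_cst|exact: gU].
  - by move=> k x; rewrite normr_id; have [_ _] := h k; exact.
rewrite I_cst mul0r => /cvgrPdist_le/(_ _ e0)[N _ /(_ N (leqnn N))].
rewrite sub0r normrN => H; exists (g N); split=> //.
exact: le_trans (ler_norm _) H.
Qed.

Lemma smooth_denseC (E : set (borel M)) : smooth_dense E -> smooth_dense (~` E).
Proof.
move=> [mE hE]; split; first exact: measurableC.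
move=> e /hE[g [sg g01 gE]]; exists (fun x => 1 - g x); split.
- by apply: (smoothB at_A) => //; exact: (smooth_cst at_A).
- by move=> x; exact: unitC.
- rewrite (_ : \int[mu]_x _ = \int[mu]_x `|\1_E x - g x|)//; apply: eq_Rintegral => x _.
  rewrite indicC indicE; rewrite -normrN; congr `|_|; case: (_ \in _) => /=; ring.
Qed.

Lemma smooth_denseU (E F : set (borel M)) : smooth_dense E -> smooth_dense F -> smooth_dense (E `|` F).
Proof.
move=> [mE hE] [mF hF]; have mEF := measurableU _ _ mE mF; split=> // e e0.
have e2 : 0 < e / 2 by rewrite divr_gt0.
have [g [sg g01 gE]] := hE _ e2; have [k [sk k01 kF]] := hF _ e2.
have sgk : S (fun x => 1 - (1 - g x) * (1 - k x)).
  have sC := smooth_cst at_A.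
  apply: (smoothB at_A) => //; apply: (smoothM at_A); exact: (smoothB at_A).
have gk01 : unit_valued (fun x => 1 - (1 - g x) * (1 - k x)).
  by move=> x; apply: unitC; apply: unitM; exact: unitC.
exists (fun x => 1 - (1 - g x) * (1 - k x)); split=> //.
have [_ i1 _] := unit_diff_intg mE sg g01; have [_ i2 _] := unit_diff_intg mF sk k01.
have [_ i3 _] := unit_diff_intg mEF sgk gk01.
apply: (@le_trans _ _ (\int[mu]_x (`|\1_E x - g x| + `|\1_F x - k x|))); last first.
  by rewrite (ID i1 i2) (splitr e) lerD.
apply: (I_le i3 (intgD i1 i2)) => x.
rewrite (_ : \1_(E `|` F) x = 1 - (1 - \1_E x) * (1 - \1_F x) :> R); last first.
  by rewrite !indicE in_setU; case: (x \in E); case: (x \in F); rewrite /=; ring.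
rewrite (_ : _ - _ = (\1_E x - g x) * (1 - \1_F x) + (1 - g x) * (\1_F x - k x)); last by ring.
apply: le_trans (ler_normD _ _) _; rewrite !normrM; apply: lerD.
  rewrite ler_piMr// indicE; case: (_ \in _); rewrite /= ?subrr ?subr0 ?normr0 ?normr1//.
by rewrite ler_piMl//; have /andP[a b] := unitC (g01 x); rewrite ger0_norm.
Qed.

Lemma smooth_dense_bigcup (E : (set (borel M))^nat) : (forall k, smooth_dense (E k)) ->
  smooth_dense (\bigcup_k E k).
Proof.
move=> hE; have mE : measurable (\bigcup_k E k) by apply: bigcupT_measurable => k; have [] := hE k.
pose F k := \big[setU/set0]_(i < k) E i.
have hF k : smooth_dense (F k).
  elim: k => [|k IH]; first by rewrite /F big_ord0; apply: smooth_dense_open; exact: open0.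
  by rewrite /F big_ord_recr /=; exact: smooth_denseU.
split=> // e e0; have e2 : 0 < e / 2 by rewrite divr_gt0.
have mF k : measurable (F k) by have [] := hF k.
have mD k : mfun (fun x => \1_(\bigcup_k E k) x - \1_(F k) x).
  by apply: measurable_funB; exact: measurable_indic.
have bD k x : `|\1_(\bigcup_k E k) x - \1_(F k) x : R| <= 1.
  by rewrite !indicE; case: (_ \in _); case: (_ \in _); rewrite /= ?subrr ?subr0 ?sub0r ?normrN ?normr0 ?normr1.
have mD' k : mfun (fun x => `|\1_(\bigcup_k E k) x - \1_(F k) x|) by exact: measurableT_comp.
have : \int[mu]_x `|\1_(\bigcup_k E k) x - \1_(F k) x| @[k --> \oo] --> \int[mu]_x ((fun=> 0 : R) x).
  apply: (I_dominated (g := fun=> 1)) => //.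
  - exact: intg_cst.
  - apply: aeW => x; apply: cvg_near_cst; have [[j _ Ejx]|nE] := pselect ((\bigcup_k E k) x).
      exists j.+1 => // k /= jk; rewrite !indicE mem_set; last by exists j.
      rewrite mem_set ?subrr ?normr0// /F -bigcup_mkord; by exists j.
    exists 0%N => // k _ /=; rewrite !indicE memNset// memNset ?subrr ?normr0// /F -bigcup_mkord.
    by move=> [j _ Ejx]; apply: nE; exists j.
  - by move=> k x; rewrite normr_id.
rewrite I_cst mul0r => /cvgrPdist_le/(_ _ e2)[N _ /(_ N (leqnn N))].
rewrite sub0r normrN => H.
have [_ /(_ _ e2)[g [sg g01 gF]]] := hF N; exists g; split=> //.
have [_ i1 _] := unit_diff_intg mE sg g01; have [_ i2 _] := unit_diff_intg (mF N) sg g01.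
have i3 : intg (fun x => `|\1_(\bigcup_k E k) x - \1_(F N) x|).
  by apply: (bounded_intg (mD' N) (C := 1)) => x; rewrite normr_id.
apply: (@le_trans _ _ (\int[mu]_x (`|\1_(\bigcup_k E k) x - \1_(F N) x| + `|\1_(F N) x - g x|))); last first.
  by rewrite (ID i3 i2) (splitr e) lerD// (le_trans (ler_norm _) H).
apply: (I_le i1 (intgD i3 i2)) => x.
by rewrite (_ : _ - g x = (\1_(\bigcup_k E k) x - \1_(F N) x) + (\1_(F N) x - g x)) ?ler_normD//; ring.
Qed.

Lemma measurable_smooth_dense (E : set (borel M)) : measurable E -> smooth_dense E.
Proof.
apply: (@smallest_sub _ _ open smooth_dense); last by move=> U; exact: smooth_dense_open.
split; first by apply: smooth_dense_open; exact: open0.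
- by move=> F hF; rewrite setTD; exact: smooth_denseC.
- exact: smooth_dense_bigcup.
Qed.

Variable h : nat -> M -> R.
Hypothesis th : forall k, test (h k).
Hypothesis h01 : forall k, unit_valued (h k).
Hypothesis hcvg : forall x, h k x @[k --> \oo] --> (1 : R).

Lemma test_dense (E : set (borel M)) (e : R) : measurable E -> 0 < e ->
  exists g, [/\ test g, unit_valued g & \int[mu]_x `|\1_E x - g x| <= e].
Proof.
move=> mE e0; have e2 : 0 < e / 2 by rewrite divr_gt0.
have [_ /(_ _ e2)[g [sg g01 gE]]] := measurable_smooth_dense mE.
have sh k : S (h k) by case: (th k).
have shg k : S (fun x => h k x * g x) by exact: (smoothM at_A).
have hg01 k : unit_valued (fun x => h k x * g x) by move=> x; exact: unitM.
have H k := unit_diff_intg mE (shg k) (hg01 k).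
have : \int[mu]_x `|\1_E x - h k x * g x| @[k --> \oo] --> \int[mu]_x `|\1_E x - g x|.
  apply: (I_dominated (g := fun=> 1)) => //.
  - by move=> k; have [] := H k.
  - by have [] := unit_diff_intg mE sg g01.
  - exact: intg_cst.
  - apply: aeW => x; apply: cvg_norm; apply: cvgB; first exact: cvg_cst.
    rewrite -[X in _ --> X]mul1r; apply: cvgM; [exact: hcvg|exact: cvg_cst].
  - by move=> k x; rewrite normr_id; have [_ _] := H k; exact.
move=> /cvgrPdist_le/(_ _ e2)[N _ /(_ N (leqnn N))] HN.
exists (fun x => h N x * g x); split=> //; first exact: (testMl at_A).
rewrite (splitr e); move: HN; rewrite ler_distlC => /andP[_ h2].
by apply: le_trans h2 _; rewrite addrC lerD2l.
Qed.

(** Test functions approximate the indicator of {psi > 0}, so psi has integral 0 over that set. The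
    conclusion is one-sided because it is also applied to - psi. *)
Lemma L2_test_zero psi : L2 psi -> (forall g, test g -> \int[mu]_x (psi x * g x) = 0) ->
  {ae mu, forall x, psi x <= 0}.
Proof.
move=> L2psi H; have mpsi := L2_measurable L2psi.
pose E : set (borel M) := [set x | 0 < psi x].
have mE : measurable E.
  rewrite (_ : E = psi @^-1` `]0, +oo[%classic); last by apply/seteqP; split=> x /=; rewrite in_itv /= andbT.
  by rewrite -[X in measurable X]setTI; apply: mpsi.
have L2E : L2 (\1_E : M -> R).
  apply: (L2_bounded finmu (C := 1)); first exact: measurable_indic.
  by move=> x; rewrite indicE; case: (_ \in _); rewrite ?normr1 ?normr0.
have iE := L2_mul L2psi L2E.
have z : \int[mu]_x (psi x * \1_E x) = 0.
  pose B := \int[mu]_x (psi x ^+ 2); have B0 : 0 <= B by apply: I_ge0 => x; exact: sqr_ge0.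
  apply/eqP; rewrite -sqrf_eq0 eq_le sqr_ge0 andbT; apply/ler_addgt0Pl => e e0; rewrite addr0.
  have d0 : 0 < e / (B + 1) by rewrite divr_gt0// ltr_wpDl.
  have [g [tg g01 gE]] := test_dense mE d0.
  have sg : S g by case: tg.
  have [m1 i1 b1] := unit_diff_intg mE sg g01.
  have L2g : L2 g.
    apply: (L2_bounded finmu (C := 1)); first exact: (smooth_mfun at_A).
    by move=> x; have /andP[a b] := g01 x; rewrite ger0_norm.
  have -> : \int[mu]_x (psi x * \1_E x) = \int[mu]_x (psi x * (\1_E x - g x)).
    rewrite -[LHS]subr0 -(H _ tg) -(IB iE (L2_mul L2psi L2g)).
    by apply: eq_Rintegral => x _; rewrite mulrBr.
  (* Since |1_E - g| <= 1, its square is at most itself, and the L^1 approximation controls the L^2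
     norm. *)
  have cs := L2_CS L2psi (L2B finmu L2E L2g); apply: le_trans cs _.
  apply: (@le_trans _ _ (B * (e / (B + 1)))); last by rewrite mulrC frac_le// ltW.
  rewrite ler_wpM2l//; apply: le_trans gE; apply: I_le => //.
    exact: (L2_sq (L2B finmu L2E L2g)).
  by move=> x; rewrite -real_normK ?num_real// expr2 ler_piMr.
have := I0_ae _ _ iE z.
case=> //; first exact: intg_measurable iE.
  move=> x; rewrite indicE; case: (boolP (x \in E)); last by rewrite mulr0.
  by rewrite inE /E /= mulr1 => /ltW.
move=> N [mN N0 HN]; exists N; split=> // x px; apply: HN => /= e; apply: px.
move: e; rewrite indicE; case: (boolP (x \in E)); first by rewrite mulr1 /= => _ ->.
by rewrite notin_setE /E /= leNgt => /negP.
Qed.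

(** Only the products h_k psi are asked to be square integrable: this applies to L(u_t), which is
    smooth but not yet known to lie in L^2. *)
Lemma test_zero_ae psi : mfun psi -> (forall k, L2 (fun x => h k x * psi x)) ->
  (forall g, test g -> \int[mu]_x (g x * psi x) = 0) -> {ae mu, forall x, psi x = 0}.
Proof.
move=> mpsi L2h H.
have H1 k g : test g -> \int[mu]_x (h k x * psi x * g x) = 0.
  move=> tg; rewrite -(H (fun x => h k x * g x)); last by apply: (testMl at_A) => //; case: tg.
  by apply: eq_Rintegral => x _; rewrite mulrAC.
have h1 k := L2_test_zero (L2h k) (H1 k).
have h2 k : {ae mu, forall x, - (h k x * psi x) <= 0}.
  apply: L2_test_zero; first exact: (L2N finmu (L2h k)).
  move=> g tg; have [C _ HC] := test_bounded at_A tg.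
  have mg : mfun g by apply: (smooth_mfun at_A); case: tg.
  rewrite -[RHS]oppr0 -(H1 k g tg) -(IN (intg_Mbounded (L2_intg finmu (L2h k)) mg HC)).
  by apply: eq_Rintegral => x _; rewrite mulNr.
apply: (ae_imp2 (ae_foralln h1) (ae_foralln h2)) => x k1 k2.
have k0 k : h k x * psi x = 0.
  by apply/eqP; rewrite eq_le k1 /= -oppr_le0 k2.
have /cvgrPdist_lt/(_ _ ltr01)[N _ /(_ N (leqnn N))] := hcvg x.
have /eqP := k0 N; rewrite mulf_eq0 => /orP[/eqP ->|/eqP //].
by rewrite subr0 normr1 ltxx.
Qed.

End Density.

(** * The heat flow of a test function *)

Section Weights.
Context {R : realType} d (T : measurableType d).
Implicit Types (m : {measure set T -> \bar R}) (w f : T -> R).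
Local Notation mfun f := (measurable_fun [set: T] f).

Lemma weighted_measure m w : mfun w -> (forall x, 0 <= w x) ->
  exists m' : {measure set T -> \bar R},
    (forall B, measurable B -> m' B = \int[m]_x (w x * \1_B x)%:E)%E /\
    forall f, mfun f -> (forall x, 0 <= f x) -> (\int[m']_x (f x)%:E = \int[m]_x (w x * f x)%:E)%E.
Proof.
move=> mw w0; pose nu (B : set T) : \bar R := (\int[m]_(x in B) (w x)%:E)%E.
have nu0 : nu set0 = 0%E by rewrite /nu integral_set0.
have nu_ge0 B : (0 <= nu B)%E by apply: integral_ge0 => x _; rewrite lee_fin.
have nuS : semi_sigma_additive nu.
  move=> F mF tF mUF; rewrite /nu ge0_integral_bigcup//.
  - by apply: is_cvg_ereal_nneg_natsum => k _; apply: integral_ge0 => x _; rewrite lee_fin.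
  - by apply/measurable_EFinP; exact: measurable_funTS.
  - by move=> x _; rewrite lee_fin.
pose m' : {measure set T -> \bar R} := HB.pack nu (isMeasure.Build d T R nu nu0 nu_ge0 nuS).
have m'E B : measurable B -> m' B = (\int[m]_x (w x * \1_B x)%:E)%E.
  move=> mB; rewrite /= /nu integral_mkcond; apply: eq_integral => x _.
  by rewrite patchE indicE; case: ifPn => _; rewrite /= ?mulr1 ?mulr0.
exists m'; split=> // f mf f0.
have id_m : measurable_fun setT (id : T -> T) by exact: measurable_id.
rewrite (@change_variables _ _ _ T T m' m id (EFin \o w) id_m _ _ setT); last first.
- by move=> x /(_ Logic.I).
- by move=> x; rewrite lee_fin.
- by [].
- exact/measurable_EFinP.
- by move=> B mB _; rewrite m'E//; apply: eq_integral => x _; rewrite EFinM.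
- by move=> x; rewrite /= lee_fin.
- exact/measurable_EFinP.
by apply: eq_integral => x _; rewrite EFinM.
Qed.

(** An identity between polarized, hence signed, measures is kept with the negative parts moved
    across, so that all measures involved are nonnegative. *)
Lemma weighted_integral_eq m1 m2 m3 m4 w1 w2 w3 w4 :
  [/\ mfun w1, mfun w2, mfun w3 & mfun w4] ->
  [/\ forall x, 0 <= w1 x, forall x, 0 <= w2 x, forall x, 0 <= w3 x & forall x, 0 <= w4 x] ->
  (forall B, measurable B ->
    \int[m1]_x (w1 x * \1_B x)%:E + \int[m2]_x (w2 x * \1_B x)%:E =
    \int[m3]_x (w3 x * \1_B x)%:E + \int[m4]_x (w4 x * \1_B x)%:E)%E ->
  forall f, mfun f -> (forall x, 0 <= f x) ->
    (\int[m1]_x (w1 x * f x)%:E + \int[m2]_x (w2 x * f x)%:E =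
     \int[m3]_x (w3 x * f x)%:E + \int[m4]_x (w4 x * f x)%:E)%E.
Proof.
move=> [mw1 mw2 mw3 mw4] [w10 w20 w30 w40] H f mf f0.
have [n1 [E1 I1]] := weighted_measure m1 mw1 w10.
have [n2 [E2 I2]] := weighted_measure m2 mw2 w20.
have [n3 [E3 I3]] := weighted_measure m3 mw3 w30.
have [n4 [E4 I4]] := weighted_measure m4 mw4 w40.
have mfE : measurable_fun setT (EFin \o f) by apply/measurable_EFinP.
have f0E x : setT x -> (0 <= (EFin \o f) x)%E by rewrite /= lee_fin.
rewrite -I1// -I2// -I3// -I4//.
have := ge0_integral_measure_add n1 n2 measurableT f0E mfE.
have := ge0_integral_measure_add n3 n4 measurableT f0E mfE.
rewrite /= => <- <-; apply: eq_measure_integral => B mB _.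
rewrite [LHS](measure_addE n1 n2 B) [RHS](measure_addE n3 n4 B).
by rewrite E1// E2// E3// E4// H.
Qed.

End Weights.

(** * Bilinear calculus of a spectral resolution *)

Section Spectral.
Context {R : realType} {M : ptopologicalType}.
Variable mu : {measure set (borel M) -> \bar R}.
Hypothesis finmu : (mu setT < +oo)%E.
Implicit Types (f g h k : M -> R).
Local Notation L2 f := (L2 mu f).
Local Notation ip := (ip mu).
Local Notation RR := (measurableTypeR R).

Lemma ip_intg f g : L2 f -> L2 g -> mu.-integrable setT (EFin \o ((fun x => f x * g x) : borel M -> R)).
Proof. exact: L2_mul. Qed.

Lemma ipC f g : ip f g = ip g f.
Proof. by apply: eq_Rintegral => x _; rewrite mulrC. Qed.

Lemma ip_linl (a : R) f g h : L2 f -> L2 g -> L2 h ->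
  ip (fun x => a * f x + g x) h = a * ip f h + ip g h.
Proof.
move=> Lf Lg Lh; have i1 := ip_intg Lf Lh; have i2 := ip_intg Lg Lh.
rewrite /ip -(IZ a i1) -(ID (intgZ a i1) i2); apply: eq_Rintegral => x _; ring.
Qed.

Lemma ip_ge0 f : 0 <= ip f f.
Proof. by apply: I_ge0 => x; rewrite -expr2 sqr_ge0. Qed.

Lemma ip_ae f f' g : L2 f -> L2 f' -> L2 g -> eq_ae mu f f' -> ip f g = ip f' g.
Proof.
move=> Lf Lf' Lg h; apply: I_ae.
- exact: measurable_funM (L2_measurable Lf) (L2_measurable Lg).
- exact: measurable_funM (L2_measurable Lf') (L2_measurable Lg).
- by apply: (ae_imp h) => x ->.
Qed.

Variables (E : set R -> (M -> R) -> M -> R) (nu : (M -> R) -> {measure set RR -> \bar R}).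
Hypothesis spE : spectral_resolution mu E nu.

(** The polarized spectral measure <E(B) f, g>; [nu] is its diagonal. *)
Definition beta (B : set R) f g : R := ip (E B f) g.

Lemma L2E B f : measurable (B : set RR) -> L2 f -> L2 (E B f).
Proof. by have [h _ _ _ _] := spE; exact: h. Qed.

Lemma betaC B f g : measurable (B : set RR) -> L2 f -> L2 g -> beta B f g = beta B g f.
Proof. by have [_ _ h _ _] := spE => mB Lf Lg; rewrite /beta h// ipC. Qed.

Lemma beta_linl B (a : R) f g h : measurable (B : set RR) -> L2 f -> L2 g -> L2 h ->
  beta B (fun x => a * f x + g x) h = a * beta B f h + beta B g h.
Proof.
move=> mB Lf Lg Lh; have [_ lin _ _ _] := spE; rewrite /beta.
rewrite -ip_linl//; [|exact: L2E..].
apply: ip_ae => //; [apply: L2E => //; exact: L2_lin|apply: L2_lin => //; exact: L2E|exact: lin].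
Qed.

Lemma nuE B f : measurable (B : set RR) -> L2 f -> nu f B = (beta B f f)%:E.
Proof. by have [_ _ _ _ [h _]] := spE; exact: h. Qed.

Lemma nu_neg f : L2 f -> nu f [set lam : R | 0 < lam] = 0%E.
Proof. by have [_ _ _ _ [_ h]] := spE; exact: h. Qed.

Lemma betaT f g : L2 f -> L2 g -> beta setT f g = ip f g.
Proof.
by have [_ _ _ [_ h] _] := spE => Lf Lg; apply: ip_ae => //; [exact: L2E|exact: h].
Qed.

Lemma beta_lin2 B (a : R) f g : measurable (B : set RR) -> L2 f -> L2 g ->
  beta B (fun x => a * f x + g x) (fun x => a * f x + g x) =
  a ^+ 2 * beta B f f + 2 * a * beta B f g + beta B g g.
Proof.
move=> mB Lf Lg; have Lfg := L2_lin a Lf Lg.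
rewrite beta_linl// (betaC mB Lf Lfg) (betaC mB Lg Lfg) !beta_linl//.
rewrite (betaC mB Lg Lf); ring.
Qed.

Lemma beta_proj B C f g : measurable (B : set RR) -> measurable (C : set RR) -> L2 f -> L2 g ->
  beta C f (E B g) = beta (B `&` C) f g.
Proof.
move=> mB mC Lf Lg; have [_ _ sa [mult _] _] := spE.
rewrite /beta -sa//; last exact: L2E.
apply/esym; apply: ip_ae => //.
- by apply: L2E => //; exact: measurableI.
- by apply: L2E => //; exact: L2E.
- exact: mult.
Qed.

Lemma beta_split B C f : measurable (B : set RR) -> measurable (C : set RR) -> L2 f ->
  beta C f f = beta (C `&` B) f f + beta (C `&` ~` B) f f.
Proof.
move=> mB mC Lf; apply: EFin_inj; rewrite EFinD.
have m1 : measurable (C `&` B : set RR) by exact: measurableI.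
have m2 : measurable (C `&` ~` B : set RR) by apply: measurableI => //; exact: measurableC.
rewrite -!nuE// -measureU//; last by rewrite setIACA setICr setI0.
by rewrite -setIUr setUv setIT.
Qed.

Lemma L2D1 f g : L2 f -> L2 g -> L2 (fun x => f x + g x).
Proof. exact: L2D. Qed.

Lemma nuD B f g : measurable (B : set RR) -> L2 f -> L2 g ->
  nu (fun x => f x + g x) B = (beta B f f + 2 * beta B f g + beta B g g)%:E.
Proof.
move=> mB Lf Lg; rewrite nuE//; last exact: L2D1.
have -> : (fun x => f x + g x) = (fun x => 1 * f x + g x) by apply/funext => x; rewrite mul1r.
by rewrite beta_lin2// expr1n mul1r mulr1.
Qed.

Lemma nuB B f g : measurable (B : set RR) -> L2 f -> L2 g ->
  nu (fun x => f x - g x) B = (beta B f f - 2 * beta B f g + beta B g g)%:E.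
Proof.
move=> mB Lf Lg; rewrite nuE//; last exact: L2B.
have -> : (fun x => f x - g x) = (fun x => (-1) * g x + f x) by apply/funext => x; ring.
rewrite beta_lin2// (betaC mB Lg Lf); congr (_%:E); ring.
Qed.

Lemma nu_fin B f : measurable (B : set RR) -> L2 f -> (nu f B < +oo)%E.
Proof. by move=> mB Lf; rewrite nuE// ltry. Qed.

End Spectral.

(** * The heat semigroup as a family of bilinear forms *)

Section HeatForm.
Context {R : realType} {M : ptopologicalType} {n : nat}.
Variable A : set (chart R M n).
Hypothesis at_A : smooth_atlas A.
Hypothesis hM : hausdorff_space M.
Variable mu : {measure set (borel M) -> \bar R}.
Hypothesis finmu : (mu setT < +oo)%E.
Variable L : (M -> R) -> M -> R.
Hypothesis dL : second_order_diffusion A L.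
Hypothesis L1 : forall x, L (fun=> 1) x = 0.
Implicit Types (f g h k : M -> R).
Local Notation S := (smooth A).
Local Notation test := (test_function A).
Local Notation L2 f := (L2 mu f).
Local Notation ip := (ip mu).
Local Notation RR := (measurableTypeR R).
Local Notation mfun w := (measurable_fun [set: RR] (w : RR -> R)).

Lemma test_L2 f : test f -> L2 f.
Proof.
move=> tf; have [C _ HC] := test_bounded at_A tf.
by apply: (L2_bounded finmu _ HC); apply: (smooth_mfun at_A); case: tf.
Qed.

Variables (E : set R -> (M -> R) -> M -> R) (nu : (M -> R) -> {measure set RR -> \bar R}).
Hypothesis spE : spectral_resolution mu E nu.
Hypothesis extE : spectral_extension mu A L nu.
Variable P : R -> (M -> R) -> M -> R.
Hypothesis PE : forall (t : R) f, 0 <= t -> L2 f -> L2 (P t f) /\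
  forall g, L2 g -> ip (P t f) g = spectral_int nu (fun lam => expR (t * lam)) f g.

(** The spectrum lies in l <= 0, where [negp l] is - l and [wexp t l] is e^(t l). Off the spectrum
    [negp] stays nonnegative and [wexp t] stays in [0, 1] for t >= 0, so estimates hold on the whole
    line. *)
Definition negp (l : R) : R := - Num.min l 0.
Definition wexp (t l : R) : R := expR (- (t * negp l)).
Local Notation J h w := (\int[nu h]_l w l).
Local Notation integ h w := ((nu h).-integrable [set: RR] (EFin \o (w : RR -> R))).

Lemma negp_ge0 l : 0 <= negp l.
Proof. by rewrite /negp oppr_ge0 ge_min lexx orbT. Qed.

Lemma negpE l : l <= 0 -> negp l = - l.
Proof. by rewrite /negp => /min_idPl ->. Qed.

Lemma m_negp : mfun negp.
Proof.
apply: (measurableT_comp (@oppr_measurable R setT)).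
by apply: measurable_minr => //; exact: measurable_id.
Qed.

Lemma m_wexp t : mfun (wexp t).
Proof.
apply: (measurableT_comp (@measurable_expR R)); apply: (measurableT_comp (@oppr_measurable R setT)).
by apply: measurable_funM => //; exact: m_negp.
Qed.

Lemma wexp_ge0 t l : 0 <= wexp t l. Proof. exact: expR_ge0. Qed.

Lemma wexp_le1 t l : 0 <= t -> wexp t l <= 1.
Proof. by move=> t0; rewrite /wexp expR_le1 oppr_le0 mulr_ge0// negp_ge0. Qed.

(** With a = - (t - s) p the error is (e^a - 1 - a) e^(-s p). For a <= 0 use e^a <= 1 / (1 - a). For
    a > 0, that is t < s, the growth of e^a is compensated by e^(-s p) <= e^(-a), which is where t
    >= 0 enters. *)
Lemma wexp_taylor (s t l : R) : 0 <= s -> 0 <= t ->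
  `|wexp t l - wexp s l + (t - s) * (negp l * wexp s l)| <= (t - s) ^+ 2 * negp l ^+ 2.
Proof.
move=> s0 t0; rewrite /wexp; set p := negp l; have p0 : 0 <= p by exact: negp_ge0.
pose a := - ((t - s) * p); have -> : - (t * p) = a + - (s * p) by rewrite /a; ring.
rewrite expRD; set e := expR (- (s * p)).
rewrite (_ : _ + _ = (expR a - 1 - a) * e); last by rewrite /a; ring.
rewrite -exprMn (_ : ((t - s) * p) ^+ 2 = a ^+ 2); last by rewrite /a sqrrN.
have e0 : 0 <= e by exact: expR_ge0.
have h1 : 0 <= expR a - 1 - a by have := expR_ge1Dx a; lra.
rewrite ger0_norm ?mulr_ge0//.
have [a0|a0] := leP a 0.
  have e1 : e <= 1 by rewrite expR_le1 oppr_le0 mulr_ge0.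
  apply: le_trans (ler_piMr h1 e1) _.
  have b0 : 0 < 1 - a by lra.
  have : expR a <= (1 - a)^-1.
    rewrite -[a]opprK expRN opprK lef_pV2 ?posrE ?expR_gt0//.
    exact: expR_ge1Dx.
  move=> h; have h2 : expR a * (1 - a) <= 1 by rewrite -ler_pdivlMr// mul1r.
  have h3 : 0 <= expR a by exact: expR_ge0.
  nra.
have ea : e <= expR (- a).
  by rewrite /e ler_expR lerN2 /a -subr_ge0 (_ : _ - _ = t * p) ?mulr_ge0//; ring.
apply: le_trans (ler_wpM2l h1 ea) _.
have h2 := expR_ge1Dx (- a).
have h3 : expR a * expR (- a) = 1 by rewrite -expRD subrr expR0.
move: h3 h2; move: (expR a) (expR (- a)) => x y h3 h2; nra.
Qed.

Lemma nu_ae_neg h : L2 h -> {ae nu h, forall l, l <= 0}.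
Proof.
move=> Lh; exists [set l : R | 0 < l]; split.
- rewrite (_ : [set l : R | 0 < l] = `]0, +oo[%classic); first exact: measurable_itv.
  by apply/seteqP; split=> x /=; rewrite in_itv /= andbT.
- exact: (nu_neg spE).
- by move=> l /= /negP; rewrite -ltNge.
Qed.

Lemma nu_finite h : L2 h -> (nu h setT < +oo)%E.
Proof. by move=> Lh; apply: (nu_fin spE). Qed.

Lemma J_ext h (w w' : R -> R) : mfun w -> mfun w' -> L2 h -> (forall l, l <= 0 -> w l = w' l) ->
  J h w = J h w'.
Proof. by move=> mw mw' Lh ww; apply: I_ae => //; apply: (ae_imp (nu_ae_neg Lh)). Qed.

Lemma m_exp t : mfun (fun l => expR (t * l)).
Proof.
apply: (measurableT_comp (@measurable_expR R)).
by apply: measurable_funM => //; exact: measurable_id.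
Qed.

Lemma spectral_exp t f g : L2 f -> L2 g ->
  spectral_int nu (fun l => expR (t * l)) f g =
  4^-1 * (J (fun x => f x + g x) (wexp t) - J (fun x => f x - g x) (wexp t)).
Proof.
have e h : L2 h -> J h (fun l => expR (t * l)) = J h (wexp t).
  move=> Lh; apply: J_ext; [exact: m_exp|exact: m_wexp|exact: Lh|].
  by move=> l l0; rewrite /wexp negpE// mulrN opprK.
by move=> Lf Lg; rewrite /spectral_int (e _ (L2D Lf Lg)) (e _ (L2B finmu Lf Lg)).
Qed.

Lemma nuBC f g B : measurable (B : set RR) -> L2 f -> L2 g ->
  nu (fun x => f x - g x) B = nu (fun x => g x - f x) B.
Proof.
move=> mB Lf Lg; rewrite !(nuB finmu spE)// (betaC spE mB Lf Lg); congr (_%:E); ring.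
Qed.

Lemma J_subC f g w : L2 f -> L2 g -> J (fun x => f x - g x) w = J (fun x => g x - f x) w.
Proof.
by move=> Lf Lg; rewrite /Rintegral; congr fine; apply: eq_measure_integral => B mB _; exact: nuBC.
Qed.

Lemma J_addC f g w : J (fun x => f x + g x) w = J (fun x => g x + f x) w.
Proof. by rewrite (_ : (fun x => f x + g x) = (fun x => g x + f x))//; apply/funext => x; rewrite addrC. Qed.

Lemma heat_L2 t f : 0 <= t -> L2 f -> L2 (P t f).
Proof. by move=> t0 Lf; have [] := PE t0 Lf. Qed.

Lemma heat_form t f g : 0 <= t -> L2 f -> L2 g ->
  ip (P t f) g = 4^-1 * (J (fun x => f x + g x) (wexp t) - J (fun x => f x - g x) (wexp t)).
Proof. by move=> t0 Lf Lg; have [_ ->//] := PE t0 Lf; rewrite spectral_exp. Qed.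

Lemma heat_sym t f g : 0 <= t -> L2 f -> L2 g -> ip (P t f) g = ip (P t g) f.
Proof. by move=> t0 Lf Lg; rewrite !heat_form// J_addC (J_subC _ Lf Lg). Qed.

Lemma wexp_bound t l : 0 <= t -> `|wexp t l| <= 1.
Proof. by move=> t0; rewrite ger0_norm ?wexp_ge0// wexp_le1. Qed.

Lemma integ_wexp t h : 0 <= t -> L2 h -> integ h (wexp t).
Proof.
move=> t0 Lh; apply: (intg_bounded (nu_finite Lh) (m_wexp t) (C := 1)) => l.
exact: wexp_bound.
Qed.

Lemma J_wexp_le t h : 0 <= t -> L2 h -> 0 <= J h (wexp t) <= fine (nu h setT).
Proof.
move=> t0 Lh; apply/andP; split; first by apply: I_ge0 => l; exact: wexp_ge0.
rewrite -[leRHS]mul1r -I_cst; apply: I_le; first exact: integ_wexp.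
  exact: (intg_cst (nu_finite Lh)).
by move=> l; exact: wexp_le1.
Qed.

Lemma heat_diag t f : 0 <= t -> L2 f -> 0 <= ip (P t f) f <= ip f f.
Proof.
move=> t0 Lf; rewrite heat_form//.
have /andP[h1 h2] := J_wexp_le t0 (L2D Lf Lf).
have /andP[h3 h4] := J_wexp_le t0 (L2B finmu Lf Lf).
have e1 : fine (nu (fun x => f x + f x) setT) = 4 * ip f f.
  by rewrite (nuD spE)//= (betaT spE)//; ring.
have e2 : fine (nu (fun x => f x - f x) setT) = 0.
  by rewrite (nuB finmu spE)//=; ring.
move: h2 h4; rewrite e1 e2 => h2 h4.
move: h1 h2 h3 h4; move: (J _ _) (J _ _) (ip _ _) => a b c h1 h2 h3 h4.
by apply/andP; split; lra.
Qed.

Lemma heat_lin t (a : R) f g h : 0 <= t -> L2 f -> L2 g -> L2 h ->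
  ip (P t (fun x => a * f x + g x)) h = a * ip (P t f) h + ip (P t g) h.
Proof.
move=> t0 Lf Lg Lh; have Lfg := L2_lin a Lf Lg.
rewrite heat_sym// [in RHS](heat_sym t0 Lf Lh) [in RHS](heat_sym t0 Lg Lh).
have LP := heat_L2 t0 Lh.
by rewrite ipC (ip_linl a Lf Lg LP) !(ipC _ (P t h)).
Qed.

(** Cauchy-Schwarz for the nonnegative symmetric form <P_t f, g>, whose diagonal is bounded by
    [heat_diag]. *)
Lemma heat_contraction t f g : 0 <= t -> L2 f -> L2 g -> ip (P t f) g ^+ 2 <= ip f f * ip g g.
Proof.
move=> t0 Lf Lg; have /andP[f1 f2] := heat_diag t0 Lf; have /andP[g1 g2] := heat_diag t0 Lg.
apply: le_trans (_ : ip (P t f) f * ip (P t g) g <= _); last exact: ler_pM.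
apply: discriminant_le => // s.
have Lfg := L2_lin s Lg Lf; have /andP[h _] := heat_diag t0 Lfg.
apply: le_trans h _; rewrite heat_lin//.
have e k : L2 k -> ip (P t k) (fun x => s * g x + f x) = s * ip (P t k) g + ip (P t k) f.
  by move=> Lk; rewrite ipC (ip_linl s Lg Lf (heat_L2 t0 Lk)) !(ipC _ (P t k)).
rewrite !e// (heat_sym t0 Lg Lf).
move: (ip (P t g) g) (ip (P t f) g) (ip (P t f) f) => a b c; rewrite le_eqVlt; apply/orP; left; apply/eqP; ring.
Qed.

Lemma heat0 f g : L2 f -> L2 g -> ip (P 0 f) g = ip f g.
Proof.
move=> Lf Lg; rewrite heat_form//.
have w1 : wexp 0 = fun=> 1 by apply/funext => l; rewrite /wexp mul0r oppr0 expR0.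
rewrite w1 !I_cst !mul1r (nuD spE)//= (nuB finmu spE)//= !(betaT spE)//.
by move: (ip _ _) (ip _ _) (ip _ _) => a b c; lra.
Qed.

Lemma test_domain f : test f -> spectral_domain mu nu f.
Proof. by move=> /extE[]. Qed.

Lemma Jfin h (w : R -> R) : integ h w -> (\int[nu h]_l (w l)%:E = (J h w)%:E)%E.
Proof. by move=> iw; rewrite /Rintegral fineK//; exact: integrable_fin_num. Qed.

Lemma J_weighted h1 h2 h3 h4 w1 w2 w3 w4 :
  [/\ mfun w1, mfun w2, mfun w3 & mfun w4] ->
  [/\ forall x, 0 <= w1 x, forall x, 0 <= w2 x, forall x, 0 <= w3 x & forall x, 0 <= w4 x] ->
  [/\ integ h1 w1, integ h2 w2, integ h3 w3 & integ h4 w4] ->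
  (forall B : set RR, measurable B ->
    J h1 (fun l => w1 l * \1_B l) + J h2 (fun l => w2 l * \1_B l) =
    J h3 (fun l => w3 l * \1_B l) + J h4 (fun l => w4 l * \1_B l)) ->
  forall (f : R -> R) (C : R), mfun f -> (forall l, 0 <= f l <= C) ->
    J h1 (fun l => w1 l * f l) + J h2 (fun l => w2 l * f l) =
    J h3 (fun l => w3 l * f l) + J h4 (fun l => w4 l * f l).
Proof.
move=> mw w0 [i1 i2 i3 i4] H f C mf f0C.
have f0 l : 0 <= f l by have /andP[] := f0C l.
have fC l : `|f l| <= C by rewrite ger0_norm//; have /andP[] := f0C l.
have b1 (B : set RR) l : `|\1_B l : R| <= 1 by rewrite indicE; case: (_ \in _); rewrite /= ?normr1 ?normr0.
have mB (B : set RR) : measurable B -> mfun (\1_B : RR -> R) by move=> ?; exact: measurable_indic.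
apply: EFin_inj; rewrite !EFinD.
rewrite -(Jfin (intg_Mbounded i1 mf fC)) -(Jfin (intg_Mbounded i2 mf fC)).
rewrite -(Jfin (intg_Mbounded i3 mf fC)) -(Jfin (intg_Mbounded i4 mf fC)).
apply: (weighted_integral_eq mw w0) => // B mB'.
rewrite (Jfin (intg_Mbounded i1 (mB _ mB') (b1 B))) (Jfin (intg_Mbounded i2 (mB _ mB') (b1 B))).
rewrite (Jfin (intg_Mbounded i3 (mB _ mB') (b1 B))) (Jfin (intg_Mbounded i4 (mB _ mB') (b1 B))).
by rewrite -!EFinD H.
Qed.

Lemma J_indic h (B : set RR) : measurable B -> L2 h -> J h (fun l => 1 * \1_B l) = beta mu E B h h.
Proof.
move=> mB Lh; rewrite (_ : (fun l => 1 * \1_B l) = \1_B); last by apply/funext => l; rewrite mul1r.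
by rewrite /Rintegral integral_indic// setIT (nuE spE).
Qed.

Lemma integ_cst h (a : R) : L2 h -> integ h (fun=> a).
Proof. by move=> Lh; exact: (intg_cst (nu_finite Lh)). Qed.

Lemma m_sq : mfun (fun l => l ^+ 2).
Proof. by apply: measurable_funX; exact: measurable_id. Qed.

Lemma domain_sq h : spectral_domain mu nu h -> integ h (fun l => l ^+ 2).
Proof.
move=> [Lh fin]; apply/integrableP; split; first by apply/measurable_EFinP; exact: m_sq.
apply: le_lt_trans fin; rewrite le_eqVlt; apply/orP; left; apply/eqP; apply: eq_integral => l _.
by rewrite /= ger0_norm// sqr_ge0.
Qed.

Lemma negp_sq l : negp l ^+ 2 <= l ^+ 2.
Proof. by rewrite /negp sqrrN; case: (leP l 0) => h //; rewrite expr0n sqr_ge0. Qed.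

Lemma domain_negp_sq h : spectral_domain mu nu h -> integ h (fun l => negp l ^+ 2).
Proof.
move=> dh; apply: (intg_le _ (domain_sq dh)); first by apply: measurable_funX; exact: m_negp.
by move=> l; rewrite ger0_norm ?sqr_ge0// negp_sq.
Qed.

Lemma domain_negp h : spectral_domain mu nu h -> integ h negp.
Proof.
move=> dh; have [Lh _] := dh.
apply: (intg_le m_negp (intgD (domain_negp_sq dh) (integ_cst 1 Lh))) => l.
have := negp_ge0 l; move: (negp l) => a a0; rewrite ger0_norm//; nra.
Qed.

Lemma integ_id h : L2 h -> integ h negp -> J h id = - J h negp.
Proof.
move=> Lh ih; rewrite -(IN ih).
apply: J_ext => //; first by apply: (measurableT_comp (@oppr_measurable R setT)); exact: m_negp.
by move=> l l0; rewrite negpE// opprK.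
Qed.

(** * Restriction by a spectral projection *)

Section Cut.
Variables (B : set RR) (f g : M -> R).
Hypothesis mB : measurable B.
Hypotheses (Lf : L2 f) (Lg : L2 g).

Lemma L2EB : L2 (E B g). Proof. exact: (L2E spE). Qed.

(** Replacing g by E(B) g restricts the spectral measures to B. Inserted in the identity <L f, g> =
    int l d<E f, g>, this localizes it to every Borel set B. *)
Lemma beta_cut (C : set RR) : measurable C ->
  beta mu E C (E B g) (E B g) = beta mu E (B `&` C) g g /\ beta mu E C f (E B g) = beta mu E (B `&` C) f g.
Proof.
move=> mC; have mBC : measurable (B `&` C) by exact: measurableI.
split; last exact: (beta_proj spE).
rewrite (beta_proj spE mB mC L2EB Lg) (betaC spE mBC L2EB Lg) (beta_proj spE mB mBC Lg Lg).
by rewrite setIA setIid.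
Qed.

Lemma nu_cut (C : set RR) : measurable C -> nu (E B g) C = nu g (B `&` C).
Proof.
move=> mC; rewrite !(nuE spE)//; [|exact: measurableI|exact: L2EB].
by have [-> _] := beta_cut mC.
Qed.

Lemma indic01 (l : R) : 0 <= (\1_B l : R). Proof. by rewrite indicE; case: (_ \in _). Qed.

Lemma split_integral (m1 m3 m4 : {measure set RR -> \bar R}) (w : R -> R) :
  (forall C : set RR, measurable C -> m1 C = m3 (C `&` ~` B) + m4 (C `&` B))%E ->
  mfun w -> (forall l, 0 <= w l) ->
  (\int[m1]_l (w l)%:E = \int[m3]_l (\1_(~` B) l * w l)%:E + \int[m4]_l (\1_B l * w l)%:E)%E.
Proof.
move=> H mw w0.
have m0 : mfun (fun=> 0) by exact: measurable_cst.
have m11 : mfun (fun=> 1) by exact: measurable_cst.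
have mi : mfun (\1_B : RR -> R) by exact: measurable_indic.
have mic : mfun (\1_(~` B) : RR -> R) by apply: measurable_indic; exact: measurableC.
have icge (l : R) : 0 <= (\1_(~` B) l : R) by rewrite indicE; case: (_ \in _).
have W : (\int[m1]_x (1 * w x)%:E + \int[m1]_x (0 * w x)%:E =
     \int[m3]_x (\1_(~` B) x * w x)%:E + \int[m4]_x (\1_B x * w x)%:E)%E.
  have W0 : [/\ forall x : R, 0 <= (1 : R), forall x : R, 0 <= (0 : R), forall x, 0 <= (\1_(~` B) x : R) & forall x, 0 <= (\1_B x : R)].
    by split=> // l; exact: indic01.
  apply: (weighted_integral_eq (And4 m11 m0 mic mi) W0 _ mw w0) => C mC.
  have eI (m : {measure set RR -> \bar R}) (D : set RR) : measurable D ->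
      (\int[m]_x (\1_D x * \1_C x)%:E = m (C `&` D))%E.
    move=> mD; have mCD : measurable (C `&` D) by exact: measurableI.
    have := integral_indic m measurableT mCD; rewrite setIT => <-.
    by apply: eq_integral => l _; rewrite indicI mulrC.
  rewrite (eI _ _ mB) (eI _ _ (measurableC mB)).
  have -> : (\int[m1]_x (0 * \1_C x)%:E = 0)%E by apply: integral0_eq => l _; rewrite mul0r.
  rewrite adde0 -H// -(setIT C) -(eI m1 setT)//; apply: eq_integral => l _.
  by rewrite indicT setIT.
move: W; rewrite (_ : \int[m1]_x (0 * w x)%:E = 0)%E; last by apply: integral0_eq => l _; rewrite mul0r.
by rewrite adde0 => <-; apply: eq_integral => l _; rewrite mul1r.
Qed.

Lemma cut_domain : spectral_domain mu nu g -> spectral_domain mu nu (E B g).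
Proof.
move=> dg; split; first exact: L2EB.
have [_ fin] := dg; apply: le_lt_trans fin.
have z0 (C : set RR) : measurable C ->
    (nu (E B g) C = (mzero : {measure set RR -> \bar R}) (C `&` ~` B) + nu g (C `&` B))%E.
  by move=> mC; rewrite nu_cut// setIC add0e.
rewrite (split_integral z0 m_sq (fun l => sqr_ge0 l)) integral_measure_zero add0e.
apply: ge0_le_integral => //.
- by move=> l _; rewrite lee_fin mulr_ge0 ?sqr_ge0// indic01.
- apply/measurable_EFinP; apply: measurable_funM; last exact: m_sq.
  exact: measurable_indic.
- by apply/measurable_EFinP; exact: m_sq.
- by move=> l _; rewrite lee_fin ler_piMl ?sqr_ge0// indicE; case: (_ \in _).
Qed.

Lemma integ_indic h (D : set RR) w : measurable D -> integ h w -> integ h (fun l => \1_D l * w l).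
Proof.
move=> mD iw; have mi : mfun (\1_D : RR -> R) by exact: measurable_indic.
have b (l : R) : `|\1_D l : R| <= 1 by rewrite indicE; case: (_ \in _); rewrite /= ?normr1 ?normr0.
by apply: (intg_ext _ (intg_Mbounded iw mi b)) => l; rewrite mulrC.
Qed.

Lemma J_split h1 h3 h4 :
  (forall C : set RR, measurable C -> nu h1 C = nu h3 (C `&` ~` B) + nu h4 (C `&` B))%E ->
  integ h3 negp -> integ h4 negp ->
  integ h1 negp /\ J h1 negp = J h3 (fun l => \1_(~` B) l * negp l) + J h4 (fun l => \1_B l * negp l).
Proof.
move=> H i3 i4; have := split_integral H m_negp negp_ge0.
rewrite (Jfin (integ_indic (measurableC mB) i3)) (Jfin (integ_indic mB i4)) -EFinD => e.
split; last by rewrite {1}/Rintegral e.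
apply/integrableP; split; first by apply/measurable_EFinP; exact: m_negp.
rewrite (_ : (\int[nu h1]_x `|(EFin \o negp) x| = \int[nu h1]_x (negp x)%:E)%E); first by rewrite e ltry.
by apply: eq_integral => l _; rewrite /= ger0_norm// negp_ge0.
Qed.

(** The spectral measure of f + E(B) g, or of f - E(B) g, is that of f off B and that of f + g, or
    of f - g, on B. The part off B cancels in the polarized difference. *)
Lemma cut_form : spectral_domain mu nu f -> spectral_domain mu nu (fun x => f x + g x) ->
  spectral_domain mu nu (fun x => f x - g x) ->
  [/\ integ (fun x => f x + E B g x) negp, integ (fun x => f x - E B g x) negp &
  J (fun x => f x + E B g x) negp - J (fun x => f x - E B g x) negp =
  J (fun x => f x + g x) (fun l => \1_B l * negp l) - J (fun x => f x - g x) (fun l => \1_B l * negp l)].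
Proof.
move=> df dD dB.
have cap (C : set RR) : measurable C -> [/\ measurable (C `&` B : set RR), measurable (C `&` ~` B : set RR) & beta mu E C f f = beta mu E (C `&` B) f f + beta mu E (C `&` ~` B) f f].
  move=> mC; split; [exact: measurableI|by apply: measurableI => //; exact: measurableC|].
  exact: (beta_split spE).
have [ip ep] : integ (fun x => f x + E B g x) negp /\ J (fun x => f x + E B g x) negp = J f (fun l => \1_(~` B) l * negp l) + J (fun x => f x + g x) (fun l => \1_B l * negp l).
  apply: J_split.
  - move=> C mC; have [m1 m2 e] := cap C mC; have [b1 b2] := beta_cut mC.
    rewrite (nuD spE mC Lf L2EB) (nuD spE m1 Lf Lg) (nuE spE m2 Lf) b1 b2 e (setIC B) -EFinD.
  congr (_%:E); ring.
  - exact: domain_negp.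
  - exact: domain_negp.
have [im em] : integ (fun x => f x - E B g x) negp /\ J (fun x => f x - E B g x) negp = J f (fun l => \1_(~` B) l * negp l) + J (fun x => f x - g x) (fun l => \1_B l * negp l).
  apply: J_split.
  - move=> C mC; have [m1 m2 e] := cap C mC; have [b1 b2] := beta_cut mC.
    rewrite (nuB finmu spE mC Lf L2EB) (nuB finmu spE m1 Lf Lg) (nuE spE m2 Lf) b1 b2 e (setIC B) -EFinD.
  congr (_%:E); ring.
  - exact: domain_negp.
  - exact: domain_negp.
by split=> //; rewrite ep em opprD addrACA subrr add0r.
Qed.

End Cut.

(** Spectrally, P_t L is the integral of l e^(t l). The extension property says this without the
    exponential; it is refined to an equality of measures and then integrated against [wexp t]. *)
Lemma generator_form t f g : 0 <= t -> test f -> test g ->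
  ip (P t (L f)) g = - (4^-1 * (J (fun x => f x + g x) (fun l => negp l * wexp t l) -
                               J (fun x => f x - g x) (fun l => negp l * wexp t l))).
Proof.
move=> t0 tf tg; have Lf := test_L2 tf; have Lg := test_L2 tg.
have tLf : test (L f) by exact: (test_L at_A).
have LLf := test_L2 tLf.
have df := test_domain tf; have dg := test_domain tg.
have dD := test_domain (testD at_A tf tg); have dB := test_domain (testB at_A tf tg).
rewrite heat_form//.
have m11 : mfun (fun=> 1) by exact: measurable_cst.
(* Equality of the measures <E(B) L f, g> and - int_B [negp] d<E f, g>, polarized and sorted by
   sign. It is the extension property applied to f and E(B) g. *)
have H (B : set RR) : measurable B ->
  J (fun x => L f x + g x) (fun l => 1 * \1_B l) + J (fun x => f x + g x) (fun l => negp l * \1_B l) =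
  J (fun x => L f x - g x) (fun l => 1 * \1_B l) + J (fun x => f x - g x) (fun l => negp l * \1_B l).
  move=> mB; rewrite (J_indic mB (L2D LLf Lg)) (J_indic mB (L2B finmu LLf Lg)).
  have nP : beta mu E B (fun x => L f x + g x) (fun x => L f x + g x) =
     beta mu E B (L f) (L f) + 2 * beta mu E B (L f) g + beta mu E B g g.
    apply: EFin_inj; rewrite -(nuE spE mB (L2D LLf Lg)); exact: (nuD spE mB LLf Lg).
  have nM : beta mu E B (fun x => L f x - g x) (fun x => L f x - g x) =
     beta mu E B (L f) (L f) - 2 * beta mu E B (L f) g + beta mu E B g g.
    apply: EFin_inj; rewrite -(nuE spE mB (L2B finmu LLf Lg)); exact: (nuB finmu spE mB LLf Lg).
  rewrite nP nM.
  have dEg := cut_domain mB Lf Lg dg.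
  have e1 : beta mu E B (L f) g = spectral_int nu id f (E B g).
    have [_ /(_ _ dEg) <-] := extE tf.
    by rewrite /beta; have [_ _ sa _ _] := spE; exact: sa.
  have LEg := L2EB mB Lg.
  have [ip im cut] := cut_form mB Lf Lg df dD dB.
  have e2 : 4 * spectral_int nu id f (E B g) =
     - (J (fun x => f x + E B g x) negp - J (fun x => f x - E B g x) negp).
    by rewrite /spectral_int (integ_id (L2D Lf LEg) ip) (integ_id (L2B finmu Lf LEg) im); field.
  move: e2; rewrite cut -e1.
  have mc h : J h (fun l => negp l * \1_B l) = J h (fun l => \1_B l * negp l).
    by apply: eq_Rintegral => l _; rewrite mulrC.
  rewrite !mc; move: (Rintegral _ _ _) (Rintegral _ _ _) (beta _ _ _ (L f) g) => a b c e2; lra.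
have w01 l : 0 <= wexp t l <= 1 by rewrite wexp_ge0 wexp_le1.
have := @J_weighted _ _ _ _ (fun=> 1) negp (fun=> 1) negp (And4 m11 m_negp m11 m_negp)
  (And4 (fun=> ler01) negp_ge0 (fun=> ler01) negp_ge0)
  (And4 (integ_cst 1 (L2D LLf Lg)) (domain_negp dD) (integ_cst 1 (L2B finmu LLf Lg)) (domain_negp dB))
  H (wexp t) 1 (m_wexp t) w01.
have m1 h : J h (fun l => 1 * wexp t l) = J h (wexp t) by apply: eq_Rintegral => l _; rewrite mul1r.
rewrite !m1; move: (Rintegral _ _ _) (Rintegral _ _ _) (Rintegral _ _ _) (Rintegral _ _ _) => a b c e h.
have -> : e = b + a - c by rewrite -h addrK.
ring.
Qed.

Lemma heat_generator t f g : 0 <= t -> test f -> test g -> ip (P t (L f)) g = ip (P t f) (L g).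
Proof.
move=> t0 tf tg; have Lf := test_L2 tf; have Lg := test_L2 tg.
have tLg : test (L g) by exact: (test_L at_A).
rewrite (heat_sym t0 Lf (test_L2 tLg)) !generator_form//.
by rewrite J_addC (J_subC _ Lf Lg).
Qed.

(** [wexp_taylor] integrated against the spectral measures of f + g and f - g. Both functions lie in
    the spectral domain, so the second moments making up C are finite. *)
Lemma heat_derivative f g : test f -> test g -> exists2 C : R, 0 <= C & forall s t : R, 0 <= s -> 0 <= t ->
  `|ip (P t f) g - ip (P s f) g - (t - s) * ip (P s (L f)) g| <= C * (t - s) ^+ 2.
Proof.
move=> tf tg; have Lf := test_L2 tf; have Lg := test_L2 tg.
have dD := test_domain (testD at_A tf tg); have dB := test_domain (testB at_A tf tg).
have [LD _] := dD; have [LB _] := dB.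
set fD := (fun x => f x + g x) in dD LD *; set fB := (fun x => f x - g x) in dB LB *.
exists (4^-1 * (J fD (fun l => negp l ^+ 2) + J fB (fun l => negp l ^+ 2))).
  by rewrite mulr_ge0// addr_ge0//; apply: I_ge0 => l; exact: sqr_ge0.
move=> s t s0 t0; rewrite generator_form// (heat_form s0 Lf Lg) (heat_form t0 Lf Lg) -/fD -/fB.
have key h : spectral_domain mu nu h -> `|J h (wexp t) - J h (wexp s) + (t - s) * J h (fun l => negp l * wexp s l)|
    <= (t - s) ^+ 2 * J h (fun l => negp l ^+ 2).
  move=> dh; have [Lh _] := dh.
  have i1 := integ_wexp t0 Lh; have i2 := integ_wexp s0 Lh.
  have i3 : integ h (fun l => negp l * wexp s l).
    by apply: (intg_Mbounded (domain_negp dh) (m_wexp s) (C := 1)) => l; exact: wexp_bound.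
  have i4 := domain_negp_sq dh.
  rewrite -(IZ (t - s) i3) -(IB i1 i2) -(ID (intgB i1 i2) (intgZ (t - s) i3)) -(IZ ((t - s) ^+ 2) i4).
  have i5 := intgD (intgB i1 i2) (intgZ (t - s) i3).
  apply: le_trans (I_abs i5) _; apply: I_le; [exact: intg_norm|exact: intgZ|].
  by move=> l; exact: wexp_taylor.
have kD := key _ dD; have kB := key _ dB.
move: kD kB; move: (J fD (wexp t)) (J fD (wexp s)) (J fD (fun l => negp l * _)) (J fD (fun l => negp l ^+ 2)) => a b c e.
move: (J fB (wexp t)) (J fB (wexp s)) (J fB (fun l => negp l * _)) (J fB (fun l => negp l ^+ 2)) => a' b' c' e'.
rewrite !ler_norml => /andP[x1 x2] /andP[y1 y2]; apply/andP; split; lra.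
Qed.

End HeatForm.

(** * Cutoff functions from (H.1) *)

Section Cutoffs.
Context {R : realType} {M : ptopologicalType} {n : nat}.
Variable A : set (chart R M n).
Hypothesis at_A : smooth_atlas A.
Hypothesis hM : hausdorff_space M.
Implicit Types (f g h u v : M -> R) (K V U : set M) (x : M).
Local Notation S := (smooth A).
Local Notation test := (test_function A).

Lemma supnorm_ge f x : ((`|f x|)%:E <= supnorm f)%E.
Proof. by apply: ereal_sup_ubound; exists x. Qed.

Lemma supnorm_ge0 f : (0 <= supnorm f)%E.
Proof. by apply: le_trans (supnorm_ge f point); rewrite lee_fin. Qed.

Lemma supnorm_sum_le f g (C : R) x : (supnorm f + supnorm g <= C%:E)%E -> `|f x| <= C /\ `|g x| <= C.
Proof.
move=> h; have f0 := supnorm_ge0 f; have g0 := supnorm_ge0 g; split; rewrite -lee_fin.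
  by apply: le_trans h; apply: le_trans (supnorm_ge f x) _; rewrite leeDl.
by apply: le_trans h; apply: le_trans (supnorm_ge g x) _; rewrite leeDr.
Qed.

(** The form in which (H.1) is used: values in [0, 1] and a single null sequence of reals bounding
    both Gamma and Gamma^Z. *)
Definition cutoff_sequence (G GZ : (M -> R) -> (M -> R) -> M -> R) (h : nat -> M -> R) (eps : nat -> R) :=
  [/\ forall k, test (h k), forall k x, 0 <= h k x <= 1, (forall x, h k x @[k --> \oo] --> (1 : R)),
   forall k x, G (h k) (h k) x <= eps k /\ GZ (h k) (h k) x <= eps k & eps k @[k --> \oo] --> (0 : R)].

Lemma monotone_limit_le1 (h : nat -> M -> R) : (forall k x, h k x <= h k.+1 x) ->
  (forall x, h k x @[k --> \oo] --> (1 : R)) -> forall k x, h k x <= 1.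
Proof.
move=> inc cv k x; have cvx := cv x; rewrite -(cvg_lim _ cvx)//.
apply: (@nondecreasing_cvgn_le R (fun k => h k x)); last by apply/cvg_ex; exists 1.
by apply/nondecreasing_seqP => j; exact: inc.
Qed.

Lemma monotone_homo (h : nat -> M -> R) : (forall k x, h k x <= h k.+1 x) ->
  forall j k x, (j <= k)%N -> h j x <= h k x.
Proof.
by move=> inc j k x; move: j k; apply/nondecreasing_seqP => j; exact: inc.
Qed.

(* Dini's theorem on the support of the first function. *)
Lemma monotone_eventually_ge0 (h : nat -> M -> R) : (forall k, test (h k)) ->
  (forall k x, h k x <= h k.+1 x) ->
  (forall x, h k x @[k --> \oo] --> (1 : R)) -> exists N, forall k x, (N <= k)%N -> 0 <= h k x.
Proof.
move=> th inc cv; have mono := monotone_homo inc.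
pose P (X : set M) := exists N, forall k x, (N <= k)%N -> X x -> 0 <= h k x.
have [N HN] : P (supp (h 0%N)).
  apply: (@compact_ind _ P); last by case: (th 0%N).
  - by exists 0%N.
  - move=> X Y [N1 H1] [N2 H2]; exists (maxn N1 N2) => k x; rewrite geq_max => /andP[k1 k2].
    by case=> [/(H1 _ _ k1)|/(H2 _ _ k2)].
  - by move=> X Y XY [N H]; exists N => k x Nk /XY; exact: H.
  - move=> x _; have /cvgrPdist_lt/(_ _ ltr01)[N _ /(_ N (leqnn N))] := cv x.
    rewrite ltr_norml => /andP[_ hN]; have hN0 : 0 < h N x by move: hN; rewrite ltrBlDr ltrDl.
    exists [set y | 0 < h N y]; split=> //.
      rewrite (_ : [set y | _] = h N @^-1` [set r | 0 < r])//; apply: open_comp; last exact: open_gt.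
      by move=> y _; apply: (smooth_continuous at_A); case: (th N).
    exists N => k y Nk; rewrite /= => y0; apply: ltW; apply: lt_le_trans y0 _; exact: mono.
exists N => k x Nk; have [sx|/supp_out h0] := pselect (supp (h 0%N) x); first exact: HN.
by rewrite -h0; exact: mono.
Qed.

Lemma cutoff_sequence_exists L GZ : vertical_form A (Gamma L) -> vertical_form A GZ -> H1 A L GZ ->
  exists (h : nat -> M -> R) (eps : nat -> R), cutoff_sequence (Gamma L) GZ h eps.
Proof.
move=> vG vZ [h [th inc cv sn]].
have [N0 HN0] := monotone_eventually_ge0 th inc cv.
have [[N1 _ HN1] cfin] := (fine_cvgP _ _).1 sn.
(* Beyond [N0] the functions are nonnegative; beyond [N1] the sup norms are finite, so that [fine]
   does not alter them. *)
pose N := maxn N0 N1.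
exists (fun k => h (N + k)%N), (fun k => fine (supnorm (Gamma L (h (N + k)%N) (h (N + k)%N)) +
   supnorm (GZ (h (N + k)%N) (h (N + k)%N)))%E); split.
- by move=> k; exact: th.
- move=> k x; rewrite HN0 ?(monotone_limit_le1 inc cv)//.
  by rewrite (leq_trans (leq_maxl N0 N1))// leq_addr.
- move=> x; rewrite (_ : (fun k => _) = (fun k => h (k + N)%N x)); last by apply/funext => k; rewrite addnC.
  by rewrite (@cvg_shiftn N _ (fun k => h k x)); exact: cv.
- move=> k x; have fN : (supnorm (Gamma L (h (N + k)%N) (h (N + k)%N)) +
    supnorm (GZ (h (N + k)%N) (h (N + k)%N)))%E \is a fin_num.
    by apply: HN1; rewrite /= (leq_trans (leq_maxr N0 N1))// leq_addr.
  have := lexx (supnorm (Gamma L (h (N + k)%N) (h (N + k)%N)) +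
    supnorm (GZ (h (N + k)%N) (h (N + k)%N)))%E.
  rewrite -[X in (_ <= X)%E -> _](fineK fN) => /(supnorm_sum_le x)[h1 h2].
  by split; [exact: le_trans (ler_norm _) h1|exact: le_trans (ler_norm _) h2].
- pose w k := fine (supnorm (Gamma L (h k) (h k)) + supnorm (GZ (h k) (h k)))%E.
  rewrite (_ : (fun k => _) = (fun k => w (k + N)%N)); last by apply/funext => k; rewrite addnC.
  by rewrite (@cvg_shiftn N _ w).
Qed.

End Cutoffs.

(** * Smooth representatives of the semigroup *)

Section HeatFlow.
Context {R : realType} {M : ptopologicalType} {n : nat}.
Variable A : set (chart R M n).
Hypothesis at_A : smooth_atlas A.
Hypothesis hM : hausdorff_space M.
Hypothesis scM : @second_countable M.
Variable mu : {measure set (borel M) -> \bar R}.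
Hypothesis finmu : (mu setT < +oo)%E.
Hypothesis smooth_mu : smooth_measure A mu.
Variable L : (M -> R) -> M -> R.
Hypothesis dL : second_order_diffusion A L.
Hypothesis L1 : forall x, L (fun=> 1) x = 0.
Hypothesis symL : symmetric_operator mu A L.
Variable GZ : (M -> R) -> (M -> R) -> M -> R.
Hypothesis vZ : vertical_form A GZ.
Implicit Types (f g h k : M -> R).
Local Notation S := (smooth A).
Local Notation test := (test_function A).
Local Notation L2 f := (L2 mu f).
Local Notation ip := (ip mu).

(* [U f t] is the smooth representative of [P t f]; only these properties of the
   semigroup are used, and only for test functions. *)
Definition heat_flow (U : (M -> R) -> R -> M -> R) : Prop :=
  forall f, test f ->
  [/\ [/\ forall t : R, 0 <= t -> S (U f t), forall t : R, 0 <= t -> L2 (U f t), U f 0 = f,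
          forall t : R, 0 <= t -> L (U f t) = U (L f) t &
          forall T : R, 0 <= T -> exists C : R, forall t : R, 0 <= t <= T -> forall x,
            Gamma L (U f t) (U f t) x <= C /\ GZ (U f t) (U f t) x <= C],
      forall g (t : R), test g -> 0 <= t -> ip (U f t) g ^+ 2 <= ip f f * ip g g,
      forall g (t : R), test g -> 0 <= t -> ip (U f t) g = ip (U g t) f &
      forall g, test g -> exists2 C : R, 0 <= C & forall s t : R, 0 <= s -> 0 <= t ->
        `|ip (U f t) g - ip (U f s) g - (t - s) * ip (U (L f) s) g| <= C * (t - s) ^+ 2].

Lemma heat_flow_exists P : heat_semigroup mu A L P -> H1 A L GZ -> H3 A mu L GZ P ->
  exists U, heat_flow U.
Proof.
move=> [E [nu [spE extE PE]]] h1 h3.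
have vG := Gamma_form at_A dL L1.
have [h [eps [th h01 hcv _ _]]] := cutoff_sequence_exists at_A vG vZ h1.
have tL f : test f -> test (L f) by exact: (test_L at_A).
have rep f t : exists u, test f -> 0 <= t -> S u /\ eq_ae mu (P t f) u.
  have [[tf t0]|no] := pselect (test f /\ 0 <= t); last first.
    by exists f => tf t0; exfalso; apply: no.
  have [C HC] := h3 f t tf t0.
  have tt : 0 <= t <= t by rewrite t0 lexx.
  by have [u [su eu _]] := HC t tt; exists u.
have /choice[V HV] : forall p : (M -> R) * R, exists u, test p.1 -> 0 <= p.2 -> S u /\ eq_ae mu (P p.2 p.1) u.
  by move=> [f t]; exact: rep.
pose U f t := V (f, t).
have US f t : test f -> 0 <= t -> S (U f t) by move=> tf t0; have [] := HV (f, t) tf t0.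
have UP f t : test f -> 0 <= t -> eq_ae mu (P t f) (U f t) by move=> tf t0; have [] := HV (f, t) tf t0.
have PL f t : test f -> 0 <= t -> L2 (P t f).
  by move=> tf t0; apply: (heat_L2 PE) => //; exact: (test_L2 at_A finmu).
have UL f t : test f -> 0 <= t -> L2 (U f t).
  by move=> tf t0; apply: (L2_ae (PL _ _ tf t0)); [apply: (smooth_mfun at_A); exact: US|exact: UP].
have Uip f g t : test f -> L2 g -> 0 <= t -> ip (U f t) g = ip (P t f) g.
  by move=> tf Lg t0; apply/esym; apply: ip_ae => //; [exact: PL|exact: UL|exact: UP].
have tL2 f : test f -> L2 f by exact: (test_L2 at_A finmu).
exists U => f tf; have Lf := tL2 _ tf; split.
- split.
  + by move=> t t0; exact: US.
  + by move=> t t0; exact: UL.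
  + apply: (ae_eq_everywhere at_A smooth_mu).
    * by apply: (smooth_continuous at_A); exact: US.
    * by apply: (smooth_continuous at_A); case: tf.
    * have : {ae mu, forall x, U f 0 x - f x = 0}.
        have sd : S (fun x => U f 0 x - f x) by apply: (smoothB at_A); [exact: US|case: tf].
        apply: (test_zero_ae at_A hM scM finmu th h01 hcv).
        - exact: (smooth_mfun at_A).
        - by move=> k; apply: tL2; exact: (testMl at_A).
        - move=> g tg; have i1 := ip_intg (UL _ _ tf (lexx 0)) (tL2 _ tg); have i2 := ip_intg Lf (tL2 _ tg).
          have e : ip (U f 0) g = ip f g by rewrite Uip// ?(heat0 finmu spE PE)//; exact: tL2.
          rewrite -[RHS](subrr (ip f g)) -{1}e /ip -(IB i1 i2); apply: eq_Rintegral => x _; ring.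
      by move=> hz; apply: (ae_imp hz) => x /eqP; rewrite subr_eq0 => /eqP.
  (* Tested against g, both sides equal [ip (P t f) (L g)]: the left by [L_adjoint], the right by
     [heat_generator]. *)
  + move=> t t0.
    apply: (ae_eq_everywhere at_A smooth_mu).
    * by apply: (smooth_continuous at_A); apply: (L_smooth at_A dL); exact: US.
    * by apply: (smooth_continuous at_A); apply: US => //; exact: tL.
    * have sLU : S (L (U f t)) by apply: (L_smooth at_A dL); exact: US.
      have sUL : S (U (L f) t) by apply: US => //; exact: tL.
      have : {ae mu, forall x, L (U f t) x - U (L f) t x = 0}.
        have sd : S (fun x => L (U f t) x - U (L f) t x) by exact: (smoothB at_A).
        apply: (test_zero_ae at_A hM scM finmu th h01 hcv).
        - exact: (smooth_mfun at_A).
        - by move=> k; apply: tL2; exact: (testMl at_A).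
        - move=> g tg.
          have i1 : mu.-integrable setT (EFin \o ((fun x => g x * L (U f t) x) : borel M -> R)).
            by apply: (test_intg at_A finmu); exact: (testMl at_A).
          have i2 := ip_intg (tL2 _ tg) (UL _ _ (tL _ tf) t0).
          transitivity (\int[mu]_x (g x * L (U f t) x - g x * U (L f) t x)).
            by apply: eq_Rintegral => x _; ring.
          rewrite (IB i1 i2) (L_adjoint at_A hM dL L1 symL tg (US _ _ tf t0)).
          apply/eqP; rewrite subr_eq0; apply/eqP.
          transitivity (ip (U f t) (L g)) => //.
          transitivity (ip (U (L f) t) g); last by exact: ipC.
          rewrite !Uip//; [|exact: tL|exact: tL2|exact: tL2 (tL _ tg)].
          by rewrite (heat_generator at_A finmu dL L1 spE extE PE).
      by move=> hz; apply: (ae_imp hz) => x /eqP; rewrite subr_eq0 => /eqP.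
  (* (H.3) bounds some smooth representative; being continuous and almost everywhere equal to
     [U f t], it is [U f t]. *)
  + move=> T T0; have [C HC] := h3 f T tf T0; exists C => t /[dup] tT /andP[t0 _] x.
    have [u [su eu /(supnorm_sum_le x)[b1 b2]]] := HC t tT.
    have <- : u = U f t.
      apply: (ae_eq_everywhere at_A smooth_mu).
      * exact: (smooth_continuous at_A).
      * by apply: (smooth_continuous at_A); exact: US.
      * by apply: (ae_imp2 eu (UP _ _ tf t0)) => y -> ->.
    by split; [exact: le_trans (ler_norm _) b1|exact: le_trans (ler_norm _) b2].
- move=> g t tg t0; rewrite Uip//; last exact: tL2.
  by apply: (heat_contraction finmu spE PE) => //; exact: tL2.
- move=> g t tg t0; rewrite !Uip//; [|exact: tL2].
  by apply: (heat_sym finmu spE PE) => //; exact: tL2.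
- move=> g tg; have [C C0 HC] := heat_derivative at_A finmu dL L1 spE extE PE tf tg.
  have Lg := tL2 _ tg; have tLf := tL _ tf.
  by exists C => // s t s0 t0; rewrite !Uip//; exact: HC.
Qed.

End HeatFlow.

(** * One-variable estimates *)

Section QuadraticExpansion.
Context {R : realType}.
Implicit Types (p : R -> R) (s t C c T : R).

(** Differentiability on [0, oo) with derivative p1 and a uniform quadratic error. No limit is
    involved, so it integrates well and makes sense at t = 0. *)
Definition quadratic_at (p p1 : R -> R) (C : R) := forall s t : R, 0 <= s -> 0 <= t ->
  `|p t - p s - (t - s) * p1 s| <= C * (t - s) ^+ 2.

Lemma quadratic_mvt (p p1 : R -> R) (C s t : R) : quadratic_at p p1 C -> 0 <= s -> s < t ->
  exists xi, s < xi < t /\ p t - p s = (t - s) * p1 xi.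
Proof.
(* Extending p to negative times by its value at 0 gives a function continuous on the whole line, as
   needed when s = 0. *)
move=> q s0 st; pose m (x : R) := Num.max x 0; pose g x := p (m x).
have m0 (x : R) : 0 <= m x by rewrite /m le_max lexx orbT.
have mE (x : R) : 0 <= x -> m x = x by move=> /max_idPl.
have mlip (x y : R) : `|m y - m x| <= `|y - x|.
  rewrite /m; case: (leP y 0) => hy; case: (leP x 0) => hx; rewrite ?subrr ?normr0//.
  - by rewrite sub0r normrN (gtr0_norm hx) distrC; have := ler_norm (x - y); lra.
  - by rewrite subr0 (gtr0_norm hy); have := ler_norm (y - x); lra.
have cg : continuous g.
  move=> x; apply/(@cvgrPdist_le _ R^o) => e e0.
  pose K := `|p1 (m x)| + `|C|; have K0 : 0 < K + 1 by rewrite ltr_wpDl// addr_ge0.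
  pose d := Num.min 1 (e / (K + 1)); have d0 : 0 < d by rewrite lt_min ltr01 divr_gt0.
  have : \forall y \near x, `|x - y| < d by exact: (@nbhsx_ballx R R x d d0).
  apply: filterS => y xy; rewrite distrC.
  have D := mlip x y; rewrite distrC in xy; have Dd := le_lt_trans D xy.
  move: Dd; rewrite lt_min => /andP[D1 D2]; set De := m y - m x in D D1 D2 *.
  have Q : `|g y - g x - De * p1 (m x)| <= C * De ^+ 2 by exact: q.
  have h : `|g y - g x| <= `|De| * K.
    rewrite (_ : g y - g x = (g y - g x - De * p1 (m x)) + De * p1 (m x)); last by rewrite subrK.
    apply: le_trans (ler_normD _ _) _; rewrite normrM /K mulrDr addrC lerD//.
    apply: le_trans Q _; rewrite -real_normK ?num_real// expr2.
    apply: le_trans (ler_wpM2r (mulr_ge0 (normr_ge0 _) (normr_ge0 _)) (ler_norm C)) _.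
    by rewrite mulrCA ler_wpM2l// ler_piMr// ltW.
  apply: le_trans h _; apply: le_trans (ler_wpM2r _ (ltW D2)) _; first by rewrite addr_ge0.
  by apply: frac_le; [exact: ltW|rewrite addr_ge0].
have dg (x : R) : x \in `]s, t[ -> is_derive x 1 g (p1 x).
  rewrite in_itv /= => /andP[sx xt]; have x0 : 0 < x by exact: le_lt_trans sx.
  apply: (@is_derive_quadratic _ _ _ _ _ C x0) => h hx.
  have xh : 0 <= x + h by move: hx; rewrite ltr_norml => /andP[? ?]; lra.
  rewrite /g !mE//; last exact: ltW.
  by have := q x (x + h) (ltW x0) xh; rewrite (_ : x + h - x = h) ?[h * _]mulrC//; ring.
have [xi] := MVT st dg (continuous_subspaceT cg).
rewrite in_itv /= => hxi; rewrite /g !mE//; last exact: le_trans (ltW st).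
by exists xi; split=> //; rewrite mulrC.
Qed.

Lemma quadratic_lipschitz (p p1 : R -> R) (C T c : R) : quadratic_at p p1 C ->
  (forall r : R, 0 <= r <= T -> `|p1 r| <= c) ->
  forall s t : R, 0 <= s <= T -> 0 <= t <= T -> `|p t - p s| <= `|t - s| * c.
Proof.
move=> q pc; have key (s t : R) : 0 <= s <= T -> 0 <= t <= T -> s < t -> `|p t - p s| <= `|t - s| * c.
  move=> /andP[s0 sT] /andP[t0 tT] st.
  have [xi [/andP[h1 h2] ->]] := quadratic_mvt q s0 st.
  rewrite normrM ler_wpM2l// pc//; apply/andP; split; lra.
move=> s t hs ht; have [st|ts|->] := ltgtP s t; first exact: key.
  by rewrite distrC [`|t - s|]distrC; exact: key.
by rewrite !subrr normr0 mul0r.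
Qed.

(** The constants C and C' disappear from the conclusion. In the applications they depend on the
    test function in an uncontrolled way, whereas c is explicit in it. *)
Lemma quadratic_remainder (p p1 p2 : R -> R) (C C' T c : R) : quadratic_at p p1 C -> quadratic_at p1 p2 C' ->
  (forall r : R, 0 <= r <= T -> `|p2 r| <= c) ->
  forall s t : R, 0 <= s <= T -> 0 <= t <= T -> `|p t - p s - (t - s) * p1 s| <= (t - s) ^+ 2 * c.
Proof.
move=> q q' pc s t hs ht.
have c0 : 0 <= c by apply: le_trans (pc _ hs).
have [xi [hxi xiD ->]] : exists xi, [/\ 0 <= xi <= T, `|xi - s| <= `|t - s| & p t - p s = (t - s) * p1 xi].
  move: hs ht => /andP[s0 sT] /andP[t0 tT]; have [st|ts|->] := ltgtP s t.
  - have [xi [/andP[h1 h2] e]] := quadratic_mvt q s0 st; exists xi; split=> //.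
      apply/andP; split; lra.
    by rewrite !ger0_norm; lra.
  - have [xi [/andP[h1 h2] e]] := quadratic_mvt q t0 ts; exists xi; split.
    + apply/andP; split; lra.
    + by rewrite !ler0_norm; lra.
    + by rewrite -[LHS]opprB e; ring.
  - by exists t; rewrite !subrr mul0r t0 tT.
rewrite -mulrBr normrM -real_normK ?num_real// expr2 -mulrA ler_wpM2l//.
by apply: le_trans (quadratic_lipschitz q' pc hs hxi) _; rewrite ler_wpM2r.
Qed.

End QuadraticExpansion.

Section QuadraticMonotone.
Context {R : realType}.

(* Summing over a subdivision into N steps, the total error is at most C T^2 / N. *)
Lemma quadratic_nonincreasing (F : R -> R) (C T : R) : 0 <= T ->
  (forall s t : R, 0 <= s -> s <= t -> t <= T -> F t - F s <= C * (t - s) ^+ 2) -> F T <= F 0.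
Proof.
move=> T0 H; apply/ler_addgt0Pr => e e0.
have [N HN] : exists N : nat, `|C| * T ^+ 2 / e < N%:R.
  by exists (Num.truncn (`|C| * T ^+ 2 / e)).+1; exact: truncnS_gt.
have N1 : (0 : R) < N.+1%:R by rewrite ltr0n.
pose d := T / N.+1%:R.
have d0 : 0 <= d by rewrite divr_ge0// ltW.
have step (j : nat) : (j <= N.+1)%N -> F (j%:R * d) <= F 0 + j%:R * (`|C| * d ^+ 2).
  elim: j => [|j IH] jN; first by rewrite !mul0r addr0.
  have hj := IH (ltnW jN).
  have le : j.+1%:R * d <= T.
    by rewrite /d mulrA ler_pdivrMr// mulrC ler_wpM2l// ler_nat.
  have e1 : j.+1%:R * d - j%:R * d = d by rewrite -natr1; ring.
  have sle : j%:R * d <= j.+1%:R * d by rewrite -subr_ge0 e1.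
  have := H (j%:R * d) (j.+1%:R * d) (mulr_ge0 (ler0n _ _) d0) sle le.
  rewrite e1 => h; have h2 : C * d ^+ 2 <= `|C| * d ^+ 2 by rewrite ler_wpM2r ?sqr_ge0// ler_norm.
  have -> : F 0 + j.+1%:R * (`|C| * d ^+ 2) = F 0 + j%:R * (`|C| * d ^+ 2) + `|C| * d ^+ 2.
    by rewrite -natr1; ring.
  lra.
have := step N.+1 (leqnn _); have -> : N.+1%:R * d = T by rewrite /d mulrC divfK// lt0r_neq0.
move=> h; apply: le_trans h _; rewrite lerD2l.
have -> : N.+1%:R * (`|C| * d ^+ 2) = `|C| * T ^+ 2 / N.+1%:R.
  by rewrite /d; field; rewrite lt0r_neq0.
move: HN; rewrite ltr_pdivrMr// ler_pdivrMr// => HN; apply: (le_trans (ltW HN)).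
by rewrite mulrC ler_wpM2l ?(ltW e0)// ler_nat.
Qed.

Lemma quadratic_constant (F : R -> R) (C T : R) : 0 <= T ->
  (forall s t : R, 0 <= s -> s <= t -> t <= T -> `|F t - F s| <= C * (t - s) ^+ 2) -> F T = F 0.
Proof.
move=> T0 H; apply/eqP; rewrite eq_le; apply/andP; split.
  apply: (quadratic_nonincreasing (C := C)) => // s t s0 st tT.
  exact: le_trans (ler_norm _) (H s t s0 st tT).
rewrite -lerN2; apply: (quadratic_nonincreasing (F := fun t => - F t) (C := C)) => // s t s0 st tT.
by rewrite -opprD; apply: le_trans (H s t s0 st tT); rewrite -normrN ler_norm.
Qed.

(** A smooth convex approximation of |x - c|, used to derive the maximum principle from smooth
    functions of u_t. *)
Definition soft (e c x : R) := Num.sqrt (e ^+ 2 + (x - c) ^+ 2).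

Lemma soft_gt0 e c x : 0 < e -> 0 < soft e c x.
Proof. by move=> e0; rewrite sqrtr_gt0 ltr_wpDr ?sqr_ge0// exprn_gt0. Qed.

Lemma soft_sq e c x : soft e c x ^+ 2 = e ^+ 2 + (x - c) ^+ 2.
Proof. by rewrite sqr_sqrtr// addr_ge0// sqr_ge0. Qed.

Lemma soft_ge e c x : `|x - c| <= soft e c x.
Proof. by rewrite -sqrtr_sqr ler_wsqrtr// lerDr sqr_ge0. Qed.

Lemma soft_le e c x : 0 <= e -> soft e c x <= e + `|x - c|.
Proof.
move=> e0; rewrite -[leRHS]ger0_norm ?addr_ge0// -sqrtr_sqr ler_wsqrtr//.
rewrite -[X in _ + X <= _](real_normK (num_real _)).
have := mulr_ge0 e0 (normr_ge0 (x - c)); move: `|x - c| => a; lra.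
Qed.

Lemma soft_slope e c x : 0 < e -> `|(x - c) / soft e c x| <= 1.
Proof.
move=> e0; have s0 := soft_gt0 c x e0.
by rewrite normrM normfV [`|soft _ _ _|]gtr0_norm// ler_pdivrMr// mul1r soft_ge.
Qed.

(** The tangent inequality at x. It amounts to Cauchy-Schwarz for the plane vectors (e, x - c) and
    (e, y - c). *)
Lemma soft_convex e c x y : 0 < e ->
  soft e c x - soft e c y <= (x - c) / soft e c x * (x - y).
Proof.
move=> e0; have a0 := soft_gt0 c x e0; have b0 := soft_gt0 c y e0.
rewrite mulrAC ler_pdivlMr//.
have h : e ^+ 2 + (x - c) * (y - c) <= soft e c x * soft e c y.
  have ab0 : 0 <= soft e c x * soft e c y by rewrite mulr_ge0// ltW.
  have [p|p] := leP (e ^+ 2 + (x - c) * (y - c)) 0; first exact: le_trans p ab0.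
  have : (e ^+ 2 + (x - c) * (y - c)) ^+ 2 <= (soft e c x * soft e c y) ^+ 2.
    rewrite exprMn !soft_sq; move: (x - c) (y - c) => a b; rewrite -subr_ge0.
    by rewrite (_ : _ - _ = (e * (a - b)) ^+ 2) ?sqr_ge0//; ring.
  by rewrite ler_pXn2r// nnegrE ltW.
have := soft_sq e c x; rewrite expr2; nra.
Qed.

End QuadraticMonotone.

(** * Uniform first-order expansions in time *)

Section UniformTaylor.
Context {R : realType} {X : Type}.
Implicit Types (F D G H : R -> X -> R) (T : R).

(** Bounds on F and D belong to the definition so that products stay in the class; the functional of
    [gradient_bound] is assembled this way. *)
Definition uniform_taylor T F D := exists2 C : R, 0 <= C &
  forall s t : R, 0 <= s <= T -> 0 <= t <= T -> forall x,
    [/\ `|F t x - F s x - (t - s) * D s x| <= C * (t - s) ^+ 2, `|F s x| <= C & `|D s x| <= C].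

Lemma taylor_ext T F D F' D' : (forall s x, F s x = F' s x) -> (forall s x, D s x = D' s x) ->
  uniform_taylor T F D -> uniform_taylor T F' D'.
Proof.
move=> eF eD [C C0 H]; exists C => // s t hs ht x.
by rewrite -!eF -!eD; exact: H.
Qed.

Lemma taylor_cst T (a : X -> R) (C : R) : (forall x, `|a x| <= C) ->
  uniform_taylor T (fun=> a) (fun _ _ => 0).
Proof.
move=> aC; exists `|C| => // s t _ _ x; split; last by rewrite normr0.
  by rewrite subrr mulr0 subrr normr0 mulr_ge0 ?sqr_ge0.
exact: le_trans (aC x) (ler_norm _).
Qed.

Lemma taylorD T F D G H : uniform_taylor T F D -> uniform_taylor T G H ->
  uniform_taylor T (fun s x => F s x + G s x) (fun s x => D s x + H s x).
Proof.
move=> [C1 C10 h1] [C2 C20 h2]; exists (C1 + C2); first exact: addr_ge0.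
move=> s t hs ht x; have [a1 a2 a3] := h1 s t hs ht x; have [b1 b2 b3] := h2 s t hs ht x.
split; [|exact: le_trans (ler_normD _ _) (lerD a2 b2)|exact: le_trans (ler_normD _ _) (lerD a3 b3)].
rewrite [leRHS]mulrDl; apply: le_trans (lerD a1 b1); apply: le_trans (ler_normD _ _).
by rewrite le_eqVlt; apply/orP; left; apply/eqP; congr `|_|; ring.
Qed.

Lemma taylorM T F D G H : 0 <= T -> uniform_taylor T F D -> uniform_taylor T G H ->
  uniform_taylor T (fun s x => F s x * G s x) (fun s x => F s x * H s x + D s x * G s x).
Proof.
move=> T0 [C1 C10 h1] [C2 C20 h2]; pose C := C1 + C2.
have C0 : 0 <= C by exact: addr_ge0.
have le1 : C1 <= C by rewrite lerDl.
have le2 : C2 <= C by rewrite lerDr.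
exists (3 * C ^+ 2 + T * C ^+ 2).
  by rewrite addr_ge0// mulr_ge0 ?sqr_ge0.
move=> s t hs ht x; have [a1 a2 a3] := h1 s t hs ht x; have [b1 b2 b3] := h2 s t hs ht x.
have [_ b4 _] := h2 t s ht hs x.
move: (le_trans a2 le1) (le_trans a3 le1) (le_trans b2 le2) (le_trans b3 le2) (le_trans b4 le2) => {}a2 {}a3 {}b2 {}b3 {}b4.
have d2 : 0 <= (t - s) ^+ 2 by exact: sqr_ge0.
move: (le_trans a1 (ler_wpM2r d2 le1)) (le_trans b1 (ler_wpM2r d2 le2)) => {}a1 {}b1.
have TC : 0 <= T * C ^+ 2 by rewrite mulr_ge0 ?sqr_ge0.
have C2' : 0 <= C ^+ 2 by exact: sqr_ge0.
split; last first.
- apply: le_trans (ler_normD _ _) _; rewrite !normrM.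
  have := ler_pM (normr_ge0 _) (normr_ge0 _) a2 b3; have := ler_pM (normr_ge0 _) (normr_ge0 _) a3 b2.
  by rewrite -expr2; lra.
- rewrite normrM; have := ler_pM (normr_ge0 _) (normr_ge0 _) a2 b2; rewrite -expr2; lra.
set rF := F t x - F s x - (t - s) * D s x in a1.
set rG := G t x - G s x - (t - s) * H s x in b1.
have dT : `|t - s| <= T.
  by move: hs ht => /andP[? ?] /andP[? ?]; rewrite ler_norml; apply/andP; split; lra.
have dG : `|(t - s) * D s x * (G t x - G s x)| <= (T * C ^+ 2 + C ^+ 2) * (t - s) ^+ 2.
  have -> : G t x - G s x = rG + (t - s) * H s x by rewrite /rG; ring.
  rewrite mulrDr; apply: le_trans (ler_normD _ _) _; rewrite [leRHS]mulrDl; apply: lerD.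
    rewrite !normrM; have h := ler_pM (normr_ge0 _) (normr_ge0 _) dT a3.
    have := ler_pM (mulr_ge0 (normr_ge0 _) (normr_ge0 _)) (normr_ge0 _) h b1.
    by move=> h'; apply: le_trans h' _; rewrite le_eqVlt; apply/orP; left; apply/eqP; ring.
  rewrite (_ : _ * _ * _ = (t - s) ^+ 2 * (D s x * H s x)); last by ring.
  rewrite normrM (ger0_norm d2) mulrC ler_wpM2r// normrM expr2; exact: ler_pM.
rewrite (_ : _ - _ - _ = rF * G t x + F s x * rG + (t - s) * D s x * (G t x - G s x)); last first.
  by rewrite /rF /rG; ring.
apply: le_trans (ler_normD _ _) _.
have h1' : `|rF * G t x| <= C * (t - s) ^+ 2 * C by rewrite normrM ler_pM.
have h2' : `|F s x * rG| <= C * (C * (t - s) ^+ 2) by rewrite normrM ler_pM.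
have := ler_normD (rF * G t x) (F s x * rG).
move: h1' h2' dG; move: (`|_ + _|) (`|_|) (`|_|) (`|_|) ((t - s) ^+ 2) => a b c d e; lra.
Qed.

Lemma taylorZ T (a : R) F D : 0 <= T -> uniform_taylor T F D ->
  uniform_taylor T (fun s x => a * F s x) (fun s x => a * D s x).
Proof.
move=> T0 h; have ca : uniform_taylor T (fun _ (_ : X) => a) (fun _ _ => 0).
  exact: (@taylor_cst T (fun=> a) `|a|).
by apply: taylor_ext (taylorM T0 ca h) => s x //; rewrite mul0r addr0.
Qed.

(** Time reversal serves the backward flow s |-> U g (T - s) in the comparison argument. *)
Lemma taylor_rev T F D : uniform_taylor T F D ->
  uniform_taylor T (fun s => F (T - s)) (fun s x => - D (T - s) x).
Proof.
move=> [C C0 h]; exists C => // s t hs ht x.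
have r (y : R) : 0 <= y <= T -> 0 <= T - y <= T by move=> /andP[? ?]; apply/andP; split; lra.
have [a b c] := h (T - s) (T - t) (r s hs) (r t ht) x; split=> //; last by rewrite normrN.
have e : T - t - (T - s) = - (t - s) by ring.
move: a; rewrite e sqrrN; apply: le_trans.
by rewrite le_eqVlt; apply/orP; left; apply/eqP; congr `|_|; ring.
Qed.

Lemma expR_remainder (y : R) : 0 <= expR y - 1 - y <= y ^+ 2 * (1 + expR y).
Proof.
have h1 := expR_ge1Dx y; have h2 := expR_ge1Dx (- y); have e0 := expR_gt0 y.
have e1 : expR y * expR (- y) = 1 by rewrite -expRD subrr expR0.
have h3 : expR y - 1 <= y * expR y.
  have := ler_wpM2l (ltW e0) h2; rewrite e1; lra.
have [y0|y0] := leP 0 y.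
  have h4 : y * (expR y - 1) <= y * (y * expR y) by rewrite ler_wpM2l.
  have := sqr_ge0 y; rewrite expr2 => h5; apply/andP; split; nra.
apply/andP; split; first lra.
have h7 : - y * (1 - expR y) <= - y * (- y) by rewrite ler_wpM2l; lra.
have h8 : 0 <= y ^+ 2 * expR y by rewrite mulr_ge0 ?sqr_ge0// ltW.
by move: h7 h8; rewrite expr2; lra.
Qed.

Lemma taylor_expR T (a : R) : 0 <= T ->
  uniform_taylor T (fun s (_ : X) => expR (a * s)) (fun s _ => a * expR (a * s)).
Proof.
move=> T0; pose K := expR (`|a| * T).
have K0 : 0 < K by exact: expR_gt0.
have bE (s : R) : 0 <= s <= T -> expR (a * s) <= K.
  move=> /andP[s0 sT]; rewrite ler_expR; apply: le_trans (ler_norm _) _.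
  by rewrite normrM ler_wpM2l// ger0_norm.
have aK : 0 <= `|a| * K by rewrite mulr_ge0// ltW.
have a2K : 0 <= a ^+ 2 * K by rewrite mulr_ge0 ?sqr_ge0// ltW.
exists (K + `|a| * K + 2 * a ^+ 2 * K); first lra.
move=> s t hs ht _.
split.
- have eq : expR (a * t) = expR (a * s) * expR (a * (t - s)) by rewrite -expRD; congr expR; ring.
  have [r1 r2] := andP (expR_remainder (a * (t - s))).
  have -> : expR (a * t) - expR (a * s) - (t - s) * (a * expR (a * s)) =
      expR (a * s) * (expR (a * (t - s)) - 1 - a * (t - s)) by rewrite eq; ring.
  have e0 := expR_ge0 (a * s).
  rewrite ger0_norm ?mulr_ge0//; apply: le_trans (ler_wpM2l e0 r2) _.
  have -> : expR (a * s) * ((a * (t - s)) ^+ 2 * (1 + expR (a * (t - s)))) =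
      (a ^+ 2 * (expR (a * s) + expR (a * t))) * (t - s) ^+ 2 by rewrite eq; ring.
  rewrite ler_wpM2r ?sqr_ge0//.
  have h : a ^+ 2 * (expR (a * s) + expR (a * t)) <= a ^+ 2 * (K + K).
    by rewrite ler_wpM2l ?sqr_ge0// lerD// bE.
  move: h K0 aK a2K; move: (expR _ + expR _) (`|a|) => p q h K0 aK a2K; lra.
- rewrite ger0_norm ?expR_ge0//; have := bE s hs; lra.
- rewrite normrM (ger0_norm (expR_ge0 _)).
  have := ler_wpM2l (normr_ge0 a) (bE s hs); lra.
Qed.

End UniformTaylor.

(** * Growth of absolutely continuous functions *)

Section AbsolutelyContinuous.
Context {R : realType}.

Lemma derivable_local_bound (g : R -> R) (x c e : R) : derivable g x 1 -> `|'D_1 g x| <= c -> 0 < e ->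
  exists2 r : R, 0 < r & forall y, `|y - x| < r -> `|g y - g x| <= (c + e) * `|y - x|.
Proof.
move=> dx Dc e0.
have dg : (fun h : R => h^-1 *: (g (h *: 1 + x) - g x)) @ 0^' --> 'D_1 g x by exact: dx.
move/(@cvgrPdist_lt _ R^o) : dg => /(_ e e0) /nbhs_ballP[r /= r0 H].
exists r => // y yx; have [->|xy] := eqVneq y x; first by rewrite !subrr normr0 mulr0.
have h0 : y - x != 0 by rewrite subr_eq0.
have br : ball 0 r (y - x) by rewrite /ball /= sub0r normrN.
have := H _ br h0; rewrite /= [(y - x) *: 1]mulr1 subrK => Hy.
have q : `|(y - x)^-1 *: (g y - g x)| <= c + e.
  rewrite -[X in `|X|](subrK ('D_1 g x)); apply: le_trans (ler_normD _ _) _.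
  by rewrite addrC lerD// distrC ltW.
have n0 : 0 < `|y - x| by rewrite normr_gt0.
by move: q; rewrite normrM normfV mulrC ler_pdivrMr.
Qed.

Lemma open_intervals_length (N : nat) (p q : nat -> R) (D : set R) (r : R) : open D ->
  (lebesgue_measure D < r%:E)%E -> (forall i, (i < N)%N -> p i <= q i) ->
  trivIset `I_N (fun i => `]p i, q i[%classic) ->
  (forall i, (i < N)%N -> `]p i, q i[%classic `<=` D) -> \sum_(i < N) (q i - p i) < r.
Proof.
move=> oD Dr pq tr sub; rewrite -lte_fin; apply: le_lt_trans Dr.
have e : lebesgue_measure (\big[setU/set0]_(i < N) (`]p i, q i[%classic : set R)) =
    (\sum_(i < N) (q i - p i))%:E.
  have mU : measurable (\big[setU/set0]_(i < N) (`]p i, q i[%classic : set (measurableTypeR R))).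
    by apply: bigsetU_measurable => i _; exact: measurable_itv.
  have mI k : (k < N)%N -> measurable (`]p k, q k[%classic : set (measurableTypeR R)).
    by move=> _; exact: measurable_itv.
  rewrite [LHS](@measure_semi_additive_ord_I _ _ _ (@lebesgue_measure R) _ N mI tr mU).
  have len (a b : R) : a <= b -> lebesgue_measure (`]a, b[%classic : set R) = (b - a)%:E.
    rewrite lebesgue_measure_itv/= lte_fin le_eqVlt => /orP[/eqP ->|->]; last by rewrite EFinB.
    by rewrite ltxx subrr.
  by rewrite -sumEFin; apply: eq_bigr => i _; apply: len; exact: pq (ltn_ord i).
rewrite -e; apply: le_measure; rewrite ?inE.
- by apply: bigsetU_measurable => i _; exact: measurable_itv.
- exact: open_measurable.
- rewrite -(@bigcup_mkord _ N (fun i => `]p i, q i[%classic : set R)) => y [i /= iN]; exact: sub.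
Qed.

(* Growth at a point of the exceptional null set is charged to an open set D of
   small measure containing it; the supremum of the points up to which the
   resulting estimate holds is T. *)
Lemma ac_lipschitz (g : R -> R) (T c : R) : 0 <= T -> 0 <= c -> absolutely_continuous T g ->
  {ae lebesgue_measure, forall t : R, 0 < t < T -> derivable g t 1 /\ `|'D_1 g t| <= c} ->
  `|g T - g 0| <= c * T.
Proof.
move=> T0 c0 ac [N0 [mN0 N00 subN0]]; apply/ler_addgt0Pr => e' e'0.
pose e := e' / (T + 1); have T1 : 0 < T + 1 by rewrite ltr_wpDl.
have e0 : 0 < e by rewrite divr_gt0.
have [delta delta0 AC] := ac e e0.
(* The endpoints join the exceptional set because the derivative is controlled at interior times
   only. *)
pose Z : set (measurableTypeR R) := N0 `|` ([set 0] `|` [set T]).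
have mZ : measurable Z by apply: measurableU => //; exact: measurableU.
have Z0 : lebesgue_measure Z = 0%E.
  rewrite /Z measureU0//; [exact: measurableU|].
  have s1 (a : R) : lebesgue_measure ([set a] : set (measurableTypeR R)) = 0%E by exact: lebesgue_measure_set1.
  by rewrite measureU0//; exact: s1.
have Zoo : (lebesgue_measure Z < +oo)%E by rewrite Z0.
have [D [oD ZD mD]] := lebesgue_regularity_outer mZ Zoo delta0.
have Dd : (lebesgue_measure D < delta%:E)%E.
  have mDm : measurable (D : set (measurableTypeR R)) by exact: open_measurable.
  have mDZ : measurable (D `\` Z : set (measurableTypeR R)) by exact: measurableD.
  have := @measureU2 _ _ _ (@lebesgue_measure R) _ _ mZ mDZ; rewrite setDUK// => le.
  by apply: le_lt_trans le _; rewrite [X in (X + _)%E]Z0 add0e.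
pose P (s : R) := exists (N : nat) (p q : nat -> R),
  [/\ forall i, (i < N)%N -> 0 <= p i /\ p i <= q i /\ q i <= s,
      trivIset `I_N (fun i => `]p i, q i[%classic),
      forall i, (i < N)%N -> `]p i, q i[%classic `<=` D &
      `|g s - g 0| <= (c + e) * s + \sum_(i < N) `|g (q i) - g (p i)|].
have ce : 0 <= c + e by rewrite addr_ge0// ltW.
have eqN (N k : nat) : (k <= N)%N -> k = N \/ (k < N)%N.
  by rewrite leq_eqVlt => /orP[/eqP|]; [left|right].
have good (s v : R) : 0 <= s -> s <= v -> `|g v - g s| <= (c + e) * (v - s) -> P s -> P v.
  move=> s0 sv gsv [N [p [q [h1 h2 h3 h4]]]]; exists N, p, q; split=> //.
    by move=> i iN; have [a [b d]] := h1 i iN; split=> //; split=> //; exact: le_trans sv.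
  rewrite (_ : g v - g 0 = (g v - g s) + (g s - g 0)); last by ring.
  by apply: le_trans (ler_normD _ _) _; move: (\sum_(_ < _) _) h4 => a; lra.
have bad (s v : R) : 0 <= s -> s <= v -> `]s, v[%classic `<=` D -> P s -> P v.
  move=> s0 sv sD [N [p [q [h1 h2 h3 h4]]]].
  exists N.+1, (fun i => if (i < N)%N then p i else s), (fun i => if (i < N)%N then q i else v); split.
  - move=> i; rewrite ltnS leq_eqVlt => /orP[/eqP ->|iN]; first by rewrite ltnn.
    by rewrite iN; have [a [b d]] := h1 i iN; split=> //; split=> //; exact: le_trans sv.
  - move=> i j /=; rewrite !ltnS => iN jN [x [/= xi xj]].
    have [jE|jl] := eqN N j jN; have [iE|il] := eqN N i iN.
    + by rewrite iE jE.
    + move: xi xj; rewrite il jE ltnn /= !in_itv/= => /andP[_ x1] /andP[x2 _].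
      by have [_ [_ d]] := h1 i il; exfalso; lra.
    + move: xi xj; rewrite jl iE ltnn /= !in_itv/= => /andP[x2 _] /andP[_ x1].
      by have [_ [_ d]] := h1 j jl; exfalso; lra.
    + by move: xi xj; rewrite il jl => xi xj; apply: (h2 i j il jl); exists x.
  - move=> i; rewrite ltnS leq_eqVlt => /orP[/eqP ->|iN]; first by rewrite ltnn.
    by rewrite iN; exact: h3.
  - rewrite big_ord_recr/= ltnn.
    rewrite (_ : \sum_(i < N) _ = \sum_(i < N) `|g (q i) - g (p i)|); last first.
      by apply: eq_bigr => i _; rewrite ltn_ord.
    rewrite (_ : g v - g 0 = (g v - g s) + (g s - g 0)); last by ring.
    apply: le_trans (ler_normD _ _) _.
    have := ler_wpM2l ce sv; move: (\sum_(_ < _) _) (`|g v - g s|) h4 => a b; lra.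
have local (x : R) : 0 <= x <= T -> exists2 r : R, 0 < r & forall s v : R,
    0 <= s -> s <= x -> x <= v -> v <= T -> x - r < s -> v < x + r -> P s -> P v.
  move=> /andP[x0 xT]; have [Dx|nDx] := pselect (D x).
    have /nbhs_ballP[r /= r0 Hr] : nbhs x D by exact: open_nbhs_nbhs.
    exists r => // s v s0 sx xv vT rs vr; apply: bad => //; first exact: le_trans xv.
    move=> y /=; rewrite in_itv/= => /andP[sy yv]; apply: Hr; rewrite /ball/= ltr_norml.
    by apply/andP; split; lra.
  have nZx : ~ Z x by move=> /ZD.
  have x00 : 0 < x.
    by rewrite lt_neqAle x0 andbT; apply/eqP => x_0; apply: nZx; right; left.
  have xTT : x < T.
    by rewrite lt_neqAle xT andbT; apply/eqP => x_0; apply: nZx; right; right.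
  have [dx Dx] : derivable g x 1 /\ `|'D_1 g x| <= c.
    by apply: contrapT => no; apply: nZx; left; apply: subN0 => /= K; apply: no; apply: K; rewrite x00.
  have [r r0 Hr] := derivable_local_bound dx Dx e0.
  exists r => // s v s0 sx xv vT rs vr; apply: good => //; first exact: le_trans xv.
  have b1 : `|g v - g x| <= (c + e) * (v - x).
    by rewrite -[v - x]ger0_norm ?subr_ge0//; apply: Hr; rewrite ger0_norm ?subr_ge0//; lra.
  have b2 : `|g s - g x| <= (c + e) * (x - s).
    rewrite -[x - s]ger0_norm ?subr_ge0// [`|x - s|]distrC; apply: Hr.
    by rewrite distrC ger0_norm ?subr_ge0//; lra.
  rewrite (_ : g v - g s = (g v - g x) - (g s - g x)); last by ring.
  by apply: le_trans (ler_normB _ _) _; lra.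
have PT : P T.
  pose E := [set s : R | 0 <= s <= T /\ P s].
  have E0 : E 0.
    split; first by rewrite lexx.
    exists 0%N, (fun=> 0), (fun=> 0); split=> //.
    by rewrite subrr normr0 big_ord0 mulr0 addr0.
  have ubE : ubound E T by move=> s [/andP[]].
  have hE : has_sup E by split; [exists 0|exists T].
  pose x := sup E.
  have up : ubound E x := sup_upper_bound hE.
  have x0 : 0 <= x := up _ E0.
  have xT : x <= T by apply: ge_sup => //; exists 0.
  have [r r0 H] : exists2 r : R, 0 < r & forall s v : R,
    0 <= s -> s <= x -> x <= v -> v <= T -> x - r < s -> v < x + r -> P s -> P v.
    by apply: local; rewrite x0.
  have [s Es rs] := sup_adherent r0 hE; have sx : s <= x := up _ Es.
  have [/andP[s0 sT] Ps] := Es.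
  pose v := Num.min T (x + r / 2).
  have r2 : 0 < r / 2 by rewrite divr_gt0.
  have xv : x <= v by rewrite le_min xT lerDl ltW.
  have vT : v <= T by rewrite ge_min lexx.
  have vr : v < x + r by rewrite gt_min ltrD2l gtr_pMr// invf_lt1// ltr1n orbT.
  have Pv : P v by exact: (H s v).
  have vx : v <= x by apply: up; split=> //; rewrite vT (le_trans x0).
  by move: vx Pv; rewrite /v; case: (leP T (x + r / 2)) => // _; lra.
have [N [p [q [h1 h2 h3 h4]]]] := PT.
have len : \sum_(i < N) (q i - p i) < delta.
  by apply: (open_intervals_length oD Dd) => // i iN; have [_ []] := h1 i iN.
have := AC N p q h1 h2 len; rewrite (_ : c * T + e' = c * T + e * (T + 1)); last by rewrite /e divfK// lt0r_neq0.
by move: (\sum_(_ < _) _) h4 => a; lra.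
Qed.

End AbsolutelyContinuous.

(** * Integrability in time of the gradient bound *)

Section DecayPrimitive.
Context {R : realType}.

(* A primitive of e^(-a t / 2) / sqrt (1 - e^(-a t / 2)), which dominates
   1 / sqrt (e^(a t) - 1). *)
Definition decay_primitive (a t : R) := 4 / a * Num.sqrt (1 - expR (- (a / 2) * t)).

Lemma decay_primitive_derive (a t : R) : 0 < a -> 0 < t ->
  is_derive t 1 (decay_primitive a) (expR (- (a / 2) * t) / Num.sqrt (1 - expR (- (a / 2) * t))).
Proof.
move=> a0 t0; set b := - (a / 2).
have b0 : b * t < 0 by rewrite /b mulNr oppr_lt0 mulr_gt0// divr_gt0.
have e1 : expR (b * t) < 1 by rewrite -(@expR0 R) ltr_expR.
have w0 : 0 < 1 - expR (b * t) by rewrite subr_gt0.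
have d1 : is_derive t 1 (fun s : R => b * s) b.
  by apply: is_derive_eq; rewrite [LHS]mulr1 ?mul0r ?addr0.
have d2 : is_derive t 1 (fun s : R => expR (b * s)) (expR (b * t) * b).
  exact: (@is_derive1_comp _ expR (fun s : R => b * s)).
have d3 : is_derive t 1 (fun s : R => 1 - expR (b * s)) (- (expR (b * t) * b)).
  by apply: (is_derive_eq (is_deriveB (is_derive_cst (1 : R) t 1) d2)); rewrite sub0r.
have d4 : is_derive t 1 (fun s : R => Num.sqrt (1 - expR (b * s)))
    ((2 * Num.sqrt (1 - expR (b * t)))^-1 * - (expR (b * t) * b)).
  apply: (@is_derive1_comp _ Num.sqrt (fun s : R => 1 - expR (b * s))).
  exact: is_derive1_sqrt.
have s0 : Num.sqrt (1 - expR (b * t)) != 0 by rewrite lt0r_neq0// sqrtr_gt0.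
have d5 : is_derive t 1 (fun s : R => 4 / a * Num.sqrt (1 - expR (b * s)))
    (4 / a * ((2 * Num.sqrt (1 - expR (b * t)))^-1 * - (expR (b * t) * b))).
  exact: is_deriveZ.
apply: is_derive_eq d5 _; rewrite /b; field.
by rewrite s0 lt0r_neq0.
Qed.

(** With y = e^(-a t / 2) one has e^(a t) - 1 = (1 - y^2) / y^2 >= (1 - y) / y^2. *)
Lemma decay_primitive_dominates (a t : R) : 0 < a -> 0 < t ->
  (Num.sqrt (expR (a * t) - 1))^-1 <= expR (- (a / 2) * t) / Num.sqrt (1 - expR (- (a / 2) * t)).
Proof.
move=> a0 t0; set y := expR (- (a / 2) * t).
have b0 : - (a / 2) * t < 0 by rewrite mulNr oppr_lt0 mulr_gt0// divr_gt0.
have y1 : y < 1 by rewrite -(@expR0 R) ltr_expR.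
have y0 : 0 < y by exact: expR_gt0.
have yE : expR (a * t) = (y ^+ 2)^-1.
  by rewrite -expRM_natl -expRN; congr expR; field.
have w0 : 0 < 1 - y by rewrite subr_gt0.
have yy : y ^+ 2 < y by rewrite expr2 gtr_pMr.
have v0 : 0 < (y ^+ 2)^-1 - 1.
  by rewrite subr_gt0 invf_gt1 ?exprn_gt0// (lt_trans yy).
rewrite yE ler_pdivlMr ?sqrtr_gt0// mulrC ler_pdivrMr ?sqrtr_gt0//.
rewrite -[X in _ <= X * _](ger0_norm (ltW y0)) -sqrtr_sqr -sqrtrM ?sqr_ge0//; apply: ler_wsqrtr.
by rewrite mulrBr mulfV ?lt0r_neq0 ?exprn_gt0// mulr1 lerD2l lerN2 ltW.
Qed.

End DecayPrimitive.

(** * Markov property, gradient bound and isoperimetry *)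

Section FlowEstimates.
Context {R : realType} {M : ptopologicalType} {n : nat}.
Variable A : set (chart R M n).
Hypothesis at_A : smooth_atlas A.
Hypothesis hM : hausdorff_space M.
Variable mu : {measure set (borel M) -> \bar R}.
Hypothesis finmu : (mu setT < +oo)%E.
Hypothesis smooth_mu : smooth_measure A mu.
Variable L : (M -> R) -> M -> R.
Hypothesis dL : second_order_diffusion A L.
Hypothesis L1 : forall x, L (fun=> 1) x = 0.
Hypothesis symL : symmetric_operator mu A L.
Variable GZ : (M -> R) -> (M -> R) -> M -> R.
Hypothesis vZ : vertical_form A GZ.
Variable h : nat -> M -> R.
Variable eps : nat -> R.
Hypothesis cutP : cutoff_sequence A (Gamma L) GZ h eps.
Variable U : (M -> R) -> R -> M -> R.
Hypothesis flow : heat_flow A mu L GZ U.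
Implicit Types (f g u v w chi phi : M -> R).
Local Notation S := (smooth A).
Local Notation test := (test_function A).
Local Notation L2 f := (L2 mu f).
Local Notation ip := (ip mu).
Local Notation mfun f := (measurable_fun [set: borel M] (f : borel M -> R)).
Local Notation intg f := (mu.-integrable [set: borel M] (EFin \o (f : borel M -> R))).

Let tL f : test f -> test (L f). Proof. exact: (test_L at_A). Qed.
Let tS f : test f -> S f. Proof. by case. Qed.
Let tL2 f : test f -> L2 f. Proof. exact: (test_L2 at_A finmu). Qed.
Let US f t : test f -> 0 <= t -> S (U f t). Proof. by move=> /flow[[h1 _ _ _ _] _ _ _]; exact: h1. Qed.
Let UL f t : test f -> 0 <= t -> L2 (U f t). Proof. by move=> /flow[[_ h1 _ _ _] _ _ _]; exact: h1. Qed.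
Let U0 f : test f -> U f 0 = f. Proof. by move=> /flow[[_ _ h1 _ _] _ _ _]. Qed.
Let LU f t : test f -> 0 <= t -> L (U f t) = U (L f) t. Proof. by move=> /flow[[_ _ _ h1 _] _ _ _]; exact: h1. Qed.
Let vG : vertical_form A (Gamma L). Proof. exact: (Gamma_form at_A dL L1). Qed.

(** Duality for the L^2 norm. Testing with h_k w gives (int h_k w^2)^2 <= c int h_k^2 w^2 <= c int
    h_k w^2; divide and let k grow. *)
Lemma L2_from_tests w (c : R) : S w -> L2 w -> (forall g, test g -> ip w g ^+ 2 <= c * ip g g) ->
  0 <= c -> ip w w <= c.
Proof.
move=> sw Lw H c0; have [th h01 hcv _ _] := cutP.
pose a (k : nat) := \int[mu]_x (h k x * w x ^+ 2).
have iw := L2_sq Lw.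
have mh (k : nat) : mfun (h k) by apply: (smooth_mfun at_A); exact: tS.
have hb (k : nat) x : `|h k x| <= 1 by have /andP[? ?] := h01 k x; rewrite ger0_norm.
have ia (k : nat) : intg (fun x => h k x * w x ^+ 2).
  by apply: (intg_ext _ (intg_Mbounded iw (mh k) (hb k))) => x; rewrite mulrC.
have ac (k : nat) : a k <= c.
  have thw : test (fun x => h k x * w x) by exact: (testMl at_A).
  have := H _ thw.
  have -> : ip w (fun x => h k x * w x) = a k by apply: eq_Rintegral => x _; ring.
  have le : ip (fun x => h k x * w x) (fun x => h k x * w x) <= a k.
    apply: I_le => //; first exact: (ip_intg (tL2 thw) (tL2 thw)).
    move=> x; have /andP[x0 x1] := h01 k x.
    rewrite (_ : _ * _ * _ = h k x * (h k x * w x ^+ 2)); last by ring.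
    by rewrite ler_piMl// mulr_ge0// sqr_ge0.
  have a0 : 0 <= a k by apply: I_ge0 => x; have /andP[x0 x1] := h01 k x; rewrite mulr_ge0// sqr_ge0.
  move=> h2; have : a k ^+ 2 <= c * a k by apply: le_trans h2 _; rewrite ler_wpM2l.
  rewrite expr2; move: a0; rewrite le_eqVlt => /orP[/eqP <-//|a0].
  by rewrite ler_pM2r.
have cva : \int[mu]_x (h k x * w x ^+ 2) @[k --> \oo] --> ip w w.
  rewrite (_ : ip w w = \int[mu]_x (w x ^+ 2)); last by apply: eq_Rintegral => x _; rewrite expr2.
  have := @I_dominated _ _ _ mu (fun (j : nat) (x : borel M) => h j x * w x ^+ 2) (fun x : borel M => w x ^+ 2) (fun x : borel M => w x ^+ 2); apply => //.
  - by move=> j; exact: intg_measurable (ia j).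
  - exact: intg_measurable iw.
  - apply: aeW => x; rewrite -[X in _ --> X]mul1r; apply: cvgM; [exact: hcv|exact: cvg_cst].
  - move=> j x; rewrite normrM [`|w x ^+ 2|]ger0_norm ?sqr_ge0//.
    by rewrite ler_piMl ?sqr_ge0.
apply: (ler_cvg_to cva (cvg_cst c)); exact: nearW.
Qed.

Lemma flow_quadratic f g : test f -> test g -> exists C : R,
  quadratic_at (fun t => ip (U f t) g) (fun t => ip (U (L f) t) g) C.
Proof.
move=> tf tg; have [_ _ _ /(_ _ tg)[C _ HC]] := flow tf.
by exists C => s t; exact: HC.
Qed.

Lemma flow_form_bound f g t : test f -> test g -> 0 <= t ->
  `|ip (U f t) g| <= Num.sqrt (ip f f * ip g g).
Proof.
move=> tf tg t0; have [_ /(_ _ _ tg t0) b _ _] := flow tf.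
by rewrite -sqrtr_sqr ler_wsqrtr.
Qed.

Lemma ip_diff a b (r : R) c g : L2 a -> L2 b -> L2 c -> L2 g ->
  ip (fun x => a x - b x - r * c x) g = ip a g - ip b g - r * ip c g.
Proof.
move=> La Lb Lc Lg; have i1 := ip_intg La Lg; have i2 := ip_intg Lb Lg; have i3 := ip_intg Lc Lg.
rewrite /ip -(IZ r i3) -(IB i1 i2) -(IB (intgB i1 i2) (intgZ r i3)).
by apply: eq_Rintegral => x _; ring.
Qed.

Lemma ip_sub a b g : L2 a -> L2 b -> L2 g -> ip (fun x => a x - b x) g = ip a g - ip b g.
Proof.
move=> La Lb Lg; have i1 := ip_intg La Lg; have i2 := ip_intg Lb Lg.
by rewrite /ip -(IB i1 i2); apply: eq_Rintegral => x _; ring.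
Qed.

(** Strong from weak: each pairing with g has a second-order remainder bounded, by contraction, by
    |L L f|_2 |g|_2, and [L2_from_tests] removes g. *)
Lemma flow_taylor f s t : test f -> 0 <= s -> 0 <= t ->
  ip (fun x => U f t x - U f s x - (t - s) * U (L f) s x) (fun x => U f t x - U f s x - (t - s) * U (L f) s x)
    <= (t - s) ^+ 4 * ip (L (L f)) (L (L f)).
Proof.
move=> tf s0 t0; have tLf := tL tf; have tLLf := tL tLf.
have Ls := UL tf s0; have Lt := UL tf t0; have LLs := UL tLf s0.
apply: L2_from_tests.
- have := US tLf s0; have := US tf s0; have := US tf t0 => S1 S2 S3.
  by apply: (smoothB at_A); [exact: (smoothB at_A)|exact: (smoothZ at_A)].
- by apply: (L2B finmu); [exact: L2B|exact: L2Z].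
- move=> g tg; have [C q] := flow_quadratic tf tg; have [C' q'] := flow_quadratic tLf tg.
  pose T := Num.max s t.
  have b (r : R) : 0 <= r <= T -> `|ip (U (L (L f)) r) g| <= Num.sqrt (ip (L (L f)) (L (L f)) * ip g g).
    by move=> /andP[r0 _]; exact: flow_form_bound.
  have hs : 0 <= s <= T by rewrite s0 le_max lexx.
  have ht : 0 <= t <= T by rewrite t0 le_max lexx orbT.
  have := quadratic_remainder q q' b hs ht; rewrite (ip_diff _ Lt Ls LLs (tL2 tg)) => le.
  rewrite -real_normK ?num_real// -mulrA.
  have D0 : 0 <= ip (L (L f)) (L (L f)) * ip g g by rewrite mulr_ge0// ip_ge0.
  move: D0 le; move: (_ * ip g g) => D D0 le; rewrite -(sqr_sqrtr D0).
  have -> : (t - s) ^+ 4 * Num.sqrt D ^+ 2 = ((t - s) ^+ 2 * Num.sqrt D) ^+ 2 by rewrite exprMn -exprM.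
  apply: lerXn2r le; rewrite nnegrE; first exact: normr_ge0.
  by rewrite mulr_ge0 ?sqr_ge0// sqrtr_ge0.
- by rewrite mulr_ge0 ?ip_ge0// (_ : 4 = 2 * 2)%N// exprM sqr_ge0.
Qed.

Lemma test_cont_intg chi q : test chi -> continuous q -> intg (fun x => chi x * q x).
Proof.
move=> tchi cq; have [C1 C10 H1] := test_bounded at_A tchi.
have cchi : continuous chi by apply: (smooth_continuous at_A); exact: tS.
have [_ cK _] := tchi; have [C2 C20 H2] := continuous_compact_bound cK cq.
apply: (@intg_bounded _ _ _ mu finmu _ (C1 * C2)).
  by apply: measurable_funM; apply: continuous_borel.
move=> x; have [sx|/supp_out ->] := pselect (supp chi x); last by rewrite mul0r normr0 mulr_ge0.
by rewrite normrM ler_pM//; exact: H2.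
Qed.

(** Passes from tested inequalities to pointwise ones: at a point with q > 0, a bump supported where
    q exceeds half its value there has a positive integral against q. *)
Lemma continuous_nonpos q : continuous q ->
  (forall chi, test chi -> (forall x, 0 <= chi x) -> \int[mu]_x (chi x * q x) <= 0) ->
  forall x, q x <= 0.
Proof.
move=> cq H x; rewrite leNgt; apply/negP => qx.
pose O : set M := [set y | q x / 2 < q y].
have oO : open O.
  rewrite (_ : O = q @^-1` [set r | q x / 2 < r])//; apply: open_comp; last exact: open_gt.
  by move=> y _; exact: cq.
have Ox : O x by rewrite /O /= gtr_pMr// invf_lt1// ltr1n.
have [chi [V [[schi cchi sO] chi01 oV Vx V1]]] := bump_at at_A hM oO Ox.
have tchi : test chi by split.
have chi0 y : 0 <= chi y by have /andP[] := chi01 y.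
have mV := open_measurable_borel oV.
have i1 : intg (fun y => q x / 2 * \1_V y).
  apply: intgZ; apply: (@intg_bounded _ _ _ mu finmu _ 1); first exact: measurable_indic.
  by move=> y; rewrite indicE; case: (_ \in _); rewrite /= ?normr1 ?normr0.
have := H _ tchi chi0; apply/negP; rewrite -ltNge.
apply: (@lt_le_trans _ _ (\int[mu]_y (q x / 2 * \1_V y))).
  have i2 : intg (fun y => \1_V y).
    apply: (@intg_bounded _ _ _ mu finmu _ 1); first exact: measurable_indic.
    by move=> y; rewrite indicE; case: (_ \in _); rewrite /= ?normr1 ?normr0.
  rewrite (IZ _ i2) mulr_gt0 ?divr_gt0// /Rintegral integral_indic// setIT fine_gt0//.
  rewrite (open_measure_gt0 at_A smooth_mu oV Vx)/=.
  apply: le_lt_trans finmu; apply: le_measure; rewrite ?inE//; exact: mV.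
apply: I_le => //; first exact: test_cont_intg.
move=> y; rewrite indicE; case: (boolP (y \in V)); rewrite ?inE /= => Vy.
  rewrite mulr1 V1// mul1r ltW//; apply: (sO y); apply: contrapT => /supp_out.
  by rewrite V1// => /eqP; rewrite oner_eq0.
rewrite mulr0; have [/sO Oy|/supp_out ->] := pselect (supp chi y); last by rewrite mul0r.
by rewrite mulr_ge0// ltW// (lt_trans _ Oy)// divr_gt0.
Qed.

(** * Pointwise time regularity of Gamma(u_t) and Gamma^Z(u_t) *)

Section Pointwise.
Variable B : (M -> R) -> (M -> R) -> M -> R.
Hypothesis vB : vertical_form A B.
Hypothesis boundB : forall f (T : R), test f -> 0 <= T -> exists C : R, forall t : R, 0 <= t <= T ->
  forall x, B (U f t) (U f t) x <= C.

Lemma sqrt_form_continuous w : S w -> continuous (fun x => Num.sqrt (B w w x)).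
Proof.
move=> sw x; apply: (@continuous_comp _ _ _ (B w w) Num.sqrt).
  by apply: (smooth_continuous at_A); exact: (form_smooth vB).
exact: sqrt_continuous.
Qed.

Lemma form_test_bound chi v phi (C : R) : test chi -> (forall x, 0 <= chi x) -> S v -> S phi ->
  (forall x, B v v x <= C) ->
  `|\int[mu]_x (chi x * B v phi x)| <= Num.sqrt C * \int[mu]_x (chi x * Num.sqrt (B phi phi x)).
Proof.
move=> tchi chi0 sv sphi BC.
have i1 : intg (fun x => chi x * B v phi x).
  by apply: test_cont_intg => //; apply: (smooth_continuous at_A); exact: (form_smooth vB).
have i2 : intg (fun x => chi x * Num.sqrt (B phi phi x)).
  by apply: test_cont_intg => //; exact: sqrt_form_continuous.
apply: le_trans (I_abs i1) _; rewrite -(IZ _ i2).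
apply: I_le; [exact: intg_norm|exact: intgZ|] => x.
rewrite normrM ger0_norm// mulrCA ler_wpM2l//.
apply: le_trans (form_abs at_A vB x sv sphi) _.
by rewrite ler_wpM2r ?sqrtr_ge0// ler_wsqrtr.
Qed.

(** The hypothesis localizes to B(w, w) <= c B(w, w)^(1/2), and dividing gives the claim. This
    replaces duality for the sup norm of a gradient. *)
Lemma form_pointwise w (c : R) : S w -> 0 <= c ->
  (forall chi, test chi -> (forall x, 0 <= chi x) ->
     \int[mu]_x (chi x * B w w x) <= c * \int[mu]_x (chi x * Num.sqrt (B w w x))) ->
  forall x, B w w x <= c ^+ 2.
Proof.
move=> sw c0 H x.
have cB : continuous (B w w) by apply: (smooth_continuous at_A); exact: (form_smooth vB).
have cs := sqrt_form_continuous sw.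
have cc : continuous (fun y => c * Num.sqrt (B w w y)).
  by move=> y; apply: (@continuousM R M (fun=> c) (fun y => Num.sqrt (B w w y))); [exact: cst_continuous|exact: cs].
have : B w w x - c * Num.sqrt (B w w x) <= 0.
  apply: (continuous_nonpos (q := fun y => B w w y - c * Num.sqrt (B w w y))).
    by move=> y; apply: (@continuousB _ _ _ (B w w) (fun y => c * Num.sqrt (B w w y))); [exact: cB|exact: cc].
  move=> chi tchi chi0.
  have i1 := test_cont_intg tchi cB; have i2 := test_cont_intg tchi cs.
  have := H _ tchi chi0; rewrite -subr_le0 -(IZ c i2) -(IB i1 (intgZ c i2)) => h1.
  apply: le_trans h1; rewrite le_eqVlt; apply/orP; left; apply/eqP.
  by apply: eq_Rintegral => y _; ring.
have B0 := form_ge0 vB x sw; rewrite -{1 3}(sqr_sqrtr B0); have s0 := sqrtr_ge0 (B w w x).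
move: (Num.sqrt _) s0 => a a0; rewrite subr_le0 => h1.
move: a0; rewrite le_eqVlt => /orP[/eqP <-|a0]; first by rewrite expr0n sqr_ge0.
by rewrite lerXn2r ?nnegrE//; [exact: ltW|rewrite -(ler_pM2r a0) -expr2].
Qed.

Lemma bound_ge0 f (T : R) : test f -> 0 <= T -> exists C : R, 0 <= C /\ forall t : R, 0 <= t <= T ->
  forall x, B (U f t) (U f t) x <= C.
Proof.
move=> tf T0; have [C HC] := boundB tf T0; exists C; split=> //.
have T00 : 0 <= (0 : R) <= T by rewrite lexx.
by apply: le_trans (HC _ T00 point); apply: (form_ge0 vB); apply: US.
Qed.

(** Fix w = u_t - u_s. By [form_adjoint], r |-> int chi B(u_r, w) is a pairing of the flow with a
    test function, and its derivative is bounded by Cauchy-Schwarz and the (H.3) bound for L f. Its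
    increment from s to t is int chi B(w, w), so [form_pointwise] concludes. *)
Lemma pointwise_lipschitz f (T : R) : test f -> 0 <= T -> exists C : R, 0 <= C /\
  forall s t : R, 0 <= s <= T -> 0 <= t <= T -> forall x,
  B (fun y => U f t y - U f s y) (fun y => U f t y - U f s y) x <= C * (t - s) ^+ 2.
Proof.
move=> tf T0; have tLf := tL tf; have [C [C0 HC]] := bound_ge0 tLf T0; exists C; split=> // s t hs ht x.
have /andP[s0 _] := hs; have /andP[t0 _] := ht.
have Ss := US tf s0; have St := US tf t0; have sw : S (fun y => U f t y - U f s y) by exact: (smoothB at_A).
rewrite -(sqr_sqrtr C0) -(real_normK (num_real (t - s))) -exprMn.
have c0 : 0 <= Num.sqrt C * `|t - s| by rewrite mulr_ge0// sqrtr_ge0.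
apply: (form_pointwise sw c0) => chi tchi chi0; set w := (fun y => U f t y - U f s y) in sw *.
have [psi tpsi Hpsi] := form_adjoint at_A hM finmu smooth_mu vB tchi sw.
have e k r : test k -> 0 <= r -> \int[mu]_x0 (chi x0 * B (U k r) w x0) = ip (U k r) psi.
  by move=> tk r0; rewrite Hpsi; [exact: ipC|exact: US].
have [C' q] := flow_quadratic tf tpsi.
have b r : 0 <= r <= T -> `|ip (U (L f) r) psi| <= Num.sqrt C * \int[mu]_x (chi x * Num.sqrt (B w w x)).
  move=> hr; have /andP[r0 _] := hr; rewrite -e//; apply: form_test_bound => //; first exact: US.
  exact: HC.
have := quadratic_lipschitz q b hs ht; rewrite mulrA [`|_| * Num.sqrt C]mulrC; apply: le_trans.
rewrite Hpsi// (_ : \int[mu]_x0 (psi x0 * w x0) = ip w psi); last exact: ipC.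
rewrite (ip_sub (UL tf t0) (UL tf s0) (tL2 tpsi)); exact: ler_norm.
Qed.

(** Same argument one order higher: w is now the Taylor remainder itself, and (H.3) is applied to L
    L f. *)
Lemma pointwise_taylor f (T : R) : test f -> 0 <= T -> exists C : R, 0 <= C /\
  forall s t : R, 0 <= s <= T -> 0 <= t <= T -> forall x,
  B (fun y => U f t y - U f s y - (t - s) * U (L f) s y)
    (fun y => U f t y - U f s y - (t - s) * U (L f) s y) x <= C * (t - s) ^+ 4.
Proof.
move=> tf T0; have tLf := tL tf; have tLLf := tL tLf.
have [C [C0 HC]] := bound_ge0 tLLf T0; exists C; split=> // s t hs ht x; set w := (fun y => _ - _ - _).
have /andP[s0 _] := hs; have /andP[t0 _] := ht.
have Ss := US tf s0; have St := US tf t0; have SL := US tLf s0.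
have sw : S w by apply: (smoothB at_A); [exact: (smoothB at_A)|exact: (smoothZ at_A)].
rewrite (_ : 4 = 2 * 2)%N// exprM -(sqr_sqrtr C0) -exprMn.
have c0 : 0 <= Num.sqrt C * (t - s) ^+ 2 by rewrite mulr_ge0 ?sqr_ge0// sqrtr_ge0.
apply: (form_pointwise sw c0) => chi tchi chi0.
have [psi tpsi Hpsi] := form_adjoint at_A hM finmu smooth_mu vB tchi sw.
have e k r : test k -> 0 <= r -> \int[mu]_x0 (chi x0 * B (U k r) w x0) = ip (U k r) psi.
  by move=> tk r0; rewrite Hpsi; [exact: ipC|exact: US].
have [C' q] := flow_quadratic tf tpsi; have [C'' q'] := flow_quadratic tLf tpsi.
have b r : 0 <= r <= T -> `|ip (U (L (L f)) r) psi| <= Num.sqrt C * \int[mu]_x (chi x * Num.sqrt (B w w x)).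
  move=> hr; have /andP[r0 _] := hr; rewrite -e//; apply: form_test_bound => //; first exact: US.
  exact: HC.
have := quadratic_remainder q q' b hs ht; rewrite mulrA [_ ^+ 2 * Num.sqrt C]mulrC; apply: le_trans.
rewrite Hpsi// (_ : \int[mu]_x0 (psi x0 * w x0) = ip w psi); last exact: ipC.
rewrite (ip_diff _ (UL tf t0) (UL tf s0) (UL tLf s0) (tL2 tpsi)); exact: ler_norm.
Qed.

(** Expand B(u + w, u + w) with w = (t - s) v + r: the two previous lemmas bound B(w, w) and B(r, r)
    by multiples of (t - s)^2 and (t - s)^4, and Cauchy-Schwarz bounds B(u, r). *)
Lemma form_flow_derivative f (T : R) : test f -> 0 <= T -> exists C : R, 0 <= C /\
  forall s t : R, 0 <= s <= T -> 0 <= t <= T -> forall x,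
  `|B (U f t) (U f t) x - B (U f s) (U f s) x - (t - s) * (2 * B (U f s) (U (L f) s) x)| <= C * (t - s) ^+ 2.
Proof.
move=> tf T0; have tLf := tL tf.
have [C0 [C00 H0]] := bound_ge0 tf T0.
have [C1 [C10 H1]] := pointwise_lipschitz tf T0; have [C2 [C20 H2]] := pointwise_taylor tf T0.
exists (2 * (Num.sqrt C0 * Num.sqrt C2) + C1); split.
  by rewrite addr_ge0// mulr_ge0// mulr_ge0// sqrtr_ge0.
move=> s t hs ht x; have /andP[s0 _] := hs; have /andP[t0 _] := ht.
have Ss := US tf s0; have St := US tf t0; have SL := US tLf s0.
pose u := U f s; pose v := U (L f) s; pose w y := U f t y - u y; pose r y := w y - (t - s) * v y.
have sw : S w by exact: (smoothB at_A).
have sr : S r by apply: (smoothB at_A) => //; exact: (smoothZ at_A).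
have e1 : B (U f t) (U f t) x = B u u x + 2 * B u w x + B w w x.
  rewrite -(form_sqD at_A vB x Ss sw); congr (B _ _ x); apply/funext => y; rewrite /w /u; ring.
have e2 : B u w x = (t - s) * B u v x + B u r x.
  have -> : w = (fun y => (t - s) * v y + r y) by apply/funext => y; rewrite /r; ring.
  rewrite (formDr at_A vB x (smoothZ at_A (t - s) SL) sr Ss).
  by rewrite (formZr at_A vB (t - s) x SL Ss).
have b1 : `|B u r x| <= Num.sqrt C0 * Num.sqrt C2 * (t - s) ^+ 2.
  apply: le_trans (form_abs at_A vB x Ss sr) _; rewrite -mulrA; apply: ler_pM; rewrite ?sqrtr_ge0//.
    by apply: ler_wsqrtr; exact: H0.
  have -> : Num.sqrt C2 * (t - s) ^+ 2 = Num.sqrt (C2 * (t - s) ^+ 4).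
    rewrite sqrtrM// (_ : (t - s) ^+ 4 = ((t - s) ^+ 2) ^+ 2); last by rewrite -exprM.
    by rewrite sqrtr_sqr ger0_norm// sqr_ge0.
  by apply: ler_wsqrtr; exact: (H2 s t hs ht x).
have b2 : `|B w w x| <= C1 * (t - s) ^+ 2.
  by rewrite ger0_norm; [exact: H1|exact: (form_ge0 vB)].
rewrite e1 e2 -/u -/v.
rewrite (_ : _ - _ - _ = 2 * B u r x + B w w x); last by ring.
apply: le_trans (ler_normD _ _) _; rewrite normrM (ger0_norm (ler0n _ 2)).
move: b1 b2; move: (`|B u r x|) (`|B w w x|) (Num.sqrt C0 * Num.sqrt C2) ((t - s) ^+ 2) => a b c e b1 b2; lra.
Qed.

End Pointwise.

(** * Integration by parts along the flow, mass and maximum principle *)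

Lemma flow_Gamma_bound f (T : R) : test f -> 0 <= T -> exists C : R, forall t : R, 0 <= t <= T ->
  forall x, Gamma L (U f t) (U f t) x <= C.
Proof.
move=> tf T0; have [[_ _ _ _ b] _ _ _] := flow tf.
by have [C HC] := b T T0; exists C => t ht x; have [] := HC t ht x.
Qed.

Lemma cutoff_limit w : intg w -> \int[mu]_x (h k x * w x) @[k --> \oo] --> \int[mu]_x w x.
Proof.
move=> iw; have [th h01 hcv _ _] := cutP.
have mh (k : nat) : mfun (h k) by apply: (smooth_mfun at_A); exact: tS.
apply: (@I_dominated _ _ _ mu (fun (k : nat) (x : borel M) => h k x * w x) w (fun x => `|w x|)).
- by move=> k; apply: measurable_funM => //; exact: intg_measurable iw.
- exact: intg_measurable iw.
- exact: intg_norm iw.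
- apply: aeW => x; rewrite -[X in _ --> X]mul1r; apply: cvgM; [exact: hcv|exact: cvg_cst].
- by move=> k x; have /andP[x0 x1] := h01 k x; rewrite normrM ler_piMl// ger0_norm.
Qed.

Lemma cutoff_Gamma k u (C : R) x : S u -> Gamma L u u x <= C ->
  `|Gamma L (h k) u x| <= Num.sqrt (eps k) * Num.sqrt C.
Proof.
move=> su uC; have [th _ _ hG _] := cutP; have [h1 _] := hG k x.
apply: le_trans (form_abs at_A vG x (tS (th k)) su) _.
by apply: ler_pM; rewrite ?sqrtr_ge0// ler_wsqrtr.
Qed.

Lemma sqrt_eps_cvg (C : R) : Num.sqrt (eps k) * C @[k --> \oo] --> (0 : R).
Proof.
have [_ _ _ _ he] := cutP; rewrite -[X in _ --> X](mul0r C).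
apply: cvgM; last exact: cvg_cst.
have := cvg_comp eps Num.sqrt he (@sqrt_continuous R 0); rewrite sqrtr0; apply.
Qed.

(** Formally int p L u = - int Gamma(p, u). With h_k p in place of p there is an extra term p
    Gamma(h_k, u), which tends to 0 uniformly because p and Gamma(u, u) are bounded. *)
Lemma flow_parts_le f t p : test f -> 0 <= t -> S p -> (exists C : R, forall x, `|p x| <= C) ->
  (forall x, 0 <= Gamma L p (U f t) x) -> \int[mu]_x (p x * U (L f) t x) <= 0.
Proof.
move=> tf t0 sp [C pC] Gp; have [th h01 hcv hG he] := cutP.
set u := U f t in Gp *; have su : S u by exact: US.
have [CG HG] := flow_Gamma_bound tf t0.
have uG x : Gamma L u u x <= CG by apply: HG; rewrite t0 lexx.
have C0 : 0 <= C by exact: le_trans (pC point).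
have Lw := UL (tL tf) t0.
have mp : mfun p by exact: (smooth_mfun at_A).
have iw : intg (fun x => p x * U (L f) t x).
  by apply: (intg_ext _ (intg_Mbounded (L2_intg finmu Lw) mp pC)) => x; rewrite mulrC.
pose m := fine (mu setT).
have bound k : \int[mu]_x (h k x * (p x * U (L f) t x)) <= Num.sqrt (eps k) * (Num.sqrt CG * C * m).
  have thp : test (fun x => h k x * p x) by exact: (testMl at_A).
  have := L_Gamma at_A hM finmu dL L1 symL thp su.
  rewrite (_ : \int[mu]_x (h k x * p x * L u x) = \int[mu]_x (h k x * (p x * U (L f) t x))); last first.
    by apply: eq_Rintegral => x _; rewrite LU// mulrA.
  move=> ->; have tG : test (Gamma L (fun x => h k x * p x) u) by exact: (test_form at_A hM vG).
  have iG := test_intg at_A finmu tG; rewrite -(IN iG).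
  rewrite !mulrA -(I_cst mu); apply: (I_le (intgN iG) (intg_cst finmu _)) => x.
  rewrite (formMl vG x (tS (th k)) sp su).
  have /andP[h0 h1] := h01 k x.
  have b1 : `|p x * Gamma L (h k) u x| <= C * (Num.sqrt (eps k) * Num.sqrt CG).
    by rewrite normrM ler_pM// cutoff_Gamma.
  have b2 := mulr_ge0 h0 (Gp x).
  move: b1; rewrite ler_norml => /andP[b1 _].
  rewrite opprD addrC; lra.
have := ler_cvg_to (cutoff_limit iw) (sqrt_eps_cvg (Num.sqrt CG * C * m)); apply.
exact: nearW.
Qed.

Lemma flow_mean0 f t : test f -> 0 <= t -> \int[mu]_x U (L f) t x = 0.
Proof.
move=> tf t0; have sC := smooth_cst at_A.
have vp : forall a : R, (forall x, 0 <= Gamma L (fun=> a) (U f t) x).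
  by move=> a x; rewrite (form_cst at_A vG)//; exact: US.
have i := L2_intg finmu (UL (tL tf) t0).
have b (a : R) : exists C : R, forall x : M, `|a| <= C by exists `|a|.
have h1 := flow_parts_le tf t0 (sC 1) (b 1) (vp 1).
have h2 := flow_parts_le tf t0 (sC (-1)) (b (-1)) (vp (-1)).
apply/eqP; rewrite eq_le; apply/andP; split.
  by apply: le_trans h1; rewrite le_eqVlt; apply/orP; left; apply/eqP; apply: eq_Rintegral => x _; rewrite mul1r.
rewrite -oppr_le0 -(IN i); apply: le_trans h2.
by rewrite le_eqVlt; apply/orP; left; apply/eqP; apply: eq_Rintegral => x _; rewrite mulN1r.
Qed.

Lemma L1_le_L2 w : L2 w -> (\int[mu]_x `|w x|) ^+ 2 <= fine (mu setT) * ip w w.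
Proof.
move=> Lw; have L1' : L2 (fun=> 1 : R) by exact: (L2_cst finmu).
have Lnw : L2 (fun x => `|w x|).
  apply: L2_intro; first by apply: measurableT_comp => //; exact: L2_measurable Lw.
  by apply: (intg_ext _ (L2_sq Lw)) => x; rewrite real_normK ?num_real.
have := L2_CS Lnw L1'.
rewrite (_ : \int[mu]_x (`|w x| * 1) = \int[mu]_x `|w x|); last by apply: eq_Rintegral => x _; rewrite mulr1.
rewrite (_ : \int[mu]_x (1 ^+ 2) = fine (mu setT)); last by rewrite I_cst expr1n mul1r.
rewrite mulrC (_ : \int[mu]_x (`|w x| ^+ 2) = ip w w)//.
by apply: eq_Rintegral => x _; rewrite real_normK ?num_real// expr2.
Qed.

Lemma flow_remainder_L1 f : test f -> exists C : R, 0 <= C /\ forall s t : R, 0 <= s -> 0 <= t ->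
  \int[mu]_x `|U f t x - U f s x - (t - s) * U (L f) s x| <= C * (t - s) ^+ 2.
Proof.
move=> tf; have tLf := tL tf; pose D := fine (mu setT) * ip (L (L f)) (L (L f)).
have m0 : 0 <= fine (mu setT) by exact: fine_ge0.
have D0 : 0 <= D by rewrite mulr_ge0// ip_ge0.
exists (Num.sqrt D); split; first exact: sqrtr_ge0.
move=> s t s0 t0; set w := (fun x => U f t x - U f s x - (t - s) * U (L f) s x).
have Lw : L2 w by apply: (L2B finmu); [apply: (L2B finmu); exact: UL|exact: (L2Z finmu (t - s) (UL tLf s0))].
have i0 : 0 <= \int[mu]_x `|w x| by apply: I_ge0.
have i1 : 0 <= Num.sqrt D * (t - s) ^+ 2 by rewrite mulr_ge0 ?sqr_ge0// sqrtr_ge0.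
rewrite -(@ler_pXn2r _ 2)// ?nnegrE//.
apply: le_trans (L1_le_L2 Lw) _; rewrite exprMn sqr_sqrtr// -exprM /D -mulrA ler_wpM2l// mulrC.
exact: (flow_taylor tf s0 t0).
Qed.

(** The L^1 expansion has a vanishing linear term by [flow_mean0], so increments of the mass are
    quadratic in the time step. *)
Lemma flow_mass f t : test f -> 0 <= t -> \int[mu]_x U f t x = \int[mu]_x f x.
Proof.
move=> tf t0; have [C [C0 HC]] := flow_remainder_L1 tf.
rewrite -{2}(U0 tf).
apply: (quadratic_constant (F := fun t => \int[mu]_x U f t x) (C := C)) => // s r s0 sr rt.
have r0 := le_trans s0 sr; have i1 := L2_intg finmu (UL tf r0); have i2 := L2_intg finmu (UL tf s0).
have i3 := intgZ (r - s) (L2_intg finmu (UL (tL tf) s0)).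
have iw := intgB (intgB i1 i2) i3.
apply: le_trans (HC s r s0 r0); apply: le_trans (I_abs iw).
rewrite (IB (intgB i1 i2) i3) (IB i1 i2) (IZ _ (L2_intg finmu (UL (tL tf) s0))).
by rewrite flow_mean0// mulr0 subr0.
Qed.

Lemma soft_smooth (e c : R) u : 0 < e -> S u -> S (fun x => soft e c (u x)).
Proof.
move=> e0 su; apply: (smooth_sqrt at_A).
  apply: (smoothD at_A); first exact: (smooth_cst at_A).
  by apply: (smoothX at_A); apply: (smoothB at_A) => //; exact: (smooth_cst at_A).
by move=> x; rewrite ltr_wpDr ?sqr_ge0// exprn_gt0.
Qed.

Lemma soft_slope_smooth (e c : R) u : 0 < e -> S u -> S (fun x => (u x - c) / soft e c (u x)).
Proof.
move=> e0 su; apply: (smoothM at_A).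
  by apply: (smoothB at_A) => //; exact: (smooth_cst at_A).
apply: (smoothV at_A); first exact: soft_smooth.
by move=> x; rewrite lt0r_neq0// soft_gt0.
Qed.

(** With r = [soft e c u] and slope p = (u - c) / r, one gets r Gamma(p, u) = (1 - p^2) Gamma(u, u).
    The Leibniz rule for r^2 = e^2 + (u - c)^2 and u - c = p r yields it without a chain rule for
    forms. *)
Lemma soft_slope_Gamma (e c : R) u x : 0 < e -> S u ->
  0 <= Gamma L (fun x => (u x - c) / soft e c (u x)) u x.
Proof.
move=> e0 su; have sC := smooth_cst at_A.
pose r y := soft e c (u y); pose p y := (u y - c) / r y; pose v y := u y - c.
have sr : S r by exact: soft_smooth.
have sp : S p by exact: soft_slope_smooth.
have sv : S v by exact: (smoothB at_A).
have r0 y : 0 < r y by exact: soft_gt0.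
have Gv : Gamma L v u x = Gamma L u u x.
  by rewrite (formBl at_A vG)// (form_cst at_A vG)// subr0.
have e1 : 2 * (r x * Gamma L r u x) = 2 * (v x * Gamma L u u x).
  have E : (fun y => r y * r y) = (fun y => e ^+ 2 + v y * v y).
    by apply/funext => y; rewrite -!expr2 soft_sq.
  have := formMl vG x sr sr su; rewrite E.
  have svv : S (fun y => v y * v y) by exact: (smoothM at_A).
  rewrite (formDl vG)// (form_cst at_A vG)// add0r (formMl vG)// Gv; lra.
have e2 : Gamma L u u x = p x * Gamma L r u x + r x * Gamma L p u x.
  rewrite -Gv -(formMl vG)//; congr (Gamma L _ u x); apply/funext => y.
  by rewrite /p divfK// lt0r_neq0.
have G0 := form_ge0 vG x su.
have vp : v x = p x * r x by rewrite /p divfK// lt0r_neq0.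
have p1 : p x ^+ 2 <= 1.
  by rewrite -real_normK ?num_real// expr_le1// soft_slope.
have e3 : Gamma L r u x = p x * Gamma L u u x.
  have rx := r0 x; apply: (mulfI (lt0r_neq0 rx)).
  by move: e1; rewrite vp; move: (r x) (p x) (Gamma L r u x) (Gamma L u u x) => a b d g; lra.
change (0 <= Gamma L p u x).
rewrite -(pmulr_rge0 _ (r0 x)); move: e2; rewrite e3 => e2.
have -> : r x * Gamma L p u x = (1 - p x ^+ 2) * Gamma L u u x.
  by move: e2; move: (Gamma L u u x) (Gamma L p u x) (p x) (r x) => a b c' d; lra.
by rewrite mulr_ge0// subr_ge0.
Qed.

(** Convex functionals decrease along the flow. For sg = 1 or -1 and e tending to 0 the integrand
    becomes twice the positive part of sg (u - c). *)
Lemma flow_soft f (t sg c e : R) : test f -> 0 <= t -> 0 < e ->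
  \int[mu]_x (sg * (U f t x - c) + soft e c (U f t x)) <= \int[mu]_x (sg * (f x - c) + soft e c (f x)).
Proof.
move=> tf t0 e0.
have [C [C0 HC]] := flow_remainder_L1 tf.
have iS r : 0 <= r -> intg (fun x => soft e c (U f r x)).
  move=> r0; have sU := US tf r0.
  have iU := intgB (L2_intg finmu (UL tf r0)) (intg_cst finmu c).
  apply: (intg_le _ (intgD (intg_cst finmu e) (intg_norm iU))).
    by apply: (smooth_mfun at_A); exact: soft_smooth.
  by move=> x; rewrite ger0_norm; [exact: soft_le (ltW e0)|exact: ltW (soft_gt0 _ _ e0)].
have iA r : 0 <= r -> intg (fun x => sg * (U f r x - c)).
  by move=> r0; apply: intgZ; exact: intgB (L2_intg finmu (UL tf r0)) (intg_cst finmu c).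
have -> : \int[mu]_x (sg * (f x - c) + soft e c (f x)) =
    \int[mu]_x (sg * (U f 0 x - c) + soft e c (U f 0 x)) by rewrite U0.
apply: (quadratic_nonincreasing (F := fun t => \int[mu]_x (sg * (U f t x - c) + soft e c (U f t x)))
  (C := (`|sg| + 1) * C)) => // s r s0 sr rt.
have r0 := le_trans s0 sr.
(* The slope is taken at the later time r, so convexity bounds the increment by p (u_r - u_s).
   Expanded around r, its main term is (r - s) int p L u_r, which is nonpositive. *)
pose p x := sg + (U f r x - c) / soft e c (U f r x).
have sp : S p by apply: (smoothD at_A); [exact: (smooth_cst at_A)|exact: soft_slope_smooth (US tf r0)].
have pC x : `|p x| <= `|sg| + 1.
  by apply: le_trans (ler_normD _ _) _; rewrite lerD2l; exact: soft_slope.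
have mp : mfun p by exact: (smooth_mfun at_A).
have Gp x : 0 <= Gamma L p (U f r) x.
  rewrite (formDl vG)//; [|exact: (smooth_cst at_A)|exact: soft_slope_smooth (US tf r0)|exact: US].
  rewrite (form_cst at_A vG)//; last exact: US.
  by rewrite add0r; apply: soft_slope_Gamma => //; exact: US.
have le0 := flow_parts_le tf r0 sp (ex_intro _ _ pC) Gp.
set w := (fun x => U f s x - U f r x - (s - r) * U (L f) r x).
have iLr := L2_intg finmu (UL (tL tf) r0).
have iw : intg w.
  apply: (intgB (intgB (L2_intg finmu (UL tf s0)) (L2_intg finmu (UL tf r0)))); exact: intgZ.
have ipw : intg (fun x => p x * w x).
  by apply: (intg_ext _ (intg_Mbounded iw mp pC)) => x; rewrite mulrC.
have ipL : intg (fun x => p x * U (L f) r x).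
  by apply: (intg_ext _ (intg_Mbounded iLr mp pC)) => x; rewrite mulrC.
rewrite -(IB (intgD (iA _ r0) (iS _ r0)) (intgD (iA _ s0) (iS _ s0))).
apply: (@le_trans _ _ (\int[mu]_x ((r - s) * (p x * U (L f) r x) - p x * w x))).
  apply: I_le.
  - exact: (intgB (intgD (iA _ r0) (iS _ r0)) (intgD (iA _ s0) (iS _ s0))).
  - exact: (intgB (intgZ _ ipL) ipw).
  - move=> x; have := soft_convex c (U f r x) (U f s x) e0.
    by rewrite /p /w; move: (_ / soft _ _ _) => q; lra.
rewrite (IB (intgZ _ ipL) ipw) (IZ _ ipL).
have h1 : (r - s) * \int[mu]_x (p x * U (L f) r x) <= 0.
  by rewrite mulr_ge0_le0// subr_ge0.
have h2 : `|\int[mu]_x (p x * w x)| <= (`|sg| + 1) * (C * (r - s) ^+ 2).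
  apply: le_trans (I_abs ipw) _.
  apply: (@le_trans _ _ (\int[mu]_x ((`|sg| + 1) * `|w x|))).
    apply: I_le; [exact: intg_norm|by apply: intgZ; exact: intg_norm|].
    by move=> x; rewrite normrM ler_wpM2r.
  rewrite (IZ _ (intg_norm iw)) ler_wpM2l ?addr_ge0//.
  by apply: le_trans (HC r s r0 s0) _; rewrite -(sqrrN (s - r)) opprB.
move: h2; rewrite ler_norml mulrA => /andP[h2 _]; lra.
Qed.

(** The sign sg treats upper and lower bounds at once. If sg (f - c) <= 0, the functional of
    [flow_soft] starts below e mu(M), and it dominates the integral of the positive part at time
    t. *)
Lemma flow_bound f (t sg c : R) : test f -> 0 <= t -> `|sg| = 1 -> (forall x, sg * (f x - c) <= 0) ->
  forall x, sg * (U f t x - c) <= 0.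
Proof.
move=> tf t0 sg1 fc; have sU := US tf t0.
have sgm (a : R) : `|sg * a| = `|a| by rewrite normrM sg1 mul1r.
pose w x := Num.max (sg * (U f t x - c)) 0.
have cw : continuous (fun x => sg * (U f t x - c)).
  apply: (smooth_continuous at_A); apply: (smoothZ at_A); apply: (smoothB at_A) => //.
  exact: (smooth_cst at_A).
have iU := intgB (L2_intg finmu (UL tf t0)) (intg_cst finmu c).
have mw : mfun w.
  by apply: measurable_maxr; [exact: continuous_borel|exact: measurable_cst].
have iw : intg w.
  apply: (intg_le mw (intg_norm iU)) => x; rewrite -[leRHS]sgm /w.
  by case: (leP (sg * (U f t x - c)) 0) => hx; rewrite ?normr0.
have w0 x : 0 <= w x by rewrite /w le_max lexx orbT.
have z : \int[mu]_x w x = 0.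
  apply/eqP; rewrite eq_le I_ge0// andbT; apply/ler_addgt0Pr => e e0; rewrite add0r.
  pose m := fine (mu setT); have m0 : 0 <= m by exact: fine_ge0.
  have d0 : 0 < e / (m + 1) by rewrite divr_gt0// ltr_wpDl.
  set d := e / (m + 1) in d0.
  have iS v : L2 v -> S v -> intg (fun x => sg * (v x - c) + soft d c (v x)).
    move=> Lv sv; have iv := intgB (L2_intg finmu Lv) (intg_cst finmu c).
    apply: (intgD (intgZ sg iv)).
    apply: (intg_le _ (intgD (intg_cst finmu d) (intg_norm iv))).
      by apply: (smooth_mfun at_A); exact: soft_smooth.
    by move=> x; rewrite ger0_norm; [exact: soft_le (ltW d0)|exact: ltW (soft_gt0 _ _ d0)].
  apply: (@le_trans _ _ (\int[mu]_x (sg * (U f t x - c) + soft d c (U f t x)))).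
    apply: (I_le iw (iS _ (UL tf t0) sU)) => x.
    have := soft_ge d c (U f t x); rewrite -sgm /w.
    move: (soft _ _ _) (sg * _) => a b; case: (leP b 0) => hb; rewrite ?(ler0_norm hb) ?(gtr0_norm hb); lra.
  apply: le_trans (flow_soft sg c tf t0 d0) _.
  apply: (@le_trans _ _ (\int[mu]_x d)).
    apply: (I_le (iS _ (tL2 tf) (tS tf)) (intg_cst finmu d)) => x.
    have := soft_le c (f x) (ltW d0); rewrite -sgm; have := fc x.
    by move: (soft _ _ _) (sg * _) => a b b0; rewrite (ler0_norm b0); lra.
  by rewrite I_cst /d; apply: frac_le => //; exact: ltW.
have hz := I0_ae mw w0 iw z.
apply: (ae_le_everywhere at_A smooth_mu (f := fun x => sg * (U f t x - c)) (g := fun=> 0)) => //.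
  exact: cst_continuous.
by apply: (ae_imp hz) => x; rewrite /w => /eqP hx; move: hx; case: (leP (sg * _) 0) => // hx; rewrite gt_eqF.
Qed.

Lemma flow_ge (c : R) f t : test f -> 0 <= t -> (forall x, c <= f x) -> forall x, c <= U f t x.
Proof.
move=> tf t0 fc x; have := @flow_bound f t (-1) c tf t0 ltac:(by rewrite normrN1).
move=> /(_ _ x); rewrite mulN1r oppr_le0 subr_ge0; apply => y.
by rewrite mulN1r oppr_le0 subr_ge0.
Qed.

Lemma flow_le (c : R) f t : test f -> 0 <= t -> (forall x, f x <= c) -> forall x, U f t x <= c.
Proof.
move=> tf t0 fc x; have := @flow_bound f t 1 c tf t0 ltac:(by rewrite normr1).
by move=> /(_ _ x); rewrite mul1r subr_le0; apply => y; rewrite mul1r subr_le0.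
Qed.

Lemma flow_abs (c : R) f t : test f -> 0 <= t -> (forall x, `|f x| <= c) -> forall x, `|U f t x| <= c.
Proof.
move=> tf t0 fc x; rewrite ler_norml.
rewrite (flow_ge tf t0)/=; last first.
  by move=> y; have := fc y; rewrite ler_norml => /andP[].
apply: (flow_le tf t0) => y.
exact: le_trans (ler_norm _) (fc y).
Qed.

(** By the maximum principle the second derivative L L u_r is bounded by sup |L L f|, so the
    remainder tested against chi >= 0 is at most that constant times int chi. *)
Lemma flow_taylor_pointwise f (T : R) : test f -> 0 <= T -> uniform_taylor T (U f) (U (L f)).
Proof.
move=> tf T0; have tLf := tL tf; have tLLf := tL tLf.
have [C0 C00 H0] := test_bounded at_A tf; have [C1 C10 H1] := test_bounded at_A tLf.
have [C2 C20 H2] := test_bounded at_A tLLf.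
exists (C0 + C1 + C2); first by rewrite !addr_ge0.
move=> s t hs ht x; have /andP[s0 _] := hs; have /andP[t0 _] := ht.
split; last 2 first.
- by apply: le_trans (flow_abs tf s0 H0 x) _; lra.
- by apply: le_trans (flow_abs tLf s0 H1 x) _; lra.
apply: (@le_trans _ _ (C2 * (t - s) ^+ 2)); last by rewrite ler_wpM2r ?sqr_ge0//; lra.
pose w x := U f t x - U f s x - (t - s) * U (L f) s x.
have sw : S w.
  by apply: (smoothB at_A); [apply: (smoothB at_A); exact: US|apply: (smoothZ at_A); exact: US].
have Lw : L2 w.
  by apply: (L2B finmu); [apply: (L2B finmu); exact: UL|exact: (L2Z finmu (t - s) (UL tLf s0))].
have cw : continuous w by exact: (smooth_continuous at_A).
have key (sg : R) : `|sg| = 1 -> sg * w x - C2 * (t - s) ^+ 2 <= 0.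
  move=> sg1; apply: (continuous_nonpos
    (q := fun y => sg * w y - C2 * (t - s) ^+ 2)).
    by apply: (smooth_continuous at_A); apply: (smoothB at_A); [exact: (smoothZ at_A)|exact: (smooth_cst at_A)].
  move=> chi tchi chi0; have ichi := test_intg at_A finmu tchi.
  have iw : intg (fun y => w y * chi y) by exact: (ip_intg Lw (tL2 tchi)).
  rewrite (_ : \int[mu]_y _ = \int[mu]_y (sg * (w y * chi y) - (C2 * (t - s) ^+ 2) * chi y)); last first.
    by apply: eq_Rintegral => y _; ring.
  rewrite (IB (intgZ sg iw) (intgZ _ ichi)) (IZ _ iw) (IZ _ ichi) subr_le0.
  have [C q] := flow_quadratic tf tchi; have [C' q'] := flow_quadratic tLf tchi.
  have b (r : R) : 0 <= r <= T -> `|ip (U (L (L f)) r) chi| <= C2 * \int[mu]_y chi y.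
    move=> /andP[r0 _]; have i := ip_intg (UL tLLf r0) (tL2 tchi).
    apply: le_trans (I_abs i) _; rewrite -(IZ _ ichi); apply: (I_le (intg_norm i) (intgZ _ ichi)) => y.
    by rewrite normrM (ger0_norm (chi0 y)) ler_wpM2r// flow_abs.
  have := quadratic_remainder q q' b hs ht.
  rewrite -(ip_diff _ (UL tf t0) (UL tf s0) (UL tLf s0) (tL2 tchi)) => hq.
  apply: le_trans (ler_norm _) _; rewrite normrM sg1 mul1r.
  by apply: le_trans hq _; rewrite mulrCA mulrA.
rewrite ler_norml; have := key 1 (normr1 _); have := key (-1) (normrN1 _); rewrite /w.
move: (_ - _ - _) => a; lra.
Qed.

(** * Comparison with subsolutions *)

Lemma cutoff_sq_limit w : intg w -> \int[mu]_x (h k x ^+ 2 * w x) @[k --> \oo] --> \int[mu]_x w x.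
Proof.
move=> iw; have [th h01 hcv _ _] := cutP.
have mh (k : nat) : mfun (h k) by apply: (smooth_mfun at_A); exact: tS.
apply: (@I_dominated _ _ _ mu (fun (k : nat) (x : borel M) => h k x ^+ 2 * w x) w (fun x => `|w x|)).
- move=> k; apply: measurable_funM; last exact: intg_measurable iw.
  exact: measurable_funX.
- exact: intg_measurable iw.
- exact: intg_norm iw.
- apply: aeW => x; rewrite -[X in _ --> X]mul1r; apply: cvgM; last exact: cvg_cst.
  by rewrite -[X in _ --> X](expr1n _ 2); apply: cvgM; exact: hcv.
- move=> k x; have /andP[x0 x1] := h01 k x.
  by rewrite normrM ler_piMl// ger0_norm ?sqr_ge0// expr_le1.
Qed.

Lemma cutoff_parts k phi v : S phi -> S v ->
  \int[mu]_x (h k x ^+ 2 * (phi x * L v x)) =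
  - \int[mu]_x (h k x ^+ 2 * Gamma L phi v x + 2 * (h k x * phi x * Gamma L (h k) v x)).
Proof.
move=> sp sv; have [th _ _ _ _] := cutP; have sh := tS (th k).
have thp : test (fun x => h k x * (h k x * phi x)).
  by apply: (testMl at_A) => //; exact: (smoothM at_A).
have := L_Gamma at_A hM finmu dL L1 symL thp sv.
rewrite (_ : \int[mu]_x (h k x * (h k x * phi x) * L v x) = \int[mu]_x (h k x ^+ 2 * (phi x * L v x))); last first.
  by apply: eq_Rintegral => x _; ring.
move=> ->; congr (- _); apply: eq_Rintegral => x _.
rewrite (formMl vG x sh (smoothM at_A sh sp) sv) (formMl vG x sh sp sv); ring.
Qed.

(* Caccioppoli's inequality: D <= L Psi is tested against h_k^2 Psi and the
   cross term is absorbed. *)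
Lemma cutoff_energy k Psi D (C : R) : S Psi -> mfun D -> (forall x, 0 <= Psi x <= C) ->
  (forall x, `|D x| <= C) -> (forall x, D x <= L Psi x) ->
  \int[mu]_x (h k x * Num.sqrt (Gamma L Psi Psi x)) <= (1 + 2 * C ^+ 2 + 4 * C ^+ 2 * eps k) * fine (mu setT).
Proof.
move=> sP mD PC DC DL; have [th h01 hcv hG _] := cutP; have sh := tS (th k).
have G0 x := form_ge0 vG x sP; have C0 : 0 <= C by exact: le_trans (DC point).
have cG : continuous (Gamma L Psi Psi) by apply: (smooth_continuous at_A); exact: (form_smooth vG).
have th2 : test (fun x => h k x ^+ 2).
  by have := testMl at_A (th k) sh; congr test_function; apply/funext => x; rewrite expr2.
have i1 : intg (fun x => h k x ^+ 2 * Gamma L Psi Psi x) by exact: (test_cont_intg).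
have i2 : intg (fun x => h k x * Num.sqrt (Gamma L Psi Psi x)).
  apply: (test_cont_intg) => //; exact: (sqrt_form_continuous vG).
have shP : S (Gamma L (h k) Psi) by exact: (form_smooth vG).
have i3 : intg (fun x => h k x * Psi x * Gamma L (h k) Psi x).
  apply: (intg_ext _ (test_intg at_A finmu (testMl at_A (th k) (smoothM at_A sP shP)))) => x.
  by rewrite mulrA.
have i4 : intg (fun x => h k x ^+ 2 * (Psi x * L Psi x)).
  apply: (test_intg at_A finmu); apply: (testMl at_A th2).
  by apply: (smoothM at_A) => //; exact: (L_smooth at_A dL).
have e := cutoff_parts k sP sP.
have lo : - C ^+ 2 * fine (mu setT) <= \int[mu]_x (h k x ^+ 2 * (Psi x * L Psi x)).
  rewrite -(I_cst mu); apply: (I_le (intg_cst finmu _) i4) => x.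
  have /andP[x0 x1] := h01 k x; have /andP[p0 p1] := PC x.
  have h20 : 0 <= h k x ^+ 2 <= 1 by rewrite sqr_ge0 expr_le1.
  have d : - (C * C) <= Psi x * L Psi x.
    apply: (@le_trans _ _ (Psi x * D x)); last by rewrite ler_wpM2l.
    have : `|Psi x * D x| <= C * C by rewrite normrM ler_pM// ger0_norm.
    by rewrite ler_norml => /andP[].
  move: h20 d; move: (h k x ^+ 2) (Psi x * _) (sqr_ge0 C) => p q; rewrite expr2.
  move: (C * C) => c c0 /andP[p0' p1'] d; nra.
have bnd x : h k x ^+ 2 * Gamma L Psi Psi x / 2 - 2 * C ^+ 2 * eps k <=
    h k x ^+ 2 * Gamma L Psi Psi x + 2 * (h k x * Psi x * Gamma L (h k) Psi x).
  have /andP[x0 x1] := h01 k x; have /andP[p0 p1] := PC x; have [he _] := hG k x.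
  have cs := form_CS at_A vG x sh sP.
  have hG0 := form_ge0 vG x sh.
  have h3 : (Psi x * Gamma L (h k) Psi x) ^+ 2 <= C ^+ 2 * eps k * Gamma L Psi Psi x.
    rewrite exprMn -mulrA ler_pM ?sqr_ge0// ?lerXn2r ?nnegrE//.
    by apply: le_trans cs _; rewrite ler_wpM2r.
  have e0 : 0 <= C ^+ 2 * eps k by rewrite mulr_ge0 ?sqr_ge0//; exact: le_trans he.
  have : `|2 * (h k x * (Psi x * Gamma L (h k) Psi x))| <= h k x ^+ 2 * Gamma L Psi Psi x / 2 + 2 * (C ^+ 2 * eps k).
    have q0 : 0 <= h k x ^+ 2 * Gamma L Psi Psi x / 2 by rewrite divr_ge0// mulr_ge0 ?sqr_ge0.
    have q1 : 0 <= h k x ^+ 2 * Gamma L Psi Psi x / 2 + 2 * (C ^+ 2 * eps k) by lra.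
    rewrite -(@ler_pXn2r _ 2)// ?nnegrE// real_normK ?num_real//.
    have := ler_wpM2l (sqr_ge0 (h k x)) h3.
    have := sqr_ge0 (h k x ^+ 2 * Gamma L Psi Psi x / 2 - 2 * (C ^+ 2 * eps k)).
    move: (_ ^+ 2 * eps k) (Psi x * _) (h k x) (Gamma L Psi Psi x) => a b c g s1 s2.
    rewrite -subr_ge0; have -> : (c ^+ 2 * g / 2 + 2 * a) ^+ 2 - (2 * (c * b)) ^+ 2 =
      (c ^+ 2 * g / 2 - 2 * a) ^+ 2 + 4 * (c ^+ 2 * (a * g) - c ^+ 2 * b ^+ 2) by field.
    by rewrite addr_ge0// mulr_ge0// subr_ge0.
  rewrite ler_norml => /andP[h4 _]; move: h4; rewrite mulrA.
  rewrite -[2 * C ^+ 2 * eps k]mulrA -[h k x * Psi x * _]mulrA; lra.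
have i5 : intg (fun x => h k x ^+ 2 * Gamma L Psi Psi x + 2 * (h k x * Psi x * Gamma L (h k) Psi x)).
  exact: (intgD i1 (intgZ 2 i3)).
have e1 : \int[mu]_x (h k x ^+ 2 * Gamma L Psi Psi x) / 2 - 2 * C ^+ 2 * eps k * fine (mu setT) <= C ^+ 2 * fine (mu setT).
  have le : \int[mu]_x (2^-1 * (h k x ^+ 2 * Gamma L Psi Psi x) - 2 * C ^+ 2 * eps k) <=
      \int[mu]_x (h k x ^+ 2 * Gamma L Psi Psi x + 2 * (h k x * Psi x * Gamma L (h k) Psi x)).
    apply: (I_le (intgB (intgZ _ i1) (intg_cst finmu _)) i5) => x.
    by apply: le_trans (bnd x); rewrite mulrC.
  move: le; rewrite (IB (intgZ _ i1) (intg_cst finmu _)) (IZ _ i1) (I_cst mu); move: lo; rewrite e; lra.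
apply: (@le_trans _ _ (\int[mu]_x (1 + h k x ^+ 2 * Gamma L Psi Psi x))).
  apply: (I_le i2 (intgD (intg_cst finmu _) i1)) => x.
  rewrite -{2}(sqr_sqrtr (G0 x)) -exprMn.
  have := sqr_ge0 (h k x * Num.sqrt (Gamma L Psi Psi x) - 1); move: (h k x * _) => a.
  have := sqr_ge0 a; rewrite !expr2; nra.
rewrite (ID (intg_cst finmu 1) i1) (I_cst mu); lra.
Qed.

(** Formally int v D <= int v L Psi = int Psi L v. With h_k^2 inserted there appear Gamma(h_k, v),
    small since Gamma(v, v) is bounded, and Gamma(h_k, Psi), where no bound on Gamma(Psi, Psi) is
    assumed and [cutoff_energy] replaces it. *)
Lemma subsolution_parts v Psi D (C : R) : S v -> S Psi -> mfun D -> intg (L v) ->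
  (forall x, 0 <= v x <= C) -> (forall x, Gamma L v v x <= C) ->
  (forall x, 0 <= Psi x <= C) -> (forall x, `|D x| <= C) -> (forall x, D x <= L Psi x) ->
  \int[mu]_x (v x * D x) <= \int[mu]_x (Psi x * L v x).
Proof.
move=> sv sP mD iLv vC GvC PC DC DL; have [th h01 hcv hG he] := cutP.
have C0 : 0 <= C by exact: le_trans (DC point).
have mv : mfun v by exact: (smooth_mfun at_A).
have mP : mfun Psi by exact: (smooth_mfun at_A).
have iD : intg (fun x => v x * D x).
  apply: (@intg_bounded _ _ _ mu finmu _ (C * C)); first exact: measurable_funM.
  by move=> x; have /andP[v0 v1] := vC x; rewrite normrM ler_pM// ger0_norm.
have iP : intg (fun x => Psi x * L v x).
  have bP x : `|Psi x| <= C by have /andP[p0 p1] := PC x; rewrite ger0_norm.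
  have i := intg_Mbounded iLv mP bP.
  by apply: (intg_ext _ i) => x; rewrite mulrC.
pose m := fine (mu setT); have m0 : 0 <= m by exact: fine_ge0.
(* Collects both cross terms: sqrt C comes from Gamma(v, v), and 1 + 6 C^2 from [cutoff_energy],
   where eps k <= 1 turns 2 C^2 + 4 C^2 eps k into 6 C^2. *)
pose K := 2 * C * (Num.sqrt C + (1 + 6 * C ^+ 2)) * m.
have step (k : nat) : eps k <= 1 ->
    \int[mu]_x (h k x ^+ 2 * (v x * D x)) - \int[mu]_x (h k x ^+ 2 * (Psi x * L v x)) <= Num.sqrt (eps k) * K.
  move=> e1; have sh := tS (th k).
  have th2 : test (fun x => h k x ^+ 2).
    by have := testMl at_A (th k) sh; congr test_function; apply/funext => x; rewrite expr2.
  have iGm u : S u -> intg (fun x => h k x * Num.sqrt (Gamma L u u x)).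
    by move=> su; apply: (test_cont_intg) => //; exact: (sqrt_form_continuous vG).
  have iq u w : S u -> S w -> intg (fun x => h k x * u x * Gamma L (h k) w x).
    move=> su sw; have shP : S (Gamma L (h k) w) by exact: (form_smooth vG).
    apply: (intg_ext _ (test_intg at_A finmu (testMl at_A (th k) (smoothM at_A su shP)))) => x.
    by rewrite mulrA.
  have i1 : intg (fun x => h k x ^+ 2 * Gamma L v Psi x).
    by apply: (test_intg at_A finmu); apply: (testMl at_A th2); exact: (form_smooth vG).
  have en := cutoff_energy k sP mD PC DC DL.
  have le1 : \int[mu]_x (h k x ^+ 2 * (v x * D x)) <= \int[mu]_x (h k x ^+ 2 * (v x * L Psi x)).
    apply: I_le.
    - have mh : mfun (fun x => h k x ^+ 2) by apply: (smooth_mfun at_A); exact: tS.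
      have bh x : `|h k x ^+ 2| <= 1.
        by have /andP[x0 x1] := h01 k x; rewrite ger0_norm ?sqr_ge0// expr_le1.
      have i := intg_Mbounded iD mh bh.
      by apply: (intg_ext _ i) => x; rewrite mulrC.
    - apply: (test_intg at_A finmu); apply: (testMl at_A th2).
      by apply: (smoothM at_A) => //; exact: (L_smooth at_A dL).
    - by move=> x; have /andP[v0 v1] := vC x; rewrite ler_wpM2l ?sqr_ge0// ler_wpM2l.
  apply: le_trans (lerD le1 (lexx _)) _.
  rewrite (cutoff_parts k sv sP) (cutoff_parts k sP sv) opprK addrC (formC vG sP sv).
  rewrite (ID i1 (intgZ 2 (iq _ _ sP sv))) (ID i1 (intgZ 2 (iq _ _ sv sP))).
  rewrite (IZ _ (iq _ _ sP sv)) (IZ _ (iq _ _ sv sP)).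
  have b1 : \int[mu]_x (h k x * Psi x * Gamma L (h k) v x) <= C * (Num.sqrt (eps k) * Num.sqrt C) * m.
    rewrite -(I_cst mu); apply: (I_le (iq _ _ sP sv) (intg_cst finmu _)) => x.
    apply: le_trans (ler_norm _) _; rewrite normrM; have /andP[x0 x1] := h01 k x.
    have /andP[p0 p1] := PC x; apply: ler_pM => //.
      by rewrite normrM !ger0_norm// -[C]mul1r ler_pM.
    exact: (cutoff_Gamma).
  have b2 : - (C * Num.sqrt (eps k) * \int[mu]_x (h k x * Num.sqrt (Gamma L Psi Psi x))) <=
      \int[mu]_x (h k x * v x * Gamma L (h k) Psi x).
    rewrite -mulNr -(IZ _ (iGm _ sP)); apply: (I_le (intgZ _ (iGm _ sP)) (iq _ _ sv sP)) => x.
    rewrite mulNr; have : `|h k x * v x * Gamma L (h k) Psi x| <=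
        C * Num.sqrt (eps k) * (h k x * Num.sqrt (Gamma L Psi Psi x)).
      have /andP[x0 x1] := h01 k x; have /andP[v0 v1] := vC x.
      rewrite normrM [`|h k x * v x|]normrM (ger0_norm x0) (ger0_norm v0).
      have := cutoff_Gamma k sP (lexx (Gamma L Psi Psi x)).
      move=> hg; have hv := ler_pM v0 (normr_ge0 _) v1 hg.
      have := ler_wpM2l x0 hv; rewrite !mulrA => h'; apply: le_trans h' _.
      by rewrite le_eqVlt; apply/orP; left; apply/eqP; ring.
    by rewrite ler_norml => /andP[].
  have s0 := sqrtr_ge0 (eps k); have sC := sqrtr_ge0 C.
  have b3 : C * Num.sqrt (eps k) * \int[mu]_x (h k x * Num.sqrt (Gamma L Psi Psi x)) <=
      C * Num.sqrt (eps k) * ((1 + 6 * C ^+ 2) * m).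
    rewrite ler_wpM2l ?mulr_ge0//; apply: le_trans en _; rewrite ler_wpM2r//.
    have := sqr_ge0 C => c2; have := ler_wpM2l c2 e1; rewrite mulr1 => c3; lra.
  move: b1 b2 b3; rewrite /K; move: (Rintegral _ _ _) (Rintegral _ _ _) (Rintegral _ _ _) (Rintegral _ _ _) => a b c d; lra.
have l1 : \int[mu]_x (h k x ^+ 2 * (v x * D x)) - \int[mu]_x (h k x ^+ 2 * (Psi x * L v x)) @[k --> \oo]
    --> \int[mu]_x (v x * D x) - \int[mu]_x (Psi x * L v x).
  by apply: cvgB; exact: cutoff_sq_limit.
rewrite -subr_le0; apply: (ler_cvg_to l1 (sqrt_eps_cvg K)).
have : \forall k \near \oo, eps k < 1 by exact: (cvgr_lt _ he).
by apply: filterS => k hk; apply: step; exact: ltW.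
Qed.

(** Along s |-> int U g (T - s) Psi_s the derivative is int U g (T - s) D_s - int Psi_s L(U g (T -
    s)), nonpositive by [subsolution_parts]. The uniform expansion of the product justifies this up
    to a quadratic error. *)
Lemma flow_comparison g (T : R) (Psi D : R -> M -> R) : test g -> (forall x, 0 <= g x) -> 0 <= T ->
  uniform_taylor T Psi D -> (forall s : R, 0 <= s <= T -> S (Psi s)) ->
  (forall s : R, 0 <= s <= T -> mfun (D s)) ->
  (forall (s : R) x, 0 <= s <= T -> 0 <= Psi s x) ->
  (forall (s : R) x, 0 <= s <= T -> D s x <= L (Psi s) x) ->
  \int[mu]_x (g x * Psi T x) <= \int[mu]_x (U g T x * Psi 0 x).
Proof.
move=> tg g0 T0 tP sP mD P0 DL; have tLg := tL tg.
have tU := taylor_rev (flow_taylor_pointwise tg T0).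
have [C C0 HC] := taylorM T0 tU tP.
have [CP CP0 HP] := tP.
have [Cg Cg0 Hg] := test_bounded at_A tg.
have [CG HG] := flow_Gamma_bound tg T0.
have rv (s : R) : 0 <= s <= T -> 0 <= T - s <= T by move=> /andP[? ?]; apply/andP; split; lra.
have b0 (s : R) : 0 <= s <= T -> 0 <= T - s by move=> /rv/andP[].
have iP (s : R) : 0 <= s <= T -> intg (fun x => U g (T - s) x * Psi s x).
  move=> hs; apply: (@intg_bounded _ _ _ mu finmu _ C).
    by apply: (smooth_mfun at_A); apply: (smoothM at_A); [apply: US => //; exact: b0|exact: sP].
  by move=> x; have [] := HC s s hs hs x.
have -> : \int[mu]_x (g x * Psi T x) = \int[mu]_x (U g (T - T) x * Psi T x) by rewrite subrr U0.
have -> : \int[mu]_x (U g T x * Psi 0 x) = \int[mu]_x (U g (T - 0) x * Psi 0 x) by rewrite subr0.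
apply: (quadratic_nonincreasing (F := fun s => \int[mu]_x (U g (T - s) x * Psi s x))
  (C := C * fine (mu setT))) => // s t s0 st tT.
have hs : 0 <= s <= T by apply/andP; split; lra.
have ht : 0 <= t <= T by apply/andP; split; lra.
have vs := b0 s hs; have sv := US tg vs.
have iLv := L2_intg finmu (UL tLg vs).
pose K := Num.max (Num.max Cg CG) CP.
have K1 : Cg <= K by rewrite /K !le_max lexx.
have K2 : CG <= K by rewrite /K !le_max lexx orbT.
have K3 : CP <= K by rewrite /K !le_max lexx !orbT.
have gK x : 0 <= U g (T - s) x <= K.
  rewrite (flow_ge tg vs g0)/=.
  by apply: le_trans (ler_norm _) _; apply: le_trans (flow_abs tg vs Hg x) K1.
have PK x : 0 <= Psi s x <= K.
  by rewrite P0//=; have [_ p _] := HP s s hs hs x; apply: le_trans (ler_norm _) (le_trans p K3).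
have DK x : `|D s x| <= K by have [_ _ p] := HP s s hs hs x; exact: le_trans p K3.
have Gv x : Gamma L (U g (T - s)) (U g (T - s)) x <= K by apply: le_trans K2; apply: HG; exact: rv.
have iLv' : intg (L (U g (T - s))) by rewrite LU.
have sub := subsolution_parts sv (sP s hs) (mD s hs) iLv' gK Gv PK DK (fun x => DL s x hs).
have iD : intg (fun x => U g (T - s) x * D s x).
  apply: (@intg_bounded _ _ _ mu finmu _ (K * K)).
    by apply: measurable_funM; [exact: (smooth_mfun at_A)|exact: mD].
  by move=> x; have /andP[v0 v1] := gK x; rewrite normrM ler_pM// ger0_norm.
have iLP : intg (fun x => Psi s x * L (U g (T - s)) x).
  have bP x : `|Psi s x| <= K by have /andP[p0 p1] := PK x; rewrite ger0_norm.
  have mP : mfun (Psi s) by apply: (smooth_mfun at_A); exact: sP.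
  have i := intg_Mbounded iLv' mP bP.
  by apply: (intg_ext _ i) => x; rewrite mulrC.
rewrite -(IB (iP t ht) (iP s hs)).
apply: (@le_trans _ _ (\int[mu]_x ((t - s) * (U g (T - s) x * D s x - Psi s x * L (U g (T - s)) x) + C * (t - s) ^+ 2))).
  apply: (I_le (intgB (iP t ht) (iP s hs)) (intgD (intgZ _ (intgB iD iLP)) (intg_cst finmu _))) => x.
  have [a _ _] := HC s t hs ht x; move: a; rewrite ler_norml => /andP[_]; rewrite LU//.
  by move: (U (L g) (T - s) x) => c; lra.
rewrite (ID (intgZ _ (intgB iD iLP)) (intg_cst finmu _)) (IZ _ (intgB iD iLP)) (IB iD iLP) (I_cst mu).
have : (t - s) * (\int[mu]_x (U g (T - s) x * D s x) - \int[mu]_x (Psi s x * L (U g (T - s)) x)) <= 0.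
  by rewrite mulr_ge0_le0 ?subr_ge0 ?subr_le0.
by rewrite [C * fine _ * _]mulrAC; lra.
Qed.

Lemma form_taylor B f (T : R) : vertical_form A B ->
  (forall f (T : R), test f -> 0 <= T -> exists C : R, forall t : R, 0 <= t <= T ->
    forall x, B (U f t) (U f t) x <= C) ->
  test f -> 0 <= T ->
  uniform_taylor T (fun s x => B (U f s) (U f s) x) (fun s x => 2 * B (U f s) (U (L f) s) x).
Proof.
move=> vB bB tf T0; have tLf := tL tf.
have [C [C0 HC]] := form_flow_derivative vB bB tf T0.
have [K [K0 HK]] := bound_ge0 vB bB tf T0.
have [K' [K'0 HK']] := bound_ge0 vB bB tLf T0.
have kk : 0 <= Num.sqrt K * Num.sqrt K' by rewrite mulr_ge0 ?sqrtr_ge0.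
exists (C + K + 2 * (Num.sqrt K * Num.sqrt K')); first by rewrite !addr_ge0// mulr_ge0.
move=> s t hs ht x; have /andP[s0 _] := hs; split.
- apply: le_trans (HC s t hs ht x) _; rewrite ler_wpM2r ?sqr_ge0//; lra.
- rewrite ger0_norm; last by apply: (form_ge0 vB); exact: US.
  by apply: le_trans (HK s hs x) _; lra.
- rewrite normrM (ger0_norm (ler0n _ 2)).
  have b : `|B (U f s) (U (L f) s) x| <= Num.sqrt K * Num.sqrt K'.
    apply: le_trans (form_abs at_A vB x (US tf s0) (US tLf s0)) _.
    by apply: ler_pM; rewrite ?sqrtr_ge0//; apply: ler_wsqrtr; [exact: HK|exact: HK'].
  by move: b; move: (`|_|) => b; lra.
Qed.

(** * Oscillation along subunit curves and perimeter *)

Hypothesis connL : subunit_connected A L.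

(** Along a subunit curve u is absolutely continuous, and almost everywhere its derivative is at
    most Gamma(u, u)^(1/2) <= c. *)
Lemma subunit_oscillation u (c : R) x y : S u -> 0 <= c -> (forall z, Gamma L u u z <= c ^+ 2) ->
  forall T : R, joining_lengths A L x y T -> `|u y - u x| <= c * T.
Proof.
move=> su c0 Gc T [T0 [gam [[_ /(_ _ su)[ac ae]] <- <-]]].
apply: (@ac_lipschitz _ (u \o gam) T c) => //.
have [N0 [mN zN sN]] := ae; exists N0; split=> // t /= nt; apply: sN => /= h1; apply: nt => t0.
have [dt le] := h1 t0; split=> //; by apply: le_trans le _; rewrite -[leRHS]ger0_norm// -sqrtr_sqr ler_wsqrtr.
Qed.

(* As k grows, the divergences of these admissible fields tend to L u / c. *)
Lemma perimeter_field k u (c : R) : S u -> 0 < c -> (forall x, Gamma L u u x <= c ^+ 2) ->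
  let phi g x := c^-1 * (h k x * Gamma L u g x) in
  [/\ subunit_field A L phi, compactly_supported_field A phi &
      is_divergence mu A phi (fun x => c^-1 * (h k x * L u x + Gamma L (h k) u x))].
Proof.
move=> su c0 Gc phi; have [th h01 _ _ _] := cutP; have sh := tS (th k).
have ci0 : 0 <= c^-1 by rewrite invr_ge0 ltW.
split.
- split.
    move=> ch Ach; have [a [sa _ aE]] := Gamma_chart at_A dL L1 Ach.
    have oc := open_cimg at_A Ach.
    exists (fun j y => c^-1 * (in_chart ch (h k) y * \sum_(i < n) a i j y * partial i (in_chart ch u) y)).
    split.
      move=> j; apply: CkZ => //; apply: CkM => //; first exact: (sh _ Ach 1%N).
      apply: Ck_sum => // i; apply: CkM => //; first exact: sa.
      by apply: Ck_partial; exact: (su _ Ach 2%N).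
    move=> g sg x chx; rewrite /phi (aE u g x su sg chx) /principal_form.
    have chK : in_chart ch (h k) (cmap ch x) = h k x.
      by rewrite /in_chart /= (cmapK at_A).
    rewrite chK exchange_big/= mulrA big_distrr/=; apply: eq_bigr => j _.
    rewrite -!mulrA; congr (_ * (_ * _)); rewrite big_distrl/=.
    by apply: eq_bigr => i _.
  move=> g sg x; rewrite /phi; have /andP[x0 x1] := h01 k x.
  rewrite normrM normrM (ger0_norm ci0) (ger0_norm x0).
  rewrite ler_pdivrMl//; apply: (@le_trans _ _ `|Gamma L u g x|); first by rewrite ler_piMl.
  apply: le_trans (form_abs at_A vG x su sg) _; rewrite ler_wpM2r ?sqrtr_ge0//.
  by rewrite -[leRHS]ger0_norm ?(ltW c0)// -sqrtr_sqr ler_wsqrtr.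
- exists (supp (h k)); first by case: (th k).
  by move=> g sg x nx; rewrite /phi (supp_out nx) mul0r mulr0.
- have sL := L_smooth at_A dL su; have sG : S (Gamma L (h k) u) by exact: (form_smooth vG).
  split.
    apply: (smooth_continuous at_A); apply: (smoothZ at_A).
    by apply: (smoothD at_A) => //; exact: (smoothM at_A).
  move=> g tg; have sg := tS tg.
  have i1 : intg (fun x => g x * h k x * L u x).
    by apply: (test_intg at_A finmu); apply: (testMl at_A) => //; exact: (testMl at_A).
  have i2 : intg (fun x => g x * Gamma L (h k) u x).
    by apply: (test_intg at_A finmu); exact: (testMl at_A).
  have i3 : intg (fun x => h k x * Gamma L u g x).
    by apply: (test_intg at_A finmu); apply: (testMl at_A) => //; exact: (form_smooth vG).
  have thg : test (fun x => g x * h k x) by exact: (testMl at_A).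
  have lg := L_Gamma at_A hM finmu dL L1 symL thg su.
  rewrite (_ : \int[mu]_x _ = \int[mu]_x (c^-1 * (g x * h k x * L u x + g x * Gamma L (h k) u x))); last first.
    by apply: eq_Rintegral => x _; ring.
  rewrite (IZ _ (intgD i1 i2)) (ID i1 i2) lg.
  rewrite (_ : \int[mu]_x Gamma L (fun y => g y * h k y) u x =
      \int[mu]_x (g x * Gamma L (h k) u x + h k x * Gamma L u g x)); last first.
    by apply: eq_Rintegral => x _; rewrite (formMl vG x sg sh su) (formC vG su sg).
  rewrite (ID i2 i3) /phi (IZ _ i3).
  by move: (Rintegral _ _ _) (Rintegral _ _ _) => p q; ring.
Qed.

(** The fields of [perimeter_field] compete in the definition of the perimeter. The term Gamma(h_k,
    u) of their divergence is of order c (eps k)^(1/2) and disappears in the limit. *)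
Lemma L_perimeter u (c : R) (E : set (borel M)) : S u -> 0 < c -> (forall x, Gamma L u u x <= c ^+ 2) ->
  intg (L u) -> caccioppoli mu A L E ->
  \int[mu]_x (\1_E x * L u x) <= c * fine (perimeter mu A L E).
Proof.
move=> su c0 Gc iL [mE [_ pE]]; have [th h01 hcv _ _] := cutP.
have mind : mfun (\1_E : M -> R) by exact: measurable_indic.
have bind x : `|(\1_E x : R)| <= 1 by rewrite indicE; case: (_ \in _); rewrite /= ?normr1 ?normr0.
have iEL : intg (fun x => \1_E x * L u x).
  by have i := intg_Mbounded iL mind bind; apply: (intg_ext _ i) => x; rewrite mulrC.
have c00 := ltW c0.
have iG k : intg (fun x => Gamma L (h k) u x * \1_E x).
  apply: (intg_Mbounded _ mind bind); apply: (test_intg at_A finmu).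
  exact: (test_form at_A hM vG).
have ihL k : intg (fun x => h k x * (\1_E x * L u x)).
  have b x : `|h k x| <= 1 by have /andP[x0 x1] := h01 k x; rewrite ger0_norm.
  have mh : mfun (h k) by apply: (smooth_mfun at_A); exact: tS.
  by have i := intg_Mbounded iEL mh b; apply: (intg_ext _ i) => x; rewrite mulrC.
have step k : \int[mu]_x (h k x * (\1_E x * L u x)) + \int[mu]_x (Gamma L (h k) u x * \1_E x) <=
    c * fine (perimeter mu A L E).
  have [sf cf df] := perimeter_field k su c0 Gc.
  pose D x := c^-1 * (h k x * L u x + Gamma L (h k) u x).
  have iD : intg (fun x => \1_E x * D x).
    apply: (intg_ext _ (intgZ c^-1 (intgD (ihL k) (iG k)))) => x.
    by rewrite /D; ring.
  have eD : (\int[mu]_x (\1_E x * D x)%:E)%E = (\int[mu]_x (\1_E x * D x))%:E.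
    by rewrite /Rintegral fineK//; exact: (integrable_fin_num _ iD).
  have le : ((\int[mu]_x (\1_E x * D x))%:E <= perimeter mu A L E)%E.
    by apply: ereal_sup_ubound; eexists; exists D; split; [exact: sf|exact: cf|exact: df|rewrite eD].
  have fP : perimeter mu A L E \is a fin_num.
    rewrite fin_numElt pE andbT; apply: lt_le_trans le; exact: ltNyr.
  move: le; rewrite -(fineK fP) lee_fin.
  rewrite (_ : \int[mu]_x (\1_E x * D x) =
    c^-1 * (\int[mu]_x (h k x * (\1_E x * L u x)) + \int[mu]_x (Gamma L (h k) u x * \1_E x))).
    by rewrite ler_pdivrMl.
  rewrite -(ID (ihL k) (iG k)) -(IZ _ (intgD (ihL k) (iG k))).
  by apply: eq_Rintegral => x _; rewrite /D; ring.
have l1 := cutoff_limit iEL.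
have l2 : - (Num.sqrt (eps k) * (c * fine (mu setT))) @[k --> \oo] --> (0 : R).
  by rewrite -[X in _ --> X]oppr0; apply: cvgN; exact: (sqrt_eps_cvg).
have l3 : \int[mu]_x (h k x * (\1_E x * L u x)) - Num.sqrt (eps k) * (c * fine (mu setT)) @[k --> \oo]
    --> \int[mu]_x (\1_E x * L u x) + 0 by exact: cvgD.
rewrite -[leLHS]addr0; apply: (ler_cvg_to l3 (cvg_cst _)); apply: nearW => k.
apply: le_trans (step k); rewrite lerD2l.
rewrite mulrA -mulNr -(I_cst mu); apply: (I_le (intg_cst finmu _) (iG k)) => x.
have := cutoff_Gamma k su (Gc x).
rewrite sqrtr_sqr (ger0_norm c00) => b.
have : `|Gamma L (h k) u x * \1_E x| <= Num.sqrt (eps k) * c.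
  by rewrite normrM; apply: le_trans b; rewrite ler_piMr.
by rewrite ler_norml => /andP[].
Qed.

Lemma set_integral_quadratic f (E : set (borel M)) : measurable E -> test f -> exists C : R,
  quadratic_at (fun t => \int[mu]_x (\1_E x * U f t x)) (fun t => \int[mu]_x (\1_E x * U (L f) t x)) C.
Proof.
move=> mE tf; have [C [C0 HC]] := flow_remainder_L1 tf.
exists C => s t s0 t0; apply: le_trans (HC s t s0 t0).
have mind : mfun (\1_E : M -> R) by exact: measurable_indic.
have bind x : `|(\1_E x : R)| <= 1 by rewrite indicE; case: (_ \in _); rewrite /= ?normr1 ?normr0.
have i g (r : R) : test g -> 0 <= r -> intg (fun x => \1_E x * U g r x).
  move=> tg r0; have j := intg_Mbounded (L2_intg finmu (UL tg r0)) mind bind.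
  by apply: (intg_ext _ j) => x; rewrite mulrC.
have tLf := tL tf; have i1 := i _ _ tf t0; have i2 := i _ _ tf s0; have i3 := i _ _ tLf s0.
rewrite -(IZ _ i3) -(IB i1 i2) -(IB (intgB i1 i2) (intgZ _ i3)).
have iw : intg (fun x => U f t x - U f s x - (t - s) * U (L f) s x).
  exact: (intgB (intgB (L2_intg finmu (UL tf t0)) (L2_intg finmu (UL tf s0)))
    (intgZ _ (L2_intg finmu (UL tLf s0)))).
apply: le_trans (I_abs (intgB (intgB i1 i2) (intgZ _ i3))) _.
apply: (I_le (intg_norm (intgB (intgB i1 i2) (intgZ _ i3))) (intg_norm iw)) => x.
rewrite (_ : _ - _ = \1_E x * (U f t x - U f s x - (t - s) * U (L f) s x)); last by ring.
by rewrite normrM ler_piMl.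
Qed.

(** * The gradient bound *)

Variables rho1 rho2 kappa dim lam : R.
Hypothesis lam_gt0 : 0 < lam.
Hypothesis rho2_gt0 : 0 < rho2.
Hypothesis kappa_ge0 : 0 <= kappa.
Hypothesis dim_gt0 : 0 < dim.
Hypothesis rho1E : rho1 = lam * (rho2 + kappa).
Hypothesis cd : CD A L GZ rho1 rho2 kappa dim.

(* CD with nu = (E - 1) / (lam E), multiplied by lam E (E - 1). *)
Lemma CD_weighted u (E : R) x : S u -> 1 <= E ->
  (lam * (E * (E - 1)) * rho1 - kappa * lam ^+ 2 * E ^+ 2) * Gamma L u u x +
    lam * (E * (E - 1)) * rho2 * GZ u u x <=
  lam * (E * (E - 1)) * Gamma2 L u x + (E - 1) * (E - 1) * Gamma2Z L GZ u x.
Proof.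
move=> su; rewrite le_eqVlt => /orP[/eqP <-|E1].
  have : 0 <= kappa * lam ^+ 2 * Gamma L u u x.
    have G0 := form_ge0 vG x su.
    by apply: mulr_ge0 => //; rewrite mulr_ge0// sqr_ge0.
  by rewrite subrr expr1n; move: (Gamma L u u x) => G; lra.
have E0 : 0 < E by exact: lt_trans E1.
have e0 : 0 < E - 1 by rewrite subr_gt0.
pose nu := (E - 1) / (lam * E).
have nu0 : 0 < nu by rewrite divr_gt0// mulr_gt0.
have := cd su nu0 x; pose a := lam * (E * (E - 1)).
have a0 : 0 <= a by rewrite !mulr_ge0// ltW.
move=> /(ler_wpM2l a0) H; rewrite -/a.
have en : a * nu = (E - 1) * (E - 1) by rewrite /a /nu; field; rewrite !lt0r_neq0.
have ek : a * (kappa / nu) = kappa * lam ^+ 2 * E ^+ 2 by rewrite /a /nu; field; rewrite !lt0r_neq0.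
have q : 0 <= a * (dim^-1 * (L u x) ^+ 2) by rewrite mulr_ge0// mulr_ge0 ?sqr_ge0// invr_ge0 ltW.
apply: le_trans (_ : _ <= a * (Gamma2 L u x + nu * Gamma2Z L GZ u x)) _; last first.
  by rewrite mulrDr mulrA en.
apply: le_trans H; rewrite -ek !mulrDr.
by move: q; move: (Gamma L u u x) (GZ u u x) (kappa / nu) (dim^-1) (L u x) => G Z k j l q; lra.
Qed.

Theorem gradient_bound f (T : R) x : test f -> (forall y, `|f y| <= 1) -> 0 < T ->
  (expR (lam * rho2 * T) - 1) * Gamma L (U f T) (U f T) x <= lam * (rho2 + 2 * kappa) / 2.
Proof.
move=> tf f1 T0; have T0' := ltW T0; have tLf := tL tf.
pose al := lam * rho2; have al0 : 0 < al by exact: mulr_gt0.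
pose E s := expR (al * s).
have E1 (s : R) : 0 <= s -> 1 <= E s.
  by move=> s0; rewrite -(@expR0 R) ler_expR mulr_ge0// ltW.
have ET0 : 0 < E T by exact: expR_gt0.
(* Dominates lam^2 (rho2 + 2 kappa) e^(al s), the deficit that the weights leave in front of Gamma,
   for all s <= T. *)
pose C0 := lam * (lam * (rho2 + 2 * kappa)) * E T.
have c0 : 0 <= lam * (rho2 + 2 * kappa) by rewrite mulr_ge0 ?(ltW lam_gt0)// addr_ge0 ?(ltW rho2_gt0)// mulr_ge0.
have C00 : 0 <= C0 := mulr_ge0 (mulr_ge0 (ltW lam_gt0) c0) (ltW ET0).
pose Psi (s : R) y := lam * (E s * (E s - 1)) * Gamma L (U f s) (U f s) y +
  (E s - 1) * (E s - 1) * GZ (U f s) (U f s) y + C0 / 2 * (U f s y * U f s y).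
(* The time derivative of [Psi], as confirmed by [tP]. *)
pose D (s : R) y := lam * (al * (E s * E s + E s * (E s - 1))) * Gamma L (U f s) (U f s) y +
  lam * (E s * (E s - 1)) * (2 * Gamma L (U f s) (U (L f) s) y) +
  2 * al * (E s * (E s - 1)) * GZ (U f s) (U f s) y +
  (E s - 1) * (E s - 1) * (2 * GZ (U f s) (U (L f) s) y) + C0 * (U f s y * U (L f) s y).
have bG g (r : R) : test g -> 0 <= r -> exists C : R, forall t : R, 0 <= t <= r ->
    forall x, Gamma L (U g t) (U g t) x <= C by exact: (flow_Gamma_bound).
have bZ g (r : R) : test g -> 0 <= r -> exists C : R, forall t : R, 0 <= t <= r ->
    forall x, GZ (U g t) (U g t) x <= C.
  move=> tg r0; have [[_ _ _ _ b] _ _ _] := flow tg.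
  by have [C HC] := b r r0; exists C => t ht y; have [] := HC t ht y.
have tE := @taylor_expR R M T al T0'.
have tm1 : uniform_taylor T (fun _ (_ : M) => - 1 : R) (fun _ _ => 0).
  exact: (@taylor_cst R M T (fun=> -1) `|-1|).
have tE1 := taylorD tE tm1.
have tu := flow_taylor_pointwise tf T0'.
have tP : uniform_taylor T Psi D.
  have h1 := taylorM T0' (taylorZ lam T0' (taylorM T0' tE tE1)) (form_taylor vG bG tf T0').
  have h2 := taylorM T0' (taylorM T0' tE1 tE1) (form_taylor vZ bZ tf T0').
  have h3 := taylorZ (C0 / 2) T0' (taylorM T0' tu tu).
  apply: taylor_ext (taylorD (taylorD h1 h2) h3) => s y //.
  by rewrite /D /E; move: (expR _) (Gamma L _ _ y) (Gamma L _ _ y) (GZ _ _ y) (GZ _ _ y) => e a b c k; field.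
have sG s g w : test g -> test w -> 0 <= s -> S (Gamma L (U g s) (U w s)).
  by move=> tg tw s0; apply: (form_smooth vG); exact: US.
have sZ s g w : test g -> test w -> 0 <= s -> S (GZ (U g s) (U w s)).
  by move=> tg tw s0; apply: (form_smooth vZ); exact: US.
have sUU s w : test w -> 0 <= s -> S (fun y => U f s y * U w s y).
  by move=> tw s0; apply: (smoothM at_A); exact: US.
have sP (s : R) : 0 <= s <= T -> S (Psi s).
  move=> /andP[s0 _]; apply: (smoothD at_A); last by apply: (smoothZ at_A); exact: sUU.
  by apply: (smoothD at_A); apply: (smoothZ at_A); [exact: sG|exact: sZ].
have mD (s : R) : 0 <= s <= T -> mfun (D s).
  move=> /andP[s0 _]; apply: (smooth_mfun at_A).
  apply: (smoothD at_A); last by apply: (smoothZ at_A); exact: sUU.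
  apply: (smoothD at_A); last by do 2!apply: (smoothZ at_A); exact: sZ.
  apply: (smoothD at_A); last by apply: (smoothZ at_A); exact: sZ.
  by apply: (smoothD at_A); [apply: (smoothZ at_A)|do 2!apply: (smoothZ at_A)]; exact: sG.
have P0 (s : R) y : 0 <= s <= T -> 0 <= Psi s y.
  move=> /andP[s0 _]; have e1 := E1 s s0; have e0 := le_trans ler01 e1.
  have G0 := form_ge0 vG y (US tf s0); have Z0 := form_ge0 vZ y (US tf s0).
  have em : 0 <= E s - 1 by rewrite subr_ge0.
  have p1 := mulr_ge0 (mulr_ge0 (ltW lam_gt0) (mulr_ge0 e0 em)) G0.
  have p2 := mulr_ge0 (mulr_ge0 em em) Z0.
  have p3 : 0 <= C0 / 2 * (U f s y * U f s y) by rewrite -expr2 mulr_ge0 ?sqr_ge0// divr_ge0.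
  exact: addr_ge0 (addr_ge0 p1 p2) p3.
have DL (s : R) y : 0 <= s <= T -> D s y <= L (Psi s) y.
  move=> /andP[s0 sT]; have e1 := E1 s s0; have su := US tf s0.
  have sGu := sG s f f tf tf s0; have sZu := sZ s f f tf tf s0.
  rewrite (LD at_A dL) //; [|by apply: (smoothD at_A); exact: (smoothZ at_A)|by apply: (smoothZ at_A); exact: sUU].
  rewrite (LD at_A dL) //; [|exact: (smoothZ at_A)|exact: (smoothZ at_A)].
  rewrite (LZ at_A dL L1 _ y sGu) (LZ at_A dL L1 _ y sZu) (LZ at_A dL L1 _ y (sUU s f tf s0)).
  rewrite (LM L (U f s) (U f s) y); have w := CD_weighted y su e1.
  have G0 := form_ge0 vG y su.
  have Es : E s <= E T by rewrite ler_expR ler_wpM2l// ltW.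
  have cE : 0 <= (C0 - lam * (lam * (rho2 + 2 * kappa)) * E s) * Gamma L (U f s) (U f s) y.
    by rewrite mulr_ge0// subr_ge0 ler_wpM2l// mulr_ge0// ltW.
  have e2 : L (Gamma L (U f s) (U f s)) y = 2 * Gamma2 L (U f s) y + 2 * Gamma L (U f s) (U (L f) s) y.
    by rewrite /Gamma2 (LU tf s0); move: (L (Gamma _ _ _) y) (Gamma _ _ _ y) => a b; field.
  have e3 : L (GZ (U f s) (U f s)) y = 2 * Gamma2Z L GZ (U f s) y + 2 * GZ (U f s) (U (L f) s) y.
    by rewrite /Gamma2Z (LU tf s0); move: (L (GZ _ _) y) (GZ _ _ y) => a b; field.
  (* The Gamma^Z terms cancel since al = lam rho2, and the e^2 terms of Gamma cancel by [rho1E]. The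
     leftover multiple of Gamma is nonnegative by [cE]. *)
  rewrite e2 e3 (LU tf s0) /D /al; move: w cE; rewrite rho1E.
  move: (Gamma2 L _ y) (Gamma2Z _ _ _ y) (Gamma L _ _ y) (Gamma L _ _ y) (GZ _ _ y) (GZ _ _ y) (E s)
    (U f s y) (U (L f) s y) => G2 Z2 X G Y Z e a b w cE.
  lra.
have cG := smooth_continuous at_A (sG T f f tf tf T0').
have key : forall y, lam * (E T * (E T - 1)) * Gamma L (U f T) (U f T) y - C0 / 2 <= 0.
  apply: (continuous_nonpos).
    by apply: (smooth_continuous at_A); apply: (smoothB at_A);
      [apply: (smoothZ at_A); exact: sG|exact: (smooth_cst at_A)].
  move=> chi tchi chi0.
  have cmp := flow_comparison tchi chi0 T0' tP sP mD P0 DL.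
  have ichi := test_intg at_A finmu tchi.
  have TT : 0 <= T <= T by rewrite T0' lexx.
  have i1 : intg (fun y => chi y * Psi T y).
    by apply: (test_intg at_A finmu); apply: (testMl at_A tchi); exact: sP.
  rewrite (_ : Rintegral _ _ _ = \int[mu]_y (chi y * (lam * (E T * (E T - 1)) * Gamma L (U f T) (U f T) y) - C0 / 2 * chi y)); last first.
    by apply: eq_Rintegral => y _; ring.
  have i2 : intg (fun y => chi y * (lam * (E T * (E T - 1)) * Gamma L (U f T) (U f T) y)).
    by apply: (test_intg at_A finmu); apply: (testMl at_A tchi); apply: (smoothZ at_A); exact: sG.
  rewrite (IB i2 (intgZ _ ichi)) (IZ _ ichi) subr_le0.
  (* At time T the Gamma^Z and square terms of [Psi] are nonnegative and dropped. At time 0 both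
     weights vanish, so [Psi 0] is C0/2 * f^2 <= C0/2. *)
  apply: (@le_trans _ _ (\int[mu]_y (chi y * Psi T y))).
    apply: (I_le i2 i1) => y; rewrite ler_wpM2l// /Psi -addrA lerDl.
    have e1 := E1 T T0'.
    have Z0 := form_ge0 vZ y (US tf T0'); have em : 0 <= E T - 1 by rewrite subr_ge0.
    have p3 : 0 <= C0 / 2 * (U f T y * U f T y) by rewrite -expr2 mulr_ge0 ?sqr_ge0// divr_ge0.
    exact: addr_ge0 (mulr_ge0 (mulr_ge0 em em) Z0) p3.
  apply: le_trans cmp _.
  (* Conservation of mass puts the same weight U chi T on both sides, which leaves an inequality
     between integrands. *)
  rewrite -(flow_mass tchi T0').
  have iU := L2_intg finmu (UL tchi T0').
  rewrite -(IZ _ iU).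
  have E0e : E 0 = 1 by rewrite /E mulr0 expR0.
  have pe y : Psi 0 y = C0 / 2 * (f y * f y).
    by rewrite /Psi E0e subrr !(mulr0, mul0r) !add0r U0.
  have b y : 0 <= f y * f y <= 1.
    by rewrite -expr2 sqr_ge0/= -(real_normK (num_real (f y))) expr_le1.
  have Uc0 y : 0 <= U chi T y by exact: (flow_ge tchi T0' chi0).
  apply: I_le.
  - have mf : mfun (Psi 0) by apply: (smooth_mfun at_A); apply: sP; rewrite lexx.
    have bP y : `|Psi 0 y| <= C0 / 2.
      rewrite pe; have /andP[b0 b1] := b y.
      have c2 : 0 <= C0 / 2 by rewrite divr_ge0.
      by rewrite (ger0_norm (mulr_ge0 c2 b0)) ler_piMr.
    exact: (intg_Mbounded iU mf bP).
  - exact: intgZ.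
  - move=> y; rewrite pe; have /andP[b0 b1] := b y.
    by rewrite mulrC ler_wpM2r// ler_piMr// divr_ge0.
have := key x; rewrite subr_le0 /C0 -/(E T) => H.
have lE : 0 < lam * E T by exact: mulr_gt0.
rewrite -(ler_pM2l lE) -/al -/(E T).
by move: H; move: (Gamma L _ _ x) => G; lra.
Qed.

(** * Convergence to the mean and the isoperimetric inequality *)

Hypothesis mu1 : mu setT = 1%E.

(** Differences u_k(y) - u_k(x) tend to 0 along a fixed subunit curve. By dominated convergence so
    does their mean in y, which is int f - u_k(x) because mass is conserved and mu(M) = 1. *)
Lemma flow_tends_mean f x : test f -> (forall y, `|f y| <= 1) ->
  U f k.+1%:R x @[k --> \oo] --> \int[mu]_y f y.
Proof.
move=> tf f1; have m1 : fine (mu setT) = 1 by rewrite mu1.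
pose al := lam * rho2; have al0 : 0 < al by exact: mulr_gt0.
pose B := lam * (rho2 + 2 * kappa) / 2.
have B0 : 0 <= B.
  by rewrite divr_ge0// mulr_ge0 ?(ltW lam_gt0)// addr_ge0 ?(ltW rho2_gt0)// mulr_ge0.
have k0 (k : nat) : (0 : R) <= k.+1%:R by exact: ler0n.
(* The crude e^x - 1 >= x suffices here. Times are k + 1 because the gradient bound says nothing at
   time 0. *)
have Gk (k : nat) z : Gamma L (U f k.+1%:R) (U f k.+1%:R) z <= Num.sqrt (B / al * k.+1%:R^-1) ^+ 2.
  have kp : (0 : R) < k.+1%:R by rewrite ltr0n.
  rewrite sqr_sqrtr; last by rewrite mulr_ge0 ?invr_ge0// divr_ge0// ltW.
  rewrite -mulrA -invfM ler_pdivlMr ?mulr_gt0// mulrC.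
  apply: le_trans (gradient_bound z tf f1 kp); rewrite -/al.
  apply: ler_wpM2r; first by apply: (form_ge0 vG); exact: US.
  by have := expR_ge1Dx (al * k.+1%:R); lra.
have lim0 (D : R) : Num.sqrt (B / al * k.+1%:R^-1) * D @[k --> \oo] --> (0 : R).
  rewrite -[X in _ --> X](mul0r D); apply: cvgM; last exact: cvg_cst.
  have hz : B / al * k.+1%:R^-1 @[k --> \oo] --> (0 : R).
    by rewrite -[X in _ --> X](mulr0 (B / al)); apply: cvgM; [exact: cvg_cst|exact: cvg_harmonic].
  by have := cvg_comp (fun k : nat => B / al * k.+1%:R^-1) Num.sqrt hz (@sqrt_continuous R 0); rewrite sqrtr0; apply.
have osc y : U f k.+1%:R y - U f k.+1%:R x @[k --> \oo] --> (0 : R).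
  have [T JT] := connL x y.
  have lo : - (Num.sqrt (B / al * k.+1%:R^-1) * T) @[k --> \oo] --> (0 : R).
    by rewrite -[X in _ --> X]oppr0; apply: cvgN; exact: lim0.
  apply: (squeeze_cvgr _ lo (lim0 T)); apply: nearW => k.
  have := subunit_oscillation (US tf (k0 k)) (sqrtr_ge0 _) (Gk k) JT.
  by rewrite ler_norml.
have iU (k : nat) := L2_intg finmu (UL tf (k0 k)).
have Ub (k : nat) y : `|U f k.+1%:R y| <= 1 by exact: (flow_abs tf (k0 k) f1).
have dom := @I_dominated _ _ _ mu (fun (k : nat) (y : borel M) => U f k.+1%:R y - U f k.+1%:R x)
  (fun=> 0) (fun=> 2).
have : \int[mu]_y (U f k.+1%:R y - U f k.+1%:R x) @[k --> \oo] --> \int[mu]_(y in [set: borel M]) (0 : R).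
  apply: dom.
  - by move=> k; exact: intg_measurable (intgB (iU k) (intg_cst finmu _)).
  - exact: measurable_cst.
  - exact: intg_cst.
  - by apply: aeW => y; exact: osc.
  - by move=> k y; apply: le_trans (ler_normB _ _) _; have := Ub k y; have := Ub k x; lra.
have -> : (fun k : nat => \int[mu]_y (U f k.+1%:R y - U f k.+1%:R x)) =
    (fun k : nat => \int[mu]_y f y - U f k.+1%:R x).
  apply/funext => k; rewrite (IB (iU k) (intg_cst finmu _)) (I_cst mu) m1 mulr1.
  by rewrite (flow_mass tf (k0 k)).
rewrite I_cst mul0r => h0.
have : \int[mu]_y f y - (\int[mu]_y f y - U f k.+1%:R x) @[k --> \oo] --> \int[mu]_y f y - 0.
  by apply: cvgB h0; exact: cvg_cst.
by rewrite subr0; under eq_fun do rewrite subKr.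
Qed.

Lemma flow_set_tends_mean f (E : set (borel M)) : measurable E -> test f -> (forall y, `|f y| <= 1) ->
  \int[mu]_x (\1_E x * U f k.+1%:R x) @[k --> \oo] --> fine (mu E) * \int[mu]_y f y.
Proof.
move=> mE tf f1; have k0 (k : nat) : (0 : R) <= k.+1%:R by exact: ler0n.
have mU (k : nat) : mfun (U f k.+1%:R) by apply: (smooth_mfun at_A); exact: US.
have Ub (k : nat) y : `|U f k.+1%:R y| <= 1 by exact: (flow_abs tf (k0 k) f1).
have i1 : intg (fun y => \1_E y).
  apply: (@intg_bounded _ _ _ mu finmu _ 1); first exact: measurable_indic.
  by move=> y; rewrite indicE; case: (_ \in _); rewrite /= ?normr1 ?normr0.
have -> : fine (mu E) * \int[mu]_y f y = \int[mu]_x (\1_E x * \int[mu]_y f y).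
  have e : \int[mu]_x \1_E x = fine (mu E) by rewrite /Rintegral integral_indic// setIT.
  rewrite -e mulrC -(IZ _ i1); by apply: eq_Rintegral => x _; rewrite mulrC.
apply: (@I_dominated _ _ _ mu (fun (k : nat) (x : borel M) => \1_E x * U f k.+1%:R x)
  (fun x => \1_E x * \int[mu]_y f y) (fun=> 1)).
- by move=> k; apply: measurable_funM => //; exact: measurable_indic.
- by apply: measurable_funM; [exact: measurable_indic|exact: measurable_cst].
- exact: intg_cst.
- by apply: aeW => x; apply: cvgM; [exact: cvg_cst|exact: flow_tends_mean].
- move=> k x; rewrite normrM -[leRHS]mulr1; apply: ler_pM => //.
  by rewrite indicE; case: (_ \in _); rewrite /= ?normr1 ?normr0.
Qed.

(** The derivative of int_E u_t is at most P(E) (B / (e^(al t) - 1))^(1/2). This blows up at t = 0,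
    so it is compared with [decay_primitive] on [s, T], and s is then made small. *)
Lemma flow_set_growth f (E : set (borel M)) (T : R) : test f -> (forall y, `|f y| <= 1) ->
  caccioppoli mu A L E -> 0 < T ->
  \int[mu]_x (\1_E x * U f T x) - \int[mu]_x (\1_E x * f x) <=
    fine (perimeter mu A L E) * Num.sqrt (lam * (rho2 + 2 * kappa) / 2) * (4 / (lam * rho2)).
Proof.
move=> tf f1 cE T0; have [mE _] := cE.
have [C q] := set_integral_quadratic mE tf; rewrite -{2}(U0 tf).
set p := (fun t : R => \int[mu]_x (\1_E x * U f t x)) in q *.
set p1 := (fun t : R => \int[mu]_x (\1_E x * U (L f) t x)) in q.
pose al := lam * rho2; have al0 : 0 < al by exact: mulr_gt0.
pose B := lam * (rho2 + 2 * kappa) / 2.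
have B0 : 0 < B.
  by rewrite divr_gt0// mulr_gt0// ltr_pwDl// mulr_ge0.
pose P := fine (perimeter mu A L E).
have cbound (t : R) : 0 < t -> p1 t <= Num.sqrt (B / (expR (al * t) - 1)) * P.
  move=> t0; have E0 : 0 < expR (al * t) - 1.
    by rewrite subr_gt0 -(@expR0 R) ltr_expR mulr_gt0.
  have c0 : 0 < Num.sqrt (B / (expR (al * t) - 1)) by rewrite sqrtr_gt0 divr_gt0.
  have Gc x : Gamma L (U f t) (U f t) x <= Num.sqrt (B / (expR (al * t) - 1)) ^+ 2.
    rewrite sqr_sqrtr; last exact: divr_ge0 (ltW B0) (ltW E0).
    by rewrite ler_pdivlMr// mulrC; exact: gradient_bound.
  have t0' := ltW t0; have iL : intg (L (U f t)) by rewrite LU//; exact: (L2_intg finmu (UL (tL tf) t0')).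
  have := L_perimeter (US tf t0') c0 Gc iL cE.
  by rewrite LU.
(* The zero field is admissible and contributes 0 to the supremum. *)
have P0 : 0 <= P.
  rewrite fine_ge0//; apply: ereal_sup_ubound.
  exists (fun _ _ => 0), (fun=> 0); split.
  - split; last by move=> g sg x; rewrite normr0 sqrtr_ge0.
    move=> ch Ach; exists (fun _ _ => 0); split; first by move=> i; apply: Ck_cst; exact: (open_cimg at_A Ach).
    by move=> g sg x _; rewrite big1// => i _; rewrite mul0r.
  - by exists set0 => //; exact: compact0.
  - split; first exact: cst_continuous.
    by move=> g tg; rewrite (_ : (fun x => g x * 0) = fun=> 0) ?I_cst ?mul0r ?oppr0//; apply/funext => x; rewrite mulr0.
  - by rewrite (_ : (fun x => _) = fun=> 0%E) ?integral0//; apply/funext => x; rewrite mulr0.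
pose K := P * Num.sqrt B * (4 / al).
have Psi0 (t : R) : 0 <= decay_primitive al t by rewrite mulr_ge0 ?sqrtr_ge0// divr_ge0// ltW.
(* The integral of (e^(al t) - 1)^(-1/2) over t > 0 is exactly pi / al; the elementary bound 4 / al
   is enough for the final constant. *)
have Psi4 (t : R) : decay_primitive al t <= 4 / al.
  rewrite /decay_primitive ler_piMr//; first by rewrite divr_ge0// ltW.
  rewrite -[leRHS]sqrtr1 ler_wsqrtr// gerBl; exact: expR_ge0.
have PB : 0 <= P * Num.sqrt B by rewrite mulr_ge0 ?sqrtr_ge0.
have step (s : R) : 0 < s -> s < T -> p T - p s <= K.
  move=> s0 sT; pose F t := P * Num.sqrt B * decay_primitive al t - p t.
  pose F1 t := P * Num.sqrt B * (expR (- (al / 2) * t) / Num.sqrt (1 - expR (- (al / 2) * t))) - p1 t.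
  have dF (t : R) : 0 < t -> is_derive t 1 F (F1 t).
    move=> t0; have d1 := decay_primitive_derive al0 t0.
    have d2 : is_derive t 1 p (p1 t).
      apply: (@is_derive_quadratic _ _ _ _ _ C t0) => k hk.
      have tk : 0 <= t + k by move: hk; rewrite ltr_norml => /andP[? ?]; lra.
      by have := q t (t + k) (ltW t0) tk; rewrite (_ : t + k - t = k) ?[k * _]mulrC//; ring.
    by apply: is_deriveB; exact: is_deriveZ.
  have cF : {within `[s, T], continuous F}.
    apply: derivable_within_continuous => t; rewrite in_itv/= => /andP[st _].
    by have [] := dF t (lt_le_trans s0 st).
  have dF' (t : R) : t \in `]s, T[ -> is_derive t 1 F (F1 t).
    by rewrite in_itv/= => /andP[st _]; apply: dF; exact: lt_trans st.
  have [xi] := MVT sT dF' cF; rewrite in_itv/= => /andP[sxi _].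
  have xi0 := lt_trans s0 sxi.
  have F10 : 0 <= F1 xi.
    rewrite subr_ge0; apply: le_trans (cbound xi xi0) _.
    rewrite sqrtrM ?(ltW B0)// sqrtrV; last first.
      by rewrite subr_ge0 -(@expR0 R) ler_expR (mulr_ge0 (ltW al0) (ltW xi0)).
    have := ler_wpM2l PB (decay_primitive_dominates al0 xi0); apply: le_trans.
    by rewrite le_eqVlt; apply/orP; left; apply/eqP; ring.
  move=> FE; have : 0 <= F T - F s by rewrite FE mulr_ge0// subr_ge0 ltW.
  have := ler_wpM2l PB (Psi4 T); have := mulr_ge0 PB (Psi0 s).
  rewrite /F /K; lra.
rewrite -/al -/B -/P -/K leNgt; apply/negP => gap.
(* Since s <= 1, the expansion at 0 gives p s - p 0 <= s (|p1 0| + |C|) < s D <= g / 2, which with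
   [step] contradicts the gap g. *)
pose D := `|p1 0| + `|C| + 1; have D0 : 0 < D by rewrite ltr_wpDl// addr_ge0.
pose g := p T - p 0 - K; have g0 : 0 < g by rewrite subr_gt0.
pose s := Num.min (Num.min 1 (T / 2)) (g / (2 * D)).
have D2 : 0 < 2 * D by rewrite mulr_gt0.
have s0 : 0 < s by rewrite !lt_min ltr01 !divr_gt0.
have s1 : s <= 1 by rewrite /s !ge_min lexx.
have sT : s < T by rewrite /s !gt_min ltr_pdivrMr// ltr_pMr// ltr1n orbT.
have sg : s * (2 * D) <= g by rewrite -ler_pdivlMr// /s ge_min lexx orbT.
have := q 0 s (lexx _) (ltW s0); rewrite subr0 ler_norml => /andP[_ h1].
have h2 : s * p1 0 <= s * `|p1 0| by rewrite ler_wpM2l ?ler_norm// ltW.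
have h3 : C * s ^+ 2 <= s * `|C|.
  rewrite expr2 mulrA mulrC ler_wpM2l ?(ltW s0)//.
  apply: le_trans (ler_norm _) _; rewrite normrM (ger0_norm (ltW s0)) ler_piMr//.
have h4 := step s s0 sT.
move: sg s0 (mulr_gt0 s0 D0) h1 h2 h3 h4; rewrite /g /D.
move: (p T) (p s) (p 0) (p1 0) (`|p1 0|) (`|C|) (s) (C * s ^+ 2) => a b c e i j k l; lra.
Qed.

Lemma set_mean_bound f (E : set (borel M)) : test f -> (forall y, `|f y| <= 1) ->
  caccioppoli mu A L E ->
  fine (mu E) * \int[mu]_x f x - \int[mu]_x (\1_E x * f x) <=
    fine (perimeter mu A L E) * Num.sqrt (lam * (rho2 + 2 * kappa) / 2) * (4 / (lam * rho2)).
Proof.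
move=> tf f1 cE; have [mE _] := cE.
have l := flow_set_tends_mean mE tf f1.
rewrite lerBlDr; apply: (ler_cvg_to l (cvg_cst _)); apply: nearW => k; rewrite -lerBlDr.
by apply: flow_set_growth => //; rewrite ltr0n.
Qed.

Hypothesis scM : @second_countable M.

Lemma variance_perimeter (E : set (borel M)) : caccioppoli mu A L E ->
  2 * fine (mu E) * (1 - fine (mu E)) <=
    fine (perimeter mu A L E) * Num.sqrt (lam * (rho2 + 2 * kappa) / 2) * (4 / (lam * rho2)).
Proof.
move=> cE; have [mE _] := cE; have [th h01 hcv _ _] := cutP.
(* The approximation of 1 - 2 * 1_E costs 3 d in int_E f and m * 3 d <= 3 d in m int f, in total 6 d
   = e. *)
apply/ler_addgt0Pr => e e0; pose d := e / 6; have d0 : 0 < d by rewrite divr_gt0.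
have [g [tg g01 gE]] := test_dense at_A hM scM finmu th h01 hcv mE d0.
set m := fine (mu E).
have leE : (mu E <= 1)%E by rewrite -mu1; apply: le_measure; rewrite ?inE.
have fE : mu E \is a fin_num by rewrite ge0_fin_numE//; apply: le_lt_trans leE (ltry _).
have m0 : 0 <= m by exact: fine_ge0.
have m1 : m <= 1 by rewrite -lee_fin fineK.
have t1 : fine (mu setT) = 1 by rewrite mu1.
have sg : S g by case: tg.
have [mEg iEg _] := unit_diff_intg at_A finmu mE sg g01.
have i1 : intg (fun x => \1_E x).
  apply: (@intg_bounded _ _ _ mu finmu _ 1); first exact: measurable_indic.
  by move=> y; rewrite indicE; case: (_ \in _); rewrite /= ?normr1 ?normr0.
have e1 : \int[mu]_x \1_E x = m by rewrite /Rintegral integral_indic// setIT.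
have [k hk] : exists k, 1 - \int[mu]_x h k x <= d.
  have := cutoff_limit (intg_cst finmu 1); rewrite I_cst t1 mulr1.
  move=> /(@cvgrPdist_le _ R^o) /(_ d d0) [N _ HN]; exists N.
  have := HN N (leqnn N); rewrite (_ : (fun x => h N x * 1) = h N); last by apply/funext => x; rewrite mulr1.
  exact: le_trans (ler_norm _).
(* g approximates 1_E in L^1, and the factor h_k restores the compact support that 1 - 2 g lacks;
   |f| <= 1 is kept. *)
pose f x := h k x * (1 - 2 * g x).
have tf : test f.
  apply: (testMl at_A (th k)); apply: (smoothB at_A); first exact: (smooth_cst at_A).
  exact: (smoothZ at_A).
have g2 x : `|1 - 2 * g x| <= 1.
  by have /andP[a b] := g01 x; rewrite ler_norml; apply/andP; split; lra.
have f1 x : `|f x| <= 1.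
  have /andP[a b] := h01 k x; rewrite /f normrM -[leRHS]mulr1; apply: ler_pM => //.
  by rewrite ger0_norm.
have ih := test_intg at_A finmu (th k); have iF := test_intg at_A finmu tf.
pose r x := (1 - h k x) + 2 * `|\1_E x - g x|.
have iR : intg r by exact: (intgD (intgB (intg_cst finmu 1) ih) (intgZ 2 iEg)).
have rE : \int[mu]_x r x <= 3 * d.
  rewrite /r (ID (intgB (intg_cst finmu 1) ih) (intgZ 2 iEg)) (IB (intg_cst finmu 1) ih) (IZ _ iEg).
  rewrite I_cst t1; lra.
have fr x : `|f x - (1 - 2 * \1_E x)| <= r x.
  have /andP[a b] := h01 k x.
  rewrite (_ : _ - _ = (h k x - 1) * (1 - 2 * g x) + 2 * (\1_E x - g x)); last by rewrite /f; ring.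
  apply: le_trans (ler_normD _ _) _; rewrite /r; apply: lerD.
    by rewrite normrM distrC [`|1 - h k x|]ger0_norm ?subr_ge0// ler_piMr// subr_ge0.
  by rewrite normrM (ger0_norm (ler0n _ 2)).
have lo : 1 - 2 * m - 3 * d <= \int[mu]_x f x.
  apply: (@le_trans _ _ (\int[mu]_x (1 - 2 * \1_E x - r x))).
    rewrite (IB (intgB (intg_cst finmu 1) (intgZ 2 i1)) iR) (IB (intg_cst finmu 1) (intgZ 2 i1)) (IZ _ i1).
    rewrite I_cst t1 e1; lra.
  apply: (I_le (intgB (intgB (intg_cst finmu 1) (intgZ 2 i1)) iR) iF) => x.
  by have := fr x; rewrite ler_norml => /andP[]; lra.
have mind : mfun (\1_E : M -> R) by exact: measurable_indic.
have bind x : `|(\1_E x : R)| <= 1 by rewrite indicE; case: (_ \in _); rewrite /= ?normr1 ?normr0.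
have iEF : intg (fun x => \1_E x * f x).
  by have j := intg_Mbounded iF mind bind; apply: (intg_ext _ j) => x; rewrite mulrC.
have up : \int[mu]_x (\1_E x * f x) <= - m + 3 * d.
  apply: (@le_trans _ _ (\int[mu]_x (r x - \1_E x))).
    apply: (I_le iEF (intgB iR i1)) => x; have := fr x; rewrite ler_norml => /andP[].
    have r0 := le_trans (normr_ge0 _) (fr x).
    by move: r0; rewrite indicE; case: (_ \in _) => /=; lra.
  rewrite (IB iR i1) e1; lra.
have := set_mean_bound tf f1 cE; rewrite -/m.
have h1 : m * (1 - 2 * m - 3 * d) <= m * \int[mu]_x f x by rewrite ler_wpM2l.
have h2 : m * d <= d by rewrite ler_piMl// ltW.
have d6 : 6 * d = e by rewrite /d; field.
move: (fine (perimeter _ _ _ _) * _ * _) (\int[mu]_x f x) h1 up => p q h1 up; lra.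
Qed.

End FlowEstimates.

Theorem proposition1p5 (R : realType) (M : ptopologicalType) (n : nat)
    (A : set (chart R M n))
    (mu : {measure set (borel M) -> \bar R})
    (L : (M -> R) -> M -> R)
    (GammaZ : (M -> R) -> (M -> R) -> M -> R)
    (P : R -> (M -> R) -> M -> R)
    (rho1 rho2 kappa d : R)
    (manifold_M : connected_smooth_manifold A)
    (smooth_mu : smooth_measure A mu)
    (diffusion_L : second_order_diffusion A L)
    (L_one : forall x : M, L (fun _ => 1) x = 0)
    (subelliptic_L : locally_subelliptic mu A L)
    (symmetric_L : symmetric_operator mu A L)
    (nonpositive_L : nonpositive_operator mu A L)
    (subunit_M : subunit_connected A L)
    (complete_M : cc_complete A L)
    (form_GammaZ : vertical_form A GammaZ)
    (squares_L : locally_sum_of_squares mu A L)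
    (heat_P : heat_semigroup mu A L P)
    (h1 : H1 A L GammaZ)
    (h2 : H2 A L GammaZ)
    (h3 : H3 A mu L GammaZ P)
    (rho1_gt0 : 0 < rho1) (rho2_gt0 : 0 < rho2)
    (kappa_ge0 : 0 <= kappa) (d_gt0 : 0 < d)
    (cd : CD A L GammaZ rho1 rho2 kappa d)
    (mu_M : mu [set: M] = 1%E) :
  ((2^-1 * Num.sqrt (rho1 / 2) * (1 / (1 + 2 * kappa / rho2)))%:E
     <= isoperimetric_constant mu A L)%E.
Proof.
have [hM scM _ at_A] := manifold_M.
have mu1 : mu [set: borel M] = 1%E by exact: mu_M.
have finmu : (mu [set: borel M] < +oo)%E by rewrite mu1 ltry.
have vG := Gamma_form at_A diffusion_L L_one.
have [h [eps cutP]] := cutoff_sequence_exists at_A vG form_GammaZ h1.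
have [U flow] := heat_flow_exists at_A hM scM finmu smooth_mu diffusion_L L_one symmetric_L
  form_GammaZ heat_P h1 h3.
(* The rate alpha is [lam * rho2]; factoring out rho2 keeps the weights free of divisions. *)
pose lam := rho1 / (rho2 + kappa).
have rk : 0 < rho2 + kappa by rewrite ltr_pwDl.
have lam_gt0 : 0 < lam by rewrite divr_gt0.
have rho1E : rho1 = lam * (rho2 + kappa) by rewrite /lam divfK// lt0r_neq0.
apply: le_ereal_inf_tmp => _ [E [cE E0 E2] <-]; rewrite lee_fin.
have fE : mu E \is a fin_num by rewrite ge0_fin_numE// (le_lt_trans E2)// ltry.
have m0 : 0 < fine (mu E) by rewrite fine_gt0// E0 -ge0_fin_numE.
have m2 : fine (mu E) <= 2^-1 by rewrite -lee_fin fineK.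
rewrite ler_pdivlMr//.
have := variance_perimeter at_A hM finmu smooth_mu diffusion_L L_one symmetric_L form_GammaZ cutP flow
  subunit_M lam_gt0 rho2_gt0 kappa_ge0 d_gt0 rho1E cd mu1 scM cE.
move: (fine (perimeter _ _ _ _)) => p.
set K := 1 + 2 * kappa / rho2; set m := fine (mu E) in m0 m2 *.
have K1 : 1 <= K by rewrite lerDl divr_ge0 ?mulr_ge0// ltW.
have K0 : 0 < K by exact: lt_le_trans K1.
set B := lam * (rho2 + 2 * kappa) / 2.
set q := Num.sqrt (rho1 / 2) / K => H.
have r20 : 0 <= rho1 / 2 by rewrite divr_ge0// ltW.
have q0 : 0 < q by rewrite divr_gt0// sqrtr_gt0 divr_gt0.
have B0 : 0 <= B by rewrite divr_ge0// mulr_ge0 ?(ltW lam_gt0)// addr_ge0 ?(ltW rho2_gt0)// mulr_ge0.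
have al0 : 0 < lam * rho2 by exact: mulr_gt0.
(* The square of the left side is 4 (rho2 + kappa) / (rho2 + 2 kappa), which is at most 4, with
   equality when kappa = 0. *)
have key : Num.sqrt B * (4 / (lam * rho2)) * q <= 2.
  have c4 : 0 <= 4 / (lam * rho2) by rewrite divr_ge0// ltW.
  rewrite -(ler_pXn2r (isT : (0 < 2)%N)) ?nnegrE//; last first.
    by rewrite mulr_ge0 ?(ltW q0)// mulr_ge0 ?sqrtr_ge0.
  rewrite /q !exprMn exprVn (sqr_sqrtr B0) (sqr_sqrtr r20).
  have -> : B * (4 ^+ 2 * (lam * rho2) ^- 2) * (rho1 / 2 * K^-1 ^+ 2) =
      4 * ((rho2 + kappa) / (rho2 + 2 * kappa)).
    rewrite /B /K rho1E; field.
    by rewrite !lt0r_neq0 ?ltr_pwDl ?mulr_ge0.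
  have r2k : 0 < rho2 + 2 * kappa by rewrite ltr_pwDl// mulr_ge0.
  rewrite (_ : 2 ^+ 2 = 4 * 1); last by ring.
  by rewrite ler_wpM2l// ler_pdivrMr// mul1r lerD2l ler_peMl// ler1n.
(* Here mu(E) <= 1/2 enters, through 1 <= 2 (1 - m). *)
have mm : m <= 2 * m * (1 - m) by nra.
have H1' := ler_wpM2r (ltW q0) (le_trans mm H).
have -> : 2^-1 * Num.sqrt (rho1 / 2) * (1 / K) * m = m * q / 2 by rewrite /q; field; rewrite lt0r_neq0.
rewrite ler_pdivrMr//; apply: le_trans H1' _.
rewrite (_ : p * Num.sqrt B * (4 / (lam * rho2)) * q = p * (Num.sqrt B * (4 / (lam * rho2)) * q)); last by ring.
apply: ler_wpM2l key.
(* A negative p would make the right side of [H] nonpositive, whereas its left side is at least m >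
   0. *)
rewrite leNgt; apply/negP => p0; move: (lt_le_trans m0 (le_trans mm H)); rewrite ltNge; apply/negP.
by rewrite negbK -mulrA nmulr_rle0// mulr_ge0 ?sqrtr_ge0// divr_ge0// ltW.
Qed.
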